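(* Let $X\subset G_m^{n+t}$ be an irreducible variety over $\overline{\mathbb{Q}}$ of dimension $s\le n$, and let $X^{re\text{-}oa}$ be the set obtained from $X$ by removing all anomalous subvarieties of $X$ produced by algebraic subgroups (and their cosets) defined by restricting the first $n$ coordinates. Then the height is bounded from above on the intersection of $X^{re\text{-}oa}$ with the union of all algebraic subgroups of $G_m^{n+t}$ of codimension at least $s$ that are defined by restricting the first $n$ coordinates.
   Context: $G_m^{N}=(\overline{\mathbb{Q}}^* )^{N}$. An algebraic subgroup is the common zero set of equations $x_1^{a_1}\cdots x_N^{a_N}=1$ with $(a_1,\dots,a_N)$ ranging over a subgroup of $\mathbb{Z}^N$; a coset is a translate $gH$. An algebraic subgroup $H\subset G_m^{n+t}$ is defined by restricting the first $n$ coordinates if $\{1\}^n\times G_m^t\subset H$. An anomalous subvariety of $X$ produced by such subgroups is an irreducible subvariety $Y\subset X$ of positive dimension contained in a coset $gH$, with $H$ defined by restricting the first $n$ coordinates, such that $\dim gH\le (n+t)-\dim X+\dim Y-1$. Height means the absolute logarithmic Weil height of a point (e.g. sum of heights of its coordinates); boundedness does not depend on the choice among standard equivalent heights. *)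

(* Defs.v *)
(* Qbar is modelled by algC (the countable algebraic closure of Q). *)
From HB Require Import structures.
From mathcomp Require Import all_boot all_order all_algebra all_field.
Set Implicit Arguments. Unset Strict Implicit. Unset Printing Implicit Defensive.
Import Order.TTheory GRing.Theory Num.Theory.
Local Open Scope ring_scope.

Definition point (N : nat) := 'I_N -> algC.
Definition pset (N : nat) := point N -> Prop.

Definition torus (N : nat) : pset N := fun x => forall i, x i != 0.

Definition psubset N (A B : pset N) := forall x, A x -> B x.
Definition pssubset N (A B : pset N) := psubset A B /\ exists x, B x /\ ~ A x.

Definition mpoly (N : nat) := seq (algC * ('I_N -> nat)).
Definition meval N (p : mpoly N) (x : point N) : algC :=
  \sum_(m <- p) m.1 * \prod_(i < N) x i ^+ m.2 i.

Definition zclosed N (Z : pset N) : Prop :=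
  exists F : mpoly N -> Prop,
    forall x, Z x <-> (torus x /\ forall p, F p -> meval p x = 0).

Definition zirreducible N (Z : pset N) : Prop :=
  [/\ zclosed Z, (exists x, Z x) &
      forall Z1 Z2, zclosed Z1 -> zclosed Z2 ->
        psubset Z (fun x => Z1 x \/ Z2 x) -> psubset Z Z1 \/ psubset Z Z2].

Definition chain_in N (Z : pset N) (k : nat) : Prop :=
  exists Y : nat -> pset N,
    (forall i, (i <= k)%N -> zirreducible (Y i) /\ psubset (Y i) Z) /\
    (forall i, (i < k)%N -> pssubset (Y i) (Y i.+1)).
Definition has_dim N (Z : pset N) (d : nat) : Prop :=
  chain_in Z d /\ ~ chain_in Z d.+1.

Definition zsubgroup N (L : ('I_N -> int) -> Prop) : Prop :=
  L (fun _ => 0) /\ forall a b, L a -> L b -> L (fun i => a i - b i).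

Definition alg_subgroup N (H : pset N) : Prop :=
  exists L, zsubgroup L /\
    forall x, H x <-> (torus x /\ forall a, L a -> \prod_(i < N) x i ^ a i = 1).

Definition restricts_first (n t : nat) (H : pset (n + t)) : Prop :=
  forall x, torus x -> (forall i : 'I_(n + t), (i < n)%N -> x i = 1) -> H x.

Definition coset N (g : point N) (H : pset N) : pset N :=
  fun x => exists h, H h /\ x = (fun i => g i * h i).

Definition re_anomalous (n t : nat) (X Y : pset (n + t)) : Prop :=
  exists dX dY,
  [/\ has_dim X dX, zirreducible Y, psubset Y X, has_dim Y dY &
      (0 < dY)%N] /\
      exists H g dC,
        [/\ alg_subgroup H, restricts_first H, torus g &
            psubset Y (coset g H)] /\ has_dim (coset g H) dC /\
            (dC <= n + t - dX + dY - 1)%N.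

Definition X_re_oa (n t : nat) (X : pset (n + t)) : pset (n + t) :=
  fun x => X x /\ ~ exists Y, re_anomalous X Y /\ Y x.

Definition union_restr_subgroups (n t s : nat) : pset (n + t) :=
  fun x => exists H d, [/\ alg_subgroup H, restricts_first H, has_dim H d,
                          (s + d <= n + t)%N & H x].

(* least common denominator of the coefficients of the monic minimal polynomial;
   L * minCpoly a is the primitive minimal polynomial over Z of a *)
Definition minpoly_lden (a : algC) : nat :=
  \big[lcmn/1%N]_(i < size (minCpoly a)) absz (denq (getCrat ((minCpoly a)`_i))).

Definition conjugates (a : algC) : seq algC :=
  sval (closed_field_poly_normal (minCpoly a)).

(* absolute multiplicative Weil height: H(a) = M(f)^(1/deg a), f primitive
   minimal polynomial over Z, M = Mahler measure *)
Definition mult_height (a : algC) : algC :=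
  ((size (minCpoly a)).-1).-root
    ((minpoly_lden a)%:R * \prod_(z <- conjugates a) Num.max 1 `|z|).

(* multiplicative height of a point: exp(sum of logarithmic heights of coords) *)
Definition point_height N (x : point N) : algC := \prod_(i < N) mult_height (x i).

(* Main.v *)
(* By noetherian induction it suffices to bound the height on an irreducible closed
   [Z] contained in [X], meeting [X_re_oa X], outside a proper closed subset. Write
   N = n + t, r = dim Z.
   An Ax-type argument shows that for every real matrix L of rank s involving only the
   first n coordinates, the forms sum_j L_bj dx_j / x_j span the cotangent space of Z
   generically: otherwise the foliation they define would produce a coset meeting Z
   anomalously through every point. Hence r rows of L can be chosen such that the
   monomials x^chi(u), u in [0,m)^r, with chi(u) close to A * u * L, are linearly
   independent on Z once A is large: following the vector fields dual to these forms
   from one point of Z, with purely imaginary times, turns them approximately into the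
   characters of (Z/m)^r, whose Fourier matrix is well conditioned. Compactness of the
   set of normalized L makes A uniform.
   Counting dimensions, for each coordinate x_i and k = 2N + 1 there is a relation
   sum_l b_l x_i^(k l) = 0 on Z, the b_l being combinations of the x^chi(u) which do not
   all vanish identically on Z. If x lies in a subgroup of codimension s, take for L a
   basis of its relations normalized by a maximal minor: then x^chi(u) is, up to
   torsion, a monomial with real exponents bounded by 1, so that H(b_l) is at most
   a constant times prod_j H(x_j)^2, whence H(x_i)^k <= c prod_j H(x_j)^2; multiply over i.
   Heights are handled without absolute values: non-archimedean contributions are
   contents of norms of polynomials, controlled by Gauss' lemma. *)
Require Import Defs.
From HB Require Import structures.
From mathcomp Require Import all_boot all_order all_algebra all_field.
From mathcomp Require Import perm.
From mathcomp Require Import ring_quotient generic_quotient fraction.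
From mathcomp Require Import ring lra zify.
From mathcomp Require Import mpoly boolp complex reals Rstruct.
From mathcomp Require classical_sets topology normedtype sequences derive exp trigo.
Set Implicit Arguments. Unset Strict Implicit. Unset Printing Implicit Defensive.
Import Order.TTheory GRing.Theory Num.Theory.
Local Open Scope ring_scope.

(** * Subfields, algebraicity and derivations *)

(** The given point of [X_re_oa] is arbitrary, not generic, so an anomalous coset has to be produced
    through that very point, and dimensions of fibres must be controlled at every point. This is why
    dimension is measured by the growth of jets, which is upper semicontinuous, and only then
    converted into chains of irreducible sets. The relations defining a subgroup have unbounded
    coefficients; after normalization their limits are real matrices, so the ground field is
    enlarged from [algC] to the complex numbers. There the Ax-type statement compares the first
    integrals of a foliation with the monomials among them; residues of logarithmic forms, being
    integers, force enough such monomials. Independence of the auxiliary monomials is required for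
    every box size m with one and the same A, because m is fixed only afterwards by the dimension
    count. An entrywise estimate for the perturbed Fourier matrix would lose a power of m, so the
    perturbation is bounded as an operator. The exponents finally used range over a finite set,
    which gives one exceptional hypersurface for all subgroups at once. *)

Section Subfields.
Variable F : fieldType.
Implicit Types (E : F -> Prop) (D : F -> F) (p q : {poly F}) (f x y z : F).

(** Subfields are predicates and derivations are functions on one ambient field, so that a tower of
    extensions stays inside one type. Division is total, with [x / 0 = 0]. *)
Definition subfield E :=
  [/\ E 1, forall x y, E x -> E y -> E (x - y) & forall x y, E x -> E y -> E (x / y)].

Definition over E p := forall i, E p`_i.

Definition adj E z : F -> Prop := fun f =>
  exists p q, [/\ over E p, over E q, q.[z] != 0 & f = p.[z] / q.[z]].

Definition deron E D :=
  (forall x y, E x -> E y -> D (x + y) = D x + D y) /\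
  (forall x y, E x -> E y -> D (x * y) = D x * y + x * D y).

Definition Dpol D p := \poly_(i < size p) D p`_i.

Definition algover E z := exists p, [/\ over E p, p != 0 & root p z].

Section One.
Variable E : F -> Prop.
Hypothesis sE : subfield E.

Lemma sf1 : E 1. Proof. by case: sE. Qed.
Lemma sfB x y : E x -> E y -> E (x - y). Proof. by case: sE => _ h _; exact: h. Qed.
Lemma sf0 : E 0. Proof. by rewrite -(subrr 1); apply: sfB; apply: sf1. Qed.
Lemma sfN x : E x -> E (- x).
Proof. by move=> Ex; rewrite -sub0r; apply: sfB => //; apply: sf0. Qed.
Lemma sfD x y : E x -> E y -> E (x + y).
Proof. by move=> Ex Ey; rewrite -[y]opprK; apply: sfB => //; apply: sfN. Qed.
Lemma sfdiv x y : E x -> E y -> E (x / y).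
Proof. by case: sE => _ _ h; exact: h. Qed.
Lemma sfV x : E x -> E x^-1.
Proof. by move=> Ex; rewrite -[x^-1]mul1r; apply: sfdiv => //; apply: sf1. Qed.
Lemma sfM x y : E x -> E y -> E (x * y).
Proof. by move=> Ex Ey; rewrite -[y]invrK; apply: sfdiv => //; apply: sfV. Qed.
Lemma sfX x n : E x -> E (x ^+ n).
Proof.
by move=> Ex; elim: n => [|n IHn]; rewrite ?expr0 ?exprS; [exact: sf1|exact: sfM].
Qed.
Lemma sf_sum (I : Type) (r : seq I) (P : pred I) (G : I -> F) :
  (forall i, P i -> E (G i)) -> E (\sum_(i <- r | P i) G i).
Proof. by move=> EG; apply: (big_ind E) => //; [exact: sf0|exact: sfD]. Qed.
Lemma sf_prod (I : Type) (r : seq I) (P : pred I) (G : I -> F) :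
  (forall i, P i -> E (G i)) -> E (\prod_(i <- r | P i) G i).
Proof. by move=> EG; apply: (big_ind E) => //; [exact: sf1|exact: sfM]. Qed.
Lemma sf_nat n : E n%:R.
Proof. by elim: n => [|n IHn]; rewrite ?mulrSr ?mulr0n; [exact: sf0|apply: sfD IHn sf1]. Qed.

Lemma over0 : over E 0. Proof. by move=> i; rewrite coef0; apply: sf0. Qed.
Lemma overC c : E c -> over E c%:P.
Proof. by move=> Ec i; rewrite coefC; case: ifP => // _; apply: sf0. Qed.
Lemma overX : over E 'X.
Proof. by move=> i; rewrite coefX; apply: sf_nat. Qed.
Lemma overXn n : over E 'X^n.
Proof. by move=> i; rewrite coefXn; apply: sf_nat. Qed.
Lemma overD p q : over E p -> over E q -> over E (p + q).
Proof. by move=> Ep Eq i; rewrite coefD; apply: sfD. Qed.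
Lemma overN p : over E p -> over E (- p).
Proof. by move=> Ep i; rewrite coefN; apply: sfN. Qed.
Lemma overB p q : over E p -> over E q -> over E (p - q).
Proof. by move=> Ep Eq; apply: overD => //; apply: overN. Qed.
Lemma overM p q : over E p -> over E q -> over E (p * q).
Proof. by move=> Ep Eq i; rewrite coefM; apply: sf_sum => j _; apply: sfM. Qed.
Lemma over_deriv p : over E p -> over E p^`().
Proof. by move=> Ep i; rewrite coef_deriv -mulr_natr; apply: sfM => //; apply: sf_nat. Qed.
Lemma overZ c p : E c -> over E p -> over E (c *: p).
Proof. by move=> Ec Ep i; rewrite coefZ; apply: sfM. Qed.
Lemma over_horner p x : over E p -> E x -> E p.[x].
Proof.
by move=> Ep Ex; rewrite horner_coef; apply: sf_sum => i _; apply: sfM => //; apply: sfX.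
Qed.

Lemma adj_sub z x : E x -> adj E z x.
Proof.
move=> Ex; exists x%:P, 1; rewrite !hornerE divr1 oner_eq0; split => //.
  exact: overC.
by apply: overC; apply: sf1.
Qed.
Lemma adj_gen z : adj E z z.
Proof.
exists 'X, 1; rewrite !hornerE divr1 oner_eq0; split => //; first exact: overX.
by apply: overC; apply: sf1.
Qed.
Lemma adj_sf z : subfield (adj E z).
Proof.
split; first by apply: adj_sub; apply: sf1.
- move=> _ _ [p [q [Ep Eq q0 ->]]] [p' [q' [Ep' Eq' q0' ->]]].
  exists (p * q' - p' * q), (q * q'); split; rewrite ?(hornerD, hornerN, hornerM) ?mulf_neq0 //.
  - by apply: overB; apply: overM.
  - exact: overM.
  - by field; rewrite q0 q0'.
- move=> _ _ [p [q [Ep Eq q0 ->]]] [p' [q' [Ep' Eq' q0' ->]]].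
  have [p0|p0] := eqVneq p'.[z] 0.
    exists 0, 1; rewrite !hornerE p0 !(mul0r, invr0, mulr0) oner_eq0; split => //.
      exact: over0.
    by apply: overC; apply: sf1.
  exists (p * q'), (q * p'); split; rewrite ?(hornerD, hornerM) ?mulf_neq0 //; try exact: overM.
  by field; rewrite q0 q0' p0.
Qed.

Lemma over_div p q : over E p -> over E q -> q \is monic ->
  exists2 u, over E u & exists2 v, over E v & p = u * q + v /\ (size v < size q)%N.
Proof.
move=> + Eq mq; have q0 := monic_neq0 mq.
have [n] := ubnP (size p); elim: n p => // n IHn p; rewrite ltnS => spn Ep.
have [spq|sqp] := ltnP (size p) (size q).
  by exists 0; [exact: over0|exists p => //; rewrite mul0r add0r].
have p0 : p != 0 by rewrite -size_poly_gt0; apply: leq_trans sqp; rewrite size_poly_gt0.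
pose t := lead_coef p *: 'X^(size p - size q) : {poly F}.
have Et : over E t by apply: overZ; [rewrite lead_coefE|exact: overXn].
have tq i : (t * q)`_i = if (i < size p - size q)%N then 0 else lead_coef p * q`_(i - (size p - size q)).
  by rewrite /t -scalerAl coefZ coefXnM; case: ifP; rewrite ?mulr0.
have sp0 : (0 < size p)%N by rewrite size_poly_gt0.
have sq0 : (0 < size q)%N by rewrite size_poly_gt0.
have spt : (size (p - t * q)%R < size p)%N.
  rewrite -[X in (_ < X)%N](prednK sp0) ltnS; apply/leq_sizeP => j hj; rewrite coefB tq.
  rewrite ifF; last by rewrite ltnNge (leq_trans _ hj) // -subn1 leq_sub2l.
  have [ej|nj] := eqVneq j (size p).-1.
    have -> : (j - (size p - size q))%N = (size q).-1.
      by rewrite ej -subn1 subnAC subKn // subn1.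
    by rewrite ej -[q`__]lead_coefE (monicP mq) mulr1 lead_coefE subrr.
  have {}hj : (size p <= j)%N by rewrite -(prednK sp0) ltn_neqAle eq_sym nj.
  rewrite !nth_default ?mulr0 ?subr0 //.
  by rewrite leq_subRL ?subnK // (leq_trans (leq_subr _ _)).
have [|u Eu [v Ev [puv sv]]] := IHn (p - t * q) (leq_trans spt spn).
  by apply: overB => //; apply: overM.
exists (t + u); first exact: overD.
by exists v => //; split => //; rewrite mulrDl -addrA -puv addrC subrK.
Qed.

Lemma min_over z : algover E z ->
  exists m, [/\ over E m, m \is monic, root m z &
    forall p, over E p -> root p z -> exists2 u, over E u & p = u * m].
Proof.
case=> p0 [Ep0 p00 rp0].
pose P n := `[< exists p, [/\ over E p, p != 0, root p z & size p = n] >].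
have exP : exists n, P n by exists (size p0); apply/asboolP; exists p0.
case: (ex_minnP exP) => n /asboolP[p [Ep p_n0 rp sp]] minP.
pose m := (lead_coef p)^-1 *: p.
have lp0 : lead_coef p != 0 by rewrite lead_coef_eq0.
have Em : over E m by apply: overZ => //; apply: sfV; rewrite lead_coefE.
have mm : m \is monic by rewrite monicE lead_coefZ mulVf.
have sm : size m = n by rewrite size_scale ?invr_eq0.
exists m; split => //; first by rewrite rootZ ?invr_eq0.
move=> q Eq rq; have [u Eu [v Ev [quv sv]]] := over_div Eq Em mm.
exists u => //; rewrite quv; suff -> : v = 0 by rewrite addr0.
apply/eqP; apply: contraTT sv => v0; rewrite -leqNgt sm; apply: minP.
apply/asboolP; exists v; split => //; rewrite /root.
have /rootP rmz : root m z by rewrite rootZ ?invr_eq0.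
by move: rq; rewrite /root quv hornerD hornerM rmz mulr0 add0r.
Qed.

(** * Extension of derivations to a simple extension *)

Section Der.
Variable D : F -> F.
Hypothesis dD : deron E D.

Lemma der0 : D 0 = 0.
Proof.
have := dD.1 _ _ sf0 sf0; rewrite addr0 => /eqP; rewrite -subr_eq0 opprD addrA subrr sub0r oppr_eq0.
by move/eqP.
Qed.
Lemma derN x : E x -> D (- x) = - D x.
Proof.
move=> Ex; apply/eqP; rewrite -addr_eq0 -dD.1 ?addNr ?der0 //; exact: sfN.
Qed.
Lemma derB x y : E x -> E y -> D (x - y) = D x - D y.
Proof. by move=> Ex Ey; rewrite dD.1 ?derN //; apply: sfN. Qed.
Lemma derM x y : E x -> E y -> D (x * y) = D x * y + x * D y.
Proof. exact: dD.2. Qed.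
Lemma der1 : D 1 = 0.
Proof.
have := dD.2 _ _ sf1 sf1; rewrite !mulr1 mul1r => /eqP.
by rewrite -subr_eq0 opprD addrA subrr sub0r oppr_eq0 => /eqP.
Qed.
Lemma derV x : E x -> x != 0 -> D x^-1 = - D x / x ^+ 2.
Proof.
move=> Ex x0; have := derM Ex (sfV Ex); rewrite divff // der1 => /esym/eqP.
rewrite addr_eq0 => /eqP h; apply: (mulfI x0); rewrite -[LHS]opprK -h.
by field.
Qed.
Lemma der_div x y : E x -> E y -> y != 0 -> D (x / y) = (D x * y - x * D y) / y ^+ 2.
Proof.
by move=> Ex Ey y0; rewrite derM ?derV //; [field | exact: sfV].
Qed.
Lemma der_sum (I : Type) (r : seq I) (G : I -> F) :
  (forall i, E (G i)) -> D (\sum_(i <- r) G i) = \sum_(i <- r) D (G i).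
Proof.
move=> EG; elim: r => [|i r IHr]; first by rewrite !big_nil der0.
by rewrite !big_cons dD.1 ?IHr //; apply: sf_sum.
Qed.
Lemma derX x n : E x -> D (x ^+ n) = x ^+ n.-1 * D x *+ n.
Proof.
move=> Ex; elim: n => [|n IHn]; first by rewrite expr0 der1 mulr0n.
rewrite exprS derM ?IHn //; last exact: sfX.
case: n {IHn} => [|n]; first by rewrite expr0 mulr1 mulr0n mulr0 addr0 mul1r.
by rewrite /= mulrnAr mulrA -exprS mulrC -mulrS.
Qed.

Lemma coef_Dpol p i : (Dpol D p)`_i = D p`_i.
Proof.
rewrite coef_poly; case: ltnP => // h; rewrite nth_default // der0 //.
Qed.
Lemma DpolD p q : over E p -> over E q -> Dpol D (p + q) = Dpol D p + Dpol D q.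
Proof. by move=> Ep Eq; apply/polyP => i; rewrite coefD !coef_Dpol coefD dD.1. Qed.
Lemma DpolN p : over E p -> Dpol D (- p) = - Dpol D p.
Proof. by move=> Ep; apply/polyP => i; rewrite coefN !coef_Dpol coefN derN. Qed.
Lemma DpolM p q : over E p -> over E q -> Dpol D (p * q) = Dpol D p * q + p * Dpol D q.
Proof.
move=> Ep Eq; apply/polyP => i; rewrite coefD !coef_Dpol !coefM der_sum; last first.
  by move=> j; apply: sfM.
rewrite -big_split /=; apply: eq_bigr => j _.
by rewrite !coef_Dpol derM.
Qed.
Lemma DpolC c : Dpol D c%:P = (D c)%:P.
Proof.
by apply/polyP => i; rewrite coef_Dpol !coefC; case: ifP => // _; rewrite der0.
Qed.
Lemma DpolX : Dpol D 'X = 0.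
Proof.
apply/polyP => i; rewrite coef_Dpol coefX coef0.
by case: (i == 1%N); rewrite ?der1 ?der0.
Qed.

(* The value forced on [p.[z]] by [D] on the coefficients and [z |-> w]. *)
Definition Dext z w p := (Dpol D p).[z] + p^`().[z] * w.

Lemma DextD z w p q : over E p -> over E q -> Dext z w (p + q) = Dext z w p + Dext z w q.
Proof. by move=> Ep Eq; rewrite /Dext DpolD // derivD !hornerD; ring. Qed.
Lemma DextM z w p q : over E p -> over E q ->
  Dext z w (p * q) = Dext z w p * q.[z] + p.[z] * Dext z w q.
Proof. by move=> Ep Eq; rewrite /Dext DpolM // derivM !hornerD !hornerM; ring. Qed.
Lemma DextN z w p : over E p -> Dext z w (- p) = - Dext z w p.
Proof. by move=> Ep; rewrite /Dext DpolN // derivN !hornerN; ring. Qed.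

Lemma der_horner p x : over E p -> E x -> D p.[x] = Dext x (D x) p.
Proof.
move=> Ep Ex; rewrite /Dext [p.[x]]horner_coef der_sum; last by move=> i; apply: sfM => //; apply: sfX.
have -> : p^`().[x] * D x = \sum_(i < size p) p`_i * D (x ^+ i).
  rewrite (@horner_coef_wide _ (size p)); last first.
    by case: (eqVneq p 0) => [->|p0]; rewrite ?deriv0 ?size_poly0 // ltnW // lt_size_deriv.
  rewrite mulr_suml.
  case sp: (size p) => [|n]; first by rewrite !big_ord0.
  rewrite big_ord_recr /= big_ord_recl /= expr0 der1 mulr0 add0r.
  rewrite coef_deriv [p`_n.+1]nth_default ?sp // mul0rn mul0r mul0r addr0.
  apply: eq_bigr => i _; rewrite derX // coef_deriv /bump /= add1n /=.
  by rewrite -mulr_natr -[in RHS]mulr_natr; ring.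
rewrite [(Dpol D p).[x]](@horner_coef_wide _ (size p)); last by rewrite size_poly.
rewrite -big_split /=; apply: eq_bigr => i _.
by rewrite coef_Dpol derM //; apply: sfX.
Qed.

(** The only obstruction to prescribing the value w at z is that a relation p(z) = 0 might force a
    nonzero value. Once this is excluded, the quotient rule applied to p(z)/q(z) does not depend on
    the fraction chosen. *)
Lemma der_ext z w : (forall p, over E p -> p.[z] = 0 -> Dext z w p = 0) ->
  exists D', [/\ deron (adj E z) D', forall x, E x -> D' x = D x & D' z = w].
Proof.
move=> H.
pose R f g := exists p q, [/\ over E p, over E q, q.[z] != 0, f = p.[z] / q.[z] &
   g = (Dext z w p * q.[z] - p.[z] * Dext z w q) / q.[z] ^+ 2].
have Rfun f g g' : R f g -> R f g' -> g = g'.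
  move=> [p [q [Ep Eq q0 -> ->]]] [p' [q' [Ep' Eq' q0' e ->]]].
  have /H : over E (p * q' - p' * q) by apply: overB; apply: overM.
  have e' : p.[z] * q'.[z] = p'.[z] * q.[z].
    by apply/eqP; rewrite -eqr_div // e.
  rewrite hornerD hornerN !hornerM e' subrr DextD ?DextN ?DextM //; try exact: overM; try (apply: overN; exact: overM).
  move=> /(_ erefl) e2.
  have : (Dext z w p * q.[z] - p.[z] * Dext z w q) * q'.[z] ^+ 2 =
         (Dext z w p' * q'.[z] - p'.[z] * Dext z w q') * q.[z] ^+ 2.
    have e3 : Dext z w p * q'.[z] = Dext z w p' * q.[z] + p'.[z] * Dext z w q - p.[z] * Dext z w q'.
      apply/eqP; rewrite -subr_eq0 -{}e2; apply/eqP. ring.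
    apply/eqP; rewrite -subr_eq0; apply/eqP.
    transitivity (q.[z] * q'.[z] * (Dext z w p * q'.[z]) - (p.[z] * q'.[z]) * Dext z w q * q'.[z]
      - (Dext z w p' * q'.[z] - p'.[z] * Dext z w q') * q.[z] ^+ 2); first ring.
    rewrite e3 e'.
    transitivity (q.[z] * (p'.[z] * q.[z] - p.[z] * q'.[z]) * Dext z w q'); first ring.
    by rewrite e'; ring.
  by move=> e4; apply/eqP; rewrite eqr_div ?expf_neq0 // e4.
have exg f : exists g, adj E z f -> R f g.
  have [[p [q [Ep Eq q0 e]]]|n] := pselect (adj E z f); last by exists 0.
  by eexists => _; exists p, q; split => //; reflexivity.
have [D' hD'] := choice exg.
have D'E f g : R f g -> D' f = g.
  move=> Rfg; apply: (Rfun f) => //; apply: hD'.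
  by case: Rfg => p [q [Ep Eq q0 e _]]; exists p, q.
have E1 : over E 1 by apply: overC; apply: sf1.
have D1 : Dext z w 1 = 0 by rewrite -polyC1 /Dext DpolC der1 derivC !hornerC mul0r addr0.
exists D'; split.
- split=> f g Af Ag.
    have [p [q [Ep Eq q0 ef eD]]] := hD' _ Af.
    have [p' [q' [Ep' Eq' q0' eg eD']]] := hD' _ Ag.
    rewrite eD eD'; apply: D'E; exists (p * q' + p' * q), (q * q').
    split; rewrite ?(hornerD, hornerM) ?mulf_neq0 //; try exact: overM; first by apply: overD; exact: overM.
      by rewrite ef eg; field; rewrite q0 q0'.
    rewrite DextD ?DextM //; try exact: overM.
    by field; rewrite q0 q0'.
  have [p [q [Ep Eq q0 ef eD]]] := hD' _ Af.
  have [p' [q' [Ep' Eq' q0' eg eD']]] := hD' _ Ag.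
  rewrite eD eD'; apply: D'E; exists (p * p'), (q * q').
  split; rewrite ?(hornerD, hornerM) ?mulf_neq0 //; try exact: overM.
    by rewrite ef eg; field; rewrite q0 q0'.
  rewrite ?DextM //; rewrite ef eg.
  by field; rewrite q0 q0'.
- move=> x Ex; apply: D'E; exists x%:P, 1; split=> //; first exact: overC.
  + by rewrite hornerC oner_eq0.
  + by rewrite !hornerC divr1.
  + by rewrite D1 !hornerC mulr0 subr0 expr1n divr1 mulr1 /Dext DpolC derivC !hornerC mul0r addr0.
- apply: D'E; exists 'X, 1; split=> //; first exact: overX.
  + by rewrite hornerC oner_eq0.
  + by rewrite hornerC hornerX divr1.
  + by rewrite D1 hornerC hornerX mulr0 subr0 expr1n divr1 mulr1 /Dext DpolX derivX !hornerC mul1r add0r.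
Qed.
End Der.
End One.
End Subfields.

(** * Bases of finitely generated extensions *)

Section Towers.
Variable F : fieldType.
Hypothesis char0 : forall n, n.+1%:R != 0 :> F.
Implicit Types (E : F -> Prop) (D : F -> F) (p q : {poly F}) (x y z f : F) (gs b : seq F).

Lemma min_over_deriv E z : subfield E -> algover E z ->
  exists m, [/\ over E m, m \is monic, root m z, m^`().[z] != 0 &
    forall p, over E p -> root p z -> exists2 u, over E u & p = u * m].
Proof.
move=> sE /(min_over sE)[m [Em mm rm minm]]; exists m; split => //.
have m0 := monic_neq0 mm.
have sm : (1 < size m)%N.
  by apply: (root_size_gt1 m0 rm).
apply/negP => /(minm _ (over_deriv sE Em))[u Eu dm].
have [u0|u0] := eqVneq u 0.
  have : m^`()`_(size m).-2 = 0 by rewrite dm u0 mul0r coef0.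
  rewrite coef_deriv; case: (size m) sm (lead_coefE m) => [|[|n]] //= _ <-.
  by rewrite (monicP mm); apply/eqP; exact: char0.
have := lt_size_deriv m0; rewrite dm size_Mmonic //.
move: u0; rewrite -size_poly_gt0; case: (size u) => // n _.
by rewrite addSn /= ltnNge leq_addl.
Qed.

Lemma der_ext_alg E D z : subfield E -> deron E D -> algover E z ->
  exists D', deron (adj E z) D' /\ forall x, E x -> D' x = D x.
Proof.
move=> sE dD /(min_over_deriv sE)[m [Em mm rm dm0 minm]].
(* This value is forced by differentiating m(z) = 0; separability makes m'(z) invertible. *)
have [|D' [dD' eD' _]] := @der_ext F E sE D dD z (- (Dpol D m).[z] / m^`().[z]); last by exists D'.
move=> p Ep /eqP rp; have [u Eu ->] := minm p Ep rp.
rewrite (DextM sE dD) // (rootP rm) mulr0 add0r /Dext mulrCA divff // mulr1 subrr mulr0 //.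
Qed.

Lemma der_ext_tr E D z w : subfield E -> deron E D -> ~ algover E z ->
  exists D', [/\ deron (adj E z) D', forall x, E x -> D' x = D x & D' z = w].
Proof.
move=> sE dD nz; apply: der_ext => // p Ep rp.
have -> : p = 0 by apply: contrapT => /eqP p0; apply: nz; exists p; rewrite /root rp eqxx.
rewrite /Dext deriv0 horner0 mul0r addr0.
have -> : Dpol D 0 = 0 by apply/polyP => i; rewrite (coef_Dpol sE) // !coef0 (der0 sE).
by rewrite horner0.
Qed.

Lemma der_zero_alg E E' D z : subfield E -> subfield E' -> (forall x, E x -> E' x) ->
  deron E' D -> (forall x, E x -> D x = 0) -> E' z -> algover E z -> D z = 0.
Proof.
move=> sE sE' sub dD D0 Ez /(min_over_deriv sE)[m [Em mm rm dm0 minm]].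
have := der_horner sE' dD (fun i => sub _ (Em i)) Ez.
rewrite (rootP rm) (der0 sE') // /Dext.
have -> : Dpol D m = 0 by apply/polyP => i; rewrite (coef_Dpol sE') // coef0 D0.
by rewrite horner0 add0r => /esym/eqP; rewrite mulf_eq0 (negPf dm0) => /eqP.
Qed.

Lemma der_zero_adj E D z : subfield E -> deron (adj E z) D ->
  (forall x, E x -> D x = 0) -> D z = 0 -> forall x, adj E z x -> D x = 0.
Proof.
move=> sE dD D0 Dz0 x [p [q [Ep Eq q0 ->]]].
have sA := adj_sf sE z; have Az := adj_gen sE z.
have Ap r : over E r -> over (adj E z) r by move=> Er i; apply: adj_sub.
have hD r : over E r -> D r.[z] = 0.
  move=> Er; rewrite (der_horner sA dD) //; last exact: Ap.
  rewrite /Dext Dz0 mulr0 addr0.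
  have -> : Dpol D r = 0 by apply/polyP => i; rewrite (coef_Dpol sA) // coef0 D0.
  exact: horner0.
rewrite (der_div sA) //; try by apply: (over_horner sA) => //; exact: Ap.
by rewrite !hD // mul0r mulr0 subrr mul0r.
Qed.

Definition gen E gs : F -> Prop := foldr (fun z E' => adj E' z) E gs.

Lemma gen_sf E gs : subfield E -> subfield (gen E gs).
Proof. by move=> sE; elim: gs => //= z gs IH; apply: adj_sf. Qed.
Lemma gen_sub E gs x : subfield E -> E x -> gen E gs x.
Proof.
by move=> sE Ex; elim: gs => //= z gs IH; apply: adj_sub => //; exact: gen_sf.
Qed.
Lemma gen_cat E gs gs' : gen E (gs' ++ gs) = gen (gen E gs) gs'.
Proof. by rewrite /gen foldr_cat. Qed.
Lemma gen_mem E gs z : subfield E -> z \in gs -> gen E gs z.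
Proof.
move=> sE; elim: gs => //= y gs IH; rewrite inE => /predU1P[->|/IH h].
  by apply: adj_gen; exact: gen_sf.
by apply: adj_sub => //; exact: gen_sf.
Qed.
Lemma adj_min E E' z x : subfield E' -> (forall x, E x -> E' x) -> E' z -> adj E z x -> E' x.
Proof.
move=> sE' sub E'z [p [q [Ep Eq q0 ->]]].
by apply: (sfdiv sE'); apply: (over_horner sE') => // i; apply: sub.
Qed.
Lemma gen_min E E' gs x : subfield E' -> (forall x, E x -> E' x) ->
  (forall z, z \in gs -> E' z) -> gen E gs x -> E' x.
Proof.
move=> sE' sub; elim: gs x => [|z gs IH] x /= Egs; first exact: sub.
apply: adj_min => //; last by apply: Egs; rewrite inE eqxx.
by move=> y; apply: IH => w wg; apply: Egs; rewrite inE wg orbT.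
Qed.

Lemma der_ext_gen E D gs : subfield E -> deron E D ->
  exists D', deron (gen E gs) D' /\ forall x, E x -> D' x = D x.
Proof.
move=> sE dD; elim: gs => [|z gs [D' [dD' eD']]]; first by exists D.
have sG := gen_sf gs sE.
have [az|nz] := pselect (algover (gen E gs) z).
  have [D2 [dD2 eD2]] := der_ext_alg sG dD' az.
  by exists D2; split => // x Ex; rewrite eD2 ?eD' //; exact: gen_sub.
have [D2 [dD2 eD2 _]] := der_ext_tr 0 sG dD' nz.
by exists D2; split => // x Ex; rewrite eD2 ?eD' //; exact: gen_sub.
Qed.

(* [b] lists the elements of [gs] that are transcendental over the field generated by their successors. *)
Inductive tower E : seq F -> seq F -> Prop :=
| tower_nil : tower E [::] [::]
| tower_alg z gs b : tower E gs b -> algover (gen E gs) z -> tower E (z :: gs) b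
| tower_tr z gs b : tower E gs b -> ~ algover (gen E gs) z -> tower E (z :: gs) (z :: b).

Lemma tower_ex E gs : exists b, tower E gs b.
Proof.
elim: gs => [|z gs [b tb]]; first by exists [::]; constructor.
have [az|nz] := pselect (algover (gen E gs) z).
  by exists b; apply: tower_alg.
by exists (z :: b); apply: tower_tr.
Qed.

Lemma tower_cat E gs b gs' b' : tower E gs b -> tower (gen E gs) gs' b' ->
  tower E (gs' ++ gs) (b' ++ b).
Proof.
move=> tb; elim=> [|z hs c tc IH az|z hs c tc IH nz] //=.
  by apply: tower_alg => //; rewrite gen_cat.
by apply: tower_tr => //; rewrite gen_cat.
Qed.

Lemma tower_mem E gs b : tower E gs b -> {subset b <= gs}.
Proof.
elim=> [|z hs c tc IH az|z hs c tc IH nz] // x; rewrite inE.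
  by move/IH; rewrite orbC => ->.
by case/predU1P=> [->|/IH]; rewrite inE ?eqxx // orbC => ->.
Qed.

(** Transcendental steps leave the value of a derivation free and algebraic steps force it, so the
    values on [b] can be prescribed. *)
Lemma tower_ext E D gs b (w : nat -> F) : subfield E -> deron E D -> tower E gs b ->
  exists D', [/\ deron (gen E gs) D', forall x, E x -> D' x = D x &
    forall i, (i < size b)%N -> D' b`_i = w i].
Proof.
move=> sE dD tb; elim: tb w => [|z hs c tc IH az|z hs c tc IH nz] w /=.
- by exists D.
- have [D1 [dD1 eD1 wD1]] := IH w; have sG := gen_sf hs sE.
  have [D2 [dD2 eD2]] := der_ext_alg sG dD1 az.
  exists D2; split => // [x Ex|i ci]; first by rewrite eD2 ?eD1 //; exact: gen_sub.
  by rewrite eD2 ?wD1 //; apply: gen_mem => //; apply: (tower_mem tc); exact: mem_nth.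
- have [D1 [dD1 eD1 wD1]] := IH (w \o S); have sG := gen_sf hs sE.
  have [D2 [dD2 eD2 zD2]] := der_ext_tr (w 0%N) sG dD1 nz.
  exists D2; split => // [x Ex|[|i] //= ci]; first by rewrite eD2 ?eD1 //; exact: gen_sub.
  by rewrite eD2 ?wD1 //; apply: gen_mem => //; apply: (tower_mem tc); exact: mem_nth.
Qed.

Lemma deron_sub E E' D : (forall x, E x -> E' x) -> deron E' D -> deron E D.
Proof. by move=> sub [h1 h2]; split=> x y /sub ? /sub ?; [exact: h1|exact: h2]. Qed.

Lemma tower_zero E D gs b : subfield E -> tower E gs b -> deron (gen E gs) D ->
  (forall x, E x -> D x = 0) -> (forall i, (i < size b)%N -> D b`_i = 0) ->
  forall x, gen E gs x -> D x = 0.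
Proof.
move=> sE tb dD D0; elim: tb dD => [|z hs c tc IH az|z hs c tc IH nz] dD b0; first exact: D0.
- have sG := gen_sf hs sE.
  have hD : forall x, gen E hs x -> D x = 0.
    by apply: IH => //; apply: deron_sub dD => x; exact: adj_sub.
  apply: der_zero_adj => //.
  apply: (@der_zero_alg (gen E hs) (gen E (z :: hs))) => //; first exact: adj_sf.
    by move=> x; exact: adj_sub.
  exact: adj_gen.
- have sG := gen_sf hs sE.
  have hD : forall x, gen E hs x -> D x = 0.
    apply: IH => //; first by apply: deron_sub dD => x; exact: adj_sub.
    by move=> i ci; apply: (b0 i.+1).
  by apply: der_zero_adj => //; apply: (b0 0%N).
Qed.

(** Values at [gs] of polynomials of degree at most d in each variable separately. The recursion on
    the variables matches that of [tower]. *)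
Fixpoint boxpol E gs (d : nat) : F -> Prop :=
  if gs is z :: gs' then fun f => exists p, [/\ (size p <= d.+1)%N,
    forall i, boxpol E gs' d p`_i & f = p.[z]] else E.

(** The spanning elements may lie outside V: only an upper bound for the dimension over E is wanted,
    and denominators are then harmless. *)
Definition spanned E (V : F -> Prop) d := exists (I : finType) (B : I -> F), (#|I| <= d)%N /\
  forall f, V f -> exists c : I -> F, (forall i, E (c i)) /\ f = \sum_i c i * B i.

Section Box.
Variable E : F -> Prop.
Hypothesis sE : subfield E.

Lemma boxpol_const gs d x : E x -> boxpol E gs d x.
Proof.
elim: gs x => //= z gs IH x Ex; exists x%:P; split; last by rewrite hornerC.
  exact: leq_trans (size_polyC_leq1 _) _.
by move=> i; rewrite coefC; case: ifP => _; apply: IH => //; apply: sf0.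
Qed.
Lemma boxpol0 gs d : boxpol E gs d 0. Proof. by apply: boxpol_const; apply: sf0. Qed.
Lemma boxpol_mono gs d d' x : (d <= d')%N -> boxpol E gs d x -> boxpol E gs d' x.
Proof.
move=> dd; elim: gs x => //= z gs IH x [p [sp cp ->]]; exists p; split => //.
  exact: leq_trans sp _.
by move=> i; apply: IH.
Qed.
Lemma boxpolD gs d x y : boxpol E gs d x -> boxpol E gs d y -> boxpol E gs d (x + y).
Proof.
elim: gs x y => [|z gs IH] x y /=; first exact: sfD.
move=> [p [sp cp ->]] [q [sq cq ->]]; exists (p + q); split; last by rewrite hornerD.
  by rewrite (leq_trans (size_polyD _ _)) // geq_max sp.
by move=> i; rewrite coefD; apply: IH.
Qed.
Lemma boxpol_sum gs d (I : Type) (r : seq I) (P : pred I) G :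
  (forall i, P i -> boxpol E gs d (G i)) -> boxpol E gs d (\sum_(i <- r | P i) G i).
Proof. by move=> h; apply: big_ind => //; [exact: boxpol0 | move=> x y; exact: boxpolD]. Qed.
Lemma boxpolM gs d d' x y : boxpol E gs d x -> boxpol E gs d' y -> boxpol E gs (d + d') (x * y).
Proof.
elim: gs x y => [|z gs IH] x y /=; first exact: sfM.
move=> [p [sp cp ->]] [q [sq cq ->]]; exists (p * q); split; last by rewrite hornerM.
  have [->|p0] := eqVneq p 0; first by rewrite mul0r size_poly0.
  have [->|q0] := eqVneq q 0; first by rewrite mulr0 size_poly0.
  rewrite size_mul // -subn1 leq_subLR add1n.
  by rewrite (leq_trans (leq_add sp sq)) // addSn addnS.
by move=> i; rewrite coefM; apply: boxpol_sum => j _; apply: IH.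
Qed.
Lemma boxpolN gs d x : boxpol E gs d x -> boxpol E gs d (- x).
Proof.
by move=> h; rewrite -mulN1r -[d]add0n; apply: boxpolM => //; apply: boxpol_const; apply: sfN => //; apply: sf1.
Qed.
Lemma boxpolX gs d x n : boxpol E gs d x -> boxpol E gs (d * n) (x ^+ n).
Proof.
move=> h; elim: n => [|n IH]; first by rewrite expr0; apply: boxpol_const; apply: sf1.
by rewrite exprS mulnS; apply: boxpolM.
Qed.
Lemma boxpol_tail z gs d x : boxpol E gs d x -> boxpol E (z :: gs) d x.
Proof.
move=> h; exists x%:P; split; last by rewrite hornerC.
  exact: leq_trans (size_polyC_leq1 _) _.
by move=> i; rewrite coefC; case: ifP => _ //; exact: boxpol0.
Qed.
Lemma boxpol_head z gs : boxpol E (z :: gs) 1 z.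
Proof.
exists 'X; split; rewrite ?hornerX ?size_polyX // => i.
by rewrite coefX; apply: boxpol_const; apply: sf_nat.
Qed.
Lemma boxpol_mem z gs : z \in gs -> boxpol E gs 1 z.
Proof.
elim: gs => //= y gs IH; rewrite inE => /predU1P[->|/IH h]; first exact: boxpol_head.
exact: boxpol_tail.
Qed.

Lemma gen_frac gs f : gen E gs f -> exists d u v,
  [/\ boxpol E gs d u, boxpol E gs d v, v != 0 & f = u / v].
Proof.
pose P f := exists d u v, [/\ boxpol E gs d u, boxpol E gs d v, v != 0 & f = u / v].
apply: (@gen_min E P).
- split.
  + by exists 0%N, 1, 1; rewrite divr1 oner_eq0; split => //; apply: boxpol_const; apply: sf1.
  + move=> _ _ [d [u [v [hu hv v0 ->]]]] [d' [u' [v' [hu' hv' v0' ->]]]].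
    exists (d + d')%N, (u * v' - v * u'), (v * v'); split; rewrite ?mulf_neq0 //.
    * by apply: boxpolD; [|apply: boxpolN]; exact: boxpolM.
    * exact: boxpolM.
    * by field; rewrite v0 v0'.
  + move=> _ _ [d [u [v [hu hv v0 ->]]]] [d' [u' [v' [hu' hv' v0' ->]]]].
    have [u0|u0] := eqVneq u' 0.
      exists 0%N, 0, 1; rewrite u0 mul0r invr0 mulr0 mul0r oner_eq0; split => //.
        exact: boxpol0.
      by apply: boxpol_const; apply: sf1.
    exists (d + d')%N, (u * v'), (v * u'); split; rewrite ?mulf_neq0 //; try exact: boxpolM.
    by field; rewrite v0 v0' u0.
- move=> x Ex; exists 0%N, x, 1; rewrite divr1 oner_eq0; split => //; first exact: boxpol_const.
  by apply: boxpol_const; apply: sf1.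
- move=> z zg; exists 1%N, z, 1; rewrite divr1 oner_eq0; split => //; first exact: boxpol_mem.
  by apply: boxpol_const; apply: sf1.
Qed.

Lemma spanned_horner (V W : F -> Prop) n m a z : spanned E V n -> a != 0 ->
  (forall f, W f -> exists p, [/\ (size p <= m)%N, forall i, V p`_i & a * f = p.[z]]) ->
  spanned E W (m * n).
Proof.
move=> [I [B [cI hB]]] a0 hW.
exists ('I_m * I)%type, (fun ik : 'I_m * I => B ik.2 * z ^+ ik.1 / a); split.
  by rewrite card_prod card_ord leq_mul2l cI orbT.
move=> f /hW[p [sp Vp e]].
have [c hc] := choice (fun i : 'I_m => hB _ (Vp i)).
exists (fun ik : 'I_m * I => c ik.1 ik.2); split; first by case=> i k; apply: (hc i).1.
rewrite -(pair_bigA _ (fun i k => c i k * (B k * z ^+ i / a))) /=.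
apply: (mulfI a0); rewrite e (horner_coef_wide _ sp) mulr_sumr.
apply: eq_bigr => i _; rewrite (hc i).2 mulr_suml mulr_sumr.
by apply: eq_bigr => k _; field.
Qed.

Lemma algover_denom gs z : algover (gen E gs) z -> exists a e n (c : nat -> F),
  [/\ a != 0, boxpol E gs e a, forall i, boxpol E gs e (c i) & a * z ^+ n.+1 = \sum_(i < n.+1) c i * z ^+ i].
Proof.
move=> /(min_over (gen_sf gs sE))[m [Em mm rm _]].
have [n sm] : exists n, size m = n.+2.
  have := root_size_gt1 (monic_neq0 mm) rm.
  by case: (size m) => [|[|n]] // _; exists n.
have hf (i : nat) : exists w : nat * F * F,
    [/\ boxpol E gs w.1.1 w.1.2, boxpol E gs w.1.1 w.2, w.2 != 0 & m`_i = w.1.2 / w.2].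
  by have [d [u [v [hu hv v0 e]]]] := gen_frac (Em i); exists (d, u, v).
have [w hw] := choice hf.
pose v i := (w i).2; pose u i := (w i).1.2; pose d i := (w i).1.1.
have Pbox (P : pred 'I_n.+1) : boxpol E gs (\sum_(i < n.+1) d i) (\prod_(i < n.+1 | P i) v i).
  rewrite [X in boxpol _ _ _ X]big_mkcond /=; elim: (index_enum _) => [|i r IHr].
    by rewrite !big_nil; apply: boxpol_const; exact: sf1.
  rewrite !big_cons; apply: boxpolM => //.
  by case: (P i); [case: (hw i)|apply: boxpol_const; exact: sf1].
pose e := (\sum_(i < n.+1) d i)%N.
exists (\prod_(i < n.+1) v i), (e + e)%N, n.
exists (fun i : nat => if (i < n.+1)%N then - (u i * \prod_(j < n.+1 | (j : nat) != i) v j) else 0).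
split.
- by apply/prodf_neq0 => i _; case: (hw i).
- by apply: boxpol_mono (Pbox xpredT); rewrite leq_addr.
- move=> i; case: ltnP => [ni|_]; last exact: boxpol0.
  apply: boxpolN; apply: boxpolM; last exact: Pbox.
  case: (hw i) => h _ _ _; apply: boxpol_mono h.
  by rewrite /e (bigD1 (Ordinal ni)) //= leq_addr.
- move/rootP: rm; rewrite horner_coef sm big_ord_recr /=.
  have -> : m`_n.+1 = 1 by move/monicP: mm; rewrite lead_coefE sm.
  rewrite mul1r => /eqP; rewrite addrC addr_eq0 => /eqP ->.
  rewrite mulrN mulr_sumr -sumrN; apply: eq_bigr => i _.
  rewrite ltn_ord; case: (hw i) => _ _ v0 ->; rewrite (bigD1 i) //= -/(v i) -/(u i).
  under [in LHS]eq_bigl do rewrite -val_eqE.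
  by rewrite -/(v i) in v0; field.
Qed.

(** The Hilbert function grows with order the transcendence degree. A transcendental generator
    contributes a factor d + 1. An algebraic one is reduced to bounded degree at the cost of a
    denominator, which replaces d by a fixed multiple and so changes only the constant. *)
Lemma hf_tower gs b : tower E gs b ->
  exists C, forall d, spanned E (boxpol E gs d) (C * d.+1 ^ size b).
Proof.
elim=> [|z hs c tc [C IH] az|z hs c tc [C IH] nz].
- exists 1%N => d; exists unit, (fun _ => 1); rewrite card_unit muln1; split => // f Ef.
  by exists (fun _ => f); split => //; rewrite big_const card_unit /= mulr1 addr0.
- have [a [e [n [k [a0 ha hk ek]]]]] := algover_denom az.
  (* Each power of z costs one factor a and adds e to the box degree of the coefficients, while the
     degree in z stays at most n. *)
  have red j : exists p, [/\ (size p <= n.+1)%N, forall i, boxpol E hs (e * j) p`_i &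
                            a ^+ j * z ^+ j = p.[z]].
    elim: j => [|j [p [sp cp ep]]].
      exists 1; rewrite size_poly1 hornerC !expr0 mulr1; split => // i.
      by rewrite coefC muln0; case: ifP => _; [apply: boxpol_const; exact: sf1|exact: boxpol0].
    exists (\poly_(i < n.+1) (a * (if i is i'.+1 then p`_i' else 0) + p`_n * k i)).
    split; first exact: size_poly.
      move=> i; rewrite coef_poly; case: ifP => _; last exact: boxpol0.
      rewrite mulnS; apply: boxpolD; last by rewrite addnC; apply: boxpolM.
      by apply: boxpolM => //; case: i => [|i]; [exact: boxpol0|exact: cp].
    rewrite horner_poly !exprS mulrACA ep (horner_coef_wide _ sp).
    under [RHS]eq_bigr do rewrite mulrDl.
    rewrite big_split /= big_ord_recr /= mulrDr.
    have -> : a * z * (p`_n * z ^+ n) = p`_n * (a * z ^+ n.+1) by rewrite exprS; ring.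
    rewrite ek [X in _ = X + _]big_ord_recl /= mulr0 mul0r add0r !mulr_sumr; congr (_ + _).
      by apply: eq_bigr => i _; rewrite /bump /= add1n exprS; ring.
    by apply: eq_bigr => i _; ring.
  have [r hr] := choice red.
  exists (n.+1 * C * e.+1 ^ size c)%N => d.
  have : spanned E (boxpol E (z :: hs) d) (n.+1 * (C * (e.+1 * d).+1 ^ size c)).
    apply: (@spanned_horner _ _ _ _ (a ^+ d) z (IH (e.+1 * d)%N)); first by rewrite expf_neq0.
    move=> f [p [sp cp ->]].
    (* All powers of z up to d are brought to the common denominator [a ^+ d]. *)
    exists (\sum_(i < d.+1) (p`_i * a ^+ (d - i)) *: r i); split.
    + apply: (big_ind (fun q => (size q <= n.+1)%N)); first by rewrite size_poly0.
        by move=> q q' sq sq'; rewrite (leq_trans (size_polyD _ _)) // geq_max sq.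
      move=> i _; apply: leq_trans (size_scale_leq _ _) _.
      by case: (hr i).
    + move=> i; rewrite coef_sum; apply: boxpol_sum => j _; rewrite coefZ.
      case: (hr j) => _ h _; rewrite mulSn.
      have -> : (d + e * d = d + e * (d - j) + e * j)%N.
        by rewrite -addnA -mulnDr subnK // -ltnS.
      by apply: boxpolM; [apply: boxpolM; [exact: cp|exact: boxpolX]|exact: h].
    + rewrite (horner_coef_wide _ sp) mulr_sumr horner_sum.
      apply: eq_bigr => i _; rewrite hornerZ; case: (hr i) => _ _ <-.
      rewrite mulrCA -!mulrA; congr (_ * _); rewrite mulrA -exprD subnK // -ltnS //.
  move=> [I [B [cI hB]]]; exists I, B; split => //; apply: leq_trans cI _.
  rewrite -!mulnA leq_mul2l /= leq_mul2l -expnMn; apply/orP; right.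
  case: (size c) => [|m] //; rewrite leq_exp2r //.
  by rewrite [X in (_ <= X)%N]mulnS -add1n leq_add2r.
- exists C => d.
  have : spanned E (boxpol E (z :: hs) d) (d.+1 * (C * d.+1 ^ size c)).
    apply: (@spanned_horner _ _ _ _ 1 z (IH d)); first exact: oner_neq0.
    by move=> f [p [sp cp ->]]; exists p; rewrite mul1r.
  by rewrite mulnCA -expnS.
Qed.
End Box.
End Towers.

(** * Linear independence of logarithmic differentials *)

Section LogResidue.
Variable F : fieldType.
Hypothesis char0 : forall n, n.+1%:R != 0 :> F.
Implicit Types (E G : F -> Prop) (D : F -> F) (p q : {poly F}) (x y z f : F) (gs b : seq F).

Lemma der_prod E D (I : eqType) (r : seq I) (a : I -> F) : subfield E -> deron E D ->
  (forall i, E (a i)) -> uniq r ->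
  D (\prod_(i <- r) a i) = \sum_(i <- r) D (a i) * \prod_(j <- r | j != i) a j.
Proof.
move=> sE dD Ea; elim: r => [|i r IHr]; first by rewrite !big_nil (der1 sE).
move=> /= /andP[ir ur]; rewrite !big_cons (derM dD) //; last by apply: sf_prod.
rewrite IHr // eqxx; congr (_ * _ + _).
  rewrite [RHS]big_seq_cond [LHS]big_seq; apply: eq_bigl => j.
  by rewrite andbC; case: eqP => [->|] //=; rewrite ?andbT // (negPf ir).
rewrite mulr_sumr [LHS]big_seq [RHS]big_seq; apply: eq_bigr => j jr.
rewrite big_cons ifT; first by rewrite mulrCA.
by apply: contraNneq ir => ->.
Qed.

(** Jacobi's formula, obtained by differentiating one row of the determinant at a time. *)
Lemma der_det E D n (X : 'M[F]_n) : subfield E -> deron E D -> (forall i j, E (X i j)) ->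
  D (\det X) = \tr (map_mx D X *m \adj X).
Proof.
move=> sE dD EX.
have Esign (s : 'S_n) : E ((-1) ^+ s) by apply: sfX => //; apply: sfN => //; apply: sf1.
have EP (s : 'S_n) : E (\prod_i X i (s i)) by apply: sf_prod.
rewrite /determinant (der_sum sE dD); last by move=> s; apply: sfM.
transitivity (\sum_i \det (\matrix_(k, j) if k == i then D (X k j) else X k j)).
  rewrite exchange_big /=; apply: eq_bigr => s _.
  rewrite (derM dD) // (der_prod sE dD) ?index_enum_uniq //.
  have -> : D ((-1) ^+ s) = 0.
    rewrite (derX sE dD) ?(derN sE dD) ?(der1 sE dD) ?oppr0 ?mulr0 ?mul0rn //; try exact: sf1.
    by apply: sfN => //; exact: sf1.
  rewrite mul0r add0r mulr_sumr; apply: eq_bigr => i _; congr (_ * _).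
  rewrite [RHS](bigD1 i) //= mxE eqxx; congr (_ * _).
  by apply: eq_bigr => j /negPf ji; rewrite mxE ji.
rewrite /mxtrace; apply: eq_bigr => i _; rewrite (expand_det_row _ i) mxE.
apply: eq_bigr => j _; rewrite !mxE eqxx; congr (_ * _).
rewrite /cofactor; congr (_ * \det _); apply/matrixP => k l; rewrite !mxE.
by rewrite eq_sym (negPf (neq_lift _ _)).
Qed.

(** The integer-valued [rho] replaces the residue of dx/x at a place where w vanishes. It keeps
    three properties: additivity, a nonzero value at w, and compatibility with linear relations over
    E between logarithmic derivatives. In this form it passes to algebraic extensions by composition
    with the norm. *)
Definition logres E D w G := exists rho : F -> int,
  [/\ forall x y, G x -> G y -> x != 0 -> y != 0 -> rho (x * y) = rho x + rho y,
      rho w != 0 &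
      forall (I : finType) (beta x : I -> F), (forall i, E (beta i)) ->
        (forall i, G (x i) /\ x i != 0) ->
        \sum_i beta i * (D (x i) / x i) = 0 -> \sum_i beta i * (rho (x i))%:~R = 0].

(** The order at w = 0 works: D acts as w d/dw, and for x = w^k r(w) with r(0) nonzero the
    logarithmic derivative is k plus a term that vanishes at w = 0. *)
Lemma logres_base E' E D w : subfield E' -> (forall x, E x -> E' x) -> ~ algover E' w ->
  deron (adj E' w) D -> (forall x, E' x -> D x = 0) -> D w = w ->
  logres E D w (adj E' w).
Proof.
move=> sE' sub trw dD D0 Dw.
have tr0 p : over E' p -> p.[w] = 0 -> p = 0.
  by move=> Ep rp; apply: contrapT => /eqP p0; apply: trw; exists p; rewrite /root rp eqxx.
have w0 : w != 0.
  apply/eqP => w0; apply: trw; exists 'X; rewrite polyX_eq0 rootX w0 eqxx; split => //.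
  exact: overX.
have sA := adj_sf sE' w.
have ADp p : over E' p -> D p.[w] = p^`().[w] * w.
  move=> Ep; rewrite (der_horner sA dD) ?/Dext ?Dw; last exact: adj_gen.
    have -> : Dpol D p = 0.
      by apply/polyP => i; rewrite (coef_Dpol sA dD) coef0 D0.
    by rewrite horner0 add0r.
  by move=> i; apply: adj_sub.
have muX n : mup 0 ('X^n : {poly F}) = n.
  have -> : 'X^n = ('X - 0%:P) ^+ n :> {poly F} by rewrite polyC0 subr0.
  by rewrite mup_XsubCX eqxx.
pose mu p := mup 0 p.
have muM p q : p != 0 -> q != 0 -> mu (p * q) = (mu p + mu q)%N.
  by move=> p0 q0; rewrite /mu mupM.
have muP p : over E' p -> p != 0 -> exists r, [/\ over E' r, r.[0] != 0 & p = 'X^(mu p) * r].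
  move=> Ep p0; have [m [r]] := multiplicity_XsubC p 0.
  rewrite p0 /= polyC0 subr0 => r0 ep.
  have em : mu p = m by rewrite /mu ep mupMr.
  exists r; rewrite em mulrC; split => // i.
  by move: (Ep (m + i)%N); rewrite ep coefMXn ltnNge leq_addr /= addKn.
have poly_case (I : finType) (beta : I -> F) (p : I -> {poly F}) : (forall i, E' (beta i)) ->
    (forall i, over E' (p i) /\ p i != 0) ->
    \sum_i beta i * (D (p i).[w] / (p i).[w]) = 0 -> \sum_i beta i * (mu (p i))%:R = 0.
  move=> Eb Ep.
  have [r hr] := choice (fun i => muP (p i) (Ep i).1 (Ep i).2).
  have Er i : over E' (r i) by case: (hr i).
  have rw0 i : (r i).[w] != 0.
    apply/eqP => /(tr0 _ (Er i)) e; case: (hr i) => _.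
    by rewrite e horner0 eqxx.
  have ldp i : D (p i).[w] / (p i).[w] = (mu (p i))%:R + w * (r i)^`().[w] / (r i).[w].
    rewrite ADp; last by case: (Ep i).
    case: (hr i) => _ _; move: (mu (p i)) (r i) (rw0 i) => k ri rw e.
    rewrite e derivM derivXn !(hornerD, hornerM, hornerMn, hornerXn).
    have -> : w ^+ k.-1 *+ k = k%:R * w ^+ k / w.
      case: k {e} => [|k]; first by rewrite mulr0n !mul0r.
      by rewrite [k.+1.-1]/= exprS -mulr_natl; field.
    by field; rewrite rw w0 expf_neq0.
  under eq_bigr do rewrite ldp.
  move=> sum0.
  (* The relation with denominators cleared. It vanishes at the transcendental w, hence identically,
     and its value at 0 is the relation between the orders. *)
  pose Q := \sum_i beta i *: (((mu (p i))%:R *: r i + 'X * (r i)^`()) * \prod_(j | j != i) r j).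
  have Eprod (P : pred I) : over E' (\prod_(j | P j) r j).
    apply: (big_ind (over E')) => //; last by move=> ? ?; exact: overM.
    by apply: overC => //; exact: sf1.
  have EQ : over E' Q.
    apply: (big_ind (over E')); first exact: over0.
      by move=> ? ?; exact: overD.
    move=> i _; apply: overZ => //; apply: overM => //; apply: overD => //.
      by apply: overZ => //; exact: sf_nat.
    by apply: overM => //; [exact: overX|exact: over_deriv].
  have Qw : Q.[w] = 0.
    transitivity ((\prod_j (r j).[w]) * 0); last by rewrite mulr0.
    rewrite -sum0 /Q horner_sum mulr_sumr; apply: eq_bigr => i _.
    rewrite !(hornerZ, hornerM, hornerD, hornerX) horner_prod.
    by rewrite [in RHS](bigD1 i) //=; field; exact: rw0.
  have := tr0 _ EQ Qw => /(congr1 (horner^~ 0)).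
  rewrite horner0 /Q horner_sum => e.
  have : (\prod_j (r j).[0]) * \sum_i beta i * (mu (p i))%:R = 0.
    rewrite -[RHS]e mulr_sumr; apply: eq_bigr => i _.
    rewrite !(hornerZ, hornerM, hornerD, hornerX) horner_prod mul0r addr0.
    by rewrite [in LHS](bigD1 i) //=; ring.
  move/eqP; rewrite mulf_eq0 => /orP[/prodf_eq0[i _]|/eqP //].
  by case: (hr i) => _ /negPf ->.
have repr x : exists pq : {poly F} * {poly F}, adj E' w x -> x != 0 ->
    [/\ over E' pq.1, over E' pq.2, pq.1.[w] != 0, pq.2.[w] != 0 & x = pq.1.[w] / pq.2.[w]].
  have [[p [q [Ep Eq q0 ->]]]|n] := pselect (adj E' w x); last by exists (0, 0).
  exists (p, q) => _ /=; rewrite mulf_eq0 invr_eq0 (negPf q0) orbF => p0; split => //.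
have [pq hpq] := choice repr.
pose rho x : int := (mu (pq x).1)%:Z - (mu (pq x).2)%:Z.
have nz p : p.[w] != 0 -> p != 0 by apply: contraNneq => ->; rewrite horner0.
have rhoE p q : over E' p -> over E' q -> p.[w] != 0 -> q.[w] != 0 ->
    rho (p.[w] / q.[w]) = (mu p)%:Z - (mu q)%:Z.
  move=> Ep Eq p0 q0; have x0 : p.[w] / q.[w] != 0 by rewrite mulf_neq0 ?invr_eq0.
  have [] := hpq (p.[w] / q.[w]) _ x0; first by exists p, q.
  rewrite /rho; case: (pq _) => p' q' /= Ep' Eq' p0' q0' /eqP.
  rewrite eqr_div // => /eqP e.
  have /(congr1 mu) : p * q' = p' * q.
    apply/eqP; rewrite -subr_eq0; apply/eqP; apply: tr0.
      by apply: overB => //; exact: overM.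
    by rewrite hornerD hornerN !hornerM e subrr.
  by rewrite !muM ?nz //; lia.
exists rho; split.
- move=> x y Gx Gy x0 y0.
  have [Ep Eq p0 q0 ex] := hpq _ Gx x0; have [Ep' Eq' p0' q0' ey] := hpq _ Gy y0.
  rewrite {1}ex {1}ey mulf_div -!hornerM rhoE ?hornerM ?mulf_neq0 //; try exact: overM.
  by rewrite !muM ?nz // /rho; lia.
- have -> : w = 'X.[w] / (1 : {poly F}).[w] by rewrite hornerX hornerC divr1.
  rewrite rhoE ?hornerX ?hornerC ?oner_eq0 //; try exact: overX; last first.
    by apply: overC => //; exact: sf1.
  have -> : mu 'X = 1%N by rewrite /mu -[RHS]muX expr1.
  by rewrite /mu mupNroot // /root hornerC oner_eq0.
- move=> I beta x Eb Gx sum0.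
  pose p i := (pq (x i)).1; pose q i := (pq (x i)).2.
  have hx i := hpq _ (Gx i).1 (Gx i).2.
  (* Numerators and denominators enter as one family, the latter with coefficient [- beta i]. *)
  have := @poly_case (I + I)%type (fun s => match s with inl i => beta i | inr i => - beta i end)
    (fun s => match s with inl i => p i | inr i => q i end).
  rewrite !big_sumType /= => H.
  transitivity (\sum_i beta i * (mu (p i))%:R + \sum_i - beta i * (mu (q i))%:R).
    rewrite -big_split; apply: eq_bigr => i _; rewrite /rho -/(p i) -/(q i).
    by rewrite rmorphB /= !pmulrn; ring.
  apply: H.
  + by case=> i; [|apply: sfN => //]; apply: sub.
  + by case=> i; case: (hx i) => ? ? /nz ? /nz ? _.
  rewrite -[RHS]sum0 -big_split; apply: eq_bigr => i _ /=.
  case: (hx i) => Ep Eq p0 q0 ->; rewrite -/(p i) -/(q i).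
  rewrite (der_div sA dD) //; try by apply: (over_horner sA); [move=> j; apply: adj_sub|exact: adj_gen].
  by field; rewrite p0 q0.
Qed.

(** Euclid's algorithm. It gives G(z) = G[z] for algebraic z, so that elements of the extension have
    coordinates in the powers of z. *)
Lemma over_inv G m z : subfield G -> over G m -> m \is monic -> root m z ->
  (forall p, over G p -> root p z -> exists2 u, over G u & p = u * m) ->
  forall q, over G q -> q.[z] != 0 -> exists2 u, over G u & u.[z] * q.[z] = 1.
Proof.
move=> sG Gm mm rm minm q Gq q0.
wlog sqm : q Gq q0 / (size q < size m)%N => [H|].
  have [u Gu [v Gv [e sv]]] := over_div sG Gq Gm mm.
  have ev : q.[z] = v.[z] by rewrite e hornerD hornerM (rootP rm) mulr0 add0r.
  by rewrite ev in q0 *; exact: H.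
have [n] := ubnP (size q); elim: n q Gq q0 sqm => // n IHn q Gq q0 sqm; rewrite ltnS => sqn.
have qn0 : q != 0 by apply: contraNneq q0 => ->; rewrite horner0.
pose l := lead_coef q; have l0 : l != 0 by rewrite lead_coef_eq0.
have Gl : G l by rewrite /l lead_coefE.
pose q1 : {poly F} := l^-1 *: q.
have Gq1 : over G q1 by apply: overZ => //; exact: sfV.
have mq1 : q1 \is monic by rewrite monicE lead_coefZ mulVf.
have sq1 : size q1 = size q by rewrite size_scale ?invr_eq0.
have [u Gu [v Gv [e sv]]] := over_div sG Gm Gq1 mq1.
have ez : u.[z] * (l^-1 * q.[z]) + v.[z] = 0.
  by rewrite -hornerZ -hornerM -hornerD -e (rootP rm).
rewrite sq1 in sv.
have [v0|v0] := eqVneq v.[z] 0.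
  move/eqP: ez; rewrite v0 addr0 !mulf_eq0 invr_eq0 (negPf l0) (negPf q0) !orbF => ru.
  have [u' _ eu] := minm _ Gu ru.
  have m0 := monic_neq0 mm.
  have u0 : u != 0.
    apply/eqP => u0; move: e sv; rewrite u0 mul0r add0r => <-.
    by rewrite ltnNge ltnW.
  have u'0 : u' != 0 by apply: contraNneq u0 => u'0; rewrite eu u'0 mul0r.
  have sum : (size m <= size u)%N.
    rewrite eu size_Mmonic //; move: u'0; rewrite -size_poly_gt0; case: (size u') => // k _.
    by rewrite addSn /= leq_addl.
  have sm : (size u + size q).-1 = size m.
    rewrite -sq1 -(size_Mmonic u0 mq1).
    have -> : u * q1 = m - v by rewrite e addrK.
    by rewrite size_polyDl // size_polyN (ltn_trans sv).
  have sq : size q = 1%N.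
    move: sm sum qn0; rewrite -size_poly_gt0; case: (size q) => [|[|k]] // sm sum _.
    by move: sum; rewrite -sm !addnS /= -ltnS -addSn leqNgt -addSn ltnS leq_addr.
  have /size_poly1P[c c0 eq] : size q == 1%N by rewrite sq.
  exists (c^-1)%:P; last by rewrite eq !hornerC mulVf.
  by apply: overC => //; apply: sfV => //; move: (Gq 0%N); rewrite eq coefC.
have [v' Gv' ev'] := IHn v Gv v0 (ltn_trans sv sqm) (leq_trans sv sqn).
exists (- (l^-1 *: (v' * u))).
  by apply: overN => //; apply: overZ; [| exact: sfV|exact: overM].
have ev : v.[z] = - (u.[z] * (l^-1 * q.[z])).
  by apply/eqP; rewrite -subr_eq0 opprK addrC ez.
by rewrite -ev' ev hornerN hornerZ hornerM; ring.
Qed.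

(** Compose [rho] with the norm. The norm is the determinant of multiplication on the powers of z,
    and the trace of a logarithmic derivative is the logarithmic derivative of the norm; taking
    traces turns a relation upstairs into one over G. *)
Lemma logres_alg E G D w z : subfield G -> (forall x, E x -> G x) -> deron (adj G z) D ->
  (forall x, G x -> G (D x)) -> algover G z -> G w -> w != 0 -> logres E D w G ->
  logres E D w (adj G z) /\ forall x, adj G z x -> adj G z (D x).
Proof.
move=> sG sub dD GD az Gw w0 [rho [rhoM rhow rhoS]].
have [m [Gm mm rm dm0 minm]] := min_over_deriv char0 sG az.
have sA := adj_sf sG z; have Az := adj_gen sG z.
have aG x : G x -> adj G z x by exact: adj_sub.
have adjP x : adj G z x -> exists2 p, over G p & x = p.[z].
  move=> [p [q [Gp Gq q0 ->]]]; have [u Gu eu] := over_inv sG Gm mm rm minm Gq q0.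
  exists (p * u); first exact: overM.
  by rewrite hornerM; apply: (mulIf q0); rewrite divfK // -mulrA eu mulr1.
have GDpol p : over G p -> over G (Dpol D p).
  by move=> Gp i; rewrite (coef_Dpol sA dD); exact: GD.
have Apol p : over G p -> adj G z p.[z].
  by move=> Gp; apply: (over_horner sA) => // i; exact: aG.
have dG : deron G D by exact: deron_sub dD.
have ADz : adj G z (D z).
  have := der_horner sA dD (fun i => aG _ (Gm i)) Az.
  rewrite (rootP rm) (der0 sA dD) /Dext => /esym/eqP; rewrite addrC addr_eq0 => /eqP e.
  have -> : D z = - (Dpol D m).[z] / m^`().[z] by rewrite -e mulrC mulKf.
  apply: (sfdiv sA); last by apply: Apol; exact: over_deriv.
  by apply: (sfN sA); apply: Apol; exact: GDpol.
have AD x : adj G z x -> adj G z (D x).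
  move=> /adjP[p Gp ->]; rewrite (der_horner sA dD) //; last by move=> i; exact: aG.
  apply: (sfD sA); first by apply: Apol; exact: GDpol.
  by apply: (sfM sA) => //; apply: Apol; exact: over_deriv.
split => //.
have [d sm] : exists d, size m = d.+2.
  have := root_size_gt1 (monic_neq0 mm) rm.
  by case: (size m) => [|[|n]] // _; exists n.
pose zeta : 'cV[F]_d.+1 := \col_i z ^+ i.
have coords x : adj G z x -> exists c : 'I_d.+1 -> F, (forall i, G (c i)) /\ x = \sum_i c i * z ^+ i.
  move=> /adjP[p Gp ->]; have [u Gu [v Gv [e sv]]] := over_div sG Gp Gm mm.
  exists (fun i => v`_i); split => //.
  rewrite e hornerD hornerM (rootP rm) mulr0 add0r; apply: horner_coef_wide.
  by rewrite -ltnS -sm.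
pose GM (X : 'M[F]_d.+1) := forall i j, G (X i j).
have matuniq X Y : GM X -> GM Y -> X *m zeta = Y *m zeta -> X = Y.
  move=> GX GY e; apply/matrixP => i j; apply/eqP; rewrite -subr_eq0.
  pose p := \poly_(k < d.+1) (X - Y) i (inord k).
  have Gp : over G p.
    move=> k; rewrite coef_poly; case: ifP => _; last exact: sf0.
    by rewrite !mxE; apply: sfB.
  have rp : root p z.
    rewrite /root horner_poly; apply/eqP.
    transitivity (((X - Y) *m zeta) i 0); last by rewrite mulmxBl e subrr mxE.
    by rewrite mxE; apply: eq_bigr => k _; rewrite inord_val [zeta _ _]mxE.
  have [u _ eu] := minm _ Gp rp.
  have u0 : u = 0.
    apply: contrapT => /eqP u0; have : (size p <= d.+1)%N by exact: size_poly.
    rewrite eu size_Mmonic // sm; move: u0; rewrite -size_poly_gt0; case: (size u) => // k _.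
    by rewrite addSn /= addnS ltnNge leq_addl.
  have : p`_j = 0 by rewrite eu u0 mul0r coef0.
  by rewrite coef_poly ltn_ord inord_val !mxE => ->.
have matex x : exists X : 'M[F]_d.+1, adj G z x -> GM X /\ X *m zeta = x *: zeta.
  have [Ax|nA] := pselect (adj G z x); last by exists 0.
  have hx (i : 'I_d.+1) : adj G z (x * z ^+ i) by apply: (sfM sA) => //; apply: (sfX sA).
  have [c hc] := choice (fun i => coords _ (hx i)).
  exists (\matrix_(i, j) c i j) => _; split; first by move=> i j; rewrite mxE; apply: (hc i).1.
  apply/colP => i; rewrite !mxE (hc i).2; apply: eq_bigr => j _; by rewrite !mxE.
have [X hX] := choice matex.
have XE x Y : adj G z x -> GM Y -> Y *m zeta = x *: zeta -> X x = Y.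
  by move=> Ax GY e; apply: matuniq => //; rewrite ?e; case: (hX _ Ax).
have GMmul Y Y' : GM Y -> GM Y' -> GM (Y *m Y').
  by move=> GY GY' i j; rewrite mxE; apply: sf_sum => // k _; apply: sfM.
have XM x y : adj G z x -> adj G z y -> X (x * y) = X x *m X y.
  move=> Ax Ay; have [GX ex] := hX _ Ax; have [GY ey] := hX _ Ay.
  apply: XE; [exact: sfM|exact: GMmul|].
  by rewrite -mulmxA ey -scalemxAr ex scalerA mulrC.
have XC c : G c -> X c = c%:M.
  move=> Gc; apply: XE; [exact: aG| |by rewrite mul_scalar_mx].
  by move=> i j; rewrite mxE; case: (i == j); rewrite ?mulr1n ?mulr0n //; exact: sf0.
have XS (I : finType) (x : I -> F) : (forall i, adj G z (x i)) ->
    X (\sum_i x i) = \sum_i X (x i).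
  move=> Ax; apply: XE; first exact: sf_sum.
    by move=> i j; rewrite summxE; apply: sf_sum => // k _; case: (hX _ (Ax k)).
  by rewrite mulmx_suml scaler_suml; apply: eq_bigr => i _; case: (hX _ (Ax i)).
have XV x : adj G z x -> x != 0 -> X x *m X x^-1 = 1%:M.
  by move=> Ax x0; rewrite -XM ?divff ?XC //; [exact: sf1|exact: sfV].
have detX0 x : adj G z x -> x != 0 -> \det (X x) != 0.
  move=> Ax x0; have /(congr1 determinant) := XV _ Ax x0.
  by rewrite det_mulmx det1 => e; apply/eqP => e0; move/eqP: e; rewrite e0 mul0r eq_sym oner_eq0.
have GdetX x : adj G z x -> G (\det (X x)).
  move=> Ax; have [GX _] := hX _ Ax; apply: sf_sum => // s _; apply: sfM => //; last exact: sf_prod.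
  by apply: sfX => //; apply: sfN => //; exact: sf1.
(* Derivatives of the basis. The correction they bring to [X (D x)] is a commutator with [X x],
   which disappears from the trace of [X (D x / x)]. *)
have [Gam [GGam eGam]] : exists Gam, GM Gam /\ Gam *m zeta = map_mx D zeta.
  have hz (i : 'I_d.+1) : adj G z (D (z ^+ i)) by apply: AD; apply: (sfX sA).
  have [c hc] := choice (fun i => coords _ (hz i)).
  exists (\matrix_(i, j) c i j); split; first by move=> i j; rewrite mxE; apply: (hc i).1.
  by apply/colP => i; rewrite !mxE (hc i).2; apply: eq_bigr => j _; rewrite !mxE.
have XD x : adj G z x -> X (D x) = map_mx D (X x) + X x *m Gam - Gam *m X x.
  move=> Ax; have [GX ex] := hX _ Ax; apply: XE; first exact: AD.
    move=> i j; rewrite !mxE.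
    apply: sfB => //; first apply: sfD => //; first by apply: GD.
      by apply: sf_sum => // k _; apply: sfM.
    by apply: sf_sum => // k _; apply: sfM.
  rewrite mulmxBl mulmxDl -!mulmxA ex eGam -scalemxAr eGam.
  apply/colP => i; have /colP/(_ i)/(congr1 D) := ex.
  rewrite !mxE (der_sum sA dD); last first.
    by move=> j; apply: (sfM sA); [exact: aG|rewrite mxE; exact: sfX].
  rewrite (derM dD) //; last exact: sfX.
  under eq_bigr => j _.
    rewrite mxE (derM dD); [|exact: aG|exact: sfX].
    over.
  rewrite big_split /= => e; apply/eqP; rewrite subr_eq; apply/eqP; rewrite -e.
  by congr (_ + _); apply: eq_bigr => j _; rewrite !mxE.
have trX x : adj G z x -> x != 0 -> \tr (X (D x / x)) = D (\det (X x)) / \det (X x).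
  move=> Ax x0; have Ax' := sfV sA Ax.
  rewrite XM //; last exact: AD.
  rewrite XD // mulmxBl mulmxDl !raddfB !raddfD /=.
  have -> : \tr (X x *m Gam *m X x^-1) = \tr Gam.
    by rewrite mxtrace_mulC mulmxA [X _ *m _](_ : _ = 1%:M) ?mul1mx // -XM // mulVf // XC //; exact: sf1.
  rewrite -mulmxA XV // mulmx1 addrK.
  have [GX _] := hX _ Ax; rewrite (der_det sG dG) //.
  have dx0 := detX0 _ Ax x0.
  have -> : X x^-1 = (\det (X x))^-1 *: \adj (X x).
    apply: (scalerI dx0); rewrite scalerA mulfV // scale1r.
    by rewrite -mul_scalar_mx -mul_adj_mx -mulmxA XV // mulmx1.
  by rewrite -scalemxAr mxtraceZ mulrC.
exists (fun x => rho (\det (X x))); split.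
- move=> x y Ax Ay x0 y0; by rewrite XM // det_mulmx rhoM //; [exact: GdetX|exact: GdetX|exact: detX0|exact: detX0].
- rewrite XC // det_scalar.
  have rX n : rho (w ^+ n.+1) = rho w *+ n.+1.
    elim: n => [|n IHn]; first by rewrite expr1 mulr1n.
    rewrite exprS rhoM ?expf_neq0 //; last exact: sfX.
    by rewrite IHn [RHS]mulrS.
  by rewrite rX mulrn_eq0.
- move=> I beta x Eb Ax sum0; apply: rhoS => // [i|].
    by case: (Ax i) => Axi x0; split; [exact: GdetX|exact: detX0].
  have Aq i : adj G z (D (x i) / x i).
    by case: (Ax i) => Axi x0; apply: (sfdiv sA) => //; exact: AD.
  have := @XS I (fun i => beta i * (D (x i) / x i)); rewrite sum0.
  rewrite XC; last exact: sf0.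
  move=> e; have {}e : (0%:M : 'M[F]_d.+1) = \sum_i X (beta i * (D (x i) / x i)).
    by apply: e => i; apply: (sfM sA); [apply: aG; exact: sub|].
  move/(congr1 mxtrace): e; rewrite mxtrace_scalar mul0rn raddf_sum /= => e; rewrite [RHS]e.
  apply: eq_bigr => i _; case: (Ax i) => Axi x0.
  rewrite XM; [|by apply: aG; apply: sub|exact: Aq].
  rewrite (XC (beta i)); last by apply: sub.
  by rewrite mul_scalar_mx mxtraceZ trX.
Qed.

Lemma logres_gen E G D w gs : subfield G -> (forall x, E x -> G x) -> deron (gen G gs) D ->
  (forall x, G x -> G (D x)) -> tower G gs [::] -> G w -> w != 0 -> logres E D w G ->
  logres E D w (gen G gs).
Proof.
move=> sG sub dD GD tw Gw w0 lG.
suff [] : logres E D w (gen G gs) /\ forall x, gen G gs x -> gen G gs (D x) by [].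
move: tw dD; move e0 : [::] => b tw; elim: tw e0 => [|z hs c tc IH az|z hs c tc IH nz] //= e0 dD.
have sGh := gen_sf hs sG.
have [lh gh] := IH e0 (deron_sub (fun x Gx => adj_sub sGh z Gx) dD).
apply: logres_alg => //; [| exact: gen_sub].
by move=> x Ex; apply: gen_sub => //; exact: sub.
Qed.

(** If some [w l] were transcendental over E, it could be made part of a transcendence basis. The
    derivation w d/dw killing the rest of the basis has a residue, and taking residues in the
    relation yields an integral relation between the [beta l] with a nonzero coefficient. *)
Lemma log_indep E gs (I : finType) (beta w : I -> F) : subfield E -> (forall x, gen E gs x) ->
  (forall l, E (beta l)) -> (forall l, w l != 0) ->
  (forall q : I -> int, \sum_l beta l * (q l)%:~R = 0 -> forall l, q l = 0) ->
  (forall D, deron (fun _ => True) D -> (forall x, E x -> D x = 0) ->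
     \sum_l beta l * (D (w l) / w l) = 0) ->
  forall l, algover E (w l).
Proof.
move=> sE Egs Eb w0 indep H l0; apply: contrapT => nw.
have sT : subfield (fun _ : F => True) by [].
(* Adjoining [w l0] before the generators makes it a member of the transcendence basis. *)
pose tw1 : tower E [:: w l0] [:: w l0] := tower_tr (tower_nil E) nw.
have [b' tb'] := tower_ex (gen E [:: w l0]) gs.
have tb := tower_cat tw1 tb'.
have genT x : gen E (gs ++ [:: w l0]) x.
  apply: (gen_min _ _ _ (Egs x)).
  - exact: gen_sf.
  - by move=> y; apply: gen_sub.
  - by move=> y yg; apply: gen_mem => //; rewrite mem_cat yg.
have zero_deron : deron E (fun _ => 0).
  by split=> *; rewrite ?addr0 ?mul0r ?mulr0 ?addr0.
have mkD (v : nat -> F) : exists D, [/\ deron (fun _ => True) D, forall x, E x -> D x = 0 &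
    forall i, (i < size (b' ++ [:: w l0]))%N -> D (b' ++ [:: w l0])`_i = v i].
  have [D [dD D0 Dv]] := tower_ext char0 v sE zero_deron tb.
  by exists D; split => //; split=> x y _ _; apply: dD.1 || apply: dD.2.
have lastb : (b' ++ [:: w l0])`_(size b') = w l0 by rewrite nth_cat ltnn subnn.
have szb : size (b' ++ [:: w l0]) = (size b').+1 by rewrite size_cat addn1.
have [D [dD D0 Dv]] := mkD (fun i => if i == size b' then w l0 else 0).
have Dw : D (w l0) = w l0 by rewrite -{1}lastb Dv ?szb // eqxx.
have Db' z : z \in b' -> D z = 0.
  move=> zb; have zi : (index z b' < size b')%N by rewrite index_mem.
  have : D (b' ++ [:: w l0])`_(index z b') = 0 by rewrite Dv ?(ltn_eqF zi) // szb ltnS ltnW.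
  by rewrite nth_cat zi nth_index.
pose E' := gen E b'; have sE' : subfield E' := gen_sf b' sE.
have D0' x : E' x -> D x = 0.
  apply: (@gen_min _ E (fun y => D y = 0)) => //.
  split; first exact: (der1 sT dD).
    by move=> y z ey ez; rewrite (derB sT dD) // ey ez subrr.
  move=> y z ey ez; have [->|z0] := eqVneq z 0; first by rewrite invr0 mulr0 (der0 sT dD).
  by rewrite (der_div sT dD) // ey ez !(mul0r, mulr0) subrr mul0r.
have nw' : ~ algover E' (w l0).
  move=> aw; have := der_zero_alg char0 sE' sT (fun _ _ => Logic.I) dD D0' Logic.I aw.
  by rewrite Dw => /eqP; exact/negP.
pose G := adj E' (w l0); have sG : subfield G := adj_sf sE' (w l0).
have dG G' : deron G' D by apply: deron_sub dD.
have GD x : G x -> G (D x).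
  have Gw : G (w l0) by exact: adj_gen.
  have dp p : over E' p -> G (D p.[w l0]).
    move=> Ep; rewrite (der_horner sG (dG _)) //; last by move=> i; apply: adj_sub.
    rewrite /Dext Dw; have -> : Dpol D p = 0.
      by apply/polyP => i; rewrite (coef_Dpol sG (dG _)) coef0 D0'.
    rewrite horner0 add0r; apply: (sfM sG) => //; apply: (over_horner sG) => // i.
    by apply: adj_sub => //; exact: over_deriv.
  have Gp p : over E' p -> G p.[w l0].
    by move=> Ep; apply: (over_horner sG) => // i; apply: adj_sub.
  move=> [p [q [Ep Eq q0 ->]]]; rewrite (der_div sT dD) //.
  apply: (sfdiv sG); last by apply: (sfX sG); exact: Gp.
  by apply: (sfB sG); apply: (sfM sG); (exact: dp || exact: Gp).
have lG : logres E D (w l0) G.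
  by apply: (@logres_base E' E) => //; move=> x; exact: gen_sub.
have [b2 tb2] := tower_ex G gs.
(* A generator transcendental over G would admit a derivation killing G and equal to 1 on it; but G
   contains a transcendence basis of the whole field. *)
have b20 : b2 = [::].
  have zG : deron G (fun _ => 0) by split=> *; rewrite ?addr0 ?mul0r ?mulr0 ?addr0.
  case: b2 tb2 => // z b2 tb2.
  have [D2 [dD2 D20 /(_ 0%N isT) /= D2z]] := tower_ext char0 (fun _ => 1) sG zG tb2.
  have gG x : gen G gs x.
    by apply: (gen_min _ _ _ (Egs x)); [exact: gen_sf| move=> y Ey; apply: gen_sub => //; apply: adj_sub => //; exact: gen_sub | move=> y; exact: gen_mem].
  have : D2 z = 0.
    apply: (tower_zero char0 sE tb) => //.
    - exact: deron_sub dD2.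
    - by move=> x Ex; apply: D20; apply: adj_sub => //; exact: gen_sub.
    - move=> i ib; apply: D20; rewrite nth_cat; case: ifP => ib'.
        by apply: adj_sub => //; apply: gen_mem => //; exact: mem_nth.
      have -> : (i - size b')%N = 0%N by move: ib ib'; rewrite szb ltnS leq_eqVlt => /predU1P[->|->]; rewrite ?subnn.
      exact: adj_gen.
  by rewrite D2z => /eqP; rewrite oner_eq0.
rewrite b20 in tb2.
have gG x : gen G gs x.
  by apply: (gen_min _ _ _ (Egs x)); [exact: gen_sf| move=> y Ey; apply: gen_sub => //; apply: adj_sub => //; exact: gen_sub | move=> y; exact: gen_mem].
have [rho [_ rhow rhoS]] : logres E D (w l0) (gen G gs).
  apply: logres_gen => //; last exact: adj_gen.
  by move=> x Ex; apply: adj_sub => //; exact: gen_sub.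
have := rhoS _ beta w Eb (fun i => conj (gG (w i)) (w0 i)) (H D dD D0).
by move/indep/(_ l0)/eqP; exact/negP.
Qed.
End LogResidue.

(** * An Ax-type theorem for subspaces of logarithmic forms *)

Lemma clear_denom m (a : 'rV[rat]_m) : exists (c : int) (u : 'rV[int]_m),
  c != 0 /\ map_mx intr u = c%:~R *: a.
Proof.
exists (\prod_i denq (a 0 i)), (\row_i (numq (a 0 i) * \prod_(j | j != i) denq (a 0 j))).
split; first by apply/prodf_neq0 => i _; exact: denq_neq0.
apply/rowP => i; rewrite !mxE [in RHS](bigD1 i) //= !intrM.
rewrite -[X in _ = _ * X]divq_num_den.
have : (denq (a 0 i))%:~R != 0 :> rat by rewrite intr_eq0 denq_neq0.
move: (numq _)%:~R (denq _)%:~R (\prod_(_ | _) _)%:~R => u v w v0.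
by field.
Qed.

Lemma submod_mx (F : fieldType) n (P : 'rV[F]_n -> Prop) :
  P 0 -> (forall (c : F) u v, P u -> P v -> P (c *: u + v)) ->
  exists M : 'M[F]_n, forall v, P v <-> (v <= M)%MS.
Proof.
move=> P0 PD.
have Pmul m (A : 'M_(m, n)) (c : 'rV_m) : (forall i, P (row i A)) -> P (c *m A).
  move=> PA; rewrite mulmx_sum_row; apply: big_ind => //.
    by move=> u v Pu Pv; rewrite -[u]scale1r; exact: PD.
  by move=> i _; rewrite -[_ *: _]addr0; exact: PD.
pose Q k := `[< exists M : 'M[F]_n, (forall i, P (row i M)) /\ \rank M = k >].
have exQ : exists k, Q k.
  by exists 0%N; apply/asboolP; exists 0; rewrite mxrank0; split => // i; rewrite row0.
have Qn k : Q k -> (k <= n)%N by move=> /asboolP[M [_ <-]]; exact: rank_leq_row.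
case: (ex_maxnP exQ Qn) => k /asboolP[M [PM rM]] maxM; exists M => v; split=> [Pv|/submxP[c ->]]; last exact: Pmul.
apply: contrapT => /negP nv.
have : (k < \rank (M + v)%MS)%N.
  rewrite -rM; apply: rank_ltmx; rewrite /ltmx addsmxSl /=.
  by apply: contra nv => /(submx_trans (addsmxSr _ _)).
rewrite ltnNge => /negP; apply; apply: maxM; apply/asboolP; exists (M + v)%MS; split => // i.
have /sub_addsmxP[[u1 u2] /= ->] := row_sub i (M + v)%MS.
rewrite -[u1 *m M]scale1r; apply: PD; first exact: Pmul.
by apply: Pmul => j; rewrite ord1 row_id.
Qed.

Section Ax.
Variable F : fieldType.
Hypothesis char0 : forall n, n.+1%:R != 0 :> F.
Variable K : F -> Prop.
Hypothesis sK : subfield K.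
Variables (gs b : seq F).
Hypothesis tb : tower K gs b.
Hypothesis genT : forall x, gen K gs x.
Let r := size b.

Definition derivation (D : F -> F) := deron (fun _ => True) D /\ forall x, K x -> D x = 0.

Variable d : 'I_r -> F -> F.
Hypothesis derd : forall i, derivation (d i).
Hypothesis dE : forall i j : 'I_r, d i b`_j = (i == j)%:R.

(** The vector field with coordinates f in the basis dual to [b]; by [derivation_eq] every
    derivation over K has this form. *)
Definition Dv (f : 'rV[F]_r) (g : F) := \sum_i f 0 i * d i g.

Let sT : subfield (fun _ : F => True). Proof. by []. Qed.

Lemma derivation_Dv f : derivation (Dv f).
Proof.
split; last by move=> x Kx; apply: big1 => i _; rewrite (derd i).2 ?mulr0.
split=> x y _ _; rewrite /Dv.
  by rewrite -big_split; apply: eq_bigr => i _ /=; rewrite (derd i).1.1 // mulrDr.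
rewrite mulr_suml mulr_sumr -big_split; apply: eq_bigr => i _ /=.
by rewrite (derd i).1.2 //; ring.
Qed.

Lemma derivation_eq D : derivation D -> D =1 Dv (\row_i D b`_i).
Proof.
move=> dD g; have dDv := derivation_Dv (\row_i D b`_i).
apply/eqP; rewrite -subr_eq0; apply/eqP.
apply: (@tower_zero _ char0 K (fun g => D g - Dv (\row_i D b`_i) g) gs b) => //.
- split=> x y _ _; first by rewrite dD.1.1 // dDv.1.1 //; ring.
  by rewrite dD.1.2 // dDv.1.2 //; ring.
- by move=> x Kx; rewrite dD.2 // dDv.2 // subrr.
- move=> i ib; rewrite /Dv (bigD1 (Ordinal ib)) //= mxE (dE (Ordinal ib) (Ordinal ib)) eqxx mulr1.
  rewrite big1 ?addr0 ?subrr // => j /negPf nj.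
  by rewrite (dE j (Ordinal ib)) nj mulr0.
Qed.

Lemma DvD c f g x : Dv (c *: f + g) x = c * Dv f x + Dv g x.
Proof.
by rewrite /Dv mulr_sumr -big_split; apply: eq_bigr => i _ /=; rewrite !mxE; ring.
Qed.
Lemma Dv0 x : Dv 0 x = 0.
Proof. by apply: big1 => i _; rewrite mxE mul0r. Qed.
Lemma Dv_mul m (c : 'rV[F]_m) (A : 'M[F]_(m, r)) x :
  Dv (c *m A) x = \sum_i c 0 i * Dv (row i A) x.
Proof.
rewrite /Dv; under eq_bigr do rewrite mxE mulr_suml.
rewrite exchange_big /=; apply: eq_bigr => i _; rewrite mulr_sumr.
by apply: eq_bigr => j _; rewrite mxE mulrA.
Qed.

Variables (n : nat) (x : 'I_n -> F).
Hypothesis x0 : forall j, x j != 0.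

Definition Lam := \matrix_(i < r, j < n) (d i (x j) / x j).

Lemma Lam_row f j : (f *m Lam) 0 j = Dv f (x j) / x j.
Proof. by rewrite mxE /Dv mulr_suml; apply: eq_bigr => i _; rewrite mxE mulrA. Qed.

Definition monz (q : 'I_n -> int) := \prod_j x j ^ q j.

Lemma monz_neq0 q : monz q != 0.
Proof. by apply/prodf_neq0 => j _; rewrite expfz_neq0. Qed.

Lemma der_expz D y (k : int) : derivation D -> y != 0 -> D (y ^ k) / y ^ k = k%:~R * (D y / y).
Proof.
move=> dD y0; have hn m : D (y ^+ m) / y ^+ m = m%:R * (D y / y).
  rewrite (derX sT dD.1) //; case: m => [|m]; first by rewrite mulr0n !mul0r.
  by rewrite exprS -mulr_natl /=; field; rewrite expf_neq0 // y0.
case: k => m; first by rewrite -exprnP hn.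
rewrite NegzE -exprnN (derV sT dD.1) ?expf_neq0 //.
have -> : (- (m.+1 : int))%:~R = - (m.+1)%:R :> F by rewrite rmorphN.
rewrite [RHS]mulNr -hn.
have := expf_neq0 m.+1 y0; move: (y ^+ m.+1) => Y Y0.
by rewrite invrK; field.
Qed.

Lemma der_monz D q : derivation D -> D (monz q) / monz q = \sum_j (q j)%:~R * (D (x j) / x j).
Proof.
move=> dD; rewrite /monz; elim: (index_enum _) => [|j s IHs].
  by rewrite !big_nil (der1 sT dD.1) mul0r.
rewrite !big_cons (derM dD.1) // -(der_expz _ dD) // -IHs.
have p0 : \prod_(j0 <- s) x j0 ^ q j0 != 0 by rewrite prodf_seq_neq0; apply/allP => k _ /=; rewrite expfz_neq0.
by field; rewrite p0 expfz_neq0.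
Qed.

Section Const.
Variables (s : nat) (L : 'M[F]_(s, n)).
Hypothesis KL : forall i j, K (L i j).
Hypothesis fL : row_free L.
Hypothesis degen : exists2 f : 'rV[F]_r, f != 0 & f *m Lam *m L^T = 0.

(** Let V be the vector fields killed by the forms of L, E the field of first integrals of V, and T
    all vector fields killing E; informally T is tangent to the Zariski closures of the leaves. The
    combinations of the forms vanishing on T have a basis with coefficients in E, and [log_indep]
    over E turns them into monomials constant along T. The count s < m + e holds because f lies in
    T, so that the s forms have rank less than e on T. *)
Theorem ax_log : exists e m (T : 'M[F]_(e, r)) (mu : 'M[int]_(m, n)),
  [/\ row_free T, (0 < e)%N, (s < m + e)%N, row_free (map_mx intr mu : 'M[rat]_(m, n)) &
      forall i f, (f <= T)%MS -> Dv f (monz (fun j => mu i j)) = 0].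
Proof.
pose V (f : 'rV[F]_r) := f *m Lam *m L^T = 0.
pose E g := forall f, V f -> Dv f g = 0.
have sE : subfield E.
  split=> [f _|y z Ey Ez f Vf|y z Ey Ez f Vf]; have [dD _] := derivation_Dv f.
  - exact: (der1 sT dD).
  - by rewrite (derB sT dD) // Ey // Ez // subrr.
  - have [->|z0] := eqVneq z 0; first by rewrite invr0 mulr0 (der0 sT dD).
    by rewrite (der_div sT dD) // Ey // Ez // !(mul0r, mulr0) subrr mul0r.
have KE y : K y -> E y by move=> Ky f _; case: (derivation_Dv f) => _; apply.
have ET c u v : (forall g, E g -> Dv u g = 0) -> (forall g, E g -> Dv v g = 0) ->
    forall g, E g -> Dv (c *: u + v) g = 0.
  by move=> hu hv g Eg; rewrite DvD hu // hv // mulr0 addr0.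
have [T0 hT0] := @submod_mx _ _ (fun f => forall g, E g -> Dv f g = 0) (fun g _ => Dv0 g) ET.
pose e := \rank T0.
have [T [fT hT]] : exists T : 'M[F]_(e, r), row_free T /\
    forall f, (f <= T)%MS <-> forall g, E g -> Dv f g = 0.
  exists (row_base T0); split; first exact: row_base_free.
  by move=> f; rewrite eq_row_base; apply: iff_sym; exact: hT0.
have VT f : V f -> (f <= T)%MS by move=> Vf; apply/hT => g; apply.
have egt0 : (0 < e)%N.
  have [f f0 Vf] := degen; rewrite lt0n; apply: contraNneq f0 => e0.
  by have /mxrankS := VT f Vf; rewrite (eqP fT) e0 leqn0 mxrank_eq0.
have int0 (k : int) : k != 0 -> k%:~R != 0 :> F.
  case: k => [[|k]|k] // _; first exact: char0.
  by rewrite NegzE rmorphN oppr_eq0; exact: char0.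
pose Rm := kermx (L *m Lam^T *m T^T).
have RelP (g : 'rV_s) : (g <= Rm)%MS <-> forall f : 'rV_r, (f <= T)%MS -> g *m L *m Lam^T *m f^T = 0.
  split=> [/sub_kermxP h f /submxP[c ->]|h].
    by rewrite trmx_mul !mulmxA in h *; rewrite h mul0mx.
  apply/sub_kermxP; apply/rowP => j; rewrite !mulmxA.
  have := h (row j T) (row_sub _ _); rewrite tr_row colE mulmxA -colE => /colP/(_ 0).
  by rewrite mxE => ->; rewrite !mxE.
pose rho := \rank Rm.
have rho_ge : (s < rho + e)%N.
  rewrite /rho mxrank_ker -mxrank_tr !trmx_mul !trmxK mulmxA -mulmxA.
  have [f f0 Vf] := degen.
  have := mxrank_mul_ker T (Lam *m L^T); rewrite (eqP fT) -/e.
  have : (0 < \rank (T :&: kermx (Lam *m L^T))%MS)%N.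
    rewrite lt0n mxrank_eq0; apply: contraNneq f0 => c0.
    rewrite -submx0 -c0 sub_capmx VT //=.
    by apply/sub_kermxP; rewrite mulmxA.
  have := rank_leq_row (L *m Lam^T *m T^T); rewrite -mxrank_tr !trmx_mul !trmxK mulmxA -mulmxA.
  by lia.
have [B [fB eB]] : exists B : 'M[F]_(rho, s), row_free B /\ (B :=: Rm)%MS.
  by exists (row_base Rm); split; [exact: row_base_free|exact: eq_row_base].
have fBT : row_full B^T by rewrite /row_full mxrank_tr.
pose phi := fullrankfun fBT.
pose U := rowsub phi B^T; have Uu : U \in unitmx by exact: fullrowsub_unit.
(* Normalizing the columns [phi] to the identity makes the basis canonical: its derivative along V
   lies in the same row space but vanishes in these columns, hence is zero, and the entries lie in
   E. *)
pose G := (invmx U)^T *m B.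
have eqG : (G :=: Rm)%MS.
  apply: eqmx_trans eB; apply: eqmxMfull.
  by rewrite row_full_unit unitmx_tr unitmx_inv.
have Gphi i j : G i (phi j) = (i == j)%:R.
  have : (G^T) (phi j) i = (rowsub phi G^T) j i by rewrite !mxE.
  rewrite mxE => ->; rewrite /G trmx_mul trmxK.
  have -> : rowsub phi (B^T *m invmx U) = U *m invmx U by rewrite /U mul_rowsub_mx.
  by rewrite mulmxV // mxE eq_sym.
clearbody G.
(* A Lie derivative: the forms are closed, v annihilates them, and the bracket of v with an element
   of T kills E again, hence lies in T. *)
have stab (g : 'rV_s) v : (g <= Rm)%MS -> V v -> (map_mx (Dv v) g <= Rm)%MS.
  move=> /RelP gR Vv; apply/RelP => f fTf.
  have dv := derivation_Dv v; have df := derivation_Dv f.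
  pose om (D : F -> F) (a : 'I_s) := \sum_j L a j * (D (x j) / x j).
  have omE (h : 'rV_s) f' : (h *m L *m Lam^T *m f'^T) 0 0 = \sum_a h 0 a * om (Dv f') a.
    rewrite -!mulmxA mxE; apply: eq_bigr => a _; congr (_ * _).
    rewrite mxE; apply: eq_bigr => j _; congr (_ * _).
    by rewrite -Lam_row -[_ *m _]trmxK trmx_mul !trmxK mxE.
  have om_v a : om (Dv v) a = 0.
    have /rowP/(_ a) := Vv; rewrite !mxE => e0; rewrite -[RHS]e0; apply: eq_bigr => j _.
    by rewrite Lam_row mulrC [in RHS]mxE.
  pose br y := Dv v (Dv f y) - Dv f (Dv v y).
  have dbr : derivation br.
    split; last by move=> y Ky; rewrite /br (df.2 y Ky) (dv.2 y Ky) (der0 sT dv.1) (der0 sT df.1) subrr.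
    split=> y z _ _; rewrite /br.
      by rewrite !(dv.1.1, df.1.1) //; ring.
    by rewrite !(dv.1.2, df.1.2) // !(dv.1.1, df.1.1) // !(dv.1.2, df.1.2) //; ring.
  have ebr := derivation_eq dbr; set h := (\row__ _) in ebr.
  have hTh : (h <= T)%MS.
    apply/hT => y Ey; rewrite -ebr /br (Ey v Vv).
    have /hT -> // := fTf; by rewrite (der0 sT dv.1) (der0 sT df.1) subrr.
  apply/rowP => k; rewrite ord1 omE mxE.
  have e1 := congr1 (fun A : 'rV_1 => Dv v (A 0 0)) (gR f fTf).
  rewrite /= omE mxE (der0 sT dv.1) (der_sum sT dv.1) // in e1.
  have e2 : \sum_a g 0 a * om br a = 0.
    have /rowP/(_ 0) := gR h hTh; rewrite omE mxE => e2.
    rewrite -[RHS]e2; apply: eq_bigr => a _; congr (_ * _).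
    by apply: eq_bigr => j _; rewrite ebr.
  transitivity (\sum_a Dv v (g 0 a * om (Dv f) a) - \sum_a g 0 a * om br a); last by rewrite e1 e2 subrr.
  rewrite -sumrB; apply: eq_bigr => a _; rewrite mxE (derM dv.1) //.
  suff -> : Dv v (om (Dv f) a) = om br a by rewrite addrK.
  transitivity (om br a + Dv f (om (Dv v) a)); last by rewrite om_v (der0 sT df.1) addr0.
  rewrite /om !(der_sum sT dv.1, der_sum sT df.1) // -big_split; apply: eq_bigr => j _ /=.
  rewrite (derM dv.1) // (derM df.1) // (dv.2 _ (KL a j)) (df.2 _ (KL a j)) !mul0r !add0r -mulrDr; congr (_ * _).
  rewrite (der_div sT dv.1) // (der_div sT df.1) // /br.
  by field.
have EG i j : E (G i j).
  move=> v Vv; have : (map_mx (Dv v) (row i G) <= G)%MS.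
    by rewrite eqG; apply: stab => //; rewrite -eqG row_sub.
  move=> /submxP[c ec].
  have c0 : c = 0.
    apply/rowP => k; have /rowP/(_ (phi k)) := ec; rewrite !mxE Gphi.
    rewrite (bigD1 k) //= Gphi eqxx mulr1 big1 ?addr0 => [<-|l /negPf lk]; last first.
      by rewrite Gphi lk mulr0.
    have dv := derivation_Dv v.
    by case: (i == k); [exact: (der1 sT dv.1)|exact: (der0 sT dv.1)].
  by have /rowP/(_ j) := ec; rewrite c0 mul0mx !mxE.
pose BB := G *m L.
have EBB i j : E (BB i j).
  by rewrite mxE; apply: (sf_sum sE) => k _; apply: (sfM sE); [exact: EG|apply: KE; exact: KL].
have rBB : \rank BB = rho by rewrite /BB mxrankMfree // eqG.
pose Pm k := `[< exists mu : 'M[int]_(k, n), row_free (map_mx intr mu : 'M[rat]_(k, n)) /\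
   forall i f, (f <= T)%MS -> Dv f (monz (fun j => mu i j)) = 0 >].
have exP : exists k, Pm k.
  exists 0%N; apply/asboolP; exists 0; split; last by case.
  by rewrite /row_free -leqn0 rank_leq_row.
have Pn k : Pm k -> (k <= n)%N by move=> /asboolP[mu [/eqP e1 _]]; rewrite -e1 rank_leq_col.
case: (ex_maxnP exP Pn) => m /asboolP[mu [fmu hmu]] maxm.
have span (q : 'rV[int]_n) : (forall f, (f <= T)%MS -> Dv f (monz (q 0)) = 0) ->
    exists (c : int) (a : 'rV[int]_m), c != 0 /\ c *: q = a *m mu.
  move=> hq.
  have [/submxP[a' ea]|nsub] := boolP ((map_mx intr q : 'rV[rat]_n) <= (map_mx intr mu : 'M[rat]_(m, n)))%MS.
    have [c [u [c0 eu]]] := clear_denom a'; exists c, u; split => //.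
    have e1 : map_mx intr (c *: q) = map_mx intr (u *m mu) :> 'rV[rat]_n.
      by rewrite map_mxZ map_mxM eu ea scalemxAl.
    apply/matrixP => i j; have /matrixP/(_ i j) := e1; rewrite !mxE => /intr_inj; exact.
  have : Pm (m + 1)%N.
    apply/asboolP; exists (col_mx mu q); split.
      rewrite map_col_mx /row_free eqn_leq rank_leq_row /= -addsmxE addn1 -{1}(eqP fmu).
      apply: rank_ltmx; rewrite /ltmx addsmxSl; apply: contra nsub => h.
      exact: submx_trans (addsmxSr _ _) h.
    move=> i f fTf; case: (splitP i) => j ej.
      rewrite (_ : (fun _ => _) = (fun k => mu j k)); first exact: hmu.
      have -> : i = lshift 1 j by apply: val_inj; rewrite /= ej.
      by apply/funext => k; rewrite col_mxEu.
    rewrite (_ : (fun _ => _) = q 0); first exact: hq.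
    have -> : i = rshift m j by apply: val_inj; rewrite /= ej.
    by apply/funext => k; rewrite col_mxEd (ord1 j).
  by move/maxm; rewrite addn1 ltnn.
pose muF : 'M[F]_(m, n) := map_mx intr mu.
suff : (rho <= m)%N by move=> rm; exists e, m, T, mu; split => //; lia.
rewrite -rBB; apply: leq_trans (rank_leq_row muF); apply: mxrankS; apply/row_subP => k.
pose bb j := BB k j.
(* The coefficients of a row may satisfy integral relations. A maximal independent set J of columns
   absorbs the other coordinates into monomials, to which [log_indep] applies. *)
pose indep (J : {set 'I_n}) := `[< forall q : 'I_n -> int, (forall j, j \notin J -> q j = 0) ->
   \sum_j bb j * (q j)%:~R = 0 -> forall j, q j = 0 >].
have ind0 : indep set0 by apply/asboolP => q q0 _ j; apply: q0; rewrite inE.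
have [J /maxsetP[/asboolP indJ maxJ] _] := maxset_exists ind0.
have expand i : exists ca : int * ('I_n -> int), [/\ ca.1 != 0, forall j, j \notin J -> ca.2 j = 0 &
    ca.1%:~R * bb i = \sum_j bb j * (ca.2 j)%:~R].
  have [iJ|iJ] := boolP (i \in J).
    exists (1, fun j => (j == i)%:R); split => //= [j jJ|].
      by case: eqP jJ => // ->; rewrite iJ.
    rewrite mul1r (bigD1 i) //= eqxx mulr1 big1 ?addr0 // => j /negPf ->.
    by rewrite mulr0.
  have nind : ~ indep (i |: J).
    by move=> h; have := maxJ _ h (subsetUr _ _) => e0; move: iJ; rewrite -e0 setU11.
  have [q [q0 qs [j0 qj0]]] : exists q : 'I_n -> int, [/\ forall j, j \notin i |: J -> q j = 0,
      \sum_j bb j * (q j)%:~R = 0 & exists j, q j != 0].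
    apply: contrapT => hq; apply: nind; apply/asboolP => q q0 qs j; apply: contrapT => /eqP qj.
    by apply: hq; exists q; split => //; exists j.
  have qi : q i != 0.
    apply/eqP => qi; move/eqP: qj0; apply; apply: indJ => // j jJ.
    have [->//|ji] := eqVneq j i; apply: q0.
    by rewrite !inE negb_or ji.
  exists (q i, fun j => if j == i then 0 else - q j); split => //= [j jJ|].
    by case: eqP => // /eqP ji; rewrite q0 ?oppr0 // !inE negb_or ji.
  rewrite (bigD1 i) //= eqxx mulr0 add0r; apply/eqP; rewrite -subr_eq0 -sumrN.
  move: qs; rewrite (bigD1 i) //= mulrC => qs; apply/eqP; rewrite -[RHS]qs; congr (_ + _).
  by apply: eq_bigr => j /negPf ->; rewrite rmorphN mulrN opprK.
have [ca hca] := choice expand.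
pose N := \prod_i (ca i).1.
have N0 : N != 0 by apply/prodf_neq0 => i _; case: (hca i).
pose A i j := (ca i).2 j * \prod_(l | l != i) (ca l).1.
have AJ i j : j \notin J -> A i j = 0 by move=> jJ; rewrite /A; case: (hca i) => _ -> //; rewrite mul0r.
have NA i : N%:~R * bb i = \sum_j bb j * (A i j)%:~R.
  rewrite /N (bigD1 i) //= intrM mulrAC; case: (hca i) => _ _ ->; rewrite mulr_suml.
  by apply: eq_bigr => j _; rewrite /A intrM; ring.
have constw j : j \in J -> forall f, (f <= T)%MS -> Dv f (monz (fun i => A i j)) = 0.
  move=> jJ f fTf.
  pose w (l : 'I_#|J|) := monz (fun i => A i (enum_val l)).
  have [l ->] : exists l : 'I_#|J|, j = enum_val l by exists (enum_rank_in jJ j); rewrite enum_rankK_in.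
  have df := derivation_Dv f.
  apply: (der_zero_alg char0 sE sT (fun _ _ => Logic.I) df.1) => //; first by move: fTf => /hT.
  apply: (@log_indep _ char0 E gs 'I_#|J| (fun l => bb (enum_val l)) w) => //.
  - move=> y; apply: (gen_min _ _ _ (genT y)); first exact: gen_sf.
      by move=> z Kz; apply: gen_sub => //; exact: KE.
    by move=> z zg; exact: gen_mem.
  - by move=> l'; exact: EBB.
  - by move=> l'; exact: monz_neq0.
  - move=> q q0 l'; pose q' j := \sum_(l | enum_val l == j) q l.
    have q'E l2 : q' (enum_val l2) = q l2.
      by apply: big_pred1 => l3; rewrite (inj_eq enum_val_inj).
    rewrite -q'E; apply: indJ => [i iJ|].
      by apply: big1 => l2 /eqP e2; move: iJ; rewrite -e2 enum_valP.
    transitivity (\sum_(j in J) bb j * (q' j)%:~R).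
      rewrite [LHS](bigID (mem J)) /= [X in _ + X]big1 ?addr0 // => i iJ.
      rewrite /q' big1 ?mulr0 // => l2 /eqP e2; by move: iJ; rewrite -e2 enum_valP.
    rewrite big_enum_val /= -[RHS]q0; apply: eq_bigr => l2 _.
    by rewrite q'E.
  - move=> D dD D0.
    have derD : derivation D by split => // y Ky; apply: D0; exact: KE.
    have eD := derivation_eq derD; set h := (\row__ _) in eD.
    have hTh : (h <= T)%MS by apply/hT => g Eg; rewrite -eD D0.
    have Bh : (row k G *m L *m Lam^T *m h^T) = 0.
      have gR : (row k G <= Rm)%MS by rewrite -eqG row_sub.
      exact: (RelP _).1 gR h hTh.
    have sum0 : \sum_j bb j * (D (x j) / x j) = 0.
      have /rowP/(_ 0) := Bh; rewrite [RHS]mxE => Bh0; rewrite -[RHS]Bh0.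
      rewrite -mulmxA [RHS]mxE; apply: eq_bigr => j' _; congr (_ * _).
        by rewrite /bb /BB -row_mul [RHS]mxE.
      by rewrite eD -Lam_row -trmx_mul [RHS]mxE.
    under eq_bigr do rewrite /w der_monz //.
    transitivity (\sum_(j in J) bb j * \sum_i (A i j)%:~R * (D (x i) / x i)).
      by rewrite [RHS]big_enum_val.
    transitivity (\sum_j bb j * \sum_i (A i j)%:~R * (D (x i) / x i)).
      rewrite [RHS](bigID (mem J)) /= [X in _ + X]big1 ?addr0 // => i iJ.
      by rewrite big1 ?mulr0 // => i' _; rewrite AJ // mul0r.
    under eq_bigr do rewrite mulr_sumr.
    rewrite exchange_big /=; transitivity (N%:~R * \sum_j bb j * (D (x j) / x j)).
      rewrite mulr_sumr; apply: eq_bigr => i _; rewrite [RHS]mulrA NA mulr_suml.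
      by apply: eq_bigr => j' _; rewrite mulrA.
    by rewrite sum0 mulr0.
have qsub j : ((\row_i (A i j)%:~R : 'rV[F]_n) <= muF)%MS.
  have [jJ|jJ] := boolP (j \in J); last first.
    rewrite (_ : \row__ _ = 0) ?sub0mx //; apply/rowP => i; rewrite !mxE AJ //.
  have [f fT0|c [a [c0 ea]]] := span (\row_i A i j).
    rewrite (_ : (\row_i A i j) 0 = (fun i => A i j)); first exact: constw.
    by apply/funext => i; rewrite mxE.
  rewrite -(eqmx_scale _ (int0 _ c0)).
  have -> : c%:~R *: (\row_i (A i j)%:~R : 'rV[F]_n) = map_mx intr a *m muF.
    by rewrite -map_mxM -ea; apply/rowP => i; rewrite !mxE -intrM.
  exact: submxMl.
rewrite -(eqmx_scale _ (int0 _ N0)).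
have -> : N%:~R *: row k BB = \sum_j bb j *: (\row_i (A i j)%:~R : 'rV[F]_n).
  apply/rowP => i; rewrite summxE !mxE -/(BB k i) -/(bb i).
  have := NA i; rewrite /bb [BB k i]mxE => ->.
  by apply: eq_bigr => j _; rewrite !mxE.
by apply: summx_sub => j _; apply: scalemx_sub; exact: qsub.
Qed.
End Const.

(** Derivations dual to b' extend to the whole field. Together with T, which kills b', they form an
    independent family of vector fields. *)
Lemma tower_killed e (T : 'M[F]_(e, r)) ms b' : row_free T -> tower K ms b' ->
  (forall z, z \in ms -> forall f, (f <= T)%MS -> Dv f z = 0) -> (size b' + e <= r)%N.
Proof.
move=> fT tb' kil.
have zK : deron K (fun _ => 0) by split=> *; rewrite ?addr0 ?mul0r ?mulr0 ?addr0.
have exD (i : 'I_(size b')) : exists D, derivation D /\ forall j : 'I_(size b'), D b'`_j = (i == j)%:R.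
  have [D [dD D0 Db]] := tower_ext char0 (fun j => (i == j :> nat)%:R) sK zK tb'.
  have [D' [dD' eD']] := der_ext_gen char0 gs (gen_sf ms sK) dD.
  exists D'; split=> [|j]; last first.
    by rewrite eD' ?Db //; apply: gen_mem => //; apply: (tower_mem tb'); exact: mem_nth.
  split; last by move=> y Ky; rewrite eD' ?D0 //; exact: gen_sub.
  apply: deron_sub dD' => y _; apply: (gen_min _ _ _ (genT y)).
  - by apply: gen_sf; exact: gen_sf.
  - by move=> z Kz; apply: gen_sub; [exact: gen_sf|exact: gen_sub].
  - by move=> z; apply: gen_mem; exact: gen_sf.
have [D hD] := choice exD.
pose Hm := \matrix_(i < size b', j < r) D i b`_j.
have eD i y : D i y = Dv (row i Hm) y.
  rewrite (derivation_eq (hD i).1); congr (Dv _ _); by apply/rowP => j; rewrite !mxE.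
suff /eqP <- : row_free (col_mx Hm T) by exact: rank_leq_col.
rewrite -kermx_eq0; apply/rowV0P => v /sub_kermxP.
rewrite -[v]hsubmxK mul_row_col; move: (lsubmx v) (rsubmx v) => v1 v2 e0.
have v10 : v1 = 0.
  apply/rowP => j; rewrite mxE.
  have : Dv (v1 *m Hm + v2 *m T) b'`_j = 0 by rewrite e0 Dv0.
  have km : Dv (v2 *m T) b'`_j = 0.
    by apply: kil; [apply: (tower_mem tb'); exact: mem_nth|exact: submxMl].
  rewrite -[v1 *m Hm]scale1r DvD mul1r km addr0.
  rewrite Dv_mul (bigD1 j) //= -eD (hD j).2 eqxx mulr1 big1 ?addr0 // => i /negPf ij.
  by rewrite -eD (hD i).2 ij mulr0.
move: e0; rewrite v10 mul0mx add0r => /(congr1 (mulmx^~ (pinvmx T))).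
by rewrite mul0mx mulmxKp // => ->; rewrite row_mx0.
Qed.
End Ax.

(** * Function fields of prime ideals *)

Section FieldOfPrime.
Local Open Scope quotient_scope.
Variables (S : comNzRingType) (I : S -> Prop).
Hypothesis I0 : I 0.
Hypothesis I1 : ~ I 1.
Hypothesis ID : forall a u v, I u -> I v -> I (a * u + v).
Hypothesis IP : forall u v, I (u * v) -> I u \/ I v.

Let pI : {pred S} := fun x => `[< I x >].
Let pI_ideal : idealr_closed pI.
Proof.
split; rewrite ?unfold_in; first exact/asboolP.
  by apply/asboolP.
by move=> a u v; rewrite !unfold_in => /asboolP hu /asboolP hv; apply/asboolP; exact: ID.
Qed.
Let pI_prime : prime_idealr_closed pI.
Proof.
move=> u v; rewrite !unfold_in => /asboolP/IP[h|h]; apply/orP; [left|right]; exact/asboolP.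
Qed.
HB.instance Definition _ := isIdealr.Build S pI pI_ideal.
HB.instance Definition _ := isPrimeIdealrClosed.Build S pI pI_prime.

Let Q := {ideal_quot pI}.
HB.instance Definition _ := GRing.ComNzRing.on Q.

(** An inverse chosen classically, only to equip the quotient with the unit-ring structure over
    which its fraction field is formed. *)
Let Qunit : {pred Q} := fun x => `[< exists y, y * x = 1 >].
Let Qinv (x : Q) : Q := if pselect (exists y, y * x = 1) is left h then projT1 (cid h) else x.
Let QmulV : {in Qunit, left_inverse 1 Qinv *%R}.
Proof.
move=> x; rewrite unfold_in /Qinv => /asboolP h; case: pselect => // h'.
exact: projT2 (cid h').
Qed.
Let Qunit_intro x y : y * x = 1 -> Qunit x.
Proof. by move=> h; apply/asboolP; exists y. Qed.
Let Qinv_out : {in [predC Qunit], Qinv =1 id}.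
Proof.
by move=> x; rewrite !inE /Qinv => /asboolP n; case: pselect.
Qed.
HB.instance Definition _ := GRing.ComNzRing_hasMulInverse.Build Q QmulV Qunit_intro Qinv_out.
Let Qid (x y : Q) : x * y = 0 -> (x == 0) || (y == 0).
Proof. exact: Quotient.rquot_IdomainAxiom. Qed.
HB.instance Definition _ := GRing.ComUnitRing_isIntegral.Build Q Qid.

Lemma prime_field : exists (F : fieldType) (phi : {rmorphism S -> F}),
  (forall P, phi P = 0 <-> I P) /\ forall f, exists P R, phi R != 0 /\ f = phi P / phi R.
Proof.
pose piQ : {rmorphism S -> Q} := \pi_Q.
exists {fraction Q}, (@tofrac Q \o piQ); split.
  move=> P /=; split=> [/eqP|IP'].
    rewrite tofrac_eq0 /= -(rmorph0 piQ) /= -Quotient.idealrBE subr0.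
    by rewrite unfold_in => /asboolP.
  apply/eqP; rewrite tofrac_eq0 -(rmorph0 piQ) /= -Quotient.idealrBE subr0.
  by apply/asboolP.
move=> f; elim/quotW: f => -[[p q] /= q0].
have e : \pi_(FracField.type Q) (@mkRatio Q (p, q) q0) * tofrac q = tofrac p.
  unlock FracField.tofrac; rewrite -[LHS]FracField.pi_mul; apply/eqmodP; rewrite /= FracField.equivfE /FracField.mulf /=.
  by rewrite !numden_Ratio ?mulf_neq0 ?oner_eq0 //= ?mulr1 1?mulrC ?mul1r.
have hq : piQ (repr q) = q by exact: reprK.
have hp : piQ (repr p) = p by exact: reprK.
exists (repr p), (repr q); rewrite /= hp hq tofrac_eq0; split => //.
by rewrite -e mulfK // tofrac_eq0.
Qed.
End FieldOfPrime.

(** * Jets and codimension *)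

Lemma mpoly_alg_ind (R : comNzRingType) M (P : {mpoly R[M]} -> Prop) :
  (forall c, P c%:MP) -> (forall i, P 'X_i) -> (forall p q, P p -> P q -> P (p + q)) ->
  (forall p q, P p -> P q -> P (p * q)) -> forall p, P p.
Proof.
move=> PC PX PD PM p; rewrite (mpolyE p); apply: big_ind => [|u v|m _]; [by rewrite -mpolyC0|exact: PD|].
rewrite -mul_mpolyC; apply: (PM) => //; rewrite mpolyXE_id.
apply: big_ind => [|u v|i _]; [by rewrite -mpolyC1|exact: PM|].
elim: (m i) => [|j IH]; first by rewrite expr0 -mpolyC1.
by rewrite exprS; apply: PM.
Qed.

Lemma submm0 M (m : 'X_{1..M}) : (m - m)%MM = 0%MM.
Proof. by apply/mnmP => i; rewrite mnmBE subnn mnm0E. Qed.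

Section Jets.
Variables (k : numFieldType) (M : nat).
Local Notation S := {mpoly k[M]}.
Implicit Types (P Q : S) (p : 'I_M -> k) (U I : S -> Prop).

(** The kap-th power of the maximal ideal at p, described by derivatives so that products and vector
    fields are handled by induction on the order. *)
Fixpoint vord p (kap : nat) P : Prop :=
  if kap is kap'.+1 then P.@[p] = 0 /\ forall i, vord p kap' P^`M(i) else True.

Definition ideal_pred I := I 0 /\ forall a u v, I u -> I v -> I (a * u + v).
Definition sumI U1 U2 : S -> Prop := fun P => exists u v, [/\ U1 u, U2 v & P = u + v].
(** A bound for the dimension of the quotient by U, in terms of representatives since U is a mere
    predicate. *)
Definition codim_le U (d : nat) := exists g : 'I_d -> S,
  forall P, exists c : 'I_d -> k, U (P - \sum_i c i *: g i).

Lemma idealM I a u : ideal_pred I -> I u -> I (a * u).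
Proof. by move=> [I0 IP] Iu; rewrite -[_ * _]addr0; apply: IP. Qed.
Lemma idealD I u v : ideal_pred I -> I u -> I v -> I (u + v).
Proof. by move=> [I0 IP] Iu Iv; rewrite -[u]mul1r; apply: IP. Qed.
Lemma idealN I u : ideal_pred I -> I u -> I (- u).
Proof. by move=> hI Iu; rewrite -mulN1r; apply: idealM. Qed.
Lemma idealB I u v : ideal_pred I -> I u -> I v -> I (u - v).
Proof. by move=> hI Iu Iv; apply: idealD => //; exact: idealN. Qed.
Lemma idealZ I c u : ideal_pred I -> I u -> I (c *: u).
Proof. by move=> hI Iu; rewrite -mul_mpolyC; exact: idealM. Qed.
Lemma ideal_sum I (J : Type) (r : seq J) (D : pred J) f : ideal_pred I ->
  (forall i, D i -> I (f i)) -> I (\sum_(i <- r | D i) f i).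
Proof. by move=> hI h; apply: big_ind => //; [case: hI|move=> u v; exact: idealD]. Qed.

Lemma sumI_ideal U1 U2 : ideal_pred U1 -> ideal_pred U2 -> ideal_pred (sumI U1 U2).
Proof.
move=> h1 h2; split; first by exists 0, 0; rewrite addr0; case: h1; case: h2.
move=> a _ _ [u [v [hu hv ->]]] [u' [v' [hu' hv' ->]]].
exists (a * u + u'), (a * v + v'); split; last by ring.
  by case: h1 => _; apply.
by case: h2 => _; apply.
Qed.
Lemma sumIl U1 U2 P : ideal_pred U2 -> U1 P -> sumI U1 U2 P.
Proof. by move=> [h _] UP; exists P, 0; rewrite addr0. Qed.
Lemma sumIr U1 U2 P : ideal_pred U1 -> U2 P -> sumI U1 U2 P.
Proof. by move=> [h _] UP; exists 0, P; rewrite add0r. Qed.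

Lemma vordS p kap P : vord p kap.+1 P -> vord p kap P.
Proof.
elim: kap P => // kap IH P [P0 dP]; split => // i; apply: IH; exact: dP.
Qed.
Lemma vord_le p kap kap' P : (kap' <= kap)%N -> vord p kap P -> vord p kap' P.
Proof.
by move=> /subnK <-; elim: (kap - kap')%N => // j IH /vordS; exact: IH.
Qed.
Lemma vordSE p kap P : vord p kap.+1 P = (P.@[p] = 0 /\ forall i, vord p kap P^`M(i)).
Proof. by []. Qed.
Lemma vordD p kap P Q : vord p kap P -> vord p kap Q -> vord p kap (P + Q).
Proof.
elim: kap P Q => // kap IH P Q; rewrite !vordSE => -[P0 dP] [Q0 dQ]; split; first by rewrite mevalD P0 Q0 addr0.
by move=> i; rewrite mderivD; apply: IH.
Qed.
Lemma vordM p kap kap' P Q : vord p kap P -> vord p kap' Q -> vord p (kap + kap') (P * Q).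
Proof.
have [n] := ubnP (kap + kap')%N; elim: n kap kap' P Q => // n IH [|kap] [|kap'] P Q //.
- rewrite add0n ltnS => ln _ [Q0 dQ]; split; first by rewrite mevalM Q0 mulr0.
  move=> i; rewrite mderivM; apply: vordD.
    have := IH 0%N kap' P^`M(i) Q; rewrite add0n; apply => //.
    exact: vordS (conj Q0 dQ : vord p kap'.+1 Q).
  exact: (IH 0%N kap' P _ ln Logic.I (dQ i)).
- rewrite addn0 ltnS => ln [P0 dP] _; split; first by rewrite mevalM P0 mul0r.
  move=> i; rewrite mderivM; apply: vordD.
    rewrite -[kap]addn0; apply: IH => //; [by rewrite addn0|exact: dP].
  have := IH kap 0%N P Q^`M(i); rewrite addn0; apply => //.
  exact: vordS (conj P0 dP : vord p kap.+1 P).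
- rewrite addSn ltnS => ln [P0 dP] [Q0 dQ]; split; first by rewrite mevalM P0 mul0r.
  move=> i; rewrite mderivM; apply: vordD; first exact: (IH kap kap'.+1 _ _ ln (dP i) (conj Q0 dQ)).
  by rewrite -addSnnS; apply: (IH kap.+1 kap' _ _ _ (conj P0 dP) (dQ i)); rewrite addSnnS.
Qed.
Lemma vordMr p kap P Q : vord p kap Q -> vord p kap (P * Q).
Proof. by move=> h; rewrite -[kap]add0n; apply: vordM. Qed.
Lemma vord0 p kap : vord p kap 0.
Proof. by elim: kap => // kap IH; split; [rewrite meval0|move=> i; rewrite mderiv0]. Qed.
Lemma vord_ideal p kap : ideal_pred (vord p kap).
Proof. by split; [exact: vord0|move=> a u v hu hv; apply: vordD => //; exact: vordMr]. Qed.
Lemma vord1 p P : P.@[p] = 0 -> vord p 1 P.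
Proof. by []. Qed.
Lemma vordX p P j : P.@[p] = 0 -> vord p j (P ^+ j).
Proof.
move=> P0; elim: j => // j IH; rewrite exprS -add1n; apply: vordM => //.
Qed.

Lemma vordE p kap P : vord p kap P <-> forall m : 'X_{1..M}, (mdeg m < kap)%N -> (P^`M[m]).@[p] = 0.
Proof.
elim: kap P => [|kap IH] P; first by split.
split=> [[P0 dP] m|h].
  have [->|m0] := eqVneq m 0%MM; first by rewrite mderivm0m.
  have [i mi] : exists i, (0 < m i)%N.
    by apply: contrapT => h; move/eqP: m0; apply; apply/mnmP => i; rewrite mnm0E; apply/eqP; rewrite -leqn0 leqNgt; apply/negP => hi; apply: h; exists i.
  have -> : m = (U_(i) + (m - U_(i)))%MM.
    apply/mnmP => j; rewrite mnmDE mnmBE mnm1E.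
    by case: eqP => [<-|_]; [rewrite subnKC|rewrite add0n subn0].
  rewrite mdegD mdeg1 add1n ltnS => h.
  by rewrite mderivmDm mderivmU1m; have /IH := dP i; apply.
split; first by rewrite -[P]mderivm0m; apply: h; rewrite mdeg0.
by move=> i; apply/IH => m hm; rewrite -mderivmU1m -mderivmDm; apply: h; rewrite mdegD mdeg1 add1n.
Qed.

Definition transl (p : 'I_M -> k) : {rmorphism S -> S} := mmap (@mpolyC M k) (fun i => 'X_i - (p i)%:MP).

Lemma translE p : [/\ forall c, transl p c%:MP = c%:MP & forall i, transl p 'X_i = 'X_i - (p i)%:MP].
Proof.
split; first by move=> c; rewrite /transl /= mmapC.
by move=> i; rewrite /transl /= mmapX mmap1U.
Qed.
Lemma transl_eval p P : (transl p P).@[p] = P.@[fun _ => 0].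
Proof.
have [tC tX] := translE p.
elim/mpoly_alg_ind: P => [c|i|u v hu hv|u v hu hv].
- by rewrite tC !mevalC.
- by rewrite tX mevalB mevalC !mevalXU subrr.
- by rewrite rmorphD !mevalD hu hv.
- by rewrite rmorphM !mevalM hu hv.
Qed.
Lemma transl_deriv p i P : (transl p P)^`M(i) = transl p P^`M(i).
Proof.
have [tC tX] := translE p.
elim/mpoly_alg_ind: P => [c|j|u v hu hv|u v hu hv].
- by rewrite tC !mderivC rmorph0.
- rewrite tX mderivB mderivC subr0 mderivX mnm1E.
  by case: eqP => [<-|_]; rewrite ?scale0r ?rmorph0 // scale1r submm0 mpolyX0 rmorph1.
- by rewrite rmorphD !mderivD rmorphD hu hv.
- by rewrite rmorphM !mderivM rmorphD !rmorphM hu hv.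
Qed.
Lemma transl_derivm p m P : (transl p P)^`M[m] = transl p P^`M[m].
Proof.
rewrite !mderivm_foldr /=; elim: (flatten _) => //= i s ->.
exact: transl_deriv.
Qed.

Definition jcoef (p : 'I_M -> k) (m : 'X_{1..M}) (P : S) : k := (P^`M[m]).@[p].

Lemma jcoefD p m P Q : jcoef p m (P + Q) = jcoef p m P + jcoef p m Q.
Proof. by rewrite /jcoef mderivmD mevalD. Qed.
Lemma jcoefZ p m c P : jcoef p m (c *: P) = c * jcoef p m P.
Proof. by rewrite /jcoef mderivmZ mevalZ. Qed.
Lemma jcoefB p m P Q : jcoef p m (P - Q) = jcoef p m P - jcoef p m Q.
Proof. by rewrite /jcoef mderivmB mevalB. Qed.
Lemma jcoef_sum p m (I : finType) (f : I -> S) : jcoef p m (\sum_i f i) = \sum_i jcoef p m (f i).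
Proof.
elim/big_rec2: _ => [|i y z _ <-]; last exact: jcoefD.
by rewrite -(scale0r (0 : S)) jcoefZ mul0r.
Qed.

Definition fact_m (m : 'X_{1..M}) : k := (\prod_(i < M) (m i)`!)%:R.
Lemma fact_m_neq0 m : fact_m m != 0.
Proof. by rewrite pnatr_eq0 -lt0n prodn_gt0 // => i; exact: fact_gt0. Qed.

(** Monomials in the coordinates centred at p, scaled to be dual to the functionals [jcoef p]. *)
Definition tmon p m : S := (fact_m m)^-1 *: transl p 'X_[m].

Lemma jcoef_tmon p m m' : jcoef p m' (tmon p m) = (m == m')%:R.
Proof.
rewrite /tmon jcoefZ /jcoef transl_derivm transl_eval mderivmX mevalZ mevalX.
have [->|ne] := eqVneq m m'.
  rewrite submm0 [X in _ * (_ * X)]big1 ?mulr1 => [|i _]; last by rewrite mnm0E expr0.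
  rewrite (eq_bigr (fun i => (m' i)`!)) ?mulVf ?fact_m_neq0 // => i _; exact: ffactnn.
have [i ni] : exists i, m i != m' i.
  by apply: contrapT => h; move/eqP: ne; apply; apply/mnmP => i; apply/eqP; apply: contrapT => /negP hi; apply: h; exists i.
have [lt|ge] := ltnP (m i) (m' i).
  by rewrite (bigD1 i) //= ffact_small // mul0n mul0r mulr0.
rewrite [X in _ * (_ * X)](bigD1 i) //= mnmBE.
have : (m i - m' i != 0)%N by rewrite subn_eq0 -ltnNge ltn_neqAle eq_sym ni.
by case: (m i - m' i)%N => // j _; rewrite expr0n mul0r !mulr0.
Qed.

Lemma jcoef_comb p T (mo : 'I_T -> 'X_{1..M}) (c : 'I_T -> k) s : injective mo ->
  jcoef p (mo s) (\sum_s' c s' *: tmon p (mo s')) = c s.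
Proof.
move=> inj; rewrite jcoef_sum.
have e s' : jcoef p (mo s) (c s' *: tmon p (mo s')) = c s' * (s' == s)%:R.
  by rewrite jcoefZ jcoef_tmon (inj_eq inj).
under eq_bigr => s' _ do rewrite e.
clear e; move: c => f; rewrite (bigD1 s) //= eqxx mulr1 big1 ?addr0 // => s' /negPf ->.
by rewrite mulr0.
Qed.

Lemma codim_widen U d d' : (d <= d')%N -> codim_le U d -> codim_le U d'.
Proof.
move=> /subnKC <- [g hg].
exists (fun i => if split i is inl j then g j else 0) => P.
have [c hc] := hg P; exists (fun i => if split i is inl j then c j else 0).
rewrite big_split_ord /= [X in _ - (_ + X)]big1 ?addr0 => [|i _]; last first.
  by rewrite (unsplitK (inr i : 'I_d + _)) scale0r.
by under eq_bigr => i _ do rewrite (unsplitK (inl i)).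
Qed.

Lemma vord_jcoef p kap P : (forall m : 'X_{1..M < kap}, jcoef p m P = 0) -> vord p kap P.
Proof.
by move=> h; apply/vordE => m mk; exact: (h (BMultinom mk)).
Qed.

(** The jets at q of finitely many elements of I form a matrix whose rank is at least its rank at p
    wherever one minor does not vanish. This minor is nonzero at p, hence not in I, and since I is
    prime some q in W avoids both its zeros and those of a. *)
Lemma codim_semicont I (W : ('I_M -> k) -> Prop) (a : S) p kap d : ideal_pred I ->
  (forall Q, (forall w, W w -> Q.@[w] = 0) <-> I Q) -> (forall u v, I (u * v) -> I u \/ I v) ->
  ~ I a -> W p -> codim_le (sumI I (vord p kap)) d ->
  exists q, [/\ W q, a.@[q] != 0 & codim_le (sumI I (vord q kap)) d].
Proof.
move=> hI IW prI Ia Wp [g hg].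
pose T := #|{: 'X_{1..M < kap}}|; pose mo (s : 'I_T) : 'X_{1..M} := enum_val s.
have mob s : (mdeg (mo s) < kap)%N by exact: bmdeg.
have hs s : exists ci : ('I_d -> k) * S, I ci.2 /\ vord p kap (tmon p (mo s) - \sum_l ci.1 l *: g l - ci.2).
  have [c [u [v [Iu vv e]]]] := hg (tmon p (mo s)).
  by exists (c, u); split => //=; rewrite e addrAC subrr add0r.
have [ci hci] := choice hs.
pose Bp : 'M[S]_T := \matrix_(s, s') ((ci s).2)^`M[mo s'].
pose B q : 'M[k]_T := map_mx (meval q) Bp.
have BE q s s' : B q s s' = jcoef q (mo s') (ci s).2 by rewrite !mxE.
pose Cm : 'M[k]_(T, d) := \matrix_(s, l) (ci s).1 l.
pose Gm : 'M[k]_(d, T) := \matrix_(l, s') jcoef p (mo s') (g l).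
(* At p the chosen elements of I reproduce the Taylor monomials up to d directions, so the rank is
   at least T - d. *)
have eB : B p = 1%:M - Cm *m Gm.
  apply/matrixP => s s'; rewrite BE !mxE.
  have : jcoef p (mo s') (tmon p (mo s) - \sum_l (ci s).1 l *: g l - (ci s).2) = 0.
    by have [_ /vordE h] := hci s; apply: h.
  rewrite !jcoefB jcoef_tmon jcoef_sum => /eqP; rewrite subr_eq0 => /eqP <-.
  congr (_ - _).
    by rewrite (inj_eq val_inj) (inj_eq enum_val_inj).
  by apply: eq_bigr => l _; rewrite !mxE jcoefZ.
have rB : (T <= \rank (B p) + d)%N.
  rewrite eB -{1}(mxrank1 k T) -{1}[1%:M](subrK (Cm *m Gm)).
  apply: leq_trans (mxrank_add _ _) _; rewrite leq_add2l.
  exact: leq_trans (mxrankM_maxl _ _) (rank_leq_col _).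
pose rho := \rank (B p).
pose f := maxrankfun (B p).
have rfB : row_free (rowsub f (B p)) by exact: maxrowsub_free.
have rfT : row_full (rowsub f (B p))^T by rewrite /row_full mxrank_tr.
pose h := fullrankfun rfT.
have Uu : rowsub h (rowsub f (B p))^T \in unitmx by exact: fullrowsub_unit.
pose minor : 'M[S]_rho := \matrix_(i, j) Bp (f j) (h i).
have minorE q : (\det minor).@[q] = \det (rowsub h (rowsub f (B q))^T).
  by rewrite -det_map_mx; congr (\det _); apply/matrixP => i j; rewrite !mxE.
have nI : ~ I (a * \det minor).
  move/prI => [//|/IW/(_ p Wp)]; rewrite minorE => e0.
  by move: Uu; rewrite unitmxE e0 unitr0.
have [q Wq nq] : exists2 q, W q & (a * \det minor).@[q] != 0.
  apply: contrapT => hq; apply: nI; apply/IW => w Ww; apply/eqP; apply: contrapT => /negP nw.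
  by apply: hq; exists w.
move: nq; rewrite mevalM mulf_eq0 negb_or => /andP[aq mq]; exists q; split => //.
have rBq : (rho <= \rank (B q))%N.
  have u : rowsub h (rowsub f (B q))^T \in unitmx by rewrite unitmxE unitfE -minorE.
  rewrite /rho -{1}(mxrank_unit u); apply: leq_trans (mxrankS (rowsub_sub _ _)) _.
  by rewrite mxrank_tr; apply: mxrankS; exact: rowsub_sub.
pose Cq := row_base ((B q)^C)%MS.
have rC : (\rank (B q)^C%MS <= d)%N by rewrite mxrank_compl; move: rB rBq; rewrite /rho; lia.
have [g' hg'] : exists g' : 'I_(\rank (B q)^C%MS) -> S,
    forall P, exists c, sumI I (vord q kap) (P - \sum_l c l *: g' l).
  exists (fun l => \sum_s Cq l s *: tmon q (mo s)) => P.
  pose v : 'rV[k]_T := \row_s jcoef q (mo s) P.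
  have : (v <= B q + Cq)%MS.
  apply: submx_full; rewrite -sub1mx; have : (1%:M <= B q + (B q)^C)%MS by rewrite sub1mx addsmx_compl_full.
  by move/submx_trans; apply; apply: addsmxS => //; rewrite eq_row_base.
  move=> /sub_addsmxP[[u1 u2] /= ev]; exists (fun l => u2 0 l).
  pose i0 := \sum_s u1 0 s *: (ci s).2.
  exists i0, (P - \sum_l u2 0 l *: (\sum_s Cq l s *: tmon q (mo s)) - i0); split; last by rewrite addrCA subrr addr0.
    by apply: ideal_sum => // s _; apply: idealZ => //; case: (hci s).
  apply: vord_jcoef => m; rewrite -[m]enum_rankK; set s := enum_rank m.
  rewrite !jcoefB !jcoef_sum; have /rowP/(_ s) := ev; rewrite !mxE -/(mo s) => ->.
  apply/eqP; rewrite subr_eq0 subr_eq; apply/eqP; congr (_ + _).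
    by apply: eq_bigr => s' _; rewrite BE jcoefZ.
  apply: eq_bigr => l _; rewrite jcoefZ; congr (_ * _).
  by rewrite (jcoef_comb q (fun s => Cq l s)) // => x y /val_inj /enum_val_inj.
by apply: codim_widen rC _; exists g'.
Qed.
End Jets.

Definition const_of (k : numFieldType) M (F : fieldType) (phi : {mpoly k[M]} -> F) : F -> Prop :=
  fun f => exists c, f = phi c%:MP.

Definition prime_pred (S : comNzRingType) (I : S -> Prop) :=
  [/\ I 0, forall a u v, I u -> I v -> I (a * u + v), ~ I 1 & forall u v, I (u * v) -> I u \/ I v].

(* The function field of a prime ideal with a transcendence basis [pb] among the coordinates; the
   derivations [pd] dual to [pb] become polynomial vector fields [pdel] after multiplication by [pa]. *)
Record pkg (k : numFieldType) M (I : {mpoly k[M]} -> Prop) := Pkg {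
  pF : fieldType;
  pphi : {rmorphism {mpoly k[M]} -> pF};
  pb : seq pF;
  pd : 'I_(size pb) -> pF -> pF;
  pa : {mpoly k[M]};
  pdel : 'I_(size pb) -> 'I_M -> {mpoly k[M]};
  pbeta : 'I_(size pb) -> 'I_M;
  pphiE : forall P, pphi P = 0 <-> I P;
  pphi_frac : forall f, exists P R, pphi R != 0 /\ f = pphi P / pphi R;
  ptower : tower (const_of pphi) [seq pphi 'X_l | l <- enum 'I_M] pb;
  pderd : forall i, derivation (const_of pphi) (pd i);
  pdE : forall i j : 'I_(size pb), pd i pb`_j = (i == j)%:R;
  paN : ~ I pa;
  pdelE : forall i l, pphi (pdel i l) = pphi pa * pd i (pphi 'X_l);
  pbetaE : forall i : 'I_(size pb), pb`_i = pphi 'X_(pbeta i) }.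

Section FromRing.
Variables (k : numFieldType) (M : nat) (F : fieldType) (phi : {rmorphism {mpoly k[M]} -> F}).
Local Notation Kc := (const_of phi).
Local Notation gs := [seq phi 'X_l | l <- enum 'I_M].

Lemma const_char0 n : n.+1%:R != 0 :> F.
Proof. have -> : n.+1%:R = (phi \o @mpolyC M k) n.+1%:R by rewrite /= !rmorph_nat.
by rewrite fmorph_eq0 pnatr_eq0. Qed.

Lemma const_sf : subfield Kc.
Proof.
split; first by exists 1; rewrite mpolyC1 rmorph1.
  by move=> _ _ [c ->] [c' ->]; exists (c - c'); rewrite mpolyCB rmorphB.
move=> _ _ [c ->] [c' ->]; exists (c / c').
by rewrite -[RHS]/((phi \o @mpolyC M k) (c / c')) fmorph_div.
Qed.

Lemma phi_gen P : gen Kc gs (phi P).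
Proof.
have sG := gen_sf gs const_sf.
elim/mpoly_alg_ind: P => [c|i|p q hp hq|p q hp hq].
- by apply: gen_sub; [exact: const_sf|exists c].
- by apply: gen_mem; [exact: const_sf|apply: map_f; rewrite mem_enum].
- by rewrite rmorphD; apply: sfD.
- by rewrite rmorphM; apply: sfM.
Qed.
End FromRing.

Lemma package (k : numFieldType) M (I : {mpoly k[M]} -> Prop) : prime_pred I -> inhabited (pkg I).
Proof.
move=> [I0 ID I1 IP].
have [F [phi [phiE frac]]] := prime_field I0 I1 ID IP.
pose Kc := const_of phi; pose gs := [seq phi 'X_l | l <- enum 'I_M].
have sK : subfield Kc := const_sf phi.
have [b tb] := tower_ex Kc gs.
have genT x : gen Kc gs x.
  by have [P [R [R0 ->]]] := frac x; apply: (sfdiv (gen_sf gs sK)); exact: phi_gen.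
have zK : deron Kc (fun _ => 0) by split=> *; rewrite ?addr0 ?mul0r ?mulr0 ?addr0.
have /choice[d hd] : forall i : 'I_(size b), exists D, derivation Kc D /\ forall j : 'I_(size b), D b`_j = (i == j)%:R.
  move=> i.
  have [D [dD D0 Db]] := tower_ext (const_char0 phi) (fun j => (i == j :> nat)%:R) sK zK tb.
  exists D; split; last by move=> j; rewrite Db.
  by split=> //; apply: deron_sub dD => y _; exact: genT.
have /choice[PR hPR] : forall t : 'I_(size b) * 'I_M, exists PR, phi PR.2 != 0 /\ d t.1 (phi 'X_t.2) = phi PR.1 / phi PR.2.
  by move=> t; have [P [R h]] := frac (d t.1 (phi 'X_t.2)); exists (P, R).
pose a := \prod_t (PR t).2.
pose del i l := (PR (i, l)).1 * \prod_(t | t != (i, l)) (PR t).2.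
have phia0 : phi a != 0 by rewrite rmorph_prod; apply/prodf_neq0 => t _; case: (hPR t).
have /choice[beta hbeta] : forall i : 'I_(size b), exists l, b`_i = phi 'X_l.
  move=> i; have : b`_i \in gs by apply: (tower_mem tb); exact: mem_nth.
  by move=> /mapP[l _ ->]; exists l.
constructor; apply: (@Pkg k M I F phi b d a del beta) => //.
- by move=> i; case: (hd i).
- by move=> i; case: (hd i).
- by move/phiE => e; rewrite e eqxx in phia0.
move=> i l; have [R0 ->] := hPR (i, l); rewrite /del /a [in RHS](bigD1 (i, l)) //= !rmorphM.
by rewrite mulrCA -!mulrA; congr (_ * _); rewrite [RHS]mulrC mulfVK.
Qed.

(** More vectors than spanning elements give a dependence, which must have coefficients in E. As E
    is a predicate, the elimination is carried out by hand, keeping track of the entries. *)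
Lemma spanned_indep (F : fieldType) (E : F -> Prop) V d (T : finType) (f : T -> F) : subfield E ->
  spanned E V d -> (forall t, V (f t)) ->
  (forall c, (forall t, E (c t)) -> \sum_t c t * f t = 0 -> forall t, c t = 0) -> (#|T| <= d)%N.
Proof.
move=> sE [I [B [cI hB]]] Vf ind.
have /choice[C hC] t := hB _ (Vf t).
apply: leq_trans cI; rewrite leqNgt; apply/negP => lt.
pose U : 'M[F]_(#|T|, #|I|) := \matrix_(t, i) C (enum_val t) (enum_val i).

have [c [Ec c0 e]] : exists c : 'rV[F]_#|T|, [/\ forall t, E (c 0 t), c != 0 & c *m U = 0].
  have EU i j : E (U i j) by rewrite mxE; case: (hC (enum_val i)).
  clearbody U; clear -sE lt EU; move: #|T| #|I| lt U EU => n; elim: n => [//|n IH] m; case: m => [|m] lt U EU.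
    exists (delta_mx 0 0); split; last by apply/matrixP => i [].
      by move=> t; rewrite mxE; exact: sf_nat.
    by apply/eqP => /matrixP/(_ 0 0)/eqP; rewrite !mxE oner_eq0.
  have [h0|[i0 ni0]] : (forall i, U i 0 = 0) \/ exists i, U i 0 != 0.
    have [h|h] := pselect (forall i, U i 0 = 0); [by left|right].
    by apply: contrapT => h'; apply: h => i; apply/eqP; apply: contrapT => /negP hi; apply: h'; exists i.
  - have [|c [Ec c0 e]] := IH m lt (\matrix_(i, j) U (lift 0 i) (lift 0 j)).
      by move=> i j; rewrite mxE.
    exists (\row_i if unlift 0 i is Some j then c 0 j else 0); split.
    + by move=> t; rewrite mxE; case: unliftP => [j _|_]; [exact: Ec|exact: sf0].
    + apply: contraNneq c0 => /rowP h; apply/eqP/rowP => j; have := h (lift 0 j).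
      by rewrite !mxE liftK.
    + apply/rowP => j; rewrite !mxE big_ord_recl !mxE unlift_none mul0r add0r.
      have [->|[j' ->]] : j = 0 \/ exists j', j = lift 0 j' by case: (unliftP 0 j) => [j' ->|->]; [right; exists j'|left].
      * by rewrite big1 // => i _; rewrite h0 mulr0.
      * have /rowP/(_ j') := e; rewrite !mxE => e'; rewrite -[RHS]e'; apply: eq_bigr => i _.
        by rewrite !mxE liftK.
  - have [|c [Ec c0 e]] := IH m lt (\matrix_(i, j) (U (lift i0 i) (lift 0 j) - U (lift i0 i) 0 / U i0 0 * U i0 (lift 0 j))).
      by move=> i j; rewrite mxE; apply: sfB => //; apply: sfM => //; apply: sfdiv.
    pose s := - \sum_i c 0 i * (U (lift i0 i) 0 / U i0 0).
    exists (\row_i if unlift i0 i is Some j then c 0 j else s); split.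
    + move=> t; rewrite mxE; case: unliftP => [j _|_]; first exact: Ec.
      by apply: sfN => //; apply: sf_sum => // i _; apply: sfM => //; apply: sfdiv.
    + apply: contraNneq c0 => /rowP h; apply/eqP/rowP => j; have := h (lift i0 j).
      by rewrite !mxE liftK.
    + apply/rowP => j; rewrite !mxE (bigD1_ord i0) //= !mxE unlift_none.
      under eq_bigr => i _ do rewrite !mxE liftK.
      case: (unliftP 0 j) => [j' ->|->].
      * have /rowP/(_ j') := e; rewrite !mxE => e'; rewrite -[RHS]e' /s mulNr addrC mulr_suml -sumrB.
        by apply: eq_bigr => i _; rewrite !mxE; ring.
      * rewrite /s mulNr addrC mulr_suml -sumrB big1 // => i _.
        by rewrite -!mulrA mulVf // mulr1 subrr.
have z : \sum_t c 0 (enum_rank t) * f t = 0.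
  rewrite (reindex_omap enum_val (fun t => Some (enum_rank t))) /=; last by move=> t _; rewrite enum_rankK.
  under eq_bigl => t do rewrite enum_valK eqxx.
  under eq_bigr => t _ do rewrite enum_valK (proj2 (hC _)) mulr_sumr.
  rewrite exchange_big /= big1 // => i _.
  under eq_bigr => t _ do rewrite mulrA.
  rewrite -mulr_suml; have /rowP/(_ (enum_rank i)) := e; rewrite !mxE.
  under eq_bigr => t _ do rewrite /U mxE enum_rankK.
  by move=> ->; rewrite mul0r.
have := ind _ (fun t => Ec (enum_rank t)) z.
move=> h; move/eqP: c0; apply; apply/rowP => t; rewrite mxE.
by have := h (enum_val t); rewrite enum_valK.
Qed.

Lemma codim_indep (k : numFieldType) M (U : {mpoly k[M]} -> Prop) d (T : finType) (f : T -> {mpoly k[M]}) :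
  U 0 -> (forall c u v, U u -> U v -> U (c *: u + v)) -> codim_le U d ->
  (forall c : T -> k, U (\sum_t c t *: f t) -> forall t, c t = 0) -> (#|T| <= d)%N.
Proof.
move=> U0 UZ [g hg] ind; have /choice[C hC] t := hg (f t).
rewrite leqNgt; apply/negP => lt.
pose A : 'M[k]_(#|T|, d) := \matrix_(t, i) C (enum_val t) i.
have : kermx A != 0.
  rewrite -mxrank_eq0 mxrank_ker -lt0n subn_gt0; exact: leq_ltn_trans (rank_leq_col _) lt.
move=> /rowV0Pn[c /sub_kermxP e c0].
have US (r : seq T) (c' : T -> k) h : (forall t, U (h t)) -> U (\sum_(t <- r) c' t *: h t).
  move=> Uh; elim: r => [|t r IH]; rewrite ?big_nil ?big_cons //; exact: UZ.
have z : U (\sum_t c 0 (enum_rank t) *: f t).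
  have := US (index_enum T) (fun t => c 0 (enum_rank t)) (fun t => f t - \sum_i C t i *: g i) hC.
  rewrite [X in U X -> _](_ : _ = \sum_t c 0 (enum_rank t) *: f t) //.
  under eq_bigr => t _ do rewrite scalerBr.
  rewrite sumrB [X in _ - X](_ : _ = 0) ?subr0 //.
  under eq_bigr => t _ do rewrite scaler_sumr.
  rewrite exchange_big /= big1 // => i _.
  under eq_bigr => t _ do rewrite scalerA.
  rewrite -scaler_suml (reindex_omap enum_val (fun t => Some (enum_rank t))) /=; last by move=> t _; rewrite enum_rankK.
  under eq_bigl => t do rewrite enum_valK eqxx.
  have /rowP/(_ i) := e; rewrite !mxE => e0.
  have e' : \sum_j c 0 j * C (enum_val j) i = 0 by rewrite -[RHS]e0; apply: eq_bigr => j _; rewrite mxE.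
  rewrite [X in X *: _](_ : _ = 0) ?scale0r // -[RHS]e'.
  by apply: eq_bigr => t _; rewrite enum_valK.
move/eqP: c0; apply; apply/rowP => t; rewrite mxE.
by have := ind _ z (enum_val t); rewrite enum_valK.
Qed.

Definition subst (k : numFieldType) r M (beta : 'I_r -> {mpoly k[M]}) : {rmorphism {mpoly k[r]} -> {mpoly k[M]}} :=
  mmap (@mpolyC M k) beta.
Lemma substC (k : numFieldType) r M (beta : 'I_r -> {mpoly k[M]}) c : subst beta c%:MP = c%:MP.
Proof. by rewrite /subst /= mmapC. Qed.
Lemma substX (k : numFieldType) r M (beta : 'I_r -> {mpoly k[M]}) i : subst beta 'X_i = beta i.
Proof. by rewrite /subst /= mmapX mmap1U. Qed.
Lemma subst_eval (k : numFieldType) r M (beta : 'I_r -> {mpoly k[M]}) q P :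
  (subst beta P).@[q] = P.@[fun i => (beta i).@[q]].
Proof.
elim/mpoly_alg_ind: P => [c|i|u v hu hv|u v hu hv].
- by rewrite substC !mevalC.
- by rewrite substX mevalXU.
- by rewrite rmorphD !mevalD hu hv.
- by rewrite rmorphM !mevalM hu hv.
Qed.
Lemma substZ (k : numFieldType) r M (beta : 'I_r -> {mpoly k[M]}) c P : subst beta (c *: P) = c *: subst beta P.
Proof. by rewrite -!mul_mpolyC rmorphM substC. Qed.

(** * Vector fields and local coordinates on a variety *)

Section Pkg.
Variables (k : numFieldType) (M : nat) (I : {mpoly k[M]} -> Prop) (pk : pkg I).
Local Notation phi := (pphi pk).
Local Notation r := (size (pb pk)).
Local Notation S := {mpoly k[M]}.
Local Notation bet := (@pbeta _ _ _ pk).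

(** A lift to the polynomial ring of the derivation [pd i] multiplied by [pa]; it preserves I. *)
Definition ptheta (i : 'I_r) (P : S) : S := \sum_l pdel i l * P^`M(l).

Lemma pd_deron (i : 'I_r) : deron (fun _ => True) (pd i). Proof. by case: (pderd i). Qed.

Lemma pthetaE (i : 'I_r) P : phi (ptheta i P) = phi (pa pk) * pd i (phi P).
Proof.
have [dD dM] := pd_deron i.
rewrite /ptheta; elim/mpoly_alg_ind: P => [c|j|u v hu hv|u v hu hv].
- rewrite big1 ?rmorph0 => [|l _]; last by rewrite mderivC mulr0.
  by have [_ ->] := pderd i; rewrite ?mulr0 //; exists c.
- rewrite -pdelE; congr (phi _); rewrite (bigD1 j) //= big1 => [|l lj]; last first.
    by rewrite mderivX mnm1E eq_sym (negPf lj) scale0r mulr0.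
  by rewrite mderivX mnm1E eqxx scale1r submm0 mpolyX0 mulr1 addr0.
- rewrite rmorphD dD // mulrDr -hu -hv -rmorphD -big_split /=; congr (phi _).
  by apply: eq_bigr => l _; rewrite mderivD mulrDr.
- rewrite rmorphM dM //.
  transitivity (phi (pa pk) * pd i (phi u) * phi v + phi (pa pk) * pd i (phi v) * phi u); last by ring.
  rewrite -hu -hv -!rmorphM -rmorphD !mulr_suml -big_split /=; congr (phi _); apply: eq_bigr => l _.
  by rewrite mderivM; ring.
Qed.

Lemma ptheta_ideal i P : I P -> I (ptheta i P).
Proof.
move=> /(pphiE pk) e; apply/(pphiE pk); rewrite pthetaE e.
by rewrite (der0 _ (pd_deron i)) ?mulr0.
Qed.

Lemma pkg_ideal : ideal_pred I.
Proof.
split; first by apply/(pphiE pk); rewrite rmorph0.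
by move=> a u v /(pphiE pk) hu /(pphiE pk) hv; apply/(pphiE pk); rewrite rmorphD rmorphM hu hv mulr0 addr0.
Qed.

Lemma ptheta_subst i (Q : {mpoly k[r]}) : phi (ptheta i (subst (fun j => 'X_(bet j)) Q)) =
  phi (pa pk * subst (fun j => 'X_(bet j)) Q^`M(i)).
Proof.
rewrite pthetaE rmorphM; congr (_ * _).
have [dD dM] := pd_deron i.
elim/mpoly_alg_ind: Q => [c|j|u v hu hv|u v hu hv].
- rewrite substC mderivC !rmorph0.
  by have [_ ->] := pderd i; rewrite ?mulr0 //; exists c.
- rewrite substX -pbetaE pdE mderivX mnm1E eq_sym.
  by case: eqP => [<-|_]; rewrite ?scale0r ?rmorph0 // scale1r submm0 mpolyX0 !rmorph1.
- by rewrite mderivD !rmorphD dD // hu hv.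
- by rewrite mderivM !(rmorphM, rmorphD) dM // hu hv /=.
Qed.

Lemma ptheta_vord q kap i P : vord q kap.+1 P -> vord q kap (ptheta i P).
Proof.
move=> [_ dP]; apply: ideal_sum => [|l _]; first exact: vord_ideal.
by apply: vordMr; exact: dP.
Qed.
Lemma pthetaD i P Q : ptheta i (P + Q) = ptheta i P + ptheta i Q.
Proof. by rewrite /ptheta -big_split /=; apply: eq_bigr => l _; rewrite mderivD mulrDr. Qed.

(** Where [pa] does not vanish, the transcendence basis behaves like local coordinates: [ptheta i]
    lowers orders by at most one, preserves I, and acts on polynomials in the basis as [pa] times
    the i-th partial derivative. *)
Lemma pkg_vord q c Q : (forall P, I P -> P.@[q] = 0) -> (pa pk).@[q] != 0 ->
  sumI I (vord q c) (subst (fun j => 'X_(bet j)) Q) ->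
  vord (fun j => q (bet j)) c Q.
Proof.
move=> qI aq; elim: c Q => // c IH Q [u [v [Iu vv e]]].
have hI := pkg_ideal.
split.
  have := congr1 (meval q) e; rewrite subst_eval mevalD (qI _ Iu) add0r.
  by case: vv => -> _; under eq_fun => j do rewrite mevalXU.
move=> i; apply: IH; set G := subst _ Q^`M(i).
have hU := sumI_ideal hI (vord_ideal q c).
have aG : sumI I (vord q c) (pa pk * G).
  have : I (ptheta i (subst (fun j => 'X_(bet j)) Q) - pa pk * G).
    by apply/(pphiE pk); rewrite rmorphB ptheta_subst subrr.
  rewrite e pthetaD => h.
  rewrite (_ : pa pk * G = (ptheta i u - (ptheta i u + ptheta i v - pa pk * G)) + ptheta i v); last by ring.
  exists (ptheta i u - (ptheta i u + ptheta i v - pa pk * G)), (ptheta i v); split => //.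
    by apply: idealB => //; exact: ptheta_ideal.
  exact: ptheta_vord.
(* This inverts [pa] modulo order c: n vanishes at q, and [1 - n ^+ c] is a multiple of [pa]. *)
pose n := 1 - ((pa pk).@[q])^-1 *: pa pk.
have n1 : vord q c (n ^+ c).
  by apply: vordX; rewrite /n mevalB mevalZ mulVf // meval1 subrr.
have [a' ea'] : exists a', 1 - n ^+ c = a' * pa pk.
  rewrite -(expr1n _ c) subrXX /n opprD opprK addrA subrr add0r.
  by eexists; rewrite -mul_mpolyC mulrC mulrA.
have -> : G = a' * (pa pk * G) + n ^+ c * G by rewrite mulrA -ea'; ring.
apply: idealD => //; first exact: idealM.
by apply: sumIr => //; rewrite mulrC; exact: vordMr.
Qed.

(** The m^r monomials in the local coordinates with all exponents below m have degree at most r m,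
    so they stay independent modulo order r m + 1. *)
Lemma pkg_growth q m d : (forall P, I P -> P.@[q] = 0) -> (pa pk).@[q] != 0 ->
  codim_le (sumI I (vord q (r * m).+1)) d -> (m ^ r <= d)%N.
Proof.
move=> qI aq cd; pose T := {ffun 'I_r -> 'I_m}.
have -> : (m ^ r)%N = #|T| by rewrite card_ffun !card_ord.
pose mo (t : T) : 'X_{1..r} := [multinom (t i : nat) | i < r].
have moI : injective mo.
  move=> t t' /mnmP h; apply/ffunP => i; apply: val_inj => /=.
  by have := h i; rewrite !mnmE.
have hU := sumI_ideal pkg_ideal (vord_ideal q (r * m).+1).
pose q' j := q (bet j : 'I_M).
apply: (codim_indep (f := fun t => subst (fun j => 'X_(bet j)) (tmon q' (mo t))) _ _ cd); first by case: hU.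
  by move=> c u v hu hv; apply: idealD => //; exact: idealZ.
move=> c hc t.
have /(pkg_vord qI aq)/vordE h : sumI I (vord q (r * m).+1) (subst (fun j => 'X_(bet j)) (\sum_t c t *: tmon q' (mo t))).
  rewrite rmorph_sum (eq_bigr (fun t => c t *: subst (fun j => 'X_(bet j)) (tmon q' (mo t)))) // => s _.
    exact: substZ.
have := h (mo t).
rewrite -/(jcoef _ _ _) jcoef_sum (eq_bigr (fun s => c s * (s == t)%:R)); last first.
  by move=> s _; rewrite jcoefZ jcoef_tmon (inj_eq moI).
clear h hc; move: c => c; rewrite (bigD1 t) //= eqxx mulr1 big1 ?addr0 => [|s /negPf ->]; last by rewrite mulr0.
apply; rewrite mdegE ltnS; apply: leq_trans (_ : \sum_(i < r) m <= _)%N; last by rewrite sum_nat_const card_ord.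
by apply: leq_sum => i _; rewrite mnmE ltnW.
Qed.

Lemma pkg_hf : exists C, forall D (T : finType) (f : T -> S),
  (forall t, boxpol (const_of phi) [seq phi 'X_l | l <- enum 'I_M] D (phi (f t))) ->
  (forall c, I (\sum_t c t *: f t) -> forall t, c t = 0) -> (#|T| <= C * D.+1 ^ r)%N.
Proof.
have [C hC] := hf_tower (const_sf phi) (ptower pk); exists C => D T f bf ind.
apply: (spanned_indep (f := fun t => phi (f t)) (const_sf phi) (hC D)) => // c cc.
have /choice[c' hc'] := cc; move=> e t; rewrite hc' (ind c') ?mpolyC0 ?rmorph0 //.
apply/(pphiE pk); rewrite rmorph_sum -[RHS]e; apply: eq_bigr => s _ /=.
by rewrite hc' -rmorphM mul_mpolyC.
Qed.
End Pkg.

(** * Base change and fibres *)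

(** The ideal of the fibre of the [fi] on the zero set of I, without passing to the radical. *)
Definition genI (k : numFieldType) M (I : {mpoly k[M]} -> Prop) m (fi : 'I_m -> {mpoly k[M]}) : {mpoly k[M]} -> Prop :=
  fun P => exists u w, I u /\ P = u + \sum_i w i * fi i.

Lemma genI_ideal (k : numFieldType) M (I : {mpoly k[M]} -> Prop) m fi : ideal_pred I -> ideal_pred (@genI k M I m fi).
Proof.
move=> hI; split.
  by exists 0, (fun _ => 0); split; [case: hI|rewrite big1 ?addr0 // => i _; rewrite mul0r].
move=> a _ _ [u [w [Iu ->]]] [u' [w' [Iu' ->]]].
exists (a * u + u'), (fun i => a * w i + w' i); split; first by case: hI => _; apply.
rewrite mulrDr -!addrA; congr (_ + _); rewrite addrCA; congr (_ + _).
by rewrite mulr_sumr -big_split; apply: eq_bigr => i _ /=; ring.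
Qed.
Lemma genI_sub (k : numFieldType) M (I : {mpoly k[M]} -> Prop) m (fi : 'I_m -> {mpoly k[M]}) P : I P -> genI I fi P.
Proof. by move=> IP; exists P, (fun _ => 0); rewrite big1 ?addr0 // => i _; rewrite mul0r. Qed.
Lemma genI_mem (k : numFieldType) M (I : {mpoly k[M]} -> Prop) m (fi : 'I_m -> {mpoly k[M]}) i : I 0 -> genI I fi (fi i).
Proof.
move=> I0; exists 0, (fun j => (j == i)%:R); split=> //; rewrite add0r (bigD1 i) //= eqxx mul1r.
by rewrite big1 ?addr0 // => j /negPf ->; rewrite mul0r.
Qed.

Lemma sum_enum_val (V : nmodType) (T : finType) (F : T -> V) : \sum_(s < #|T|) F (enum_val s) = \sum_t F t.
Proof.
rewrite [RHS](reindex_omap enum_val (fun t => Some (enum_rank t))) /=; last by move=> t _; rewrite enum_rankK.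
by apply: eq_bigl => s; rewrite enum_valK eqxx.
Qed.

Section BaseChange.
Variables (k C : numFieldType) (sg : {rmorphism k -> C}) (M : nat).
Local Notation S := {mpoly k[M]}.
Local Notation SC := {mpoly C[M]}.

Definition bc : {rmorphism S -> SC} := mmap (@mpolyC M C \o sg) (fun i => 'X_i).
Lemma bcC c : bc c%:MP = (sg c)%:MP.
Proof. by rewrite /bc /= mmapC. Qed.
Lemma bcX i : bc 'X_i = 'X_i.
Proof. by rewrite /bc /= mmapX mmap1U. Qed.
Lemma bcB P Q : bc (P - Q) = bc P - bc Q. Proof. exact: rmorphB. Qed.
Lemma bcD P Q : bc (P + Q) = bc P + bc Q. Proof. exact: rmorphD. Qed.
Lemma bcM P Q : bc (P * Q) = bc P * bc Q. Proof. exact: rmorphM. Qed.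
Lemma bc_sum (J : finType) (P : J -> S) : bc (\sum_j P j) = \sum_j bc (P j).
Proof. exact: rmorph_sum. Qed.
Lemma bcZ c P : bc (c *: P) = sg c *: bc P.
Proof. by rewrite -!mul_mpolyC rmorphM bcC. Qed.
Lemma bc_eval P w : (bc P).@[fun i => sg (w i)] = sg P.@[w].
Proof.
elim/mpoly_alg_ind: P => [c|i|u v hu hv|u v hu hv].
- by rewrite bcC !mevalC.
- by rewrite bcX !mevalXU.
- by rewrite rmorphD !mevalD rmorphD hu hv.
- by rewrite rmorphM !mevalM rmorphM hu hv.
Qed.
Lemma bc_deriv P i : (bc P)^`M(i) = bc P^`M(i).
Proof.
elim/mpoly_alg_ind: P => [c|j|u v hu hv|u v hu hv].
- by rewrite bcC !mderivC rmorph0.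
- rewrite bcX !mderivX mnm1E.
  by case: eqP => [<-|_]; rewrite ?scale0r ?rmorph0 // !scale1r submm0 !mpolyX0 rmorph1.
- by rewrite rmorphD !mderivD rmorphD hu hv.
- by rewrite rmorphM !mderivM hu hv rmorphD !rmorphM.
Qed.
Lemma bc_vord p kap P : vord p kap P -> vord (fun i => sg (p i)) kap (bc P).
Proof.
elim: kap P => // kap IH P; rewrite !vordSE => -[P0 dP]; split; first by rewrite bc_eval P0 rmorph0.
by move=> i; rewrite bc_deriv; apply: IH.
Qed.

Definition kfree m (e : 'I_m -> C) := forall x : 'I_m -> k, \sum_j sg (x j) * e j = 0 -> forall j, x j = 0.

(** Expanding coefficients in a family free over k splits an identity over C into identities over
    k. *)
Lemma kbasis n (c : 'I_n -> C) : exists m (e : 'I_m -> C) (a : 'I_n -> 'I_m -> k),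
  kfree e /\ forall i, c i = \sum_j sg (a i j) * e j.
Proof.
elim: n c => [|n IH] c; first by exists 0%N, (fun _ => 0), (fun _ _ => 0); split=> [x _ []|[]].
have [m [e [a [fe ce]]]] := IH (fun i => c (lift ord_max i)).
have [[b eb]|nb] := pselect (exists b, c ord_max = \sum_j sg (b j) * e j).
  exists m, e, (fun i => if unlift ord_max i is Some i' then a i' else b); split=> // i.
  by case: unliftP => [i' ->|->].
exists m.+1, (fun j => if unlift ord_max j is Some j' then e j' else c ord_max),
  (fun i j => if unlift ord_max i is Some i' then (if unlift ord_max j is Some j' then a i' j' else 0)
    else if unlift ord_max j is Some j' then 0 else 1).
have split_sum (x : 'I_m.+1 -> C) : \sum_j x j * (if unlift ord_max j is Some j' then e j' else c ord_max) =
    x ord_max * c ord_max + \sum_j x (lift ord_max j) * e j.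
  rewrite (bigD1_ord ord_max) //= unlift_none; congr (_ + _).
  by apply: eq_bigr => j _; rewrite liftK.
split=> [x|i].
  rewrite split_sum => ex.
  have x0 : x ord_max = 0.
    apply/eqP; apply: contrapT => /negP xn; apply: nb.
    exists (fun j => - (x (lift ord_max j) / x ord_max)).
    have sx : sg (x ord_max) != 0 by rewrite fmorph_eq0.
    apply: (mulfI sx); rewrite mulr_sumr; move/eqP: ex; rewrite addr_eq0 => /eqP ->.
    rewrite -sumrN; apply: eq_bigr => j _; rewrite rmorphN fmorph_div; move: (sg _) sx => y y0.
    by field.
  move: ex; rewrite x0 rmorph0 mul0r add0r => /fe h j.
  by case: (unliftP ord_max j) => [j' ->|->] //.
rewrite split_sum unlift_none.
case: unliftP => [i' ->|->]; rewrite ?rmorph0 ?rmorph1 ?mul0r ?mul1r ?add0r.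
  by rewrite ce; apply: eq_bigr => j _; rewrite liftK.
by rewrite big1 ?addr0 // => j _; rewrite liftK rmorph0 mul0r.
Qed.

Variable W : ('I_M -> k) -> Prop.
Definition Ik (P : S) := forall w, W w -> P.@[w] = 0.
(** Vanishing over C is tested on points with coordinates in k only; by [IC_expand] every element is
    a combination of elements of [Ik]. *)
Definition IC (P : SC) := forall w, W w -> P.@[fun i => sg (w i)] = 0.

Lemma Ik_IC P : Ik P <-> IC (bc P).
Proof.
split=> h w Ww; first by rewrite bc_eval h ?rmorph0.
by apply/eqP; rewrite -(fmorph_eq0 sg) -bc_eval h.
Qed.
Lemma Ik_ideal : ideal_pred Ik.
Proof.
by split=> [w _|a u v hu hv w Ww]; rewrite ?meval0 // mevalD mevalM hu ?hv // mulr0 addr0.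
Qed.
Lemma IC_ideal : ideal_pred IC.
Proof.
by split=> [w _|a u v hu hv w Ww]; rewrite ?meval0 // mevalD mevalM hu ?hv // mulr0 addr0.
Qed.

Lemma bc_expand (P : SC) : exists m (e : 'I_m -> C) (Q : 'I_m -> S), kfree e /\ P = \sum_j e j *: bc (Q j).
Proof.
have [m [e [a [fe ae]]]] := kbasis (fun i : 'I_(size (msupp P)) => P@_(tnth (in_tuple (msupp P)) i)).
exists m, e, (fun j => \sum_(i < size (msupp P)) a i j *: 'X_[tnth (in_tuple (msupp P)) i]); split=> //.
have bcXm mm : bc 'X_[mm] = 'X_[mm].
  rewrite !mpolyXE_id rmorph_prod; apply: eq_bigr => i _ /=.
  by rewrite rmorphXn /= -/bc bcX.
rewrite {1}(mpolyE P) big_tnth.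
transitivity (\sum_(i < size (msupp P)) \sum_j e j *: (sg (a i j) *: 'X_[tnth (in_tuple (msupp P)) i] : SC)).
  apply: eq_bigr => i _; rewrite ae scaler_suml; apply: eq_bigr => j _.
  by rewrite scalerA mulrC.
rewrite exchange_big; apply: eq_bigr => j _; rewrite rmorph_sum scaler_sumr.
by apply: eq_bigr => i _; rewrite /= -/bc bcZ bcXm.
Qed.

Lemma eval_expand m (e : 'I_m -> C) (Q : 'I_m -> S) w :
  (\sum_j e j *: bc (Q j)).@[fun i => sg (w i)] = \sum_j sg (Q j).@[w] * e j.
Proof.
rewrite (raddf_sum (meval (fun i => sg (w i)))); apply: eq_bigr => j _ /=.
by rewrite mevalZ bc_eval mulrC.
Qed.

Lemma IC_expand m (e : 'I_m -> C) (Q : 'I_m -> S) : kfree e -> IC (\sum_j e j *: bc (Q j)) -> forall j, Ik (Q j).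
Proof. by move=> fe h j w Ww; apply: (fe (fun j => (Q j).@[w])); rewrite -eval_expand h. Qed.

Lemma IC_indep (T : finType) (f : T -> S) :
  (forall c : T -> k, Ik (\sum_t c t *: f t) -> forall t, c t = 0) ->
  forall c : T -> C, IC (\sum_t c t *: bc (f t)) -> forall t, c t = 0.
Proof.
move=> ind c h t.
have [m [e [a [fe ae]]]] := kbasis (fun i : 'I_#|T| => c (enum_val i)).
have ce s : c s = \sum_j sg (a (enum_rank s) j) * e j by rewrite -ae enum_rankK.
have : IC (\sum_j e j *: bc (\sum_s a (enum_rank s) j *: f s)).
  rewrite (_ : \sum_j _ = \sum_t c t *: bc (f t)) //.
  under [RHS]eq_bigr => s _ do rewrite ce scaler_suml.
  rewrite exchange_big; apply: eq_bigr => j _; rewrite rmorph_sum scaler_sumr.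
  by apply: eq_bigr => s _; rewrite /= -/bc bcZ scalerA mulrC.
move=> /(IC_expand fe) h' ; rewrite ce big1 // => j _.
by rewrite (ind _ (h' j) t) rmorph0 mul0r.
Qed.

(** A coefficient of each factor outside [Ik] gives a product outside [Ik], hence a point of W where
    both coefficients are nonzero; there both factors are nonzero because the families are free over
    k. *)
Lemma IC_prime : prime_pred Ik -> prime_pred IC.
Proof.
move=> [_ _ I1 IP]; have [h0 hD] := IC_ideal; split=> //.
  move=> h; apply: I1; apply/Ik_IC; rewrite rmorph1; exact: h.
move=> u v; have [m [e [Q [fe ->]]]] := bc_expand u; have [m' [e' [Q' [fe' ->]]]] := bc_expand v => h.
have [h1|/existsNP[i ni]] := pselect (forall i, Ik (Q i)).
  left=> w Ww; rewrite eval_expand big1 // => i _.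
  by rewrite h1 // rmorph0 mul0r.
right; apply: contrapT => nv.
have /existsNP[j nj] : ~ forall j, Ik (Q' j).
  by move=> h2; apply: nv => w Ww; rewrite eval_expand big1 // => j _; rewrite h2 // rmorph0 mul0r.
have : ~ Ik (Q i * Q' j) by move=> /IP[].
apply=> w Ww; have := h w Ww; rewrite mevalM !eval_expand => /eqP; rewrite mulf_eq0 => /orP[] /eqP.
  by move=> /(fe (fun j => (Q j).@[w])) h'; rewrite mevalM h' mul0r.
by move=> /(fe' (fun j => (Q' j).@[w])) h'; rewrite mevalM h' mulr0.
Qed.

Lemma IC_codim p kap d : codim_le (sumI Ik (vord p kap)) d ->
  codim_le (sumI IC (vord (fun i => sg (p i)) kap)) d.
Proof.
move=> [g hg]; exists (fun i => bc (g i)) => P.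
have [m [e [Q [_ ->]]]] := bc_expand P.
have /choice[c hc] j := hg (Q j).
exists (fun i => \sum_j e j * sg (c j i)).
have hU := sumI_ideal IC_ideal (vord_ideal (fun i => sg (p i)) kap).
rewrite (_ : _ - _ = \sum_j e j *: bc (Q j - \sum_i c j i *: g i)).
  apply: ideal_sum => // j _; apply: idealZ => //.
  have [u [v [Iu vv ->]]] := hc j; exists (bc u), (bc v); split; [exact/Ik_IC|exact: bc_vord|exact: rmorphD].
have e1 j (A B : S) : e j *: bc (A - B) = e j *: bc A - e j *: bc B by rewrite bcB scalerBr.
rewrite [RHS](eq_bigr _ (fun j _ => e1 j _ _)) sumrB; congr (_ - _).
under eq_bigr => i _ do rewrite scaler_suml.
rewrite exchange_big; apply: eq_bigr => j _; rewrite bc_sum scaler_sumr.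
by apply: eq_bigr => i _; rewrite bcZ scalerA.
Qed.

Hypothesis prI : prime_pred Ik.
Variable pk : pkg IC.
Local Notation phi := (pphi pk).
Local Notation r := (size (pb pk)).
Local Notation Kc := (const_of phi).

(** The lower bound for the growth is available only where [pa] does not vanish; semicontinuity
    carries a small codimension at p to such a point. *)
Lemma point_growth p m d : W p -> codim_le (sumI Ik (vord p (r * m).+1)) d -> (m ^ r <= d)%N.
Proof.
move=> Wp /IC_codim cd.
have [_ _ _ pr] := IC_prime prI.
have [q [[w [Ww ->]] aq cq]] := @codim_semicont C M IC (fun q => exists w, W w /\ q = fun i => sg (w i)) (pa pk)
  (fun i => sg (p i)) (r * m).+1 d IC_ideal (fun Q => conj (fun h w Ww => h _ (ex_intro _ w (conj Ww erefl)))
    (fun h q '(ex_intro w (conj Ww e)) => eq_ind_r (fun q => Q.@[q] = 0) (h w Ww) e)) pr (@paN _ _ _ pk) (ex_intro _ p (conj Wp erefl)) cd.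
by apply: (pkg_growth (q := fun i => sg (w i)) _ aq cq) => P; apply.
Qed.

(** Repeated reduction along the fibre writes every polynomial, modulo order kap, as a combination
    of the h generators of the fibre, with coefficients polynomials in the [fi] of degree at most
    kap. The space of such coefficients is bounded by the Hilbert function of the [fi]. *)
Lemma fibre_codim p m (fi : 'I_m -> S) b' : W p -> (forall i, (fi i).@[p] = 0) ->
  tower Kc [seq phi (bc (fi i)) | i <- enum 'I_m] b' ->
  exists D, forall kap h, codim_le (sumI (genI Ik fi) (vord p kap)) h ->
    codim_le (sumI Ik (vord p kap)) (h * (D * kap.+1 ^ size b')).
Proof.
move=> Wp fp tb'; have sK := const_sf phi.
have [D hD] := hf_tower sK tb'; exists D => kap h [g hg].
pose ms := [seq phi (bc (fi i)) | i <- enum 'I_m].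
pose bx c (u : S) := boxpol Kc ms c (phi (bc u)).
(* Each round replaces [w i] by its own expansion and gains one order, because [fi i] vanishes at
   p. *)
have step c : (c <= kap)%N -> forall P, exists u : 'I_h -> S,
    (forall l, bx c (u l)) /\ sumI Ik (vord p c) (P - \sum_l u l * g l).
  elim: c => [|c IH] lc P.
    exists (fun _ => 0); split; first by move=> l; rewrite /bx !rmorph0; exact: boxpol0.
    by apply: sumIr => //; exact: Ik_ideal.
  have [cl [_ [v [[u [w [Iu ->]]] vv e]]]] := hg P.
  have /choice[U hU] i := IH (ltnW lc) (w i).
  exists (fun l => (cl l)%:MP + \sum_i fi i * U i l); split.
    move=> l; rewrite /bx bcD bcC rmorphD bc_sum rmorph_sum; apply: boxpolD => //.
      by apply: boxpol_const => //; exists (sg (cl l)).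
    apply: boxpol_sum => // i _; rewrite bcM rmorphM -add1n; apply: boxpolM => //.
      by apply: boxpol_mem => //; apply: map_f; rewrite mem_enum.
    by case: (hU i) => hb _; exact: hb.
  have -> : P - \sum_l ((cl l)%:MP + \sum_i fi i * U i l) * g l =
      (u + \sum_i fi i * (w i - \sum_l U i l * g l)) + v.
    rewrite (eq_bigr (fun l => cl l *: g l + \sum_i fi i * (U i l * g l))); last first.
      move=> l _; rewrite mulrDl mul_mpolyC mulr_suml; congr (_ + _).
      by apply: eq_bigr => i _; rewrite mulrA.
    rewrite big_split /= opprD addrA e exchange_big /=.
    rewrite [\sum_i fi i * (_ - _)](eq_bigr (fun i => w i * fi i - \sum_l fi i * (U i l * g l))); last first.
      by move=> i _; rewrite mulrBr mulr_sumr mulrC.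
    by rewrite sumrB; ring.
  have hU' := sumI_ideal Ik_ideal (vord_ideal p c.+1).
  apply: (idealD hU'); last by apply: sumIr; [exact: Ik_ideal|exact: vord_le lc vv].
  apply: (idealD hU'); first by apply: sumIl => //; exact: vord_ideal.
  apply: (ideal_sum _ hU') => i _; have [_ [a [b [Ia vb ->]]]] := hU i.
  rewrite mulrDr; apply: (idealD hU').
    by apply: sumIl; [exact: vord_ideal|apply: (idealM _ Ik_ideal)].
  by apply: sumIr; [exact: Ik_ideal|rewrite -add1n; apply: vordM => //; exact: vord1].
(* A largest family of admissible coefficients independent modulo [Ik] spans all of them; its size
   is bounded over C, where [IC_indep] preserves independence. *)
pose free n := exists f : 'I_n -> S, (forall t, bx kap (f t)) /\ forall c, Ik (\sum_t c t *: f t) -> forall t, c t = 0.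
have free_le n : free n -> (n <= D * kap.+1 ^ size b')%N.
  move=> [f [bf ind]]; rewrite -[n]card_ord.
  apply: (spanned_indep (f := fun t => phi (bc (f t))) sK (hD kap)) => // c cc.
  have /choice[c' hc'] := cc; move=> e t; rewrite hc' (IC_indep ind (c := c')) ?mpolyC0 ?rmorph0 //.
  apply/(pphiE pk); rewrite rmorph_sum -[RHS]e; apply: eq_bigr => s _ /=.
  by rewrite hc' -rmorphM mul_mpolyC.
have ex0 : exists n, `[< free n >].
  by exists 0%N; apply/asboolP; exists (fun _ => 0); split=> [[]|c _ []].
have ubd n : `[< free n >] -> (n <= D * kap.+1 ^ size b')%N by move/asboolP/free_le.
case: (ex_maxnP ex0 ubd) => n /asboolP[f [bf ind]] maxn.
have spn u : bx kap u -> exists c : 'I_n -> k, Ik (u - \sum_t c t *: f t).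
  move=> bu; apply: contrapT => nc.
  suff /asboolP/maxn : free n.+1 by rewrite ltnn.
  exists (fun t => if unlift ord_max t is Some t' then f t' else u); split=> [t|c].
    by case: unliftP.
  rewrite (bigD1_ord ord_max) //= unlift_none.
  under eq_bigr => t _ do rewrite liftK.
  have [c0|c0] := eqVneq (c ord_max) 0; last first.
    move=> h1; case: nc; exists (fun t => - (c ord_max)^-1 * c (lift ord_max t)).
    rewrite (_ : _ - _ = (c ord_max)^-1 *: (c ord_max *: u + \sum_t c (lift ord_max t) *: f t)).
      by apply: (idealZ _ Ik_ideal).
    rewrite scalerDr scalerA mulVf // scale1r scaler_sumr -sumrN; congr (_ + _).
    by apply: eq_bigr => t _; rewrite scalerA mulNr scaleNr opprK.
  rewrite c0 scale0r add0r => /ind h1 t.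
  by case: (unliftP ord_max t) => [t' ->|->] //; exact: h1.
apply: (@codim_widen _ _ _ (h * n)); first by rewrite leq_mul2l (ubd n) ?orbT //; apply/asboolP; exists f.
have -> : (h * n)%N = #|{: 'I_h * 'I_n}| by rewrite card_prod !card_ord.
pose ev (s : 'I_#|{: 'I_h * 'I_n}|) : 'I_h * 'I_n := enum_val s.
exists (fun s => f (ev s).2 * g (ev s).1) => P.
have [u [bu hu]] := step kap (leqnn _) P.
have /choice[cu hcu] l := spn _ (bu l).
exists (fun s => cu (ev s).1 (ev s).2).
have -> : \sum_s cu (ev s).1 (ev s).2 *: (f (ev s).2 * g (ev s).1) = \sum_l \sum_t cu l t *: (f t * g l).
  by rewrite pair_big /= -(sum_enum_val (fun q : 'I_h * 'I_n => cu q.1 q.2 *: (f q.2 * g q.1))).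
rewrite (_ : P - _ = (P - \sum_l u l * g l) + \sum_l (u l - \sum_t cu l t *: f t) * g l); last first.
  rewrite -addrA; congr (_ + _); rewrite -sumrN -sumrN -big_split; apply: eq_bigr => l _ /=.
  rewrite mulrBl mulr_suml addrA addNr add0r; congr (- _).
  by apply: eq_bigr => t _; rewrite scalerAl.
have hU := sumI_ideal Ik_ideal (vord_ideal p kap).
apply: (idealD hU) => //; apply: (ideal_sum _ hU) => l _; apply: sumIl; first exact: vord_ideal.
by rewrite mulrC; apply: (idealM _ Ik_ideal).
Qed.

Lemma fibre_growth p m (fi : 'I_m -> S) b' : W p -> (forall i, (fi i).@[p] = 0) ->
  tower Kc [seq phi (bc (fi i)) | i <- enum 'I_m] b' ->
  exists D, forall m h, codim_le (sumI (genI Ik fi) (vord p (r * m).+1)) h ->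
    (m ^ r <= h * (D * (r * m).+2 ^ size b'))%N.
Proof.
move=> Wp fp tb; have [D hD] := fibre_codim Wp fp tb; exists D => n h /hD.
exact: point_growth.
Qed.
End BaseChange.

(** * Noetherianity and the Nullstellensatz *)

Definition idl (R : comNzRingType) (I : R -> Prop) := I 0 /\ forall a u v, I u -> I v -> I (a * u + v).
Inductive ispan (R : comNzRingType) (A : R -> Prop) : R -> Prop :=
| ispan0 : ispan A 0
| ispanD a u v : A u -> ispan A v -> ispan A (a * u + v).
Definition noeth (R : comNzRingType) := forall I : R -> Prop, idl I ->
  exists s : seq R, (forall x, x \in s -> I x) /\ forall x, I x -> ispan (fun y => y \in s) x.

Section Ideals.
Variable R : comNzRingType.
Implicit Types (I A : R -> Prop).
Lemma idl_mul I a u : idl I -> I u -> I (a * u).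
Proof. by move=> [I0 h] Iu; rewrite -[_ * _]addr0; apply: h. Qed.
Lemma idl_add I u v : idl I -> I u -> I v -> I (u + v).
Proof. by move=> [I0 h] Iu Iv; rewrite -[u]mul1r; apply: h. Qed.
Lemma idl_sub I u v : idl I -> I u -> I v -> I (u - v).
Proof. by move=> hI Iu Iv; rewrite -mulN1r; apply: idl_add => //; exact: idl_mul. Qed.
Lemma idl_sum I (J : Type) (r : seq J) (P : pred J) F : idl I -> (forall j, P j -> I (F j)) -> I (\sum_(j <- r | P j) F j).
Proof. by move=> hI h; apply: big_ind => //; [case: hI|move=> u v; exact: idl_add]. Qed.
Lemma ispan_add A u v : ispan A u -> ispan A v -> ispan A (u + v).
Proof. by elim=> [|a x y Ax _ IH] sv; rewrite ?add0r // -addrA; apply: ispanD => //; exact: IH. Qed.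
Lemma ispan_mul A a u : ispan A u -> ispan A (a * u).
Proof. by elim=> [|b x y Ax _ IH]; rewrite ?mulr0 ?mulrDr ?mulrA; [exact: ispan0|exact: ispanD]. Qed.
Lemma ispan_idl A : idl (ispan A).
Proof. by split; [exact: ispan0|move=> a u v su sv; apply: ispan_add => //; exact: ispan_mul]. Qed.
Lemma ispan_mem (A : R -> Prop) u : A u -> ispan A u.
Proof. by move=> Au; rewrite -[u]mul1r -[_ * _]addr0; apply: ispanD => //; exact: ispan0. Qed.
Lemma ispan_min A I u : idl I -> (forall x, A x -> I x) -> ispan A u -> I u.
Proof. by move=> hI sub; elim=> [|a x y Ax _ IH]; case: (hI) => // _; apply => //; exact: sub. Qed.
Lemma ispan_mono A A' u : (forall x, A x -> A' x) -> ispan A u -> ispan A' u.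
Proof. by move=> sub; apply: ispan_min; [exact: ispan_idl|move=> x Ax; apply: ispan_mem; exact: sub]. Qed.
End Ideals.

(** Hilbert's basis theorem, by the usual sequence of elements of least degree outside the ideal of
    their predecessors. *)
Lemma noeth_poly (R : comNzRingType) : noeth R -> noeth {poly R}.
Proof.
move=> nR I hI; apply: contrapT => nfg.
have nxt (s : seq {poly R}) : exists f, (forall x, x \in s -> I x) ->
    [/\ I f, ~ ispan (fun y => y \in s) f & forall g, I g -> ~ ispan (fun y => y \in s) g -> (size f <= size g)%N].
  have [sI|] := pselect (forall x, x \in s -> I x); last by exists 0.
  have [f0 [If0 nf0]] : exists f, I f /\ ~ ispan (fun y => y \in s) f.
    by apply: contrapT => h; apply: nfg; exists s; split=> // x Ix; apply: contrapT => nx; apply: h; exists x.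
  have ex : exists n, `[< exists f, [/\ I f, ~ ispan (fun y => y \in s) f & size f = n] >].
    by exists (size f0); apply/asboolP; exists f0.
  case: (ex_minnP ex) => n /asboolP[f [If nf sf]] minf; exists f => _; split=> // g Ig ng.
  by rewrite sf; apply: minf; apply/asboolP; exists g.
have [nx hnx] := choice nxt.
pose fix bld n := if n is n'.+1 then nx (bld n') :: bld n' else [::].
pose f n := nx (bld n).
have bI n x : x \in bld n -> I x.
  elim: n x => //= n IH x; rewrite inE => /predU1P[->|]; last exact: IH.
  by case: (hnx _ IH).
have fI n : I (f n) by case: (hnx _ (bI n)).
have fN n : ~ ispan (fun y => y \in bld n) (f n) by case: (hnx _ (bI n)).
have fmin n g : I g -> ~ ispan (fun y => y \in bld n) g -> (size (f n) <= size g)%N by case: (hnx _ (bI n)) => _ _; apply.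
have fb n i : (i < n)%N -> f i \in bld n.
  by elim: n => //= n IH; rewrite ltnS leq_eqVlt inE => /predU1P[->|/IH ->]; rewrite ?eqxx ?orbT.
have fmono i n : (i <= n)%N -> (size (f i) <= size (f n))%N.
  move=> le; apply: fmin => // h; apply: (fN n); apply: ispan_mono h => x.
  elim: (n) le => [|m IH]; first by rewrite leqn0 => /eqP ->.
  by rewrite leq_eqVlt ltnS => /predU1P[->//|/IH h] /h /=; rewrite inE => ->; rewrite orbT.
pose a n := lead_coef (f n).
have [s [sB hs]] := nR _ (ispan_idl (fun x => exists i, x = a i)).
have [N hN] : exists N, forall x, x \in s -> ispan (fun x => exists i, (i < N)%N /\ x = a i) x.
  elim: s sB {hs} => [|y s IH] sB; first by exists 0%N.
  have [N hN] := IH (fun x xs => sB x (mem_behead (s := y :: s) xs)).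
  have [N' hN'] : exists N, ispan (fun x => exists i, (i < N)%N /\ x = a i) y.
    elim: (sB y (mem_head _ _)) => [|b u v [i ->] _ [N1 h1]]; first by exists 0%N; exact: ispan0.
    exists (maxn i.+1 N1); apply: ispanD; first by exists i; split=> //; rewrite leq_max leqnn.
    by apply: ispan_mono h1 => x [j [lj ->]]; exists j; split=> //; rewrite leq_max lj orbT.
  exists (maxn N N') => x; rewrite inE => /predU1P[->|/hN h].
    by apply: ispan_mono hN' => z [j [lj ->]]; exists j; split=> //; rewrite leq_max lj orbT.
  by apply: ispan_mono h => z [j [lj ->]]; exists j; split=> //; rewrite leq_max lj.
have aN : ispan (fun x => exists i, (i < N)%N /\ x = a i) (a N).
  apply: (ispan_min (ispan_idl _) hN); apply: hs; apply: ispan_mem; by exists N.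
have [g [gs gsz gc]] : exists g : {poly R}, [/\ ispan (fun y => y \in bld N) g, (size g <= size (f N))%N & g`_(size (f N)).-1 = a N].
  apply: (ispan_min (I := fun c => exists g : {poly R}, [/\ ispan (fun y => y \in bld N) g, (size g <= size (f N))%N & g`_(size (f N)).-1 = c])) aN.
    split; first by exists 0; rewrite size_poly0 coef0; split=> //; exact: ispan0.
    move=> b _ _ [g1 [s1 z1 <-]] [g2 [s2 z2 <-]]; exists (b%:P * g1 + g2); split.
    - by apply: ispan_add => //; exact: ispan_mul.
    - apply: leq_trans (size_polyD _ _) _; rewrite geq_max z2 andbT mul_polyC.
      exact: leq_trans (size_scale_leq _ _) z1.
    - by rewrite coefD coefCM.
  move=> _ [i [iN ->]]; have le := fmono _ _ (ltnW iN).
  exists ('X^(size (f N) - size (f i)) * f i); split.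
  - by apply: ispan_mul; apply: ispan_mem; exact: fb.
  - apply: leq_trans (size_polyMleq _ _) _; rewrite size_polyXn addSn /=.
    by rewrite subnK.
  - rewrite coefXnM; have fi0 : (0 < size (f i))%N.
      by rewrite lt0n size_poly_eq0; apply/eqP => e; apply: (fN i); rewrite e; exact: ispan0.
    rewrite ltnNge (_ : (_ <= _)%N = true) /=; last by rewrite -subn1 leq_sub2l.
    by rewrite /a lead_coefE; congr (_`_ _); move: fi0 le; case: (size (f i)) => // u _; case: (size (f N)) => //= v; rewrite ltnS subSS => uv; rewrite subKn.
have fN0 : f N != 0 by apply/eqP => e; apply: (fN N); rewrite e; exact: ispan0.
have : (size (f N) <= size (f N - g)%R)%N.
  apply: fmin; first by apply: idl_sub => //; apply: ispan_min gs => //; exact: bI.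
  by move=> h; apply: (fN N); rewrite -[f N](subrK g); exact: ispan_add.
apply/negP; rewrite -ltnNge -(ltn_predK (m := 0) (n := size (f N))) ?lt0n ?size_poly_eq0 // ltnS.
apply/leq_sizeP => j; rewrite leq_eqVlt => /predU1P[<-|lj]; first by rewrite coefB gc subrr.
have lj' : (size (f N) <= j)%N by move: lj; case: (size (f N)) => //=.
by rewrite coefB !nth_default ?subrr //; exact: leq_trans gsz lj'.
Qed.

Lemma noeth_surj (R R' : comNzRingType) (h : {rmorphism R -> R'}) : (forall y, exists x, y = h x) -> noeth R -> noeth R'.
Proof.
move=> sj nR I hI.
have [|s [sI hs]] := nR (fun x => I (h x)).
  split; first by rewrite rmorph0; case: hI.
  by move=> a u v hu hv; rewrite rmorphD rmorphM; case: hI => _; apply.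
exists (map h s); split=> [x /mapP[y /sI Iy ->] //|x].
have [y ->] := sj x; move/hs; elim=> [|a u v us _ IH]; first by rewrite rmorph0; exact: ispan0.
by rewrite rmorphD rmorphM; apply: ispanD => //; exact: map_f.
Qed.

Section PolyStep.
Variables (k : numFieldType) (n : nat).
Definition pstep : {rmorphism {poly {mpoly k[n]}} -> {mpoly k[n.+1]}} :=
  horner_eval 'X_ord_max \o map_poly (subst (fun i : 'I_n => 'X_(lift ord_max i : 'I_n.+1))).
Lemma pstepE P : pstep P = (map_poly (subst (fun i : 'I_n => 'X_(lift ord_max i : 'I_n.+1))) P).['X_ord_max].
Proof. by []. Qed.
Lemma pstep_surj Q : exists P, Q = pstep P.
Proof.
elim/mpoly_alg_ind: Q => [c|i|_ _ [p ->] [q ->]|_ _ [p ->] [q ->]].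
- by exists c%:MP%:P; rewrite pstepE map_polyC hornerC /= substC.
- case: (unliftP ord_max i) => [j ->|->].
    by exists ('X_j)%:P; rewrite pstepE map_polyC hornerC /= substX.
  by exists 'X; rewrite pstepE map_polyX hornerX.
- by exists (p + q); rewrite rmorphD.
- by exists (p * q); rewrite rmorphM.
Qed.
End PolyStep.

Lemma mpoly0_const (k : numFieldType) (P : {mpoly k[0]}) : exists c, P = c%:MP.
Proof.
elim/mpoly_alg_ind: P => [c|[]//|_ _ [p ->] [q ->]|_ _ [p ->] [q ->]].
- by exists c.
- by exists (p + q); rewrite mpolyCD.
- by exists (p * q); rewrite mpolyCM.
Qed.

Lemma noeth_mpoly (k : numFieldType) n : noeth {mpoly k[n]}.
Proof.
elim: n => [|n IH]; last by apply: (noeth_surj (@pstep_surj k n)); exact: noeth_poly.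
move=> I hI; have [I1|n1] := pselect (I 1).
  exists [:: 1]; split=> [x|x _]; first by rewrite inE => /eqP ->.
  by rewrite -[x]mulr1; apply: ispan_mul; apply: ispan_mem; rewrite inE.
exists [::]; split=> // x; have [c ->] := mpoly0_const x => Ic.
have [->|c0] := eqVneq c 0; first by rewrite mpolyC0; exact: ispan0.
by case: n1; rewrite -mpolyC1 -(mulVf c0) mpolyCM; exact: idl_mul.
Qed.

Lemma noeth_max (R : comNzRingType) (Phi : (R -> Prop) -> Prop) I0 : noeth R -> idl I0 -> Phi I0 ->
  exists I, [/\ idl I, Phi I, forall x, I0 x -> I x & forall J, idl J -> Phi J -> (forall x, I x -> J x) -> forall x, J x -> I x].
Proof.
move=> nR h0 p0; apply: contrapT => nmax.
pose good (I : R -> Prop) := [/\ idl I, Phi I & forall x, I0 x -> I x].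
have /choice[nx hnx] : forall I : R -> Prop, exists J, good I -> [/\ good J, forall x, I x -> J x & exists x, J x /\ ~ I x].
  move=> I; have [[hI pI sI]|] := pselect (good I); last by exists I.
  apply: contrapT => nJ; apply: nmax; exists I; split=> // J hJ pJ IJ x Jx.
  apply: contrapT => nx; apply: nJ; exists J => _; split=> //; last by exists x.
  by split=> // y /sI /IJ.
pose J n := iter n nx I0.
have gJ n : good (J n) by elim: n => [|n /hnx[]].
have JS n x : J n x -> J n.+1 x by case: (hnx _ (gJ n)) => _ h _; exact: h.
have Jm i j x : (i <= j)%N -> J i x -> J j x.
  by move=> /subnK <-; elim: (j - i)%N => //= m IH /IH /JS.
have [|s [sJ hs]] := nR (fun x => exists n, J n x).
  split; first by exists 0%N; case: h0.
  move=> a u v [i Ju] [j Jv]; exists (maxn i j); case: (gJ (maxn i j)) => -[_ h] _ _.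
  by apply: h; [apply: Jm Ju|apply: Jm Jv]; rewrite ?leq_maxl ?leq_maxr.
have [N hN] : exists N, forall x, x \in s -> J N x.
  elim: s sJ {hs} => [|y s IH] sJ; first by exists 0%N.
  have [N hN] := IH (fun x xs => sJ x (mem_behead (s := y :: s) xs)).
  have [N' hN'] := sJ y (mem_head _ _); exists (maxn N N') => x; rewrite inE => /predU1P[->|/hN h].
    by apply: Jm hN'; rewrite leq_maxr.
  by apply: Jm h; rewrite leq_maxl.
have [_ _ [x [Jx nJx]]] := hnx _ (gJ N); apply: nJx.
apply: (ispan_min _ hN); first by case: (gJ N).
by apply: hs; exists N.+1.
Qed.

Section Nullstellensatz.
Variable k : numClosedFieldType.

(** Stated for any ring with a family of evaluations, so that it can be carried from R to [{poly R}]
    and thus through the variables one at a time. *)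
Definition nullst (R : comNzRingType) (Pt : Type) (ev : Pt -> {rmorphism R -> k}) :=
  forall J g, prime_pred J -> ~ J g -> exists w, (forall P, J P -> ev w P = 0) /\ ev w g != 0.

Lemma prime_pull (R R' : comNzRingType) (h : {rmorphism R -> R'}) (J : R' -> Prop) :
  prime_pred J -> prime_pred (fun P => J (h P)).
Proof.
move=> [J0 JD J1 JP]; split; [by rewrite rmorph0| |by rewrite rmorph1|].
  by move=> a u v hu hv; rewrite rmorphD rmorphM; exact: JD.
by move=> u v; rewrite rmorphM => /JP.
Qed.

Lemma prime_exp (R : comNzRingType) (J : R -> Prop) a N : prime_pred J -> J (a ^+ N) -> J a.
Proof.
move=> [_ _ J1 JP]; elim: N => [|N IH]; first by rewrite expr0.
by rewrite exprS => /JP[].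
Qed.

(** Degrees are taken modulo the contraction J' of J. If J is extended from J', a coefficient of g
    yields the point. Otherwise let P have least degree in J and let Q in J + (g) have degree 0.
    Over a zero of J' where the leading coefficient of P and the constant term of Q survive, a root
    of P is a zero of J, by pseudo-division, and g cannot vanish there because Q does not. *)
Lemma nullst_poly (R : comNzRingType) Pt (ev : Pt -> {rmorphism R -> k}) : nullst ev ->
  nullst (fun wt : Pt * k => horner_eval wt.2 \o map_poly (ev wt.1) : {rmorphism {poly R} -> k}).
Proof.
move=> nR J g pJ ng; have [J0 JD J1 JP] := pJ.
have hJ : idl J by [].
pose J' c := J c%:P.
have hJ' : idl J' by split; rewrite /J' ?polyC0 // => a u v hu hv; rewrite polyCD polyCM; exact: JD.
have pJ' : prime_pred J'.
  case: hJ' => h1 h2; split; [exact: h1|exact: h2|by rewrite /J' polyC1|].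
  by move=> u v; rewrite /J' polyCM => /JP.
have [_ _ _ pP'] := pJ'.
pose z (P : {poly R}) := forall i, J' P`_i.
have zJ P : z P -> J P.
  move=> zP; rewrite -[P]coefK poly_def; apply: (idl_sum _ hJ) => i _.
  by rewrite -mul_polyC mulrC; exact: (idl_mul _ hJ (zP i)).
pose dg (Q : {poly R}) d := ~ J' Q`_d /\ forall i, (d < i)%N -> J' Q`_i.
have dg_ex Q : ~ z Q -> exists d, dg Q d.
  move=> /existsNP[i0 ni0].
  have ex : exists i, `[< ~ J' Q`_i >] by exists i0; apply/asboolP.
  have ub i : `[< ~ J' Q`_i >] -> (i <= size Q)%N.
    move=> /asboolP h; rewrite leqNgt; apply/negP => lt; apply: h.
    by rewrite nth_default; [case: hJ'|exact: ltnW].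
  case: (ex_maxnP ex ub) => d /asboolP nd maxd; exists d; split=> // i di.
  by apply: contrapT => /asboolP/maxd; rewrite leqNgt di.
have red Q d : dg Q d -> forall P : {poly R}, exists N (B Rm : {poly R}), z (Q`_d ^+ N *: P - B * Q - Rm) /\ forall i, (d <= i)%N -> J' Rm`_i.
  move=> [nd hd] P; have : forall i, (size P <= i)%N -> J' P`_i by move=> i h; rewrite nth_default //; case: hJ'.
  move: (size P) => sz; elim: sz P => [|e IH] P hP.
    by exists 0%N, 0, P; split=> [i|i _]; [rewrite expr0 scale1r mul0r subr0 subrr coef0; case: hJ'|exact: hP].
  have [ed|de] := ltnP e d.
    exists 0%N, 0, P; split=> [i|i di]; first by rewrite expr0 scale1r mul0r subr0 subrr coef0; case: hJ'.
    by apply: hP; exact: leq_trans ed di.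
  have [|N [B [Rm [h1 h2]]]] := IH (Q`_d *: P - P`_e *: ('X^(e - d) * Q)).
    move=> i ei; rewrite coefB !coefZ coefXnM ltnNge (leq_trans _ ei) ?leq_subr //=.
    move: ei; rewrite leq_eqVlt => /predU1P[<-|ei].
      by rewrite subKn // mulrC subrr; case: hJ'.
    apply: (idl_sub hJ'); apply: (idl_mul _ hJ'); first exact: hP.
    by apply: hd; rewrite -[X in (X < _)%N](subKn de) ltn_sub2r // (leq_ltn_trans (leq_subr _ _)).
  exists N.+1, (B + (Q`_d ^+ N * P`_e) *: 'X^(e - d)), Rm; split=> //.
  rewrite (_ : _ - _ - _ = Q`_d ^+ N *: (Q`_d *: P - P`_e *: ('X^(e - d) * Q)) - B * Q - Rm) //.
  by rewrite exprSr -!mul_polyC !polyCM; ring.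
have evz w P : (forall c, J' c -> ev w c = 0) -> z P -> map_poly (ev w) P = 0.
  by move=> hw zP; apply/polyP => i; rewrite coef_map coef0 /= hw.
have [allz|/existsNP[P0 /not_implyP[JP0 nzP0]]] := pselect (forall P, J P -> z P).
  have /existsNP[i ni] : ~ z g by move/zJ.
  have [w [hw gw]] := nR J' g`_i pJ' ni.
  have /closed_nonrootP[t nt] : map_poly (ev w) g != 0.
    by apply: contraNneq gw => /polyP/(_ i); rewrite coef_map coef0 => ->.
  exists (w, t); split=> //= P /allz /(evz w _ hw) e; by rewrite /horner_eval e horner0.
pose minJ d := exists P, J P /\ dg P d.
have exJ : exists d, `[< minJ d >] by have [d h] := dg_ex _ nzP0; exists d; apply/asboolP; exists P0.
case: (ex_minnP exJ) => d /asboolP[P [JPP [nd hd]]] mind.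
have lowJ Rm : J Rm -> (forall i, (d <= i)%N -> J' Rm`_i) -> z Rm.
  move=> JR hR; apply: contrapT => /dg_ex[e [ne he]].
  have : (d <= e)%N by apply: mind; apply/asboolP; exists Rm.
  by move=> /hR.
have d0 : (0 < d)%N.
  rewrite lt0n; apply/negP => /eqP e; apply: nd; rewrite e; rewrite e in hd.
  rewrite /J' (_ : (P`_0)%:P = P - (P - (P`_0)%:P)); last by ring.
  apply: (idl_sub hJ) => //; apply: zJ => -[|i]; rewrite coefB coefC ?subrr ?subr0 /=; [by case: hJ'|exact: hd].
pose G Q := exists A B, J A /\ Q = A + B * g.
have hG : idl G.
  split; first by exists 0, 0; rewrite mul0r addr0.
  move=> a _ _ [A [B [JA ->]]] [A' [B' [JA' ->]]]; exists (a * A + A'), (a * B + B'); split; [exact: JD|ring].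
have GJ Q : J Q -> G Q by exists Q, 0; rewrite mul0r addr0.
have Gg : G g by exists 0, 1; rewrite mul1r add0r.
pose minG e := exists Q, G Q /\ dg Q e.
have exG : exists e, `[< minG e >] by exists d; apply/asboolP; exists P; split=> //; exact: GJ.
case: (ex_minnP exG) => e /asboolP[Q [GQ [ne he]]] mine.
have lowG T : G T -> exists N B, z (Q`_e ^+ N *: T - B * Q).
  move=> GT; have [N [B [Rm [h1 h2]]]] := red Q e (conj ne he) T; exists N, B => i.
  have zR : z Rm.
    have GR : G Rm.
      rewrite (_ : Rm = Q`_e ^+ N *: T - B * Q - (Q`_e ^+ N *: T - B * Q - Rm)); last by ring.
      apply: (idl_sub hG); last by apply: GJ; exact: zJ.
      by apply: (idl_sub hG); rewrite -?mul_polyC; apply: (idl_mul _ hG).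
    apply: contrapT => /dg_ex[f [nf hf]].
    have : (e <= f)%N by apply: mine; apply/asboolP; exists Rm.
    by move=> /h2.
  have := idl_add hJ' (h1 i) (zR i); by rewrite -coefD subrK.
(* If the least degree in J + (g) were positive, pseudo-division of P by Q would put Q into J, and
   then that of g by Q would put g into J. *)
have e0 : e = 0%N.
  apply/eqP; rewrite -leqn0 leqNgt; apply/negP => e0; apply: ng.
  have JQ : J Q.
    have [N [B zB]] := lowG _ (GJ _ JPP).
    have : J (B * Q).
      rewrite (_ : B * Q = Q`_e ^+ N *: P - (Q`_e ^+ N *: P - B * Q)); last by ring.
      by apply: (idl_sub hJ); [rewrite -mul_polyC; exact: (idl_mul _ hJ)|exact: zJ].
    move=> /JP[] // JB; exfalso.
    have nzB : ~ z B.
      move=> zB'; have := zB d; rewrite coefB coefZ => h.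
      have h' : J' (Q`_e ^+ N * P`_d).
        rewrite -[X in J' X](subrK (B * Q)`_d); apply: (idl_add hJ') => //.
        rewrite coefM; apply: (idl_sum _ hJ') => i _; rewrite mulrC; exact: (idl_mul _ hJ').
      by case: (pP' _ _ h') => [/(prime_exp pJ')|].
    have [f [nf hf]] := dg_ex _ nzB.
    have df : (d <= f)%N by apply: mind; apply/asboolP; exists B.
    have := zB (f + e)%N; rewrite coefB coefZ => h.
    have h' : J' (B * Q)`_(f + e).
      rewrite (_ : (B * Q)`_(f + e) = Q`_e ^+ N * P`_(f + e) - (Q`_e ^+ N * P`_(f + e) - (B * Q)`_(f + e))); last by ring.
      apply: (idl_sub hJ') => //; apply: (idl_mul _ hJ'); apply: hd.
      by rewrite -addn1; apply: leq_add.
    move: h'; rewrite coefM (bigD1 (Ordinal (_ : f < (f + e).+1)%N)) //=; first by rewrite ltnS leq_addr.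
    move=> lf h'; have h2 : J' (B`_f * Q`_e).
      have := idl_sub hJ' h' (_ : J' (\sum_(i < (f + e).+1 | i != Ordinal lf) B`_i * Q`_(f + e - i))).
      rewrite addrK addKn; apply; apply: (idl_sum _ hJ') => i nif.
      have [lti|gei] := ltnP f i; first by rewrite mulrC; apply: (idl_mul _ hJ'); exact: hf.
      apply: (idl_mul _ hJ'); apply: he.
      have lti : (i < f)%N by rewrite ltn_neqAle gei andbT; apply: contra nif => /eqP h3; apply/eqP; exact: val_inj.
      by rewrite ltn_subRL ltn_add2r.
    by case: (pP' _ _ h2).
  have [N [B zB]] := lowG _ Gg.
  have : J ((Q`_e ^+ N)%:P * g).
    rewrite mul_polyC -[_ *: g](subrK (B * Q)); apply: (idl_add hJ); [exact: zJ|exact: (idl_mul _ hJ)].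
  by move=> /JP[] //; rewrite -/(J' _) => /(prime_exp pJ').
rewrite e0 in ne he.
have [A [B [JA eQ]]] := GQ.
have nac : ~ J' (P`_d * Q`_0) by move=> /pP'[].
have [w [hw]] := nR J' _ pJ' nac; rewrite rmorphM mulf_eq0 negb_or => /andP[aw cw].
have szP : (1 < size (map_poly (ev w) P))%N.
  rewrite ltnNge; apply/negP => /leq_sizeP/(_ d d0); rewrite coef_map /= => h.
  by rewrite h eqxx in aw.
have /closed_rootP[t rt] : size (map_poly (ev w) P) != 1%N by rewrite neq_ltn szP orbT.
have evJ T : J T -> (map_poly (ev w) T).[t] = 0.
  move=> JT; have [N [D [Rm [h1 h2]]]] := red P d (conj nd hd) T.
  have zR : z Rm.
    apply: lowJ => //.
    rewrite (_ : Rm = P`_d ^+ N *: T - D * P - (P`_d ^+ N *: T - D * P - Rm)); last by ring.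
    apply: (idl_sub hJ); last exact: zJ.
    by apply: (idl_sub hJ); rewrite -?mul_polyC; apply: (idl_mul _ hJ).
  have := evz w _ hw h1; rewrite !rmorphB /= (evz w _ hw zR) subr0 rmorphM /= map_polyZ /= => e1.
  have := congr1 (fun p => p.[t]) e1; rewrite hornerD hornerN hornerM (rootP rt) mulr0 subr0 hornerZ horner0 => /eqP.
  by rewrite mulf_eq0 rmorphXn expf_eq0 (negPf aw) andbF /= => /eqP.
exists (w, t); split=> //=; rewrite /horner_eval.
apply: contraNneq cw => gt.
have : (map_poly (ev w) Q).[t] = 0 by rewrite eQ rmorphD rmorphM hornerD hornerM gt mulr0 addr0 evJ.
have -> : map_poly (ev w) Q = (ev w Q`_0)%:P.
  apply/polyP => -[|i]; rewrite coef_map coefC //=; by rewrite hw //; exact: he.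
by rewrite hornerC => ->.
Qed.

Lemma nullst_mpoly n : nullst (fun w : 'I_n -> k => meval w : {rmorphism {mpoly k[n]} -> k}).
Proof.
elim: n => [|n IH] J g pJ ng.
  exists (fun _ => 0); split=> [P|]; last first.
    have [c e] := mpoly0_const g; rewrite e /= mevalC; apply/eqP => c0; apply: ng.
    by rewrite e c0 mpolyC0; case: pJ.
  have [c ->] := mpoly0_const P => Jc; rewrite /= mevalC.
  apply/eqP; apply: contrapT => /negP c0; case: pJ => J0 JD J1 _; apply: J1.
  rewrite -mpolyC1 -(mulVf c0) mpolyCM -[_ * _]addr0; apply: JD => //.

have [||[w t] [hw gw]] := nullst_poly IH (J := fun P => J (pstep k n P)) (g := projT1 (cid (pstep_surj g))).
- exact: prime_pull.
- by case: (cid _) => P /= <-.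
pose p i := if unlift ord_max i is Some j then w j else t.
have evE P : (pstep k n P).@[p] = (map_poly (meval w) P).[t].
  rewrite pstepE; elim/poly_ind: P => [|P c IHP]; first by rewrite !rmorph0 !horner0 meval0.
  rewrite !rmorphD !rmorphM /= !map_polyX !map_polyC !hornerMXaddC mevalD mevalM IHP mevalXU /p unlift_none.
  congr (_ + _); rewrite /= subst_eval; apply: meval_eq => j; by rewrite mevalXU liftK.
exists p; split=> [P JPp|].
  by have [Q eQ] := pstep_surj P; rewrite eQ in JPp *; rewrite /= evE; exact: (hw Q JPp).
by move: gw => /=; case: (cid _) => Q /= ->; rewrite evE.
Qed.
End Nullstellensatz.

(** * Closed subsets of the torus and chains *)

(** The torus as a closed subset of affine space of dimension 2N: with the inverses as coordinates,
    Laurent monomials become polynomials. *)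
Definition dbl N (x : point N) : 'I_(N + N) -> algC :=
  fun i => match split i with inl j => x j | inr j => (x j)^-1 end.
Definition dset N (Z : pset N) : ('I_(N + N) -> algC) -> Prop := fun w => exists x, Z x /\ w = dbl x.
Definition zeros N (J : {mpoly algC[N + N]} -> Prop) : pset N :=
  fun x => torus x /\ forall P, J P -> P.@[dbl x] = 0.
Definition tor_rel N (j : 'I_N) : {mpoly algC[N + N]} := 'X_(lshift N j) * 'X_(rshift N j) - 1.

Section Zar.
Variable N : nat.
Local Notation S := {mpoly algC[N + N]}.
Implicit Types (x : point N) (Z : pset N) (J : S -> Prop).

Lemma dbl_l x j : dbl x (lshift N j) = x j.
Proof. by rewrite /dbl (unsplitK (inl j)). Qed.
Lemma dbl_r x j : dbl x (rshift N j) = (x j)^-1.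
Proof. by rewrite /dbl (unsplitK (inr j)). Qed.
Lemma tor_rel_eval x j : torus x -> (tor_rel j).@[dbl x] = 0.
Proof. by move=> tx; rewrite mevalB mevalM !mevalXU dbl_l dbl_r divff ?meval1 ?subrr ?tx. Qed.
Lemma dbl_ex (w : 'I_(N + N) -> algC) : (forall j, (tor_rel j).@[w] = 0) -> exists x, torus x /\ w = dbl x.
Proof.
move=> hw; have e j : w (lshift N j) * w (rshift N j) = 1.
  by have /eqP := hw j; rewrite mevalB mevalM !mevalXU meval1 subr_eq0 => /eqP.
exists (fun j => w (lshift N j)); split=> [j|].
  by apply/eqP => h; have := e j; rewrite h mul0r => /eqP; rewrite eq_sym oner_eq0.
apply: funext => i; rewrite -(splitK i); case: (split i) => j; rewrite [unsplit _]/= ?dbl_l ?dbl_r //.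
by apply: (mulfI (x := w (lshift N j))); rewrite ?e ?divff //; apply/eqP => h; have := e j; rewrite h mul0r => /eqP; rewrite eq_sym oner_eq0.
Qed.

Lemma Defs_mevalE (p : Defs.mpoly N) x : Defs.meval p x =
  (\sum_(m <- p) m.1 *: \prod_(i < N) 'X_(lshift N i) ^+ m.2 i : S).@[dbl x].
Proof.
rewrite (raddf_sum (meval (dbl x))); apply: eq_bigr => m _ /=.
rewrite mevalZ (rmorph_prod (meval (dbl x))); congr (_ * _); apply: eq_bigr => i _ /=.
by rewrite (rmorphXn (meval (dbl x))) /= mevalXU dbl_l.
Qed.

Definition dmul (p q : Defs.mpoly N) : Defs.mpoly N :=
  [seq (a.1 * b.1, fun i => (a.2 i + b.2 i)%N) | a <- p, b <- q].
Lemma dmul_eval p q x : Defs.meval (dmul p q) x = Defs.meval p x * Defs.meval q x.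
Proof.
rewrite /Defs.meval /dmul big_allpairs_dep mulr_suml; apply: eq_bigr => a _.
rewrite mulr_sumr; apply: eq_bigr => b _ /=; rewrite mulrACA -big_split; congr (_ * _).
by apply: eq_bigr => i _; rewrite /= exprD.
Qed.
Lemma dcat_eval p q x : Defs.meval (p ++ q) x = Defs.meval p x + Defs.meval q x.
Proof. by rewrite /Defs.meval big_cat. Qed.
Lemma dmon_eval c (m : 'I_N -> nat) x : Defs.meval [:: (c, m)] x = c * \prod_(i < N) x i ^+ m i.
Proof. by rewrite /Defs.meval big_seq1. Qed.

(** Multiplication by a power of the product of the coordinates leads back from doubled coordinates
    to the polynomials in the definition of [zclosed]. *)
Lemma clear_dbl (P : S) : exists (p : Defs.mpoly N) D, forall x, torus x ->
  Defs.meval p x = (\prod_i x i) ^+ D * P.@[dbl x].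
Proof.
elim/mpoly_alg_ind: P => [c|i|u v [p [D hp]] [q [E hq]]|u v [p [D hp]] [q [E hq]]].
- by exists [:: (c, fun _ => 0%N)], 0%N => x _; rewrite dmon_eval mevalC big1 ?mul1r ?mulr1.
- rewrite -(splitK i); case: (split i) => j /=.
    exists [:: (1, fun i => (i == j)%N : nat)], 0%N => x _; rewrite dmon_eval mevalXU dbl_l !mul1r.
    by rewrite (bigD1 j) //= eqxx big1 ?mulr1 // => l /negPf ->.
  exists [:: (1, fun i => (i != j)%N : nat)], 1%N => x tx; rewrite dmon_eval mevalXU dbl_r mul1r expr1.
  rewrite (bigD1 j) //= [in RHS](bigD1 j) //= eqxx mul1r mulrAC divff ?tx // mul1r.
  by apply: eq_bigr => l ->.
- exists (dmul p [:: (1, fun _ => E)] ++ dmul q [:: (1, fun _ => D)]), (D + E)%N => x tx.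
  rewrite dcat_eval !dmul_eval !dmon_eval !mul1r hp // hq // !prodrXl exprD mevalD; ring.
- exists (dmul p q), (D + E)%N => x tx; rewrite dmul_eval hp // hq // exprD mevalM; ring.
Qed.

Lemma zclosed_zeros J : zclosed (zeros J).
Proof.
exists (fun p => exists P, J P /\ exists D, forall x, torus x -> Defs.meval p x = (\prod_i x i) ^+ D * P.@[dbl x]).
move=> x; split=> -[tx h]; split=> //.
  by move=> p [P [JP [D hp]]]; rewrite hp // h // mulr0.
move=> P JP; have [p [D hp]] := clear_dbl P.
have /eqP := h p (ex_intro _ P (conj JP (ex_intro _ D hp))).
rewrite hp // mulf_eq0 expf_eq0 => /orP[/andP[_ /eqP h0]|/eqP //].
have nz : \prod_i x i != 0 by apply/prodf_neq0 => i _; exact: tx.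
by rewrite h0 eqxx in nz.
Qed.

Lemma zclosed_torus Z x : zclosed Z -> Z x -> torus x.
Proof. by move=> [F hF] /hF[]. Qed.
Lemma zclosedE Z x : zclosed Z -> torus x -> (forall P, Ik (dset Z) P -> P.@[dbl x] = 0) -> Z x.
Proof.
move=> [F hF] tx h; apply/hF; split=> // p Fp; rewrite Defs_mevalE; apply: h => w [y [Zy ->]].
by rewrite -Defs_mevalE; have /hF[_] := Zy; apply.
Qed.
Lemma zclosed_sep Z x : zclosed Z -> torus x -> ~ Z x -> exists P, Ik (dset Z) P /\ P.@[dbl x] != 0.
Proof.
move=> cZ tx nZ; apply: contrapT => h; apply: nZ; apply: zclosedE => // P IP.
by apply/eqP; apply: contrapT => /negP n; apply: h; exists P.
Qed.

Lemma zirr_prime Z : zirreducible Z -> prime_pred (Ik (dset Z)).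
Proof.
move=> [cZ [x0 Zx0] irr]; have [h0 hD] := Ik_ideal (dset Z); split=> //.
  by move=> /(_ (dbl x0) (ex_intro _ x0 (conj Zx0 erefl)))/eqP; rewrite meval1 oner_eq0.
move=> u v huv.
have [|h|h] := irr _ _ (zclosed_zeros (fun P => P = u)) (zclosed_zeros (fun P => P = v)).
- move=> x Zx; have tx := zclosed_torus cZ Zx.
  have /eqP := huv _ (ex_intro _ x (conj Zx erefl)); rewrite mevalM mulf_eq0 => /orP[]/eqP h; [left|right].
    by split=> // _ ->.
  by split=> // _ ->.
- by left=> w [x [/h[_ hx] ->]]; exact: hx.
- by right=> w [x [/h[_ hx] ->]]; exact: hx.
Qed.

Lemma zeros_nullst J g : prime_pred J -> (forall j, J (tor_rel j)) -> ~ J g ->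
  exists x, zeros J x /\ g.@[dbl x] != 0.
Proof.
move=> pJ tJ ng; have [w [hw gw]] := nullst_mpoly pJ ng.
have [|x [tx e]] := @dbl_ex w; first by move=> j; exact: hw.
by exists x; rewrite e in hw gw.
Qed.
Lemma zeros_ideal J P : prime_pred J -> (forall j, J (tor_rel j)) -> Ik (dset (zeros J)) P -> J P.
Proof.
move=> pJ tJ h; apply: contrapT => /(zeros_nullst pJ tJ)[x [zx]].
by rewrite h ?eqxx //; exists x.
Qed.
Lemma zeros_irr J : prime_pred J -> (forall j, J (tor_rel j)) -> zirreducible (zeros J).
Proof.
move=> pJ tJ; split; first exact: zclosed_zeros.
  by case: (pJ) => _ _ /(zeros_nullst pJ tJ)[x [zx _]] _; exists x.
move=> Z1 Z2 c1 c2 sub; apply: contrapT => /not_orP[/existsNP[x1 /not_implyP[z1 n1]] /existsNP[x2 /not_implyP[z2 n2]]].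
have [P1 [I1 h1]] := zclosed_sep c1 (proj1 z1) n1.
have [P2 [I2 h2]] := zclosed_sep c2 (proj1 z2) n2.
have : J (P1 * P2).
  apply: zeros_ideal => // w [x [zx ->]]; rewrite mevalM.
  case: (sub _ zx) => h; first by rewrite I1 ?mul0r //; exists x.
  by rewrite I2 ?mulr0 //; exists x.
case: (pJ) => _ _ _ /[apply] -[/(proj2 z1)|/(proj2 z2)] /eqP; exact/negP.
Qed.
Lemma tor_dset Z j : (forall x, Z x -> torus x) -> Ik (dset Z) (tor_rel j).
Proof. by move=> tZ w [x [Zx ->]]; apply: tor_rel_eval; exact: tZ. Qed.
End Zar.

(** * Hilbert-Samuel growth and chains of irreducible subsets *)

Section Growth.
Variable M : nat.
Local Notation S := {mpoly algC[M]}.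
Variable q : 'I_M -> algC.
Implicit Types (J : S -> Prop).

(* Hilbert-Samuel growth of [J] at [q] of order larger than [e - 1]. *)
Definition big J e := forall C, exists kap, (0 < kap)%N /\
  forall d, (d * kap <= C * kap ^ e)%N -> ~ codim_le (sumI J (vord q kap)) d.
Definition adjI J (g : S) : S -> Prop := fun P => exists a w, J a /\ P = a + w * g.

Lemma adjI_ideal J g : ideal_pred J -> ideal_pred (adjI J g).
Proof.
move=> hJ; split; first by exists 0, 0; rewrite mul0r addr0; case: hJ.
move=> a _ _ [u [w [Ju ->]]] [u' [w' [Ju' ->]]]; exists (a * u + u'), (a * w + w').
by split; [case: hJ => _; apply|ring].
Qed.
Lemma adjI_sub J g P : J P -> adjI J g P.
Proof. by exists P, 0; rewrite mul0r addr0. Qed.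
Lemma adjI_mem J g : ideal_pred J -> adjI J g g.
Proof. by move=> [J0 _]; exists 0, 1; rewrite mul1r add0r. Qed.

Lemma nbig J e : ~ big J e -> exists C, forall kap, (0 < kap)%N -> exists d,
  (d * kap <= C * kap ^ e)%N /\ codim_le (sumI J (vord q kap)) d.
Proof.
move=> /existsNP[C hC]; exists C => kap k0; apply: contrapT => h; apply: hC; exists kap; split=> // d dk cd.
by apply: h; exists d.
Qed.

(** Codimensions add along multiplication by u: a polynomial is first reduced modulo J and u, and
    then the cofactor of u is reduced modulo U1. *)
Lemma codim_cat J (u : S) c kap h1 h2 (U1 : S -> Prop) : ideal_pred J ->
  (forall P, U1 P -> sumI J (vord q kap) (u * P)) ->
  c = u -> codim_le (sumI (adjI J c) (vord q kap)) h1 -> codim_le U1 h2 ->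
  codim_le (sumI J (vord q kap)) (h1 + h2).
Proof.
move=> hJ hU -> [g1 hg1] [g2 hg2].
exists (fun i => match split i with inl j => g1 j | inr j => u * g2 j end) => P.
have [c1 [_ [v [[a [w [Ja ->]]] vv e]]]] := hg1 P.
have [c2 hc2] := hg2 w.
exists (fun i => match split i with inl j => c1 j | inr j => c2 j end).
rewrite big_split_ord /= (eq_bigr (fun i => c1 i *: g1 i)) => [|i _]; last by rewrite (unsplitK (inl i)).
rewrite [X in _ - (_ + X)](eq_bigr (fun i => u * (c2 i *: g2 i))) => [|i _]; last by rewrite (unsplitK (inr i)) scalerAr.
rewrite -mulr_sumr opprD addrA e.
rewrite (_ : _ + _ + _ - _ = a + v + u * (w - \sum_i c2 i *: g2 i)); last by ring.
have hS := sumI_ideal hJ (vord_ideal q kap).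
apply: idealD => //; last exact: hU.
by exists a, v.
Qed.

Lemma codim0 J kap : codim_le (sumI J (vord q kap)) 0 -> sumI J (vord q kap) 1.
Proof. by move=> [g hg]; have [c] := hg 1; rewrite big_ord0 subr0. Qed.

Lemma big_eval J e P : ideal_pred J -> big J e -> J P -> P.@[q] = 0.
Proof.
move=> hJ bJ JP; apply/eqP; apply: contrapT => /negP Pq.
have [kap [_ h]] := bJ 0%N; apply: (h 0%N) => //.
pose n := 1 - (P.@[q])^-1 *: P.
have n1 : vord q kap (n ^+ kap).
  by apply: vordX; rewrite /n mevalB mevalZ mulVf // meval1 subrr.
have [a' ea'] : exists a', 1 - n ^+ kap = a' * P.
  rewrite -(expr1n _ kap) subrXX /n opprD opprK addrA subrr add0r.
  by eexists; rewrite -mul_mpolyC mulrC mulrA.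
exists (fun _ => 0) => Q; exists (fun _ => 0); rewrite big_ord0 subr0.
exists (Q * a' * P), (Q * n ^+ kap); split; [exact: idealM|exact: vordMr|].
by rewrite -mulrA -ea'; ring.
Qed.

Lemma big0 J : ideal_pred J -> (forall P, J P -> P.@[q] = 0) -> big J 0.
Proof.
move=> hJ Jq C; exists C.+1; split=> // d; rewrite expn0 muln1 => dC.
have -> : d = 0%N by case: d dC => // d; rewrite mulSn => /(leq_trans (leq_addr _ _)); rewrite ltnn.
move=> /codim0[u [v [Ju [v0 _] e]]]; have := congr1 (meval q) e.
by rewrite mevalD meval1 Jq // v0 addr0 => /eqP; rewrite oner_eq0.
Qed.

(** If u v lies in J but neither factor does, both enlarged ideals have smaller growth by
    maximality, while the codimension of J is at most the sum of theirs. *)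
Lemma big_max_prime J e : ideal_pred J -> big J e ->
  (forall J', ideal_pred J' -> big J' e -> (forall P, J P -> J' P) -> forall P, J' P -> J P) -> prime_pred J.
Proof.
move=> hJ bJ mx; have [J0 JD] := hJ; split=> //.
  by move=> /(big_eval hJ bJ)/eqP; rewrite meval1 oner_eq0.
move=> u v Juv; apply: contrapT => /not_orP[nu nv].
have nb w : ~ J w -> ~ big (adjI J w) e.
  move=> nw b; apply: nw; apply: (mx (adjI J w)) => //; [exact: adjI_ideal|exact: adjI_sub|exact: adjI_mem].
have [C1 h1] := nbig (nb _ nu); have [C2 h2] := nbig (nb _ nv).
have [kap [k0 h]] := bJ (C1 + C2)%N.
have [d1 [l1 c1]] := h1 _ k0; have [d2 [l2 c2]] := h2 _ k0.
apply: (h (d1 + d2)%N); first by rewrite !mulnDl leq_add.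
apply: (codim_cat hJ _ erefl c1 c2) => P [_ [w [[a [b [Ja ->]]] vw ->]]].
exists (u * a + b * (u * v)), (u * w); split; [|exact: vordMr|ring].
by apply: idealD => //; apply: idealM.
Qed.

(** Multiplication by g raises the order by one, so passing from order kap to kap + 1 costs at most
    the codimension of J + (g). Summation over kap raises the growth by one, hence J + (g) cannot
    have lost more than one. *)
Lemma big_drop J e g : ideal_pred J -> big J e.+1 -> g.@[q] = 0 -> big (adjI J g) e.
Proof.
move=> hJ bJ g0; case: e bJ => [|e] bJ.
  apply: big0; first exact: adjI_ideal.
  by move=> _ [a [w [Ja ->]]]; rewrite mevalD mevalM g0 mulr0 addr0 (big_eval hJ bJ).
apply: contrapT => /nbig[C hC].
have cd kap : exists d, (d <= kap * (C * kap ^ e))%N /\ codim_le (sumI J (vord q kap)) d.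
  elim: kap => [|kap [d [ld cd]]].
    exists 0%N; split=> //; exists (fun _ => 0) => P; exists (fun _ => 0); exists 0, (P - \sum_(i < 0) 0 *: 0).
    by split=> //; [case: hJ|rewrite add0r].
  have [d' [ld' cd']] := hC kap.+1 isT.
  exists (d' + d)%N; split.
    rewrite mulSn leq_add //.
      by move: ld'; rewrite expnS mulnCA mulnC leq_pmul2l.
    apply: leq_trans ld _; rewrite leq_mul // leq_mul //.
    by case: (e) => // e'; rewrite leq_exp2r.
  apply: (codim_cat hJ _ erefl cd' cd) => P [a [v [Ja vv ->]]].
  exists (g * a), (g * v); split; [exact: idealM| |ring].
  by rewrite -add1n; apply: vordM => //; exact: vord1.
have [kap [k0 h]] := bJ C; have [d [ld cdd]] := cd kap; apply: (h d) => //.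
rewrite !expnS; apply: leq_trans (leq_mul ld (leqnn kap)) _.
by rewrite [X in (X <= _)%N](_ : _ = C * (kap * (kap * kap ^ e)))%N //; lia.
Qed.

Lemma big_proper J e : ideal_pred J -> big J e.+1 -> exists g, g.@[q] = 0 /\ ~ J g.
Proof.
move=> hJ bJ; apply: contrapT => h.
have mJ P : P.@[q] = 0 -> J P by move=> P0; apply: contrapT => n; apply: h; exists P.
have [kap [k0 hk]] := bJ 1%N; apply: (hk 1%N); first by rewrite !mul1n expnS leq_pmulr // expn_gt0 k0.
exists (fun _ => 1) => P; exists (fun _ => P.@[q]); rewrite big_ord1; apply: sumIl; first exact: vord_ideal.
by apply: mJ; rewrite mevalB mevalZ meval1 mulr1 subrr.
Qed.
End Growth.

Lemma big_max M (q : 'I_M -> algC) e J : ideal_pred J -> big q J e ->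
  exists J1, [/\ ideal_pred J1, big q J1 e, forall P, J P -> J1 P & prime_pred J1].
Proof.
move=> hJ bJ.
have [J1 [hJ1 bJ1 sJ1 mJ1]] := @noeth_max _ (fun I => big q I e) J (@noeth_mpoly algC M) hJ bJ.
by exists J1; split=> //; apply: (big_max_prime hJ1 bJ1 mJ1).
Qed.

(** An ideal maximal for its growth is prime. Cutting it by a function that vanishes at p but is not
    in it lowers the growth by at most one, and strictly shrinks the zero set. *)
Lemma big_chain N (p : point N) e J : ideal_pred J -> (forall j, J (tor_rel j)) -> big (dbl p) J e ->
  exists J', [/\ prime_pred J', forall P, J P -> J' P, forall P, J' P -> P.@[dbl p] = 0 & chain_in (zeros J') e].
Proof.
elim: e J => [|e IH] J hJ tJ bJ; have [J1 [hJ1 bJ1 sJ1 pJ1]] := big_max hJ bJ.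
  exists J1; split=> //; first by move=> P JP; exact: (big_eval hJ1 bJ1 JP).
  exists (fun _ => zeros J1); split=> // i _; split=> //; apply: zeros_irr => // j; exact: sJ1.
have [g [gq ng]] := big_proper hJ1 bJ1.
have tJ1 j : J1 (tor_rel j) by exact: sJ1.
have [|J2 [pJ2 sJ2 eJ2 [Y [hY1 hY2]]]] := IH _ (adjI_ideal g hJ1) _ (big_drop hJ1 bJ1 gq).
  by move=> j; apply: adjI_sub.
exists J1; split=> //; first by move=> P JP; exact: (big_eval hJ1 bJ1 JP).
have z21 : pssubset (zeros J2) (zeros J1).
  split=> [x [tx hx]|]; first by split=> // P JP; apply: hx; apply: sJ2; exact: adjI_sub.
  have [x [zx gx]] := zeros_nullst pJ1 tJ1 ng; exists x; split=> // -[_ /(_ g)].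
  by move=> h; rewrite h ?eqxx // in gx; apply: sJ2; exact: adjI_mem.
exists (fun i => if (i <= e)%N then Y i else zeros J1); split=> i ie.
  case: leqP => h; last by split=> //; exact: zeros_irr.
  have [h1 h2] := hY1 _ h; split=> // x /h2; by case: z21 => sub _; exact: sub.
rewrite -ltnS ie; case: (ltnP i e) => h; first exact: hY2.
have -> : i = e by apply/eqP; rewrite eqn_leq -ltnS ie h.
case: z21 => sub [x [zx nx]]; have [_ h2] := hY1 e (leqnn e).
by split=> [y /h2/sub //|]; exists x; split=> // /h2.
Qed.

Lemma chain_trunc N (Z : pset N) e e' : (e' <= e)%N -> chain_in Z e -> chain_in Z e'.
Proof.
move=> le [Y [h1 h2]]; exists Y; split=> i ie; first by apply: h1; exact: leq_trans ie le.
by apply: h2; exact: leq_trans ie le.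
Qed.
Lemma chain_sub N (Z Z' : pset N) e : psubset Z Z' -> chain_in Z e -> chain_in Z' e.
Proof.
move=> sub [Y [h1 h2]]; exists Y; split=> // i ie.
by have [h3 h4] := h1 i ie; split=> // x /h4/sub.
Qed.

(** The theorem on the dimension of fibres, at the prescribed point p: by [fibre_growth] the growth
    of the fibre is at least the transcendence degree of Z minus that of the [fi], and [big_chain]
    converts it into a chain. *)
Lemma fibre_chain (C : numFieldType) (sg : {rmorphism algC -> C}) N (Z : pset N) (p : point N)
    (pk : pkg (IC sg (dset Z))) m (fi : 'I_m -> {mpoly algC[N + N]}) b' e :
  (forall x, Z x -> torus x) -> prime_pred (Ik (dset Z)) -> Z p -> (forall i, (fi i).@[dbl p] = 0) ->
  tower (const_of (pphi pk)) [seq pphi pk (bc sg (N + N) (fi i)) | i <- enum 'I_m] b' ->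
  (size b' + e <= size (pb pk))%N ->
  exists Y, [/\ zirreducible Y, Y p, chain_in Y e &
    forall y, Y y -> [/\ torus y, forall P, Ik (dset Z) P -> P.@[dbl y] = 0 & forall i, (fi i).@[dbl y] = 0]].
Proof.
move=> tZ pI Zp fp tb le.
have Wp : dset Z (dbl p) by exists p.
have hI := Ik_ideal (dset Z).
have hJ := genI_ideal fi hI.
set r := size (pb pk) in le *; set b := size b' in le.
have bJ : big (dbl p) (genI (Ik (dset Z)) fi) (r - b).
  have [r0|r0] := posnP r.
    rewrite r0 sub0n; apply: big0 => // P [u [w [Iu ->]]].
    rewrite mevalD Iu // add0r (raddf_sum (meval (dbl p))) big1 // => i _ /=.
    by rewrite mevalM fp mulr0.
  have [D hD] := fibre_growth pI Wp fp tb => C'.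
  (* A collects all factors lost in the comparison below: kap + 1 is at most 2 kap, and kap is at
     most (r + 1)(A + 1). *)
  pose A := (C' * (D * (2 ^ b * r.+1 ^ r)))%N.
  exists (r * A.+1).+1; split=> // d dk /hD; apply/negP; rewrite -ltnNge -/b -/r.
  set kap := (r * A.+1).+1 in dk *.
  have k1 : (kap <= r.+1 * A.+1)%N by rewrite /kap mulSn -addn1 addnC leq_add2r.
  have Ak : (A < kap)%N by rewrite /kap ltnS; apply: leq_trans (leq_pmull _ r0).
  rewrite -(ltn_pmul2r (isT : 0 < kap)%N).
  apply: (@leq_ltn_trans (A * A.+1 ^ r)); last by rewrite mulnC ltn_pmul2l // expn_gt0.
  have -> : (d * (D * kap.+1 ^ b) * kap = d * kap * (D * kap.+1 ^ b))%N by lia.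
  apply: leq_trans (leq_mul dk (leqnn _)) _.
  apply: (@leq_trans (C' * kap ^ (r - b) * (D * (2 ^ b * kap ^ b)))).
    rewrite leq_mul2l; apply/orP; right; rewrite leq_mul2l -expnMn; apply/orP; right.
    by case: (b) => // b0; rewrite leq_exp2r // mul2n -addnn; rewrite /kap; lia.
  have -> : (C' * kap ^ (r - b) * (D * (2 ^ b * kap ^ b)) = C' * (D * (2 ^ b * (kap ^ (r - b) * kap ^ b))))%N by lia.
  rewrite -expnD subnK; last exact: leq_trans (leq_addr _ _) le.
  rewrite /A -!mulnA; do 3 (rewrite leq_mul2l; apply/orP; right).
  by rewrite -expnMn leq_exp2r.
have [j|J' [pJ' sJ' eJ' cJ']] := big_chain hJ _ bJ.
  by apply: genI_sub; exact: tor_dset.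
have tJ' j : J' (tor_rel j) by apply: sJ'; apply: genI_sub; exact: tor_dset.
exists (zeros J'); split.
- exact: zeros_irr.
- by split=> //; exact: tZ.
- by apply: chain_trunc cJ'; rewrite leq_subRL // (leq_trans (leq_addr _ _) le).
move=> y [ty hy]; split=> // [P IP|i]; apply: hy; apply: sJ'; first exact: genI_sub.
by apply: genI_mem; case: hI.
Qed.

(** * Transcendence degree bounds the length of chains *)

Lemma leq_exp2rW a b r : (a <= b)%N -> (a ^ r <= b ^ r)%N.
Proof. by case: r => // r; rewrite leq_exp2r. Qed.

Lemma growth_le C A e r : (forall D, D.+1 ^ e <= C * (A * D.+1) ^ r)%N -> (e <= r)%N.
Proof.
move=> h; rewrite leqNgt; apply/negP => re.
have := h (C * A ^ r)%N; apply/negP; rewrite -ltnNge expnMn mulnA.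
rewrite -(subnKC re) expnD -[r.+1]addn1 expnD expn1.
apply: leq_trans (leq_pmulr _ _); last by rewrite expn_gt0.
by rewrite mulnC ltn_pmul2l ?expn_gt0.
Qed.

Lemma boxpol_ex (k : numFieldType) M (I : {mpoly k[M]} -> Prop) (pk : pkg I) P :
  exists d, boxpol (const_of (pphi pk)) [seq pphi pk 'X_l | l <- enum 'I_M] d (pphi pk P).
Proof.
have sK := const_sf (pphi pk).
elim/mpoly_alg_ind: P => [c|i|u v [d hd] [d' hd']|u v [d hd] [d' hd']].
- by exists 0%N; apply: boxpol_const => //; exists c.
- by exists 1%N; apply: boxpol_mem => //; apply: map_f; rewrite mem_enum.
- exists (maxn d d'); rewrite rmorphD; apply: boxpolD => //; [apply: boxpol_mono hd|apply: boxpol_mono hd'] => //.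
    exact: leq_maxl.
  exact: leq_maxr.
- by exists (d + d')%N; rewrite rmorphM; apply: boxpolM.
Qed.

Lemma subst_mon (k : numFieldType) r M (f : 'I_r -> {mpoly k[M]}) (mm : 'X_{1..r}) :
  subst f 'X_[mm] = \prod_i f i ^+ mm i.
Proof.
rewrite mpolyXE_id rmorph_prod; apply: eq_bigr => i _ /=.
by rewrite (rmorphXn (subst f)) substX.
Qed.

(** Monomials in more independent functions would outgrow the Hilbert function of the function
    field. *)
Lemma algindep_le (k : numFieldType) M (I : {mpoly k[M]} -> Prop) (pk : pkg I) e (f : 'I_e -> {mpoly k[M]}) :
  (forall Q, I (subst f Q) -> Q = 0) -> (e <= size (pb pk))%N.
Proof.
move=> ind; have [C hC] := pkg_hf pk; have sK := const_sf (pphi pk).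
have /choice[dl hdl] i := boxpol_ex pk (f i).
pose A := (\sum_i dl i).+1.
apply: (@growth_le C A) => D; pose T := {ffun 'I_e -> 'I_D.+1}.
have -> : (D.+1 ^ e)%N = #|T| by rewrite card_ffun !card_ord.
pose mo (t : T) : 'X_{1..e} := [multinom (t i : nat) | i < e].
have moI : injective mo.
  move=> t t' /mnmP h; apply/ffunP => i; apply: val_inj => /=.
  by have := h i; rewrite !mnmE.
apply: leq_trans (hC ((\sum_i dl i) * D)%N T (fun t => subst f 'X_[mo t]) _ _) _.
- move=> t; rewrite subst_mon rmorph_prod /=.
  apply: boxpol_mono (_ : (\sum_i dl i * D <= _)%N) _; first by rewrite big_distrl.
  rewrite -[index_enum _]/(index_enum 'I_e); elim: (index_enum 'I_e) => [|i s IH].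
    by rewrite !big_nil; apply: boxpol_const => //; exact: sf1.
  rewrite !big_cons rmorphXn; apply: boxpolM => //; rewrite mnmE.
  apply: boxpol_mono (boxpolX sK (t i) (hdl i)) => //.
  by rewrite leq_mul2l -ltnS ltn_ord orbT.
- move=> c h t; have Q0 : \sum_t c t *: 'X_[mo t] = 0 :> {mpoly k[e]}.
    apply: ind; rewrite rmorph_sum (eq_bigr (fun t => c t *: subst f 'X_[mo t])) // => s _; exact: substZ.
  have /mpolyP/(_ (mo t)) := Q0; rewrite mcoeff0 raddf_sum (eq_bigr (fun s => c s * (s == t)%:R)); last first.
    by move=> s _; rewrite /= mcoeffZ mcoeffX (inj_eq moI).
  clear h Q0; move: c => c; rewrite (bigD1 t) //= eqxx mulr1 big1 ?addr0 // => s /negPf ->.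
  by rewrite mulr0.
- rewrite leq_mul2l; apply/orP; right; apply: leq_exp2rW; rewrite /A.
  by move: (\sum_i dl i)%N => sdl; nia.
Qed.

Lemma subst_subst (k : numFieldType) r s M (f : 'I_s -> {mpoly k[M]}) (h : 'I_r -> 'I_s) c :
  subst f (subst (fun i => 'X_(h i)) c) = subst (fun i => f (h i)) c.
Proof.
elim/mpoly_alg_ind: c => [c|i|u v hu hv|u v hu hv].
- by rewrite !substC.
- by rewrite !substX.
- by rewrite [subst _ (u + v)]rmorphD !rmorphD hu hv.
- by rewrite [subst _ (u * v)]rmorphM !rmorphM hu hv.
Qed.

Lemma subst_pstep (k : numFieldType) e M (f : 'I_e -> {mpoly k[M]}) g P :
  subst (fun i : 'I_e.+1 => if unlift ord_max i is Some j then f j else g) (pstep k e P) =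
  (map_poly (subst f) P).[g].
Proof.
rewrite pstepE; elim/poly_ind: P => [|P c IHP]; first by rewrite !rmorph0 !horner0 rmorph0.
rewrite !rmorphD !rmorphM /= !map_polyX !map_polyC !hornerMXaddC rmorphD rmorphM IHP substX unlift_none.
congr (_ + _); rewrite [LHS]subst_subst.
by congr (mmap _ _ c); apply: funext => i; rewrite liftK.
Qed.

(** Each strict inclusion yields one more function: g vanishes on the smaller set but not on the
    larger. A relation between f and g, divided by the largest possible power of g, restricts on the
    smaller set to a relation for f alone. *)
Lemma chain_algindep N (Y : nat -> pset N) e : (forall i, (i <= e)%N -> zirreducible (Y i)) ->
  (forall i, (i < e)%N -> pssubset (Y i) (Y i.+1)) ->
  exists f : 'I_e -> {mpoly algC[N + N]}, forall Q, Ik (dset (Y e)) (subst f Q) -> Q = 0.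
Proof.
elim: e => [|e IH] irr inc.
  exists (fun _ => 0) => Q; have [c ->] := mpoly0_const Q; rewrite substC.
  have [_ [x Yx] _] := irr 0%N isT => /(_ (dbl x) (ex_intro _ x (conj Yx erefl))).
  by rewrite mevalC => ->; rewrite mpolyC0.
have [||f hf] := IH.
- by move=> i ie; apply: irr; exact: leqW.
- by move=> i ie; apply: inc; exact: leqW.
have [sub [x [Yx nYx]]] := inc e (ltnSn e).
have [c1 _ _] := irr e (leqnSn e); have ic2 := irr e.+1 (leqnn _); have [c2 _ _] := ic2.
have [g [Ig gx]] := zclosed_sep c1 (zclosed_torus c2 Yx) nYx.
have ng : ~ Ik (dset (Y e.+1)) g by move=> h; move/eqP: gx; apply; apply: h; exists x.
have [_ _ _ pr] := zirr_prime ic2.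
exists (fun i => if unlift ord_max i is Some j then f j else g) => Q.
have [P ->] := pstep_surj Q; rewrite subst_pstep => hP; apply: contrapT => nz.
have P0 : P != 0 by apply: contra_notN nz => /eqP ->; rewrite rmorph0.
have ex : exists m, P`_m != 0.
  by exists (size P).-1; rewrite -lead_coefE lead_coef_eq0.
case: (ex_minnP ex) => m Pm minm.
have eP : P = drop_poly m P * 'X^m.
  rewrite -[LHS](poly_take_drop m); rewrite [take_poly m P](_ : _ = 0) ?add0r //.
  apply/polyP => i; rewrite coef_take_poly coef0; case: ltnP => // im.
  by apply/eqP; apply: contraLR im => /minm; rewrite -leqNgt.
have : Ik (dset (Y e.+1)) (map_poly (subst f) (drop_poly m P)).[g].
  move: hP; rewrite {1}eP rmorphM /= map_polyXn hornerM hornerXn => /pr[] // h; exfalso.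
  by elim: (m) h => [|i IHm]; rewrite ?expr0 ?exprS => h; [case: (zirr_prime ic2) => _ _ /(_ h)|case: (pr _ _ h)].
move=> h; have h0 : Ik (dset (Y e)) (subst f P`_m).
  move=> w [y [Yy ->]]; have := h (dbl y) (ex_intro _ y (conj (sub _ Yy) erefl)).
  have g0 : g.@[dbl y] = 0 by apply: Ig; exists y.
  have [q [c eq]] : exists q c, drop_poly m P = q * 'X + c%:P.
    by elim/poly_ind: (drop_poly m P) => [|q c _]; [exists 0, 0; rewrite mul0r add0r|exists q, c].
  have -> : P`_m = c.
    by have := congr1 (fun p : {poly _} => p`_0) eq; rewrite /= coef_drop_poly add0n coefD coefMX coefC add0r.
  by rewrite eq rmorphD rmorphM /= map_polyX map_polyC hornerMXaddC mevalD mevalM g0 mulr0 add0r.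
by move/eqP: Pm; apply; exact: hf.
Qed.

Section Torus.
Variable N : nat.

Lemma mpoly_torus0 (Q : {mpoly algC[N]}) : (forall x : point N, torus x -> Q.@[x] = 0) -> Q = 0.
Proof.
move=> h; apply/eqP; apply: contrapT => /negP Q0.
have pr : prime_pred (fun P : {mpoly algC[N]} => P = 0).
  split=> // [a u v -> ->||u v /eqP]; first by rewrite mulr0 addr0.
    by move/eqP; rewrite oner_eq0.
  by rewrite mulf_eq0 => /orP[]/eqP; [left|right].
have [|w [_]] := nullst_mpoly pr (g := Q * \prod_(i < N) 'X_i).
  apply/eqP; rewrite mulf_neq0 //; apply/prodf_neq0 => i _.
  by rewrite -msize_poly_eq0 msizeX.
rewrite /= mevalM mulf_eq0 negb_or => /andP[+ /negP w0]; rewrite h ?eqxx // => i.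
apply/eqP => wi; apply: w0; rewrite (bigD1 i) //= mevalM mevalXU wi mul0r.
exact: eqxx.
Qed.

Lemma clear_mpoly (P : {mpoly algC[N + N]}) : exists (P' : {mpoly algC[N]}) D,
  forall x : point N, torus x -> P'.@[x] = (\prod_i x i) ^+ D * P.@[dbl x].
Proof.
have [p [D hp]] := clear_dbl P.
exists (\sum_(m <- p) m.1 *: \prod_(i < N) 'X_i ^+ m.2 i), D => x tx; rewrite -hp //.
rewrite (raddf_sum (meval x)); apply: eq_bigr => m _ /=.
rewrite mevalZ (rmorph_prod (meval x)); congr (_ * _); apply: eq_bigr => i _ /=.
by rewrite (rmorphXn (meval x)) /= mevalXU.
Qed.

Lemma torus_prime : prime_pred (Ik (dset (@torus N))).
Proof.
have [h0 hD] := Ik_ideal (dset (@torus N)); split=> //.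
  have t1 : torus (fun _ : 'I_N => 1) by move=> i; exact: oner_neq0.
  by move=> /(_ _ (ex_intro _ _ (conj t1 erefl)))/eqP; rewrite meval1 oner_eq0.
move=> u v huv; have [u' [D hu]] := clear_mpoly u; have [v' [E hv]] := clear_mpoly v.
have nz (x : point N) : torus x -> \prod_i x i != 0 by move=> tx; apply/prodf_neq0 => i _; exact: tx.
have : u' * v' = 0.
  apply: mpoly_torus0 => x tx; rewrite mevalM hu // hv // mulrACA -mevalM huv ?mulr0 //.
  by exists x.
move/eqP; rewrite mulf_eq0 => /orP[]/eqP e0; [left|right] => w [x [tx ->]].
  have /eqP := hu x tx; rewrite e0 meval0 eq_sym mulf_eq0 expf_eq0 (negPf (nz _ tx)) andbF /= => /eqP //.
have /eqP := hv x tx; rewrite e0 meval0 eq_sym mulf_eq0 expf_eq0 (negPf (nz _ tx)) andbF /= => /eqP //.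
Qed.
End Torus.

(** * Cosets and monomials *)

(** A Laurent monomial in doubled coordinates: negative exponents go to the inverse coordinates. *)
Definition chp (K : numFieldType) N (a : 'I_N -> int) : {mpoly K[N + N]} :=
  \prod_j match a j with Posz n => 'X_(lshift N j) ^+ n | Negz n => 'X_(rshift N j) ^+ n.+1 end.

Lemma chp_eval N (a : 'I_N -> int) (x : point N) : (chp algC a).@[dbl x] = \prod_j x j ^ a j.
Proof.
rewrite (rmorph_prod (meval (dbl x))); apply: eq_bigr => j _ /=.
case: (a j) => m; rewrite (rmorphXn (meval (dbl x))) /= mevalXU ?dbl_l ?dbl_r //.
by rewrite exprVn.
Qed.
Lemma chp_phi (K : numFieldType) N (F : fieldType) (phi : {rmorphism {mpoly K[N + N]} -> F}) a :
  (forall j, phi ('X_(lshift N j) * 'X_(rshift N j)) = 1) -> phi (chp K a) = monz (fun j => phi 'X_(lshift N j)) a.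
Proof.
move=> h; rewrite /chp rmorph_prod; apply: eq_bigr => j _ /=.
have e : phi 'X_(rshift N j) = (phi 'X_(lshift N j))^-1.
  have := h j; rewrite rmorphM => e; have n0 : phi 'X_(lshift N j) != 0.
    by apply/eqP => z; rewrite z mul0r in e; move/eqP: e; rewrite eq_sym oner_eq0.
  by apply: (mulfI n0); rewrite e divff.
case: (a j) => m; rewrite rmorphXn //= e.
by rewrite exprVn.
Qed.
Lemma chp_bc (C : numFieldType) (sg : {rmorphism algC -> C}) N a : bc sg (N + N) (chp algC a) = chp C a.
Proof.
rewrite /chp (rmorph_prod (bc sg (N + N))); apply: eq_bigr => j _ /=.
by case: (a j) => m; exact: etrans (rmorphXn (bc sg (N + N)) _ _) (congr1 (fun z => z ^+ _) (bcX sg _)).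
Qed.

Lemma intr_row_free (F : fieldType) m n (mu : 'M[int]_(m, n)) : (forall n, n.+1%:R != 0 :> F) ->
  row_free (map_mx intr mu : 'M[rat]_(m, n)) -> row_free (map_mx intr mu : 'M[F]_(m, n)).
Proof.
move=> char0 fA; set A := map_mx intr mu in fA.
have rfT : row_full A^T by rewrite /row_full mxrank_tr.
pose h := fullrankfun rfT.
have : rowsub h A^T \in unitmx by exact: fullrowsub_unit.
have -> : rowsub h A^T = map_mx intr (rowsub h mu^T) by apply/matrixP => i j; rewrite !mxE.
rewrite unitmxE unitfE det_map_mx intr_eq0 => d0.
have u : map_mx intr (rowsub h mu^T) \in @unitmx F m.
  rewrite unitmxE unitfE det_map_mx; move: d0; case: (\det _) => [[|k]|k] // _.
    exact: char0.
  by rewrite -[X in X != 0]/(- (k.+1%:R)) oppr_eq0; exact: char0.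
rewrite /row_free eqn_leq rank_leq_row /= -{1}(mxrank_unit u).
have -> : map_mx intr (rowsub h mu^T) = rowsub h (map_mx intr mu : 'M[F]_(m, n))^T by apply/matrixP => i j; rewrite !mxE.
by rewrite -[X in (_ <= X)%N]mxrank_tr; apply: mxrankS; exact: rowsub_sub.
Qed.

Section PkgTorus.
Variables (K : numFieldType) (N : nat) (I : {mpoly K[N + N]} -> Prop) (pk : pkg I).
Hypothesis tI : forall j : 'I_N, I ('X_(lshift N j) * 'X_(rshift N j) - 1).
Local Notation phi := (pphi pk).
Definition pkx (j : 'I_N) : pF pk := phi 'X_(lshift N j).

Lemma pkx_inv j : phi ('X_(lshift N j) * 'X_(rshift N j)) = 1.
Proof. by have /(pphiE pk) := tI j; rewrite rmorphB rmorph1 => /eqP; rewrite subr_eq0 => /eqP. Qed.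
Lemma pkx_neq0 j : pkx j != 0.
Proof.
by apply/eqP => h; have /eqP := pkx_inv j; rewrite rmorphM -/(pkx j) h mul0r eq_sym oner_eq0.
Qed.
Lemma pkx_r j : phi 'X_(rshift N j) = (pkx j)^-1.
Proof. by apply: (mulfI (pkx_neq0 j)); rewrite divff ?pkx_neq0 // -[RHS](pkx_inv j) rmorphM. Qed.

Lemma Lam_free (f : 'rV[pF pk]_(size (pb pk))) : (forall j, Dv (@pd _ _ _ pk) f (pkx j) = 0) -> f = 0.
Proof.
move=> h; have [dD _] : derivation (const_of phi) (Dv (@pd _ _ _ pk) f).
  by apply: (@derivation_Dv _ (const_of phi) (pb pk)) => i; exact: pderd.
have sT : subfield (fun _ : pF pk => True) by [].
apply/rowP => i; rewrite mxE.
transitivity (Dv (@pd _ _ _ pk) f (pb pk)`_i).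
  by rewrite /Dv (bigD1 i) //= pdE eqxx mulr1 big1 ?addr0 // => l li; rewrite pdE (negPf li) mulr0.
rewrite pbetaE -(splitK (pbeta i)); case: (split _) => j /=; first exact: h.
by rewrite pkx_r (derV sT dD) ?pkx_neq0 // -/(pkx j) h oppr0 mul0r.
Qed.

(** Exponent vectors of constant monomials are killed by the matrix of logarithmic derivatives,
    whose rank is the transcendence degree because the differentials of the coordinates span. *)
Lemma rank_bound m (mu : 'M[int]_(m, N)) : row_free (map_mx intr mu : 'M[rat]_(m, N)) ->
  (forall i, exists c, I (chp K (fun j => mu i j) - c%:MP)) -> (size (pb pk) + m <= N)%N.
Proof.
move=> fmu hc; set r := size (pb pk); have ch0 := const_char0 phi.
pose La := Lam (@pd _ _ _ pk) pkx.
pose Mu := map_mx intr mu : 'M[pF pk]_(m, N).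
have rM : \rank Mu = m by apply/eqP; exact: intr_row_free.
have rL : \rank La = r.
  apply/eqP; rewrite -/(row_free La) -kermx_eq0; apply/rowV0P => f /sub_kermxP e.
  apply: Lam_free => j; have /rowP/(_ j) := e; rewrite !mxE => e'.
  rewrite -[RHS](mul0r (pkx j)) -e' mulr_suml; apply: eq_bigr => i _.
  by rewrite mxE -mulrA mulfVK // pkx_neq0.
suff z0 : La *m Mu^T = 0 by have := mulmx0_rank_max z0; rewrite mxrank_tr rM rL.
apply/matrixP => l i; rewrite !mxE.
have [c Ic] := hc i; have [dD dK] := pderd l.
have sT : subfield (fun _ : pF pk => True) by [].
have e : phi (chp K (fun j => mu i j)) = phi c%:MP.
  by have /(pphiE pk) := Ic; rewrite rmorphB => /eqP; rewrite subr_eq0 => /eqP.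
have z : pd l (monz pkx (fun j => mu i j)) = 0.
  by rewrite -[monz _ _]/(monz (fun j => phi 'X_(lshift N j)) _) -chp_phi ?e ?dK //; [exists c|exact: pkx_inv].
have m0 : monz pkx (fun j => mu i j) != 0.
  by apply/prodf_neq0 => j _; apply: expfz_neq0; exact: pkx_neq0.
have := der_monz pkx_neq0 (fun j => mu i j) (pderd l); rewrite z mul0r => e2.
by rewrite [RHS]e2; apply: eq_bigr => j _; rewrite !mxE mulrC.
Qed.
End PkgTorus.

Lemma tower_size (F : fieldType) (E : F -> Prop) gs b : tower E gs b -> (size b <= size gs)%N.
Proof. by elim=> //= z hs c _ h _; exact: leqW. Qed.

Lemma tor_Ik N (Z : pset N) (j : 'I_N) : (forall x, Z x -> torus x) -> Ik (dset Z) ('X_(lshift N j) * 'X_(rshift N j) - 1).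
Proof. exact: tor_dset. Qed.

Lemma coset_chain N (Z : pset N) e m (mu : 'M[int]_(m, N)) : chain_in Z e ->
  row_free (map_mx intr mu : 'M[rat]_(m, N)) ->
  (forall i y y', Z y -> Z y' -> \prod_j y j ^ mu i j = \prod_j y' j ^ mu i j) -> (e + m <= N)%N.
Proof.
move=> [Y [h1 h2]] fmu cst.
have [iY sY] := h1 e (leqnn e); have [cY [y0 Yy0] _] := iY.
have tY x : Y e x -> torus x by exact: zclosed_torus.
have [pk] := package (zirr_prime iY).
have [|f hf] := @chain_algindep N Y e _ h2; first by move=> i ie; case: (h1 i ie).
have er := algindep_le pk hf.
apply: leq_trans (_ : size (pb pk) + m <= N)%N; first by rewrite leq_add2r.
apply: (rank_bound pk) fmu _ => [j|i]; first exact: tor_Ik.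
exists (\prod_j y0 j ^ mu i j) => w [y [Yy ->]].
by rewrite mevalB mevalC chp_eval (cst i y y0) ?subrr //; exact: sY.
Qed.

Lemma dim_ex N (Z : pset N) e B : chain_in Z e -> (forall e', chain_in Z e' -> (e' <= B)%N) ->
  exists d, [/\ has_dim Z d, (e <= d)%N & (d <= B)%N].
Proof.
move=> ce ub.
have ex : exists n, `[< chain_in Z n >] by exists e; apply/asboolP.
have ub' n : `[< chain_in Z n >] -> (n <= B)%N by move/asboolP/ub.
case: (ex_maxnP ex ub') => d /asboolP cd mx; exists d; split; last exact: ub.
  by split=> // /asboolP/mx; rewrite ltnn.
by apply: mx; apply/asboolP.
Qed.

(** Y lies in the coset through p of the subgroup cut out by the rows of [mu]. The m independent
    rows bound its dimension by n + t - m, and s < m + e turns this into the inequality required of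
    an anomalous subvariety. *)
Lemma coset_bound n t (X : pset (n + t)) s Y p e m (mu : 'M[int]_(m, n + t)) :
  has_dim X s -> (s <= n)%N -> zirreducible Y -> psubset Y X -> Y p -> chain_in Y e -> (0 < e)%N -> (s < m + e)%N ->
  row_free (map_mx intr mu : 'M[rat]_(m, n + t)) -> (forall i (j : 'I_(n + t)), (n <= j)%N -> mu i j = 0) ->
  (forall i y, Y y -> \prod_j y j ^ mu i j = \prod_j p j ^ mu i j) -> ~ X_re_oa X p.
Proof.
move=> dX sn iY sYX Yp cY e0 sme fmu mu0 cst [_ []]; exists Y; split=> //.
have [cl _ _] := iY; have tY x : Y x -> torus x by exact: zclosed_torus.
have c0 N : row_free (map_mx intr (0 : 'M[int]_(0, N)) : 'M[rat]_(0, N)) by rewrite /row_free -leqn0 rank_leq_row.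
have ub0 e' : chain_in Y e' -> (e' <= n + t)%N.
  by move=> h; rewrite -[e']addn0; apply: (coset_chain h (c0 _)) => -[].
have [dY [hY le _]] := dim_ex cY ub0.
pose H : pset (n + t) := fun x => torus x /\ forall i, \prod_j x j ^ mu i j = 1.
have tp := tY _ Yp.
have pr (a : 'I_(n + t) -> int) (x y : point (n + t)) : \prod_j (x j * y j) ^ a j = \prod_j x j ^ a j * \prod_j y j ^ a j.
  by rewrite -big_split; apply: eq_bigr => j _; rewrite expfzMl.
have sub : psubset Y (coset p H).
  move=> y Yy; exists (fun j => y j / p j); split; last by apply: funext => j; rewrite mulrC mulfVK.
  split=> [j|i]; first by rewrite mulf_neq0 ?invr_eq0 ?tp ?(tY _ Yy).
  have nz : \prod_j p j ^ mu i j != 0 by apply/prodf_neq0 => j _; apply: expfz_neq0; exact: tp.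
  apply: (mulfI nz); rewrite mulr1 -pr -[RHS](cst i y Yy); apply: eq_bigr => j _.
  by rewrite mulrC mulfVK.
have bd e' : chain_in (coset p H) e' -> (e' <= n + t - m)%N.
  move=> /coset_chain/(_ fmu) h; rewrite -(leq_add2r m) subnK.
    by apply: h => i _ _ [y [[_ hy] ->]] [y' [[_ hy'] ->]]; rewrite !pr hy hy'.
  by rewrite -(eqP fmu) rank_leq_col.
have [dC [hC _ leC]] := dim_ex (chain_sub sub cY) bd.
exists s, dY; split; first by split=> //; exact: leq_trans e0 le.
exists H, p, dC; split; last first.
  have : (m <= n + t)%N by rewrite -(eqP fmu) rank_leq_col.
  split=> //; apply: leq_trans leC _.
  move: le sme sn; clear; lia.
split=> //; last first.
  move=> x tx hx; split=> // i; rewrite big1 // => j _.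
  by case: (ltnP j n) => [/hx ->|/(mu0 i) ->]; rewrite ?exp1rz ?expr0z.
(* Taking all exponents trivial on H, instead of the span of [mu], makes the defining equations of H
   immediate. *)
exists (fun a => forall x, H x -> \prod_j x j ^ a j = 1); split.
  split=> [x _|a b ha hb x Hx]; first by rewrite big1.
  have [tx _] := Hx; rewrite (eq_bigr (fun j => x j ^ a j * (x j ^ b j)^-1)).
    by rewrite big_split /= prodfV ha // hb // invr1 mulr1.
  by move=> j _; rewrite expfzDr ?tx // -invr_expz.
move=> x; split=> [Hx|[tx hx]].
  by split=> [|a]; [case: Hx|apply].
by split=> // i; apply: hx => y [].
Qed.

(** If the exponents in L had rank m below N - d, the fibre of m of them through 1 would contain an
    irreducible Y with chains longer than d. A multiple of each a in L is a combination of the rows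
    of [mu], so x^a takes roots of unity as values on Y, is constant there, and equals 1: Y would
    lie in H. *)
Lemma subgroup_rank N (H : pset N) (L : ('I_N -> int) -> Prop) d :
  (forall x, H x <-> (torus x /\ forall a, L a -> \prod_(i < N) x i ^ a i = 1)) -> has_dim H d ->
  exists m (mu : 'M[int]_(m, N)), [/\ row_free (map_mx intr mu : 'M[rat]_(m, N)), forall i, L (fun j => mu i j) & (N <= m + d)%N].
Proof.
move=> HL [_ nd].
pose good m := exists mu : 'M[int]_(m, N), row_free (map_mx intr mu : 'M[rat]_(m, N)) /\ forall i, L (fun j => mu i j).
have ex : exists m, `[< good m >].
  exists 0%N; apply/asboolP; exists 0; split; last by case.
  by rewrite /row_free -leqn0 rank_leq_row.
have ub m : `[< good m >] -> (m <= N)%N by move=> /asboolP[mu [fmu _]]; rewrite -(eqP fmu) rank_leq_col.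
case: (ex_maxnP ex ub) => m /asboolP[mu [fmu Lmu]] mx; exists m, mu; split=> //.
have mN := ub m (introT (asboolP _) (ex_intro _ mu (conj fmu Lmu))).
have dep a : L a -> exists (D : int) (c : 'I_m -> int), D != 0 /\ forall j, D * a j = \sum_i c i * mu i j.
  move=> La; pose av : 'rV[int]_N := \row_j a j.
  have : ((map_mx intr av : 'rV[rat]_N) <= (map_mx intr mu : 'M[rat]_(m, N)))%MS.
    apply: contrapT => /negP na; suff /asboolP/mx : good (m + 1)%N by rewrite addn1 ltnn.
    exists (col_mx mu av); split; last first.
      move=> i; rewrite -(splitK i); case: (split i) => l /=.
        by have -> : (fun j => col_mx mu av (lshift 1 l) j) = (fun j => mu l j) by apply: funext => j; rewrite col_mxEu.
      by have -> : (fun j => col_mx mu av (rshift m l) j) = a by apply: funext => j; rewrite col_mxEd mxE.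
    rewrite map_col_mx /row_free -addsmxE.
    have r1 : \rank (map_mx intr av : 'rV[rat]_N) = 1%N.
      by rewrite rank_rV; case: eqP => // e; case: na => //; rewrite e sub0mx.
    rewrite mxrank_disjoint_sum ?(eqP fmu) ?r1 //.
    apply/eqP; rewrite -mxrank_eq0; apply/eqP/eqP.
    have : (\rank (map_mx intr mu :&: map_mx intr av : 'M[rat]_N)%MS < \rank (map_mx intr av : 'rV[rat]_N))%N.
      apply: rank_ltmx; rewrite ltmxE capmxSr /=.
      by apply: contraNN na => /submx_trans; apply; exact: capmxSl.
    by rewrite r1 ltnS leqn0.
  move=> /submxP[c ec]; have [D [u [D0 eu]]] := clear_denom c.
  exists D, (fun i => u 0 i); split=> // j.
  have /rowP/(_ j) : D%:~R *: (map_mx intr av : 'rV[rat]_N) = map_mx intr u *m map_mx intr mu by rewrite ec eu scalemxAl.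
  rewrite !mxE => /eqP; under eq_bigr => i _ do rewrite !mxE -intrM.
  by rewrite -rmorph_sum -intrM eqr_int => /eqP.
pose T := @torus N; have pT := @torus_prime N.
pose sg : {rmorphism algC -> algC} := idfun.
have [pk] := package (@IC_prime algC algC sg _ _ pT).
have rN : (N <= size (pb pk))%N.
  apply: (algindep_le pk (f := fun j => 'X_(lshift N j))) => Q hQ; apply: mpoly_torus0 => x tx.
  have := hQ (dbl x) (ex_intro _ x (conj tx erefl)); rewrite subst_eval.
  by move=> <-; apply: meval_eq => j; rewrite mevalXU dbl_l.
pose fi i := chp algC (fun j => mu i j) - 1.
have [b' tb'] := tower_ex (const_of (pphi pk)) [seq pphi pk (bc sg (N + N) (fi i)) | i <- enum 'I_m].
have sb : (size b' <= m)%N by have := tower_size tb'; rewrite size_map size_enum_ord.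
pose one : point N := fun _ => 1.
have t1 : torus one by move=> i; exact: oner_neq0.
have one_exp a : \prod_j one j ^ a j = 1 by rewrite big1 // => j _; rewrite exp1rz.
have [|||Y [iY Y1 cY hY]] := @fibre_chain algC sg N T one pk m fi b' (N - m) _ pT t1 _ tb'.
- by [].
- by move=> i; rewrite mevalB chp_eval one_exp meval1 subrr.
- have ar z : (z <= m)%N -> (z + (N - m) <= N)%N by move: mN; clear; lia.
  exact: leq_trans (ar _ sb) rN.
rewrite leqNgt; apply/negP => lt; apply: nd.
apply: (chain_trunc (e := N - m)); first by rewrite ltn_subRL.
apply: chain_sub cY => y Yy; have [ty _ fy] := hY y Yy; apply/HL; split=> // a /dep[D [c [D0 ec]]].
have mu1 z i : Y z -> \prod_j z j ^ mu i j = 1.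
  by move=> /hY[_ _ /(_ i)] /eqP; rewrite mevalB chp_eval meval1 subr_eq0 => /eqP.
have aD z : Y z -> (\prod_j z j ^ a j) ^+ `|D|%N = 1.
  move=> Yz; have [tz _ _] := hY z Yz.
  have e1 : (\prod_j z j ^ a j) ^ D = 1.
    transitivity (\prod_i (\prod_j z j ^ mu i j) ^ c i); last by rewrite big1 // => i _; rewrite mu1 // exp1rz.
    transitivity (\prod_j z j ^ (D * a j)).
      elim/big_ind2: _ => [|u u' v v' <- <-|j _]; rewrite ?exp1rz //; first by rewrite expfzMl.
      by rewrite mulrC exprz_exp.
    transitivity (\prod_i \prod_j z j ^ (c i * mu i j)).
      rewrite exchange_big; apply: eq_bigr => j _; rewrite ec.
      elim/big_rec2: _ => [|i u v _ <-]; first by rewrite expr0z.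
      by rewrite expfzDr ?tz.
    apply: eq_bigr => i _; elim/big_ind2: _ => [|u u' v v' -> ->|j _]; rewrite ?exp1rz //; first by rewrite expfzMl.
    by rewrite mulrC exprz_exp.
  move: e1; case: (D) => k //= /eqP; rewrite NegzE -invr_expz invr_eq1 => /eqP //.
have D1 : (0 < `|D|)%N by rewrite absz_gt0.
have [rs ers] := closed_field_poly_normal ('X^`|D| - 1 : {poly algC}).
have : Ik (dset Y) (\prod_(z <- rs) (chp algC a - z%:MP)).
  move=> w [z [Yz ->]]; rewrite (rmorph_prod (meval (dbl z))) /=.
  under eq_bigr => u _ do rewrite mevalB mevalC chp_eval.
  have := congr1 (fun p => p.[\prod_j z j ^ a j]) ers.
  rewrite lead_coefDl ?lead_coefXn ?scale1r; last by rewrite size_polyXn size_polyN size_poly1 ltnS.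
  rewrite horner_prod hornerD hornerXn hornerN hornerC aD // subrr => e1.
  by rewrite [RHS]e1; apply: eq_bigr => u _; rewrite hornerXsubC.
have [_ _ n1 pr] := zirr_prime iY.
elim: rs {ers} => [|u rs IH]; rewrite ?big_nil ?big_cons; first by move/n1.
move=> /pr[h|]; last exact: IH.
have val z : Y z -> \prod_j z j ^ a j = u.
  move=> Yz; have := h (dbl z) (ex_intro _ z (conj Yz erefl)).
  by rewrite mevalB mevalC chp_eval => /eqP; rewrite subr_eq0 => /eqP.
by rewrite val // -(val one Y1) one_exp.
Qed.

(** * Complex exponentials *)

Notation cRe := complex.Re.
Notation cIm := complex.Im.
Definition nm (R : rcfType) (z : R[i]) : R := ComplexField.Normc.normc z.
Definition rc (R : rcfType) (x : R) : R[i] := Complex x 0.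

Section Norm.
Variable R : rcfType.
Implicit Types z w : R[i].
Lemma rc_is_zmod : zmod_morphism (@rc R). Proof. by move=> x y; apply/eqP; rewrite eq_complex /= subr0 !eqxx. Qed.
Lemma rc_is_monoid : monoid_morphism (@rc R).
Proof. by split=> // x y; apply/eqP; rewrite eq_complex /= !(mulr0, mul0r) subr0 addr0 !eqxx. Qed.
HB.instance Definition _ := GRing.isZmodMorphism.Build R R[i] (@rc R) rc_is_zmod.
HB.instance Definition _ := GRing.isMonoidMorphism.Build R R[i] (@rc R) rc_is_monoid.
Lemma nm_ge0 z : 0 <= nm z. Proof. by case: z => a b; exact: sqrtr_ge0. Qed.
Lemma nmM z w : nm (z * w) = nm z * nm w. Proof. exact: ComplexField.Normc.normcM. Qed.
Lemma nmD z w : nm (z + w) <= nm z + nm w. Proof. exact: le_normcD. Qed.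
Lemma nmN z : nm (- z) = nm z. Proof. exact: normcN. Qed.
Lemma nm0 : nm (0 : R[i]) = 0. Proof. exact: ComplexField.Normc.normc0. Qed.
Lemma nm1 : nm (1 : R[i]) = 1. Proof. exact: ComplexField.Normc.normc1. Qed.
Lemma nm_eq0 z : nm z = 0 -> z = 0. Proof. exact: ComplexField.Normc.eq0_normc. Qed.
Lemma nmB z w : nm (z - w) <= nm z + nm w. Proof. by rewrite -(nmN w); exact: nmD. Qed.
Lemma nmX z n : nm (z ^+ n) = nm z ^+ n.
Proof. by elim: n => [|n IH]; rewrite ?expr0 ?nm1 // !exprS nmM IH. Qed.
Lemma nm_sum (J : Type) (s : seq J) (P : pred J) (F : J -> R[i]) :
  nm (\sum_(j <- s | P j) F j) <= \sum_(j <- s | P j) nm (F j).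
Proof.
elim/big_rec2: _ => [|j y x _ h]; first by rewrite nm0.
by apply: le_trans (nmD _ _) _; rewrite lerD2l.
Qed.
Lemma nm_rc (x : R) : nm (rc x) = `|x|.
Proof. by rewrite /nm /= expr0n /= addr0 sqrtr_sqr. Qed.
Lemma nm_sqr z : nm z ^+ 2 = cRe z ^+ 2 + cIm z ^+ 2.
Proof. by case: z => a b /=; rewrite /nm /= sqr_sqrtr // addr_ge0 // sqr_ge0. Qed.
Lemma nm_Re z : `|cRe z| <= nm z.
Proof. by rewrite -(ler_pXn2r (n := 2)) ?nnegrE ?nm_ge0 // real_normK ?num_real // nm_sqr lerDl sqr_ge0. Qed.
Lemma nm_Im z : `|cIm z| <= nm z.
Proof. by rewrite -(ler_pXn2r (n := 2)) ?nnegrE ?nm_ge0 // real_normK ?num_real // nm_sqr lerDr sqr_ge0. Qed.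
Lemma nm_le (a b : R) : nm (Complex a b) <= `|a| + `|b|.
Proof.
rewrite -(ler_pXn2r (n := 2)) ?nnegrE ?nm_ge0 ?addr_ge0 // nm_sqr /=.
by rewrite sqrrD !real_normK ?num_real // addrAC lerDl mulrn_wge0 // mulr_ge0.
Qed.
Lemma nm_nat n : nm (n%:R : R[i]) = n%:R.
Proof. by rewrite -[n%:R : R[i]](rmorph_nat (@rc R)) nm_rc normr_nat. Qed.
Lemma nmV z : nm z^-1 = (nm z)^-1. Proof. exact: ComplexField.Normc.normcV. Qed.
Lemma nm_conj z : z * conjc z = rc (nm z ^+ 2).
Proof.
by rewrite nm_sqr; case: z => a b; apply/eqP; rewrite eq_complex /= !expr2; apply/andP; split; apply/eqP; ring.
Qed.
Lemma nm_conjE z : nm (conjc z) = nm z.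
Proof. by case: z => a b; rewrite /nm /= sqrrN. Qed.
End Norm.

Module Cexp.
Import classical_sets topology normedtype sequences derive exp trigo.
Import numFieldNormedType.Exports.
Section Exp.
Variable R : realType.

Lemma sin_bnd (b : R) : `|sin b| <= `|b|.
Proof.
wlog b0 : b / 0 <= b.
  move=> h; have [/h //|lt] := leP 0 b.
  by rewrite -normrN -[`|b|]normrN -sinN; apply: h; rewrite oppr_ge0 ltW.
have [c _] := @MVT_segment R sin cos 0 b b0 (fun x _ => is_derive_sin x) (continuous_subspaceT (@continuous_sin R)).
by rewrite sin0 !subr0 => ->; rewrite normrM ler_piMl // cos_max.
Qed.
Lemma cos_bnd (b : R) : `|cos b - 1| <= b ^+ 2.
Proof.
wlog b0 : b / 0 <= b.
  move=> h; have [/h //|lt] := leP 0 b.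
  by rewrite -cosN -sqrrN; apply: h; rewrite oppr_ge0 ltW.
have [c] := @MVT_segment R cos (fun x => - sin x) 0 b b0 (fun x _ => is_derive_cos x) (continuous_subspaceT (@continuous_cos R)).
rewrite in_itv /= => /andP[c0 cb]; rewrite cos0 subr0 => ->; rewrite normrM normrN (ger0_norm b0) expr2 ler_wpM2r //.
by apply: le_trans (sin_bnd c) _; rewrite ger0_norm.
Qed.
Lemma sinB_bnd (b : R) : `|b| <= 1 -> `|sin b - b| <= b ^+ 2.
Proof.
wlog b0 : b / 0 <= b.
  move=> h; have [/h //|lt] := leP 0 b.
  by move=> b1; rewrite -normrN opprD -sinN -sqrrN; apply: h; rewrite ?normrN // oppr_ge0 ltW.
rewrite ger0_norm // => b1.
have [c] := @MVT_segment R sin cos 0 b b0 (fun x _ => is_derive_sin x) (continuous_subspaceT (@continuous_sin R)).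
rewrite in_itv /= => /andP[c0 cb]; rewrite sin0 !subr0 => ->.
rewrite -{2}[b]mul1r -mulrBl normrM (ger0_norm b0) expr2 ler_wpM2r //.
apply: le_trans (cos_bnd c) _; rewrite expr2; nra.
Qed.
Lemma exp_bnd (a : R) : `|a| <= 1 / 2 -> `|expR a - 1 - a| <= 2 * a ^+ 2.
Proof.
rewrite ler_norml => /andP[l u].
have h1 := expR_ge1Dx a; have h2 := expR_ge1Dx (- a).
have e1 : expR a * expR (- a) = 1 by rewrite -expRD subrr expR0.
have p := expR_gt0 a; rewrite ler_norml; apply/andP; split; nra.
Qed.

Definition Ce (z : R[i]) : R[i] := Complex (expR (cRe z) * cos (cIm z)) (expR (cRe z) * sin (cIm z)).

Lemma CeD z w : Ce (z + w) = Ce z * Ce w.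
Proof.
case: z w => a b [c d]; apply/eqP; rewrite eq_complex /= expRD cosD sinD.
by apply/andP; split; apply/eqP; ring.
Qed.
Lemma Ce0 : Ce 0 = 1.
Proof. by apply/eqP; rewrite eq_complex /= expR0 cos0 sin0 !mul1r !eqxx. Qed.
Lemma nm_Ce z : nm (Ce z) = expR (cRe z).
Proof.
have p := expR_gt0 (cRe z).
by apply/eqP; rewrite -(eqrXn2 (n := 2)) ?nm_ge0 ?ltW // nm_sqr /= !exprMn -mulrDr cos2Dsin2 mulr1.
Qed.
Lemma nm_Ce_le z : nm z <= 1 / 2 -> nm (Ce z) <= 2.
Proof.
rewrite nm_Ce => h; have h1 := nm_Re z; have := exp_bnd (le_trans h1 h).
move: (nm z) (cRe z) h h1 => m a h h1; rewrite !ler_norml in h1 * => /andP[_ h2].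
by case/andP: h1 => l u; nra.
Qed.
Lemma Ce_bnd z : nm z <= 1 / 2 -> nm (Ce z - 1 - z) <= 8 * nm z ^+ 2.
Proof.
move=> h; have ha := nm_Re z; have hb := nm_Im z; have hr := nm_Ce_le h; rewrite nm_Ce in hr.
have m0 := nm_ge0 z; move: (nm z) h m0 ha hb hr => m; case: z => a b /= h m0 ha hb hr.
have e := exp_bnd (le_trans ha h); have c := cos_bnd b; have s := sin_bnd b.
have b1 : `|b| <= 1 by lra.
have s1 := sinB_bnd b1.
rewrite /Ce /=; apply: le_trans (nm_le _ _) _; rewrite !subr0 /=.
have p := expR_gt0 a.
have r1 : `|expR a * cos b - 1 - a| <= 2 * a ^+ 2 + 2 * b ^+ 2.
  have -> : expR a * cos b - 1 - a = (expR a - 1 - a) + expR a * (cos b - 1) by ring.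
  apply: le_trans (ler_normD _ _) _; apply: lerD => //; rewrite normrM (ger0_norm (ltW p)).
  by apply: ler_pM => //; exact: ltW.
have r2 : `|expR a * sin b - b| <= (`|a| + 2 * a ^+ 2) * `|b| + b ^+ 2.
  have -> : expR a * sin b - b = ((expR a - 1 - a) + a) * sin b + (sin b - b) by ring.
  apply: le_trans (ler_normD _ _) _; apply: lerD => //; rewrite normrM; apply: ler_pM => //.
  by apply: le_trans (ler_normD _ _) _; rewrite addrC lerD2l.
have a2 : a ^+ 2 = `|a| ^+ 2 by rewrite real_normK ?num_real.
have b2 : b ^+ 2 = `|b| ^+ 2 by rewrite real_normK ?num_real.
apply: le_trans (lerD r1 r2) _; rewrite a2 b2; move: (normr_ge0 a) (normr_ge0 b) ha hb.
move: `|a| `|b| => x y x0 y0 xm ym.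
have : x * y <= m ^+ 2 by nra.
have : x ^+ 2 <= m ^+ 2 by nra.
have : y ^+ 2 <= m ^+ 2 by nra.
have : x ^+ 2 * y <= x ^+ 2 by nra.
nra.
Qed.
Lemma CeX z n : Ce z ^+ n = Ce (n%:R * z).
Proof.
elim: n => [|n IH]; first by rewrite expr0 mul0r Ce0.
by rewrite exprS IH -CeD -natr1; congr Ce; ring.
Qed.
Lemma Ce_neq0 z : Ce z != 0.
Proof.
apply/eqP => e; have := Ce0; rewrite -(subrr z) CeD e mul0r => /eqP; rewrite eq_sym.
by rewrite oner_eq0.
Qed.
Lemma CeN z : Ce (- z) = (Ce z)^-1.
Proof. by apply: (mulfI (Ce_neq0 z)); rewrite -CeD subrr Ce0 divff // Ce_neq0. Qed.
Lemma CeZ z (k : int) : Ce z ^ k = Ce (k%:~R * z).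
Proof.
case: k => n; first by rewrite -exprnP CeX.
by rewrite NegzE -exprnN CeX -CeN; congr Ce; rewrite mulrNz mulNr.
Qed.
Lemma Ce_sum (J : Type) (s : seq J) (F : J -> R[i]) : Ce (\sum_(j <- s) F j) = \prod_(j <- s) Ce (F j).
Proof. by elim/big_rec2: _ => [|j y x _ <-]; rewrite ?Ce0 ?CeD. Qed.

Definition tau : R := pi *+ 2.
Lemma tau_ge0 : 0 <= tau. Proof. by rewrite /tau mulrn_wge0 // pi_ge0. Qed.
Lemma Ce_tau : Ce (Complex 0 tau) = 1.
Proof. by apply/eqP; rewrite eq_complex /= expR0 /tau cos2pi sin2pi !mul1r !eqxx. Qed.
Lemma Ce_lt_tau x : 0 < x < tau -> Ce (Complex 0 x) != 1.
Proof.
move=> /andP[x0 x1]; apply/negP => /eqP[]; rewrite expR0 !mul1r => c1 s1.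
have p0 := pi_gt0 R.
have inj (y : R) : 0 <= y <= pi -> cos y = 1 -> y = 0.
  by move=> /andP[h1 h2] e; apply: cos_inj; rewrite ?in_itv /= ?h1 ?h2 ?lexx ?ltW // e cos0.
have [le|lt] := leP x pi; first by have := inj x _ c1; rewrite le ltW // => /(_ isT) e; rewrite e ltxx in x0.
have e : cos (tau - x) = 1 by rewrite cosB /tau cos2pi sin2pi c1 s1 mulr0 mulr1 addr0.
have := inj (tau - x) _ e; move: x1; rewrite /tau mulr2n => x1 h.
have : 0 <= pi + pi - x <= pi by apply/andP; split; lra.
by move=> /h; lra.
Qed.
End Exp.
End Cexp.

(** * Perturbed Fourier matrices *)

Import Cexp.
Section DFT.
Variables (R : realType) (r n : nat).
Hypothesis n0 : (0 < n)%N.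
Local Notation C := R[i].
Local Notation T := {ffun 'I_r -> 'I_n}.

Definition dz : C := Ce (Complex 0 (tau R / n%:R)).
(** The character table of (Z/n)^r. *)
Definition om (t s : T) : C := \prod_b dz ^+ (t b * s b).

Lemma dz_exp k : dz ^+ k = Ce (Complex 0 (tau R * (k%:R / n%:R))).
Proof.
rewrite /dz CeX; congr Ce; rewrite -[k%:R](rmorph_nat (@rc R)).
by apply/eqP; rewrite eq_complex /= !mul0r mulr0 subr0 addr0 eqxx; apply/eqP; ring.
Qed.
Lemma nR0 : (n%:R : R) != 0. Proof. by rewrite pnatr_eq0 -lt0n. Qed.
Lemma dz_n : dz ^+ n = 1.
Proof. by rewrite dz_exp divff ?nR0 // mulr1 Ce_tau. Qed.
Lemma dz_neq0 : dz != 0. Proof. exact: Ce_neq0. Qed.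
Lemma dz_neq1 k : (0 < k < n)%N -> dz ^+ k != 1.
Proof.
move=> /andP[k0 kn]; rewrite dz_exp; apply: Ce_lt_tau.
have nR : 0 < n%:R :> R by rewrite ltr0n.
have t0 : 0 < tau R by rewrite /tau mulrn_wgt0 // trigo.pi_gt0.
by rewrite mulr_gt0 ?divr_gt0 ?ltr0n //= -{2}[tau R]mulr1 ltr_pM2l // ltr_pdivrMr // mul1r ltr_nat.
Qed.
Lemma dz_sum (x y : 'I_n) : \sum_(s < n) dz ^+ (x * s) * (dz ^+ (y * s))^-1 = n%:R * (x == y)%:R.
Proof.
have dn := dz_neq0; set q := dz ^+ x / dz ^+ y.
have eqs s : dz ^+ (x * s) * (dz ^+ (y * s))^-1 = q ^+ s by rewrite /q exprMn exprVn -!exprM.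
under eq_bigr => s _ do rewrite eqs.
have [xy|xy] := eqVneq x y; rewrite ?mulr1 ?mulr0.
  rewrite (eq_bigr (fun=> 1)) ?sumr_const ?card_ord // => s _.
  by rewrite /q xy divff ?expf_neq0 // expr1n.
have q1 : q != 1.
  have main (u v : 'I_n) : (u < v)%N -> dz ^+ v != dz ^+ u.
    move=> uv; rewrite -(subnKC (ltnW uv)) exprD -subr_eq0 -{2}[dz ^+ u]mulr1 -mulrBr mulf_neq0 ?expf_neq0 //.
    by rewrite subr_eq0 dz_neq1 // subn_gt0 uv (leq_ltn_trans (leq_subr _ _)).
  apply: contraNneq xy => qe; have ee : dz ^+ x = dz ^+ y by rewrite -[LHS](mulfVK (_ : dz ^+ y != 0)) ?expf_neq0 // -/q qe mul1r.
  case: (ltngtP x y) => [/main|/main|h]; rewrite ?ee ?eqxx //.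
  by apply/eqP; exact: val_inj.
have qn : q ^+ n = 1 by rewrite /q exprMn exprVn -!exprM ![(_ * n)%N]mulnC !exprM dz_n !expr1n divr1.
by have := subrX1 q n; rewrite qn subrr => /esym/eqP; rewrite mulf_eq0 subr_eq0 (negPf q1) /= => /eqP.
Qed.

Definition dq : R := #|{: T}|%:R.
Lemma om_neq0 t s : om t s != 0.
Proof. by apply/prodf_neq0 => b _; rewrite expf_neq0 // dz_neq0. Qed.
Lemma om_orth t t' : \sum_s om t s * (om t' s)^-1 = rc dq * (t == t')%:R.
Proof.
have -> : \sum_s om t s * (om t' s)^-1 = \prod_b \sum_(x < n) dz ^+ (t b * x) * (dz ^+ (t' b * x))^-1.
  rewrite bigA_distr_bigA; apply: eq_bigr => s _.
  by rewrite /om -prodfV -big_split.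
under eq_bigr => b _ do rewrite dz_sum.
rewrite big_split /= prodr_const card_ord /dq card_ffun !card_ord rmorph_nat natrX; congr (_ * _).
have [->|tt] := eqVneq t t'; first by rewrite big1 // => b _; rewrite eqxx.
have [b tb] : exists b, t b != t' b.
  by apply: contrapT => h; move/eqP: tt; apply; apply/ffunP => b; apply/eqP; apply: contrapT => /negP nb; apply: h; exists b.
by rewrite (bigD1 b) //= (negPf tb) mul0r.
Qed.
Lemma nm_om t s : nm (om t s) = 1.
Proof.
rewrite /om; elim/big_rec: _ => [|b x _ h]; first exact: nm1.
rewrite nmM h mulr1 nmX (_ : nm dz = 1) ?expr1n //.
by rewrite nm_Ce /= exp.expR0.
Qed.
Lemma conj_om t s : conjc (om t s) = (om t s)^-1.
Proof. by apply: (mulfI (om_neq0 t s)); rewrite nm_conj nm_om expr1n divff ?om_neq0 // rmorph1. Qed.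

Definition dft (a : T -> C) s := \sum_t a t * om t s.
Definition sq (a : T -> C) : R := \sum_t nm (a t) ^+ 2.
Lemma sq_ge0 a : 0 <= sq a. Proof. by apply: sumr_ge0 => t _; rewrite exprn_ge0 // nm_ge0. Qed.

Lemma parseval a : sq (dft a) = dq * sq a.
Proof.
suff : rc (sq (dft a)) = rc (dq * sq a) by case.
have rc_sq b : rc (sq b) = \sum_t b t * conjc (b t).
  by rewrite /sq rmorph_sum; apply: eq_bigr => t _; rewrite nm_conj.
have -> : rc (dq * sq a) = rc dq * rc (sq a) by exact: rmorphM.
rewrite !rc_sq /dft.
have cj s : conjc (\sum_t a t * om t s) = \sum_t conjc (a t) * (om t s)^-1.
  by rewrite rmorph_sum; apply: eq_bigr => t _; rewrite rmorphM /= conj_om.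
under eq_bigr => s _ do rewrite cj mulr_suml.
rewrite exchange_big mulr_sumr; apply: eq_bigr => t _ /=.
under eq_bigr => s _ do rewrite mulr_sumr.
rewrite exchange_big /=.
rewrite (eq_bigr (fun t' => a t * conjc (a t') * (rc dq * (t == t')%:R))).
  rewrite (bigD1 t) //= eqxx big1 ?addr0 => [|t' /negPf h]; last by rewrite eq_sym h !mulr0.
  by rewrite mulr1 mulrC.
move=> t' _; rewrite -om_orth mulr_sumr; apply: eq_bigr => s _; ring.
Qed.

(* Bounded bilinear forms, with the two norms balanced as for the Fourier matrix. *)
Definition opn (X : T -> T -> C) (K : R) := forall a b : T -> C,
  nm (\sum_t \sum_s a t * X t s * b s) <= K * (dq * sq a + sq b).

(** Parseval's identity, and 2 x y bounded by x^2 + y^2. *)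
Lemma opn_base : opn om (1 / 2).
Proof.
move=> a b; rewrite exchange_big /= -parseval.
rewrite (eq_bigr (fun s => dft a s * b s)) => [|s _]; last by rewrite /dft mulr_suml.
apply: le_trans (nm_sum _ _ _) _; rewrite /sq -big_split /= mulr_sumr; apply: ler_sum => s _.
rewrite nmM -subr_ge0; move: (nm (dft a s)) (nm (b s)) => x y.
rewrite (_ : _ - _ = 1 / 2 * (x - y) ^+ 2); last by field.
by rewrite mulr_ge0 ?sqr_ge0 // divr_ge0.
Qed.
(** Entrywise multiplication by de(t) la(s) is multiplication by diagonal matrices on both sides, so
    it costs only the factor l, whatever the size of the matrix. *)
Lemma opn_diag X K l (de : T -> R) (la : T -> C) : 0 <= K -> 0 <= l -> opn X K ->
  (forall t, `|de t| <= 1) -> (forall s, nm (la s) <= l) -> opn (fun t s => rc (de t) * la s * X t s) (K * l).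
Proof.
move=> K0 l0 hX hd hl a b.
have Q0 : 0 <= dq * sq a + sq b by rewrite addr_ge0 ?mulr_ge0 ?sq_ge0 ?ler0n.
have [l00|ln] := eqVneq l 0.
  rewrite big1 ?nm0 ?mulr_ge0 // => t _; rewrite big1 // => s _.
  by rewrite (nm_eq0 (_ : nm (la s) = 0)) ?mulr0 ?mul0r ?mulr0 ?mul0r //; apply/eqP; rewrite eq_le nm_ge0 -{1}l00 hl.
have lp : 0 < l by rewrite lt_def ln.
rewrite (_ : \sum_t _ = rc l * \sum_t \sum_s (a t * rc (de t)) * X t s * (la s / rc l * b s)); last first.
  rewrite mulr_sumr; apply: eq_bigr => t _; rewrite mulr_sumr; apply: eq_bigr => s _.
  have : rc l != 0 by rewrite fmorph_eq0.
  by move: (rc l) => z z0; field.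
rewrite nmM nm_rc (ger0_norm l0) [K * l]mulrC -mulrA ler_wpM2l //.
apply: le_trans (hX _ _) _; rewrite ler_wpM2l // lerD //.
  rewrite ler_wpM2l ?ler0n //; apply: ler_sum => t _.
  by rewrite ler_pXn2r ?nnegrE ?nm_ge0 // nmM nm_rc ler_piMr ?nm_ge0.
apply: ler_sum => s _; rewrite ler_pXn2r ?nnegrE ?nm_ge0 // !nmM nmV nm_rc (ger0_norm l0).
by rewrite ler_piMl ?nm_ge0 // ler_pdivrMr // mul1r.
Qed.
Lemma opn_add X Y K L : opn X K -> opn Y L -> opn (fun t s => X t s + Y t s) (K + L).
Proof.
move=> hX hY a b; rewrite mulrDl; apply: le_trans (lerD (hX a b) (hY a b)); apply: le_trans (nmD _ _).
rewrite -big_split le_eqVlt; apply/orP; left; apply/eqP; congr nm; apply: eq_bigr => t _ /=.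
rewrite -big_split; apply: eq_bigr => s _ /=; ring.
Qed.
Lemma opn_ext X Y K : (forall t s, X t s = Y t s) -> opn X K -> opn Y K.
Proof.
move=> e h a b; have := h a b; congr (nm _ <= _).
by apply: eq_bigr => t _; apply: eq_bigr => s _; rewrite e.
Qed.
Lemma opn_sum (J : Type) (js : seq J) (X : J -> T -> T -> C) (K : J -> R) : (forall j, opn (X j) (K j)) ->
  opn (fun t s => \sum_(j <- js) X j t s) (\sum_(j <- js) K j).
Proof.
move=> h; elim: js => [|j js IH].
  rewrite big_nil => a b; rewrite big1 ?nm0 ?mul0r // => t _.
  by rewrite big1 // => s _; rewrite big_nil mulr0 mul0r.
by rewrite big_cons; apply: opn_ext (opn_add (h j) IH) => t s; rewrite big_cons.
Qed.
Lemma opn_scale X K (x : R) : 0 <= x -> opn X K -> opn (fun t s => rc x * X t s) (x * K).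
Proof.
move=> x0 h a b; rewrite -mulrA; apply: le_trans (ler_wpM2l x0 (h a b)).
rewrite -[X in X * nm _](ger0_norm x0) -nm_rc -nmM le_eqVlt; apply/orP; left; apply/eqP; congr nm.
rewrite mulr_sumr; apply: eq_bigr => t _; rewrite mulr_sumr; apply: eq_bigr => s _; ring.
Qed.

Lemma le_arch (x y G : R) : 0 <= G -> (forall m : nat, x <= y + G / m.+1%:R) -> x <= y.
Proof.
move=> G0 h; rewrite leNgt; apply/negP => lt.
have [m hm] : exists m : nat, G / (x - y) < m.+1%:R.
  exists (Num.bound (G / (x - y))); apply: lt_trans (archi_boundP _) _; last by rewrite ltr_nat.
  by rewrite divr_ge0 // subr_ge0 ltW.
have m0 : 0 < m.+1%:R :> R by rewrite ltr0n.
have := h m; rewrite -lerBlDl ler_pdivlMr //.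
by rewrite ltr_pdivrMr ?subr_gt0 // mulrC in hm; rewrite leNgt hm.
Qed.

Lemma pow_diff (A B : C) (M e : R) m : 1 <= M -> nm A <= M -> nm B <= M -> nm (A - B) <= e ->
  nm (A ^+ m - B ^+ m) <= m%:R * (M ^+ m * e).
Proof.
move=> M1 hA hB hAB; have M0 : 0 <= M by apply: le_trans M1.
have e0 : 0 <= e by apply: le_trans hAB; exact: nm_ge0.
elim: m => [|m IH]; first by rewrite !expr0 subrr nm0 mul0r.
have -> : A ^+ m.+1 - B ^+ m.+1 = A * (A ^+ m - B ^+ m) + (A - B) * B ^+ m by rewrite !exprS; ring.
apply: le_trans (nmD _ _) _; rewrite !nmM nmX -natr1 mulrDl mul1r; apply: lerD.
  apply: le_trans (ler_pM (nm_ge0 _) (nm_ge0 _) hA IH) _.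
  by rewrite exprS !mulrA [M * m%:R]mulrC.
rewrite mulrC; apply: ler_pM => //; rewrite ?exprn_ge0 ?nm_ge0 //.
apply: (@le_trans _ _ (M ^+ m)); first by apply: lerXn2r; rewrite ?nnegrE ?nm_ge0.
by rewrite exprS ler_peMl // exprn_ge0.
Qed.

Lemma one_exp (x : R) m : 0 <= x -> x <= 1 / 2 -> (1 + x / m.+1%:R) ^+ m.+1 <= 1 + x + 2 * x ^+ 2.
Proof.
move=> x0 x1; have h : (1 + x / m.+1%:R) ^+ m.+1 <= sequences.expR x.
  apply: le_trans (_ : sequences.expR (x / m.+1%:R) ^+ m.+1 <= _).
    rewrite ler_pXn2r ?nnegrE ?addr_ge0 ?divr_ge0 ?ler0n // ?exp.expR_ge1Dx //.
    by rewrite ltW // exp.expR_gt0.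
  by rewrite -exp.expRM_natl mulrC mulfVK // pnatr_eq0.
apply: le_trans h _; have : `|x| <= 1 / 2 by rewrite ger0_norm.
by move=> /exp_bnd; rewrite ler_norml => /andP[_]; lra.
Qed.

(** Finite powers stand in for the exponential series: they expand into powers of w, to which the
    operator bounds apply, and the error tends to 0 with growing m. *)
Lemma Ce_pow (w : C) m : nm w <= 1 / 8 -> nm (Ce w - (1 + w / m.+1%:R) ^+ m.+1) <= 1 / m.+1%:R.
Proof.
move=> hw; set M : R := m.+1%:R; have M1 : 1 <= M by rewrite /M ler1n.
have M0 : 0 < M by apply: lt_le_trans M1.
have mC : (m.+1%:R : C) = rc M by rewrite /M rmorph_nat.
have w0 := nm_ge0 w.
have nw : nm (w / m.+1%:R) = nm w / M by rewrite nmM nmV nm_nat.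
have sw : nm w / M <= nm w by rewrite ler_pdivrMr // ler_peMr.
have -> : Ce w = Ce (w / m.+1%:R) ^+ m.+1 by rewrite CeX mulrC mulfVK // pnatr_eq0.
have d : nm (Ce (w / m.+1%:R) - (1 + w / m.+1%:R)) <= 8 * (nm w / M) ^+ 2.
  by rewrite opprD addrA -nw; apply: Ce_bnd; rewrite nw; apply: le_trans sw _; lra.
have B1 : nm (1 + w / m.+1%:R) <= 1 + nm w / M by apply: le_trans (nmD _ _) _; rewrite nm1 nw.
have x0 : 0 <= nm w / M by rewrite divr_ge0 // ltW.
set x := nm w / M in d B1 x0 sw nw.
have x8 : x <= 1 / 8 by lra.
have A1 : nm (Ce (w / m.+1%:R)) <= 1 + 2 * x.
  rewrite -[Ce _](subrK (1 + w / m.+1%:R)); apply: le_trans (nmD _ _) _; nra.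
have B2 : nm (1 + w / m.+1%:R) <= 1 + 2 * x by lra.
have y1 : 1 <= 1 + 2 * x by lra.
apply: le_trans (pow_diff m.+1 y1 A1 B2 d) _; rewrite -/M.
have p2 : (1 + 2 * x) ^+ m.+1 <= 2.
  have -> : 2 * x = (2 * nm w) / M by rewrite /x mulrA.
  apply: le_trans (one_exp m _ _) _; nra.
have p0 : 0 <= (1 + 2 * x) ^+ m.+1 by apply: exprn_ge0; lra.
apply: (@le_trans _ _ (M * (2 * (8 * x ^+ 2)))).
  apply: ler_wpM2l; first exact: ltW.
  by apply: ler_wpM2r => //; rewrite mulr_ge0 // exprn_ge0.
rewrite ler_pdivlMr // /x expr_div_n.
have Mn : M != 0 by rewrite gt_eqF.
have fld (M' u : R) : M' != 0 -> M' * (2 * (8 * (u ^+ 2 / M' ^+ 2))) * M' = 16 * u ^+ 2 by move=> ?; field.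
rewrite fld //.
nra.
Qed.

(** Expanded in powers of w, the perturbation exp(w) - 1 is a sum of diagonal rescalings of the
    Fourier matrix. Its operator norm is therefore a fixed fraction of that of the matrix,
    independently of n and r, and a nonzero vector cannot have vanishing perturbed transform. *)
Lemma dft_perturb N (a : T -> C) (de : T -> 'I_N -> R) (la : T -> 'I_N -> C) (l : R) :
  0 <= l -> N%:R * l <= 1 / 8 -> (forall t i, `|de t i| <= 1) -> (forall s i, nm (la s i) <= l) ->
  dq * sq a <= 2 * (\sum_t nm (a t)) * \sum_s nm (\sum_t a t * om t s * Ce (\sum_i rc (de t i) * la s i)).
Proof.
move=> l0 Nl hd hl; set x := N%:R * l in Nl.
have x0 : 0 <= x by rewrite mulr_ge0.
pose w t s := \sum_i rc (de t i) * la s i.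
have wle t s : nm (w t s) <= 1 / 8.
  apply: le_trans Nl; apply: le_trans (nm_sum _ _ _) _.
  rewrite /x -[N in N%:R]card_ord mulr_natl -sumr_const; apply: ler_sum => i _.
  rewrite nmM nm_rc; apply: le_trans (hl s i); rewrite ler_piMl ?nm_ge0 //; exact: hd.
have opw k : opn (fun t s => w t s ^+ k * om t s) (1 / 2 * x ^+ k).
  elim: k => [|k IH].
    by rewrite expr0 mulr1; apply: opn_ext opn_base => t s; rewrite expr0 mul1r.
  have := opn_sum (index_enum 'I_N) (fun i => opn_diag _ l0 IH (fun t => hd t i) (fun s => hl s i)).
  rewrite sumr_const card_ord => h.
  have e : 1 / 2 * x ^+ k.+1 = 1 / 2 * x ^+ k * l *+ N by rewrite exprS /x -mulr_natl; ring.
  rewrite e; apply: opn_ext (h _) => [t s|]; last by rewrite mulr_ge0 ?exprn_ge0 // divr_ge0.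
  by rewrite -mulr_suml exprS mulrA.
have opm m : opn (fun t s => ((1 + w t s / m.+1%:R) ^+ m.+1 - 1) * om t s) (1 / 2 * ((1 + x / m.+1%:R) ^+ m.+1 - 1)).
  pose co (k : nat) : R := 'C(m.+1, k)%:R / m.+1%:R ^+ k.
  have co0 k : 0 <= co k by rewrite divr_ge0 ?exprn_ge0 ?ler0n.
  have ex (y : R) : (1 + y / m.+1%:R) ^+ m.+1 - 1 = \sum_(k < m.+1) co k.+1 * y ^+ k.+1.
    rewrite [1 + _]addrC exprD1n big_ord_recl /= bin0 mulr1n expr0 addrC addKr.
    apply: eq_bigr => k _; rewrite /bump /= add1n expr_div_n -mulr_natl /co; ring.
  have exC (y : C) : (1 + y / m.+1%:R) ^+ m.+1 - 1 = \sum_(k < m.+1) rc (co k.+1) * y ^+ k.+1.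
    rewrite [1 + _]addrC exprD1n big_ord_recl /= bin0 mulr1n expr0 addrC addKr.
    apply: eq_bigr => k _; rewrite /bump /= add1n expr_div_n -mulr_natl /co fmorph_div rmorphXn !rmorph_nat; ring.
  have := opn_sum (index_enum 'I_m.+1) (fun k : 'I_m.+1 => opn_scale (co0 k.+1) (opw k.+1)).
  rewrite ex mulr_sumr (eq_bigr (fun k : 'I_m.+1 => 1 / 2 * (co k.+1 * x ^+ k.+1))) => [|k _]; last by ring.
  apply: opn_ext => t s; rewrite exC mulr_suml; apply: eq_bigr => k _; ring.
pose A := \sum_t nm (a t).
have A0 : 0 <= A by apply: sumr_ge0 => t _; exact: nm_ge0.
(* Testing against the conjugate transform makes the unperturbed form equal to the square norm of
   the transform. *)
pose b s := conjc (dft a s).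
have sqb : sq b = dq * sq a by rewrite -parseval; apply: eq_bigr => s _; rewrite nm_conjE.
have bA s : nm (b s) <= A.
  rewrite nm_conjE; apply: le_trans (nm_sum _ _ _) _; apply: ler_sum => t _.
  by rewrite nmM nm_om mulr1.
pose Q := dq * sq a; have Q0 : 0 <= Q by rewrite mulr_ge0 ?sq_ge0 ?ler0n.
pose F s := \sum_t a t * om t s * Ce (w t s).
have base : \sum_t \sum_s a t * om t s * b s = rc Q.
  rewrite exchange_big /Q -parseval rmorph_sum; apply: eq_bigr => s _ /=.
  by rewrite -nm_conj /b /dft -mulr_suml.
pose D := \sum_t \sum_s a t * (Ce (w t s) - 1) * om t s * b s.
have eD : rc Q = \sum_s F s * b s - D.
  rewrite -base exchange_big /D [X in _ - X]exchange_big -sumrB; apply: eq_bigr => s _.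
  rewrite /F mulr_suml -sumrB; apply: eq_bigr => t _; ring.
pose G := \sum_t \sum_s nm (a t) * nm (b s).
have hD : nm D <= 1 / 4 * Q.
  have G0 : 0 <= G by apply: sumr_ge0 => t _; apply: sumr_ge0 => s _; rewrite mulr_ge0 ?nm_ge0.
  apply: (le_arch G0) => m.
  pose D1 := \sum_t \sum_s a t * (((1 + w t s / m.+1%:R) ^+ m.+1 - 1) * om t s) * b s.
  pose D2 := \sum_t \sum_s a t * (Ce (w t s) - (1 + w t s / m.+1%:R) ^+ m.+1) * om t s * b s.
  have -> : D = D1 + D2.
    rewrite /D /D1 /D2 -big_split; apply: eq_bigr => t _ /=; rewrite -big_split; apply: eq_bigr => s _ /=; ring.
  apply: le_trans (nmD _ _) _; apply: lerD.
    apply: le_trans (opm m a b) _; rewrite sqb -/Q.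
    have := one_exp m x0 _; have h : x <= 1 / 2 by lra.
    move=> /(_ h) h2; have : (1 + x / m.+1%:R) ^+ m.+1 - 1 <= 1 / 4 by nra.
    by move=> h3; nra.
  rewrite /D2 /G mulr_suml; apply: le_trans (nm_sum _ _ _) _; apply: ler_sum => t _.
  rewrite mulr_suml; apply: le_trans (nm_sum _ _ _) _; apply: ler_sum => s _.
  rewrite !nmM nm_om mulr1 mulrAC; apply: ler_wpM2l; first by rewrite mulr_ge0 ?nm_ge0.
  by have := Ce_pow m (wle t s); rewrite mul1r.
have : Q <= A * \sum_s nm (F s) + 1 / 4 * Q.
  rewrite -{1}(ger0_norm Q0) -nm_rc eD; apply: le_trans (nmB _ _) _; apply: lerD => //.
  rewrite mulr_sumr; apply: le_trans (nm_sum _ _ _) _; apply: ler_sum => s _.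
  by rewrite nmM mulrC ler_wpM2r ?nm_ge0.
move=> h; apply: (@le_trans _ _ (2 * (A * \sum_s nm (F s)))); last by rewrite mulrA.
rewrite -/Q; move: (A * _) h => Z h; lra.
Qed.
End DFT.

(** * Embedding the algebraic numbers in the complex numbers *)

Section Sigma.
Variable R : realType.
Local Notation C := R[i].
Definition ga (q : rat * rat) : algC := ratr q.1 + 'i * ratr q.2.
Definition gb (q : rat * rat) : C := Complex (ratr q.1) (ratr q.2).
Definition gsub (q q' : rat * rat) := (q.1 - q'.1, q.2 - q'.2).
Definition gadd (q q' : rat * rat) := (q.1 + q'.1, q.2 + q'.2).
Definition gmul (q q' : rat * rat) := (q.1 * q'.1 - q.2 * q'.2, q.1 * q'.2 + q.2 * q'.1).
Definition gn (q : rat * rat) := q.1 ^+ 2 + q.2 ^+ 2.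

Lemma ga_sub q q' : ga (gsub q q') = ga q - ga q'.
Proof. rewrite /ga /= !rmorphB /=; ring. Qed.
Lemma ga_add q q' : ga (gadd q q') = ga q + ga q'.
Proof. rewrite /ga /= !rmorphD /=; ring. Qed.
Lemma ga_mul q q' : ga (gmul q q') = ga q * ga q'.
Proof.
rewrite /ga /= rmorphB rmorphD !rmorphM /=.
transitivity (ratr q.1 * ratr q'.1 + 'i ^+ 2 * (ratr q.2 * ratr q'.2) + 'i * (ratr q.1 * ratr q'.2 + ratr q.2 * ratr q'.1) : algC).
  by rewrite sqrCi; ring.
ring.
Qed.
Lemma gb_sub q q' : gb (gsub q q') = gb q - gb q'.
Proof. by apply/eqP; rewrite eq_complex /= !rmorphB !eqxx. Qed.
Lemma gb_add q q' : gb (gadd q q') = gb q + gb q'.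
Proof. by apply/eqP; rewrite eq_complex /= !rmorphD !eqxx. Qed.
Lemma gb_mul q q' : gb (gmul q q') = gb q * gb q'.
Proof. by apply/eqP; rewrite eq_complex /= rmorphB rmorphD !rmorphM !eqxx. Qed.
Lemma ga_norm q : `|ga q| ^+ 2 = ratr (gn q).
Proof.
rewrite normC2_Re_Im /ga Re_rect ?Im_rect ?rmorphD ?rmorphXn //; exact/Creal_Crat/Crat_rat.
Qed.
Lemma gb_norm q : nm (gb q) ^+ 2 = ratr (gn q).
Proof. by rewrite nm_sqr /= rmorphD !rmorphXn. Qed.
Lemma ga_gb q (e : rat) : 0 < e -> `|ga q| < ratr e -> nm (gb q) < ratr e.
Proof.
move=> e0 h; rewrite -(ltr_pXn2r (n := 2)) ?nnegrE ?nm_ge0 ?ler0q ?ltW // gb_norm -rmorphXn ltr_rat.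
by rewrite -(ltr_rat algC) rmorphXn -ga_norm ltr_pXn2r // ?nnegrE ?normr_ge0 // ler0q ltW.
Qed.

(** Gaussian rationals have the same norm in both fields, so z and c are matched when the same ones
    approximate both. The matching is unique and compatible with sums and products, and so defines
    an embedding. *)
Definition apx (z : algC) (c : C) := forall e : rat, 0 < e -> exists q, `|z - ga q| < ratr e /\ nm (c - gb q) < ratr e.

Lemma small_eq0 (x : R) : 0 <= x -> (forall e : rat, 0 < e -> x <= ratr e) -> x = 0.
Proof.
move=> x0 h; apply/eqP; rewrite eq_le x0 andbT leNgt; apply/negP => xp.
have [e he] := rat_in_itvoo xp.
have /andP[e0 ex] : (0 < ratr e :> R) && (ratr e < x) by move: he; rewrite interval.in_itv.
by have := h e; rewrite -(ltr0q R) => /(_ e0); rewrite leNgt ex.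
Qed.

Lemma apx_uniq z c c' : apx z c -> apx z c' -> c = c'.
Proof.
move=> h h'; apply/eqP; rewrite -subr_eq0; apply/eqP/nm_eq0/small_eq0; first exact: nm_ge0.
move=> e e0; have e4 : 0 < e / 4 by rewrite divr_gt0.
have [q [h1 h2]] := h _ e4; have [q' [h3 h4]] := h' _ e4.
have h5 : nm (gb q - gb q') < ratr (e / 4 + e / 4).
  rewrite -gb_sub; apply: ga_gb; first by rewrite addr_gt0.
  rewrite ga_sub rmorphD (_ : ga q - ga q' = (z - ga q') - (z - ga q)); last by ring.
  by apply: le_lt_trans (ler_normB _ _) _; apply: ltrD.
rewrite (_ : c - c' = (c - gb q) + (gb q - gb q') - (c' - gb q')); last by ring.
apply: le_trans (nmB _ _) _; apply: le_trans (lerD (nmD _ _) (lexx _)) _.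
apply: le_trans (lerD (lerD (ltW h2) (ltW h5)) (ltW h4)) _.
rewrite -!rmorphD /= ler_rat; lra.
Qed.

Lemma apx_add z c z' c' : apx z c -> apx z' c' -> apx (z + z') (c + c').
Proof.
move=> h h' e e0; have e2 : 0 < e / 2 by rewrite divr_gt0.
have [q [h1 h2]] := h _ e2; have [q' [h3 h4]] := h' _ e2; exists (gadd q q').
have ee : e = e / 2 + e / 2 by lra.
rewrite ga_add gb_add ee !rmorphD; split.
  by rewrite opprD addrACA; apply: le_lt_trans (ler_normD _ _) _; apply: ltrD.
by rewrite opprD addrACA; apply: le_lt_trans (nmD _ _) _; apply: ltrD.
Qed.

Lemma apx_mul z c z' c' : apx z c -> apx z' c' -> apx (z * z') (c * c').
Proof.
move=> h h' e e0.
have [B [B1 hz hz' hc hc']] : exists B : rat, [/\ 1 <= B, `|z| <= ratr B, `|z'| <= ratr B, nm c <= ratr B & nm c' <= ratr B].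
  exists ((Num.bound `|z| + Num.bound `|z'| + Num.bound (nm c) + Num.bound (nm c')).+1)%:R.
  have hN (x : algC) n : 0 <= x -> (Num.bound x <= n)%N -> x <= n%:R.
    by move=> x0 le; apply: le_trans (ltW (archi_boundP x0)) _; rewrite ler_nat.
  have hR (x : R) n : 0 <= x -> (Num.bound x <= n)%N -> x <= n%:R.
    by move=> x0 le; apply: le_trans (ltW (archi_boundP x0)) _; rewrite ler_nat.
  rewrite !ratr_nat ler1n; split=> //; [apply: hN|apply: hN|apply: hR|apply: hR]; rewrite ?normr_ge0 ?nm_ge0 //; lia.
pose d := e / (2 * B + 1 + e).
have s0 : 0 < 2 * B + 1 + e by lra.
have d0 : 0 < d by rewrite divr_gt0.
have d1 : d < 1 by rewrite ltr_pdivrMr // mul1r; lra.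
have dd : B * d + (B + d) * d < e.
  have : d * (2 * B + 1 + e) = e by rewrite mulfVK // gt_eqF.
  by move=> h0; nra.
have [q [h1 h2]] := h _ d0; have [q' [h3 h4]] := h' _ d0; exists (gmul q q').
rewrite ga_mul gb_mul; split.
  rewrite (_ : z * z' - _ = z * (z' - ga q') + ga q' * (z - ga q)); last by ring.
  apply: le_lt_trans (ler_normD _ _) _; rewrite !normrM.
  apply: le_lt_trans (_ : ratr (B * d + (B + d) * d) < _); last by rewrite ltr_rat.
  have hq' : `|ga q'| <= ratr B + ratr d.
    rewrite (_ : ga q' = z' - (z' - ga q')); last by ring.
    by apply: le_trans (ler_normB _ _) _; apply: lerD => //; exact: ltW.
  have -> : ratr (B * d + (B + d) * d) = ratr B * ratr d + (ratr B + ratr d) * ratr d :> algC by rewrite !(rmorphD, rmorphM).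
  by apply: lerD; apply: ler_pM; rewrite ?normr_ge0 ?(ltW h1) ?(ltW h3).
rewrite (_ : c * c' - _ = c * (c' - gb q') + gb q' * (c - gb q)); last by ring.
apply: le_lt_trans (nmD _ _) _; rewrite !nmM.
apply: le_lt_trans (_ : ratr (B * d + (B + d) * d) < _); last by rewrite ltr_rat.
have hq' : nm (gb q') <= ratr B + ratr d.
  rewrite (_ : gb q' = c' - (c' - gb q')); last by ring.
  by apply: le_trans (nmB _ _) _; apply: lerD => //; exact: ltW.
have -> : ratr (B * d + (B + d) * d) = ratr B * ratr d + (ratr B + ratr d) * ratr d :> R by rewrite !(rmorphD, rmorphM).
by apply: lerD; apply: ler_pM; rewrite ?nm_ge0 ?(ltW h2) ?(ltW h4).
Qed.

Lemma apx_ex z : exists c, apx z c.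
Proof.
have real_ex (x : algC) : x \is Num.real -> exists y : R, forall e : rat, 0 < e -> exists q : rat, `|x - ratr q| < ratr e /\ `|y - ratr q| < ratr e.
  move=> xr; have fl (e : rat) : 0 < e -> exists q : rat, ratr q <= x /\ x < ratr (q + e).
    move=> e0; pose m := (Num.bound e^-1).+1; pose f := Num.floor (x * m%:R).
    have m0 : 0 < m%:R :> algC by rewrite ltr0n.
    have xm : x * m%:R \is Num.real by rewrite rpredM // rpred_nat.
    have em : m%:R^-1 <= e.
      rewrite -[e]invrK lef_pV2 ?posrE ?invr_gt0 ?ltr0n //.
      have i0 : 0 <= e^-1 by rewrite invr_ge0 ltW.
      by apply: le_trans (ltW (archi_boundP i0)) _; rewrite ler_nat leqnSn.
    have e1 : ratr (f%:~R / m%:R) = f%:~R / m%:R :> algC by rewrite fmorph_div /= ratr_int ratr_nat.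
    have e3 : ratr m%:R^-1 = m%:R^-1 :> algC by rewrite fmorphV /= ratr_nat.
    exists (f%:~R / m%:R); rewrite rmorphD /= e1; split.
      by rewrite ler_pdivrMr // real_floor_le.
    apply: (@lt_le_trans _ _ ((f + 1)%:~R / m%:R)); first by rewrite ltr_pdivlMr // real_floorD1_gt.
    by rewrite rmorphD /= mulrDl lerD2l mul1r -e3 ler_rat.
  pose E (y : R) := exists q : rat, ratr q <= x /\ y = ratr q.
  have ubq (q : rat) : x < ratr q -> forall y, E y -> y <= ratr q.
    by move=> xq _ [q' [h ->]]; rewrite ler_rat -(ler_rat algC); apply: ltW (le_lt_trans h xq).
  have [q0 [h0 h0']] := fl 1 isT.
  have hub : classical_sets.has_ubound E by exists (ratr (q0 + 1)) => y; exact: ubq.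
  exists (sup E) => e e0; have e2 : 0 < e / 2 by rewrite divr_gt0.
  have [q [h1 h2]] := fl _ e2; exists q.
  have lq : ratr q <= sup E by apply: (ub_le_sup hub); exists q.
  have uq : sup E <= ratr (q + e / 2) by apply: ge_sup; [exists (ratr q0), q0|move=> y; exact: ubq].
  have ee : e / 2 < e by lra.
  split.
    rewrite ger0_norm ?subr_ge0 // ltrBlDl; apply: lt_trans h2 _.
    by rewrite -rmorphD ltr_rat ltrD2l.
  rewrite ger0_norm ?subr_ge0 // ltrBlDl; apply: le_lt_trans uq _.
  by rewrite -rmorphD ltr_rat ltrD2l.
have [a ha] := real_ex _ (Creal_Re z); have [b hb] := real_ex _ (Creal_Im z).
exists (Complex a b) => e e0; have e2 : 0 < e / 2 by rewrite divr_gt0.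
have [q [h1 h2]] := ha _ e2; have [q' [h3 h4]] := hb _ e2; exists (q, q').
have ee : e = e / 2 + e / 2 by lra.
rewrite ee !rmorphD; split.
  rewrite [z in `|z - _|]Crect /ga /= opprD addrACA -mulrBr; apply: le_lt_trans (ler_normD _ _) _.
  by rewrite normrM normCi mul1r; apply: ltrD.
by apply: le_lt_trans (nm_le _ _) _; apply: ltrD.
Qed.

Lemma sigma_ex : exists sg : {rmorphism algC -> C}, True.
Proof.
have /choice[f hf] := apx_ex.
have f_zmod : zmod_morphism f.
  move=> x y; apply: (apx_uniq (hf _)).
  have := apx_add (hf (x - y)) (hf y); rewrite subrK => h.
  by rewrite -(apx_uniq h (hf x)) addrK; exact: hf.
have f_mon : monoid_morphism f.
  split=> [|x y]; last by apply: (apx_uniq (hf _)); apply: apx_mul.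
  apply: (apx_uniq (hf _)) => e e0; exists (1, 0).
  have -> : ga (1, 0) = 1 by rewrite /ga /= rmorph1 rmorph0 mulr0 addr0.
  have -> : gb (1, 0) = 1 by apply/eqP; rewrite eq_complex /= rmorph1 rmorph0 !eqxx.
  by rewrite !subrr normr0 nm0 !ltr0q.
pose m1 := GRing.isZmodMorphism.Build algC C f f_zmod.
pose m2 := GRing.isMonoidMorphism.Build algC C f f_mon.
pose F : {rmorphism algC -> C} := HB.pack f m1 m2.
by exists F.
Qed.
End Sigma.

(** * Euler polygons along the dual vector fields *)

Import Cexp.
Definition dblC (K : fieldType) N (z : 'I_N -> K) : 'I_(N + N) -> K :=
  fun i => match split i with inl j => z j | inr j => (z j)^-1 end.
Lemma dblC_l (K : fieldType) N (z : 'I_N -> K) j : dblC z (lshift N j) = z j.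
Proof. by rewrite /dblC (unsplitK (inl j)). Qed.
Lemma dblC_r (K : fieldType) N (z : 'I_N -> K) j : dblC z (rshift N j) = (z j)^-1.
Proof. by rewrite /dblC (unsplitK (inr j)). Qed.
Lemma chp_evalC (K : numFieldType) N (a : 'I_N -> int) (z : 'I_N -> K) : (chp K a).@[dblC z] = \prod_j z j ^ a j.
Proof.
rewrite (rmorph_prod (meval (dblC z))); apply: eq_bigr => j _ /=.
case: (a j) => m; rewrite (rmorphXn (meval (dblC z))) /= mevalXU ?dblC_l ?dblC_r //.
by rewrite exprVn.
Qed.

Lemma taylor_add (K : comNzRingType) (a b c a' b' c' : K) :
  a + a' - (b + b') - (c + c') = (a - b - c) + (a' - b' - c').
Proof. ring. Qed.
Lemma taylor_mul (K : comNzRingType) (u' u du v' v dv : K) :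
  u' * v' - u * v - (du * v + u * dv) = u' * (v' - v - dv) + (u' - u - du) * (v + dv) + du * dv.
Proof. ring. Qed.
Lemma taylor_split (K : comNzRingType) (a b c : K) : a = b + c + (a - b - c).
Proof. ring. Qed.

Lemma combine_le (F : realFieldType) (a b c d w x : F) : b <= d * w -> c <= a * x -> a * x <= a * (1 / 2) ->
  a <= b + c -> a <= 2 * w * d.
Proof. move=> *; lra. Qed.

Section Flow.
Variables (R : realType) (N : nat).
Local Notation C := R[i].
Local Notation SC := {mpoly C[N + N]}.
Implicit Types (P Q : SC) (la et : 'I_N -> C).
Variable p : 'I_N -> C.
Hypothesis p0 : forall j, p j != 0.

(** P at the translate of p by the exponential of [la]. In these logarithmic coordinates monomials
    are exponentials of linear forms. *)
Definition hf P la : C := P.@[dblC (fun j => p j * Ce (la j))].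
Definition nV n (la : 'I_n -> C) : R := \sum_j nm (la j).
(** The invariant vector field x_j d/dx_j in doubled coordinates. *)
Definition Ed j P : SC := 'X_(lshift N j) * P^`M(lshift N j) - 'X_(rshift N j) * P^`M(rshift N j).
Definition small (x : R) la := forall j, nm (la j) <= x.

Lemma nV_ge0 n (la : 'I_n -> C) : 0 <= nV la.
Proof. by apply: sumr_ge0 => j _; exact: nm_ge0. Qed.
Lemma nm_nV n (la : 'I_n -> C) j : nm (la j) <= nV la.
Proof. by rewrite /nV (bigD1 j) //= lerDl; apply: sumr_ge0 => i _; exact: nm_ge0. Qed.
Lemma hfD P Q la : hf (P + Q) la = hf P la + hf Q la. Proof. exact: mevalD. Qed.
Lemma hfM P Q la : hf (P * Q) la = hf P la * hf Q la. Proof. exact: mevalM. Qed.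
Lemma hfZ c P la : hf (c *: P) la = c * hf P la. Proof. exact: mevalZ. Qed.
Lemma hf_sum (J : finType) (P : J -> SC) la : hf (\sum_j P j) la = \sum_j hf (P j) la.
Proof. by rewrite /hf (raddf_sum (meval _)). Qed.
Lemma hfXl j la : hf 'X_(lshift N j) la = p j * Ce (la j).
Proof. by rewrite /hf mevalXU dblC_l. Qed.
Lemma hfXr j la : hf 'X_(rshift N j) la = (p j)^-1 * Ce (- la j).
Proof. by rewrite /hf mevalXU dblC_r invfM CeN mulrC. Qed.
Lemma EdD j P Q : Ed j (P + Q) = Ed j P + Ed j Q.
Proof. by rewrite /Ed !mderivD; ring. Qed.
Lemma EdM j P Q : Ed j (P * Q) = Ed j P * Q + P * Ed j Q.
Proof. by rewrite /Ed !mderivM; ring. Qed.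

Lemma hbound P : exists B, 0 <= B /\ forall la, small (1 / 2) la -> nm (hf P la) <= B.
Proof.
elim/mpoly_alg_ind: P => [c|i|u v [B [B0 hB]] [B' [B0' hB']]|u v [B [B0 hB]] [B' [B0' hB']]].
- by exists (nm c); split=> [|la _]; rewrite ?nm_ge0 // /hf mevalC.
- rewrite -(splitK i); case: (split i) => j /=.
    exists (nm (p j) * 2); split=> [|la h]; first by rewrite mulr_ge0 ?nm_ge0.
    by rewrite hfXl nmM ler_wpM2l ?nm_ge0 // nm_Ce_le.
  exists (nm (p j)^-1 * 2); split=> [|la h]; first by rewrite mulr_ge0 ?nm_ge0.
  by rewrite hfXr nmM ler_wpM2l ?nm_ge0 // nm_Ce_le // nmN.
- exists (B + B'); split=> [|la h]; first exact: addr_ge0.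
  by rewrite hfD; apply: le_trans (nmD _ _) _; apply: lerD; [apply: hB|apply: hB'].
- exists (B * B'); split=> [|la h]; first exact: mulr_ge0.
  by rewrite hfM nmM; apply: ler_pM; rewrite ?nm_ge0 //; [apply: hB|apply: hB'].
Qed.

Definition dif P la et := \sum_j et j * hf (Ed j P) la.
Lemma dif_bound P : exists B, 0 <= B /\ forall la et, small (1 / 2) la -> nm (dif P la et) <= B * nV et.
Proof.
have /choice[B hB] j := hbound (Ed j P).
exists (\sum_j B j); split=> [|la et h]; first by apply: sumr_ge0 => j _; case: (hB j).
apply: le_trans (nm_sum _ _ _) _; rewrite /nV mulr_sumr; apply: ler_sum => j _.
rewrite nmM mulrC ler_wpM2r ?nm_ge0 //; have [B0 hj] := hB j.
apply: le_trans (hj _ h) _; rewrite (bigD1 j) //= lerDl; apply: sumr_ge0 => i _; by case: (hB i).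
Qed.

Lemma htaylor P : exists B, 0 <= B /\ forall la et, small (1 / 2) la -> small (1 / 2) et ->
  small (1 / 2) (fun j => la j + et j) ->
  nm (hf P (fun j => la j + et j) - hf P la - dif P la et) <= B * nV et ^+ 2.
Proof.
have one (c x y : C) : nm x <= 1 / 2 -> nm y <= 1 / 2 ->
    nm (c * Ce (x + y) - c * Ce x - y * (c * Ce x)) <= nm c * 16 * nm y ^+ 2.
  move=> hx hy; rewrite CeD (_ : _ - _ - _ = c * (Ce x * (Ce y - 1 - y))); last by ring.
  rewrite !nmM -mulrA ler_wpM2l ?nm_ge0 //.
  apply: le_trans (ler_pM (nm_ge0 _) (nm_ge0 _) (nm_Ce_le hx) (Ce_bnd hy)) _.
  by rewrite mulrA; apply: ler_wpM2r; [rewrite exprn_ge0 ?nm_ge0|lra].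
have sqV et j : nm (et j) ^+ 2 <= nV et ^+ 2 by rewrite ler_pXn2r ?nnegrE ?nm_ge0 ?nV_ge0 // nm_nV.
elim/mpoly_alg_ind: P => [c|i|u v [B [B0 hB]] [B' [B0' hB']]|u v [B [B0 hB]] [B' [B0' hB']]].
- exists 0; split=> // la et _ _ _; rewrite /hf !mevalC subrr /dif big1 => [|j _].
    by rewrite subrr nm0 mul0r.
  by rewrite /Ed !mderivC !mulr0 subrr /hf meval0 mulr0.
- rewrite -(splitK i); case: (split i) => j /=.
    exists (nm (p j) * 16); split=> [|la et h1 h2 h3]; first by rewrite mulr_ge0 ?nm_ge0.
    have -> : dif 'X_(lshift N j) la et = et j * (p j * Ce (la j)).
      rewrite /dif (bigD1 j) //= big1 ?addr0 => [|l lj].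
        rewrite /Ed !mderivX !mnm1E eqxx eq_lrshift scale1r scale0r mulr0 subr0 submm0 mpolyX0 mulr1.
        by rewrite hfXl.
      by rewrite /Ed !mderivX !mnm1E eq_lrshift (inj_eq (@lshift_inj _ _)) eq_sym (negPf lj) !scale0r !mulr0 subrr /hf meval0 mulr0.
    rewrite !hfXl; apply: le_trans (one _ _ _ (h1 j) (h2 j)) _.
    by rewrite ler_wpM2l // mulr_ge0 ?nm_ge0.
  exists (nm (p j)^-1 * 16); split=> [|la et h1 h2 h3]; first by rewrite mulr_ge0 ?nm_ge0.
  have -> : dif 'X_(rshift N j) la et = - et j * ((p j)^-1 * Ce (- la j)).
    rewrite /dif (bigD1 j) //= big1 ?addr0 => [|l lj].
      rewrite /Ed !mderivX !mnm1E eqxx eq_rlshift scale1r scale0r mulr0 sub0r submm0 mpolyX0 mulr1.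
      by rewrite /hf mevalN -/(hf _ la) hfXr mulrN mulNr.
    by rewrite /Ed !mderivX !mnm1E eq_rlshift (inj_eq (@rshift_inj _ _)) eq_sym (negPf lj) !scale0r !mulr0 subrr /hf meval0 mulr0.
  rewrite !hfXr opprD; apply: le_trans (one _ _ _ _ _) _; rewrite ?nmN //.
  by rewrite ler_wpM2l // mulr_ge0 ?nm_ge0.
- exists (B + B'); split=> [|la et h1 h2 h3]; first exact: addr_ge0.
  have -> : dif (u + v) la et = dif u la et + dif v la et.
    by rewrite /dif -big_split; apply: eq_bigr => j _ /=; rewrite EdD hfD mulrDr.
  rewrite !hfD taylor_add.
  by rewrite mulrDl; apply: le_trans (nmD _ _) _; apply: lerD; [apply: hB|apply: hB'].
- have [Bu [Bu0 hu]] := hbound u; have [Bv [Bv0 hv]] := hbound v.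
  have [Du [Du0 hdu]] := dif_bound u; have [Dv' [Dv0' hdv]] := dif_bound v.
  exists (Bu * B' + B * (Bv + Dv' * N%:R) + Du * Dv'); split=> [|la et h1 h2 h3].
    by rewrite !(addr_ge0, mulr_ge0) // ler0n.
  have -> : dif (u * v) la et = dif u la et * hf v la + hf u la * dif v la et.
    rewrite /dif mulr_suml mulr_sumr -big_split; apply: eq_bigr => j _ /=; rewrite EdM hfD !hfM.
    by rewrite mulrDr mulrA; congr (_ + _); rewrite mulrCA.
  rewrite !hfM; set u' := hf u (fun j => la j + et j); set v' := hf v (fun j => la j + et j).
  rewrite taylor_mul.
  have V1 : nV et <= N%:R.
    rewrite -[N in N%:R]card_ord -sumr_const; apply: ler_sum => j _.
    by apply: le_trans (h2 j) _; lra.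
  apply: le_trans (nmD _ _) _; rewrite [X in _ <= X]mulrDl; apply: lerD.
    apply: le_trans (nmD _ _) _; rewrite [X in _ <= X]mulrDl !nmM; apply: lerD.
      by rewrite -mulrA; apply: ler_pM; rewrite ?nm_ge0 //; [exact: hu|exact: hB'].
    rewrite -[X in _ <= X]mulrA [(Bv + _) * _]mulrC mulrA; apply: ler_pM; rewrite ?nm_ge0 //; first exact: hB.
    apply: le_trans (nmD _ _) _; apply: lerD; first exact: hv.
    apply: le_trans (hdv _ _ h1) _; exact: ler_wpM2l.
  by rewrite nmM expr2 mulrACA; apply: ler_pM; rewrite ?nm_ge0 //; [exact: hdu|exact: hdv].
Qed.

Lemma hlip P : exists B, 0 <= B /\ forall la, small (1 / 2) la -> nm (hf P la - hf P (fun _ => 0)) <= B * nV la.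
Proof.
have [B [B0 hB]] := htaylor P; have [D [D0 hD]] := dif_bound P.
have z : small (1 / 2) (fun _ => 0) by move=> j; rewrite nm0 divr_ge0.
exists (B * N%:R + D); split=> [|la h]; first by rewrite addr_ge0 // mulr_ge0.
have e : (fun j => 0 + la j) = la by apply: funext => j; rewrite add0r.
have h' : small (1 / 2) (fun j => 0 + la j) by rewrite e.
have := hB _ _ z h h'; rewrite e => h1.
rewrite -[hf P la - _](subrK (dif P (fun _ => 0) la)); apply: le_trans (nmD _ _) _; rewrite mulrDl; apply: lerD; last exact: hD.
apply: le_trans h1 _; rewrite expr2 -mulrA ler_wpM2l // ler_wpM2r ?nV_ge0 //.
rewrite -[N in N%:R]card_ord -sumr_const; apply: ler_sum => j _.
by apply: le_trans (h j) _; lra.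
Qed.

Variables (I : SC -> Prop) (G : nat) (g : 'I_G -> SC) (r : nat) (del : 'I_r -> 'I_N -> SC).
(** The vector field with components [del i j] on the x_j; the square with a minus sign is the
    induced derivative of the inverse coordinate. *)
Definition theta i P : SC := \sum_j del i j * (P^`M(lshift N j) - 'X_(rshift N j) ^+ 2 * P^`M(rshift N j)).
Hypothesis Ig : forall l, I (g l).
Hypothesis Igen : forall P, I P -> exists v : 'I_G -> SC, P = \sum_l v l * g l.
Hypothesis Ith : forall i P, I P -> I (theta i P).
Hypothesis Ip : forall P, I P -> hf P (fun _ => 0) = 0.

(** The pairing of the r forms given by L with the r vector fields, at the point with logarithmic
    coordinates [la]. *)
Definition Om (L : 'I_r -> 'I_N -> R) la : 'M[C]_r :=
  \matrix_(i, b) \sum_j rc (L b j) * hf (del i j * 'X_(rshift N j)) la.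

Variable L0 : 'I_r -> 'I_N -> R.
Hypothesis Om0 : Om L0 (fun _ => 0) \in unitmx.

(** A small perturbation of an invertible matrix. The bounds are uniform for L near L0, as the later
    compactness argument demands. *)
Lemma Om_inv : exists rho K : R, [/\ 0 < rho, rho <= 1 / 2, 0 <= K &
  forall L la (u : 'rV[C]_r), (forall b j, `|L b j - L0 b j| <= rho) -> small rho la ->
  exists f : 'rV[C]_r, f *m Om L la = u /\ nV (f 0) <= K * nV (u 0)].
Proof.
have /choice[Bb hBb] (t : 'I_r * 'I_N) := hbound (del t.1 t.2 * 'X_(rshift N t.2)).
have /choice[Bl hBl] (t : 'I_r * 'I_N) := hlip (del t.1 t.2 * 'X_(rshift N t.2)).
pose Q := \sum_t (Bb t + Bl t).
have Q0 : 0 <= Q by apply: sumr_ge0 => t _; apply: addr_ge0; [case: (hBb t)|case: (hBl t)].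
have Qb t : Bb t <= Q.
  rewrite /Q (bigD1 t) //= -addrA lerDl addr_ge0 //; first by case: (hBl t).
  by apply: sumr_ge0 => i _; apply: addr_ge0; [case: (hBb i)|case: (hBl i)].
have Ql t : Bl t <= Q.
  rewrite /Q (bigD1 t) //= [Bb t + _]addrC -addrA lerDl addr_ge0 //; first by case: (hBb t).
  by apply: sumr_ge0 => i _; apply: addr_ge0; [case: (hBb i)|case: (hBl i)].
pose q0 := \sum_b \sum_j `|L0 b j|.
have q00 : 0 <= q0 by apply: sumr_ge0 => b _; apply: sumr_ge0.
pose W := invmx (Om L0 (fun _ => 0)).
pose w := \sum_i \sum_b nm (W i b).
have w0 : 0 <= w by apply: sumr_ge0 => b _; apply: sumr_ge0 => j _; exact: nm_ge0.
pose Z := N%:R * (Q + q0 * (Q * N%:R)).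
have Z0 : 0 <= Z by rewrite !(mulr_ge0, addr_ge0) // ler0n.
have ent rho L la : rho <= 1 / 2 -> 0 <= rho -> (forall b j, `|L b j - L0 b j| <= rho) -> small rho la ->
    forall i b, nm (Om L la i b - Om L0 (fun _ => 0) i b) <= Z * rho.
  move=> rho2 rho0 hL hl i b; rewrite !mxE -sumrB; apply: le_trans (nm_sum _ _ _) _.
  rewrite /Z -mulrA mulr_natl -[N in _ *+ N]card_ord -sumr_const; apply: ler_sum => j _.
  have sm : small (1 / 2) la by move=> l; exact: le_trans (hl l) rho2.
  set h := hf _ la; set h0 := hf _ _.
  rewrite (_ : _ - _ = rc (L b j - L0 b j) * h + rc (L0 b j) * (h - h0)); last by rewrite rmorphB; ring.
  apply: le_trans (nmD _ _) _; rewrite !nmM !nm_rc mulrDl; apply: lerD.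
    rewrite mulrC; apply: ler_pM; rewrite ?nm_ge0 //.
    by apply: le_trans (Qb (i, j)); apply: (hBb (i, j)).2.
  rewrite -mulrA; apply: ler_pM; rewrite ?nm_ge0 //.
    rewrite /q0 (bigD1 b) //= (bigD1 j) //= -addrA lerDl addr_ge0 //; first by apply: sumr_ge0.
    by apply: sumr_ge0 => b' _; apply: sumr_ge0.
  apply: le_trans ((hBl (i, j)).2 _ sm) _; rewrite -mulrA; apply: ler_pM; rewrite ?nV_ge0 //; first by case: (hBl (i, j)).
  rewrite mulr_natl -[N in _ *+ N]card_ord -sumr_const; apply: ler_sum => l _; exact: hl.
have nVmul (f : 'rV[C]_r) (A : 'M[C]_r) e : (forall i b, nm (A i b) <= e) -> nV ((f *m A) 0) <= nV (f 0) * (r%:R * e).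
  move=> hA; rewrite /nV.
  apply: le_trans (_ : \sum_(b < r) (\sum_i nm (f 0 i)) * e <= _); last first.
    by rewrite sumr_const card_ord -mulrnAr mulr_natl.
  apply: ler_sum => b _; rewrite mxE mulr_suml; apply: le_trans (nm_sum _ _ _) _; apply: ler_sum => i _.
  by rewrite nmM ler_wpM2l ?nm_ge0.
have Wb i b : nm (W i b) <= w.
  rewrite /w (bigD1 i) //= (bigD1 b) //= -addrA lerDl addr_ge0 //; first by apply: sumr_ge0 => *; exact: nm_ge0.
  by apply: sumr_ge0 => ? _; apply: sumr_ge0 => ? _; exact: nm_ge0.
pose D := r%:R * w * (r%:R * Z).
have D0 : 0 <= D by exact: mulr_ge0 (mulr_ge0 (ler0n _ _) w0) (mulr_ge0 (ler0n _ _) Z0).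
pose rho := 1 / (2 * (D + 1)).
have rho0 : 0 < rho by rewrite divr_gt0 // mulr_gt0 // ltr_wpDl.
have rho2 : rho <= 1 / 2 by rewrite /rho ler_pdivrMr ?mulr_gt0 ?ltr_wpDl //; lra.
have Drho : D * rho <= 1 / 2.
  rewrite /rho mulrA mulr1 ler_pdivrMr ?mulr_gt0 ?ltr_wpDl //; lra.
exists rho, (2 * (r%:R * w)); split=> //; first by rewrite !mulr_ge0.
move=> L la u hL hl.
have key (f : 'rV[C]_r) : nV (f 0) <= 2 * (r%:R * w) * nV ((f *m Om L la) 0).
  pose A := Om L la - Om L0 (fun _ => 0).
  have hA i b : nm (A i b) <= Z * rho by rewrite /A [X in nm X]mxE [X in nm (_ + X)]mxE; exact: ent rho2 (ltW rho0) hL hl i b.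
  have ef : f = f *m Om L la *m W - f *m A *m W.
    by rewrite -mulmxBl -mulmxBr /A opprB addrC subrK mulmxK.
  have : nV (f 0) <= nV ((f *m Om L la *m W) 0) + nV ((f *m A *m W) 0).
    rewrite {1}ef /nV -big_split; apply: ler_sum => i _ /=; rewrite !mxE; exact: nmB.
  have h1 := nVmul (f *m Om L la) _ _ Wb; have h2 := nVmul (f *m A) _ _ Wb; have h3 := nVmul f _ _ hA.
  have rw0 : 0 <= r%:R * w by rewrite mulr_ge0.
  have h4 : nV ((f *m A *m W) 0) <= nV (f 0) * (D * rho).
    apply: le_trans h2 _; apply: le_trans (ler_wpM2r rw0 h3) _.
    by rewrite le_eqVlt; apply/orP; left; apply/eqP; rewrite /D; ring.
  have h5 : nV (f 0) * (D * rho) <= nV (f 0) * (1 / 2) by rewrite ler_wpM2l ?nV_ge0.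
  by move=> h6; exact: combine_le h1 h4 h5 h6.
have un : Om L la \in unitmx.
  rewrite -row_free_unit -kermx_eq0; apply/rowV0P => f /sub_kermxP e.
  have := key f; rewrite e {2}/nV big1 ?mulr0 => [h|i _]; last by rewrite mxE nm0.
  apply/rowP => i; rewrite mxE; apply: nm_eq0; apply/eqP; rewrite eq_le nm_ge0 andbT.
  exact: le_trans (nm_nV _ i) h.
exists (u *m invmx (Om L la)); split; first by rewrite mulmxKV.
by apply: le_trans (key _) _; rewrite mulmxKV.
Qed.

Lemma theta_dif i P la : \sum_j hf (del i j * 'X_(rshift N j)) la * hf (Ed j P) la = hf (theta i P) la.
Proof.
rewrite hf_sum; apply: eq_bigr => j _; rewrite -!hfM.
have e : hf ('X_(lshift N j) * 'X_(rshift N j)) la = 1.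
  by rewrite hfM hfXl hfXr mulrACA divff // mul1r -CeD subrr Ce0.
rewrite (_ : del i j * 'X_(rshift N j) * Ed j P =
  'X_(lshift N j) * 'X_(rshift N j) * (del i j * P^`M(lshift N j)) + (- 1) *: (del i j * ('X_(rshift N j) ^+ 2 * P^`M(rshift N j)))).
  rewrite hfD hfM e mul1r hfZ mulN1r mulrBr /hf mevalB //.
by rewrite /Ed scaleN1r; ring.
Qed.

(** Along M + 1 Euler steps the forms L take their prescribed values exactly, being linear in [la].
    The equations of I acquire an error of order 1/(M + 1) by a discrete Gronwall argument: [theta]
    of an equation is a combination of the equations, so a step multiplies the error by a factor 1 +
    O(1/M) and adds O(1/M^2). Only c depends on L. *)
Lemma euler : exists rho u0 K : R, [/\ 0 < rho, 0 < u0, 0 <= K &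
  forall L, (forall b j, `|L b j - L0 b j| <= rho) -> exists c, 0 <= c /\
  forall (u : 'rV[C]_r) (M : nat), nV (u 0) <= u0 -> exists la,
  [/\ small (K * nV (u 0)) la, forall b, \sum_j rc (L b j) * la j = u 0 b &
      forall l, nm (hf (g l) la) <= c / M.+1%:R]].
Proof.
have [rho [K [rho0 rho2 K0 hK]]] := Om_inv.
have /choice[Bb hBb] (t : 'I_r * 'I_N) := hbound (del t.1 t.2 * 'X_(rshift N t.2)).
pose Q := \sum_t Bb t.
have Q0 : 0 <= Q by apply: sumr_ge0 => t _; case: (hBb t).
have Qb t : Bb t <= Q by rewrite /Q (bigD1 t) //= lerDl; apply: sumr_ge0 => i _; case: (hBb i).
pose K1 := N%:R * (Q * K).
have K10 : 0 <= K1 by rewrite !mulr_ge0 ?ler0n.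
pose u0 := rho / (K1 + 1).
have u00 : 0 < u0 by rewrite divr_gt0 // ltr_wpDl.
have K1u0 : K1 * u0 <= rho by rewrite /u0 mulrA ler_pdivrMr ?ltr_wpDl // mulrDr mulr1 mulrC lerDl ltW.
clearbody u0.
exists rho, u0, K1; split=> // L hL.
have /choice[wl hwl] (t : 'I_r * 'I_G) := Igen (Ith t.1 (Ig t.2)).
have /choice[Bw hBw] (t : ('I_r * 'I_G) * 'I_G) := hbound (wl t.1 t.2).
have /choice[Bt hBt] l := htaylor (g l).
(* c1 bounds the coefficients expressing [theta] of the equations by the equations, c2 the
   second-order Taylor remainders. *)
pose c1 := \sum_t Bw t; pose c2 := \sum_l Bt l.
have c10 : 0 <= c1 by apply: sumr_ge0 => t _; case: (hBw t).
have c20 : 0 <= c2 by apply: sumr_ge0 => t _; case: (hBt t).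
pose c3 := G%:R * (K * u0 * (r%:R * c1)) + c2 * (K1 * u0) ^+ 2.
have u0' := ltW u00.
have c30 : 0 <= c3.
  exact: addr_ge0 (mulr_ge0 (ler0n _ _) (mulr_ge0 (mulr_ge0 K0 u0') (mulr_ge0 (ler0n _ _) c10))) (mulr_ge0 c20 (exprn_ge0 _ (mulr_ge0 K10 u0'))).
exists (c3 * sequences.expR c3); split; first by rewrite mulr_ge0 // ltW // exp.expR_gt0.
move=> u M hu; pose MR : R := M.+1%:R.
have MR0 : 0 < MR by rewrite ltr0n.
have MR1 : 1 <= MR by rewrite ler1n.
have /choice[fu hfu] (la : 'I_N -> C) : exists f : 'rV[C]_r, small rho la -> f *m Om L la = u /\ nV (f 0) <= K * nV (u 0).
  have [h|nh] := pselect (small rho la); last by exists 0.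
  by have [f hf'] := hK L la u hL h; exists f.
pose gv la j := \sum_i fu la 0 i * hf (del i j * 'X_(rshift N j)) la.
have gvb la : small rho la -> nV (gv la) <= K1 * nV (u 0).
  move=> sl; have sm : small (1 / 2) la by move=> l; exact: le_trans (sl l) rho2.
  have [_ fb] := hfu _ sl.
  rewrite /K1 -mulrA mulr_natl -[N in _ *+ N]card_ord -sumr_const; apply: ler_sum => j _.
  apply: le_trans (nm_sum _ _ _) _; rewrite -mulrA; apply: le_trans (ler_wpM2l Q0 fb).
  rewrite /nV mulr_sumr; apply: ler_sum => i _; rewrite nmM mulrC ler_wpM2r ?nm_ge0 //.
  by apply: le_trans (Qb (i, j)); apply: (hBb (i, j)).2.
pose step la := fun j => la j + gv la j / M.+1%:R.
pose lm m := iter m step (fun _ => 0).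
have nVd (v : 'I_N -> C) : nV (fun j => v j / M.+1%:R) = nV v / MR.
  by rewrite /nV mulr_suml; apply: eq_bigr => j _; rewrite nmM nmV nm_nat.
have uK : K1 * nV (u 0) <= rho by apply: le_trans K1u0; rewrite ler_wpM2l.
have U0 := nV_ge0 (u 0).
have inv m : (m <= M.+1)%N -> [/\ nV (lm m) <= m%:R / MR * (K1 * nV (u 0)), forall b, \sum_j rc (L b j) * lm m j = m%:R / M.+1%:R * u 0 b &
    \sum_l nm (hf (g l) (lm m)) <= m%:R * (c3 / MR ^+ 2) * (1 + c3 / MR) ^+ m].
  have smR k la : (k <= M.+1)%N -> nV la <= k%:R / MR * (K1 * nV (u 0)) -> small rho la.
    move=> kM h j; apply: le_trans (nm_nV _ j) _; apply: le_trans h _; apply: le_trans uK.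
    by rewrite ler_piMl ?mulr_ge0 // ler_pdivrMr // mul1r ler_nat.
  elim: m => [|m IH] mM.
    split=> [|b|]; rewrite ?mul0r /=; first by rewrite /nV big1 ?mul0r // => j _; rewrite nm0.
      by rewrite big1 // => j _; rewrite mulr0.
    by rewrite big1 ?mul0r // => l _; rewrite Ip ?nm0.
  have [h1 h2 h3] := IH (ltnW mM); set la := lm m in h1 h2 h3.
  have sl : small rho la := smR m la (ltnW mM) h1.
  have sm : small (1 / 2) la by move=> l; exact: le_trans (sl l) rho2.
  have [fO fb] := hfu _ sl; have gb := gvb _ sl.
  have e1 : nV (lm m.+1) <= m.+1%:R / MR * (K1 * nV (u 0)).
    rewrite -natr1 !mulrDl mul1r; apply: le_trans (_ : nV la + nV (fun j => gv la j / M.+1%:R) <= _).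
      by rewrite /nV -big_split; apply: ler_sum => j _ /=; exact: nmD.
    by apply: lerD => //; rewrite nVd mulrC ler_wpM2l // invr_ge0 ltW.
  split=> // [b|].
    rewrite -natr1 !mulrDl mul1r -h2 (eq_bigr (fun j => rc (L b j) * la j + rc (L b j) * gv la j / M.+1%:R)) => [|j _]; last by rewrite mulrDr mulrA.
    rewrite big_split -mulr_suml /=; congr (_ + _); rewrite [RHS]mulrC; congr (_ / _).
    have /rowP/(_ b) := fO; rewrite mxE => <-.
    rewrite (eq_bigr (fun j => \sum_i fu la 0 i * (rc (L b j) * hf (del i j * 'X_(rshift N j)) la))) => [|j _].
      by rewrite exchange_big; apply: eq_bigr => i _; rewrite mxE mulr_sumr.
    by rewrite /gv mulr_sumr; apply: eq_bigr => i _; rewrite mulrCA.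
  have se : small (1 / 2) (fun j => gv la j / M.+1%:R).
    move=> j; apply: le_trans (nm_nV (fun j => gv la j / M.+1%:R) j) _; rewrite nVd.
    apply: le_trans rho2; apply: le_trans uK; apply: le_trans gb.
    by rewrite ler_pdivrMr // ler_peMr ?nV_ge0.
  have sle : small (1 / 2) (fun j => la j + gv la j / M.+1%:R).
    by move=> j; exact: le_trans (smR m.+1 _ mM e1 j) rho2.
  set E := \sum_l nm (hf (g l) la) in h3.
  have E0 : 0 <= E by apply: sumr_ge0 => l _; exact: nm_ge0.
  have one l : nm (hf (g l) (step la)) <= nm (hf (g l) la) + K * u0 * (r%:R * c1) / MR * E + Bt l * ((K1 * u0) ^+ 2 / MR ^+ 2).
    have := (hBt l).2 _ _ sm se sle; rewrite nVd -/(step la) => ht.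
    rewrite (taylor_split (hf (g l) (step la)) (hf (g l) la) (dif (g l) la (fun j => gv la j / M.+1%:R))).
    apply: le_trans (nmD _ _) _; apply: lerD; last first.
      apply: le_trans ht _; rewrite ler_wpM2l ?(hBt l).1 // expr_div_n.
      rewrite ler_wpM2r ?invr_ge0 ?exprn_ge0 ?(ltW MR0) // ler_pXn2r ?nnegrE ?nV_ge0 ?mulr_ge0 ?(ltW u00) //.
      by apply: le_trans gb _; rewrite ler_wpM2l.
    apply: le_trans (nmD _ _) _; rewrite lerD2l.
    have -> : dif (g l) la (fun j => gv la j / M.+1%:R) = (\sum_i fu la 0 i * hf (theta i (g l)) la) / M.+1%:R.
      rewrite /dif mulr_suml (eq_bigr (fun j => \sum_i fu la 0 i * (hf (del i j * 'X_(rshift N j)) la * hf (Ed j (g l)) la) / M.+1%:R)).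
        rewrite exchange_big; apply: eq_bigr => i _; rewrite -theta_dif mulr_sumr mulr_suml.
        by apply: eq_bigr => j _.
      move=> j _; rewrite /gv !mulr_suml; apply: eq_bigr => i _.
      by rewrite mulrAC -[_ * hf _ _ * hf _ _]mulrA.
    rewrite nmM nmV nm_nat mulrAC ler_wpM2r ?invr_ge0 ?(ltW MR0) //.
    apply: le_trans (nm_sum _ _ _) _.
    have th i : nm (hf (theta i (g l)) la) <= c1 * E.
      rewrite (hwl (i, l)) hf_sum; apply: le_trans (nm_sum _ _ _) _; rewrite /E mulr_sumr; apply: ler_sum => l' _.
      rewrite hfM nmM ler_wpM2r ?nm_ge0 //; apply: le_trans ((hBw ((i, l), l')).2 _ sm) _.
      by rewrite /c1 (bigD1 ((i, l), l')) //= lerDl; apply: sumr_ge0 => t _; case: (hBw t).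
    apply: le_trans (_ : \sum_i (K * u0) * (c1 * E) <= _).
      apply: ler_sum => i _; rewrite nmM; apply: ler_pM; rewrite ?nm_ge0 //.
      apply: le_trans (nm_nV _ i) _; apply: le_trans fb _; exact: ler_wpM2l.
    rewrite sumr_const card_ord le_eqVlt; apply/orP; left; apply/eqP.
    by rewrite -mulr_natl; ring.
  have -> : lm m.+1 = step la by [].
  apply: le_trans (ler_sum _ (fun l _ => one l)) _.
  rewrite !big_split /= -/E sumr_const card_ord -mulr_suml -/c2.
  have c3a : G%:R * (K * u0 * (r%:R * c1)) <= c3 by rewrite lerDl mulr_ge0 ?exprn_ge0 ?mulr_ge0 // ltW.
  have c3b : c2 * (K1 * u0) ^+ 2 <= c3.
    by rewrite lerDr !mulr_ge0 ?ler0n // ltW.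
  set x := 1 + c3 / MR in h3 *.
  have x1 : 1 <= x by rewrite lerDl divr_ge0 // ltW.
  apply: (@le_trans _ _ (x * E + c3 / MR ^+ 2)).
    apply: lerD; last first.
      by rewrite mulrA ler_wpM2r // invr_ge0 exprn_ge0 // ltW.
    rewrite /x mulrDl mul1r lerD2l.
    have -> : K * u0 * (r%:R * c1) / MR * E *+ G = G%:R * (K * u0 * (r%:R * c1)) / MR * E by rewrite -mulr_natl; ring.
    by apply: ler_wpM2r => //; apply: ler_wpM2r => //; rewrite invr_ge0 ltW.
  have p1 : 1 <= x ^+ m.+1 by apply: exprn_ege1.
  have y0 : 0 <= c3 / MR ^+ 2 by rewrite divr_ge0 // exprn_ge0 // ltW.
  apply: (@le_trans _ _ (x * (m%:R * (c3 / MR ^+ 2) * x ^+ m) + c3 / MR ^+ 2 * x ^+ m.+1)).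
    by apply: lerD; [rewrite ler_wpM2l // (le_trans _ x1)|rewrite ler_peMr].
  have gs (x' m' q y : R) : x' * (m' * q * y) + q * (x' * y) = (m' + 1) * q * (x' * y) by ring.
  by rewrite [x ^+ m.+1]exprS gs natr1.
have [h1 h2 h3] := inv M.+1 (leqnn _).
exists (lm M.+1); split=> [j|b|l].
- apply: le_trans (nm_nV _ j) _; apply: le_trans h1 _; rewrite divff ?mul1r //; exact: lt0r_neq0.
- by rewrite h2 divff ?mul1r // pnatr_eq0.
- apply: le_trans (_ : \sum_l nm (hf (g l) (lm M.+1)) <= _).
    by rewrite (bigD1 l) //= lerDl; apply: sumr_ge0 => i _; exact: nm_ge0.
  apply: le_trans h3 _; rewrite -/MR.
  have ex : (1 + c3 / MR) ^+ M.+1 <= sequences.expR c3.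
    apply: le_trans (_ : sequences.expR (c3 / MR) ^+ M.+1 <= _).
      rewrite ler_pXn2r ?nnegrE ?addr_ge0 ?divr_ge0 ?(ltW MR0) ?exp.expR_ge1Dx //.
      by rewrite ltW // exp.expR_gt0.
    by rewrite -exp.expRM_natl -/MR mulrC mulfVK // lt0r_neq0.
  have fd (x y : R) : x != 0 -> x * (y / x ^+ 2) = y / x by move=> ?; field.
  rewrite fd ?lt0r_neq0 //.
  rewrite [X in _ <= X]mulrAC; apply: ler_wpM2l => //.
  by rewrite divr_ge0 // ltW.
Qed.
End Flow.

(** * Independence of monomials near one matrix *)

Section KeyLocal.
Variables (R : realType) (N : nat).
Local Notation C := R[i].
Local Notation SC := {mpoly C[N + N]}.
Variable p : 'I_N -> C.
Hypothesis p0 : forall j, p j != 0.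
Variables (I : SC -> Prop) (G : nat) (g : 'I_G -> SC) (r : nat) (del : 'I_r -> 'I_N -> SC).
Hypothesis Ig : forall l, I (g l).
Hypothesis Igen : forall P, I P -> exists v : 'I_G -> SC, P = \sum_l v l * g l.
Hypothesis Ith : forall i P, I P -> I (theta del i P).
Hypothesis Ip : forall P, I P -> P.@[dblC p] = 0.
Variable L0 : 'I_r -> 'I_N -> R.
Hypothesis Om0 : \det (\matrix_(i, b) \sum_j rc (L0 b j) * (del i j * 'X_(rshift N j)).@[dblC p] : 'M[C]_r) != 0.

(** Evaluate the relation at points reached with u_b = 2 pi i s_b/(A n). Up to the constant
    p^chi(t), the monomial chi(t) takes there the value of an entry of the Fourier matrix times the
    exponential of a small correction due to the rounding of chi. Since s_b < n, the size of u is
    controlled by A alone, so one A0 serves all n. *)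
Lemma keyloc : exists (rho : R) (A0 : nat), 0 < rho /\ forall L, (forall b j, `|L b j - L0 b j| <= rho) ->
  forall (A n : nat) (chi : {ffun 'I_r -> 'I_n} -> 'I_N -> int), (0 < A)%N -> (A0 <= A)%N -> (0 < n)%N ->
  (forall t j, `|(chi t j)%:~R - A%:R * \sum_b (t b)%:R * L b j| <= 1 :> R) ->
  forall a : {ffun 'I_r -> 'I_n} -> C, I (\sum_t a t *: chp C (chi t)) -> forall t, a t = 0.
Proof.
have hf0 P : hf p P (fun _ => 0) = P.@[dblC p].
  by rewrite /hf; congr meval; congr dblC; apply: funext => j; rewrite Ce0 mulr1.
have Om0' : Om p del L0 (fun _ => 0) \in unitmx.
  rewrite unitmxE unitfE; move: Om0; congr (\det _ != 0); apply/matrixP => i b; rewrite !mxE.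
  by apply: eq_bigr => j _; rewrite hf0.
have Ip' P : I P -> hf p P (fun _ => 0) = 0 by rewrite hf0; exact: Ip.
have [rho [u0 [K [rho0 u00 K0 hE]]]] := euler p0 Ig Igen Ith Ip' Om0'.
have tau0 := tau_ge0 R.
(* b1 keeps u within u0, and b2 makes (N + 1) l at most 1/8; N + 1 in place of N bounds l itself
   also for N = 0. *)
pose b1 := tau R * r%:R / u0; pose b2 := 8 * (N%:R + 1) * (K * (tau R * r%:R)).
have b10 : 0 <= b1 by rewrite divr_ge0 ?mulr_ge0 ?ler0n // ltW.
have b20 : 0 <= b2.
  apply: mulr_ge0; first by apply: mulr_ge0; [exact: ler0n|apply: addr_ge0; [exact: ler0n|exact: ler01]].
  by apply: mulr_ge0 => //; apply: mulr_ge0 => //; exact: ler0n.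
exists rho, (Num.bound b1 + Num.bound b2)%N; split=> // L hL A n chi A0 leA n0 hchi a Ia.
have [c [c0 hc]] := hE L hL.
have AR0 : 0 < A%:R :> R by rewrite ltr0n.
have hb (x : R) m : 0 <= x -> (Num.bound x <= m)%N -> x <= m%:R.
  by move=> x0 le; apply: le_trans (ltW (archi_boundP x0)) _; rewrite ler_nat.
have hA1 : b1 <= A%:R by apply: hb => //; apply: leq_trans leA; rewrite leq_addr.
have hA2 : b2 <= A%:R by apply: hb => //; apply: leq_trans leA; rewrite leq_addl.
pose U (s : {ffun 'I_r -> 'I_n}) : 'rV[C]_r := \row_b Complex 0 (tau R * ((s b)%:R / (A%:R * n%:R))).
have nR0 : 0 < n%:R :> R by rewrite ltr0n.
have Ub s : nV (U s 0) <= tau R * r%:R / A%:R.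
  rewrite /nV -mulrA [r%:R / _]mulrC mulrA; apply: le_trans (_ : \sum_(b < r) tau R / A%:R <= _).
    apply: ler_sum => b _; rewrite mxE; apply: le_trans (nm_le _ _) _; rewrite normr0 add0r ger0_norm; last first.
      by rewrite mulr_ge0 ?divr_ge0 ?mulr_ge0 ?ler0n.
    rewrite ler_wpM2l // ler_pdivrMr ?mulr_gt0 // mulrA mulVf ?gt_eqF // mul1r ler_nat.
    exact: ltnW (ltn_ord _).
  by rewrite sumr_const card_ord mulr_natr.
have Uu s : nV (U s 0) <= u0.
  apply: le_trans (Ub s) _; rewrite ler_pdivrMr // [X in _ <= X]mulrC.
  by move: hA1; rewrite /b1 ler_pdivrMr.
pose l := K * (tau R * r%:R / A%:R).
have l0 : 0 <= l by rewrite !mulr_ge0 ?invr_ge0 ?ler0n.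
have l8 : (N%:R + 1) * l <= 1 / 8.
  rewrite /l (_ : (N%:R + 1) * _ = b2 / 8 / A%:R); last by rewrite /b2; field; rewrite gt_eqF.
  by rewrite ler_pdivrMr //; lra.
have Nl : N%:R * l <= 1 / 8 by apply: le_trans l8; rewrite mulrDl lerDl mul1r.
have l2 : l <= 1 / 2.
  have : l <= (N%:R + 1) * l by rewrite ler_peMl // lerDr.
  lra.
have [v ev] := Igen Ia.
have /choice[Bv hBv] i := hbound p (v i).
pose Bs := \sum_i Bv i.
have Bs0 : 0 <= Bs by apply: sumr_ge0 => i _; case: (hBv i).
pose pc t := \prod_j p j ^ chi t j.
have pc0 t : pc t != 0 by apply/prodf_neq0 => j _; apply: expfz_neq0.
pose a' t := a t * pc t.
(* The vanishing relation leaves only the error of the Euler polygon, and the number m of steps is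
   arbitrary. *)
have main m : dq R r n * sq a' <= 0 + (2 * (\sum_t nm (a' t)) * (dq R r n * (Bs * c))) / m.+1%:R.
  have /choice[la hla] s := hc (U s) m (Uu s).
  have las s i : nm (la s i) <= l.
    have [h _ _] := hla s; apply: le_trans (h i) _; rewrite /l ler_wpM2l //; exact: Ub.
  have := dft_perturb n0 a' (de := fun t j => (chi t j)%:~R - A%:R * \sum_b (t b)%:R * L b j) l0 Nl hchi las.
  move=> h; rewrite add0r; apply: le_trans h _; rewrite -!mulrA.
  have s0 : 0 <= \sum_t nm (a' t) by apply: sumr_ge0 => t _; exact: nm_ge0.
  rewrite ler_wpM2l // ler_wpM2l // /dq mulr_natl -sumr_const; apply: ler_sum => s _.
  have [_ hu hg] := hla s.
  have sm : small (1 / 2) (la s) by move=> j; exact: le_trans (las s j) l2.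
  rewrite [X in nm X](_ : _ = hf p (\sum_t a t *: chp C (chi t)) (la s)).
    rewrite ev hf_sum; apply: le_trans (nm_sum _ _ _) _; rewrite mulrA /Bs !mulr_suml; apply: ler_sum => i _.
    rewrite hfM nmM -[X in _ <= X]mulrA.
    exact: ler_pM (nm_ge0 _) (nm_ge0 _) ((hBv i).2 _ sm) (hg i).
  rewrite hf_sum; apply: eq_bigr => t _; rewrite hfZ /a' -!mulrA; congr (_ * _).
  rewrite /hf chp_evalC; transitivity (\prod_j (p j ^ chi t j * Ce ((chi t j)%:~R * la s j))); last first.
    by apply: eq_bigr => j _; rewrite expfzMl -CeZ.
  rewrite big_split /= -Ce_sum; congr (_ * _); rewrite (_ : om R t s = Ce (\sum_b Complex 0 (tau R * ((t b)%:R * (s b)%:R / n%:R)))).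
    rewrite -CeD; congr Ce.
    have -> : \sum_b Complex 0 (tau R * ((t b)%:R * (s b)%:R / n%:R)) = \sum_j rc (A%:R * \sum_b (t b)%:R * L b j) * la s j.
      transitivity (\sum_b rc (A%:R * (t b)%:R) * \sum_j rc (L b j) * la s j).
        apply: eq_bigr => b _; rewrite hu mxE; apply/eqP; rewrite eq_complex /= !mul0r mulr0 subr0 addr0 eqxx /=.
        apply/eqP; field; by rewrite !gt_eqF.
      rewrite (eq_bigr (fun b => \sum_j rc (A%:R * (t b)%:R * L b j) * la s j)) => [|b _]; last first.
        by rewrite mulr_sumr; apply: eq_bigr => j _; rewrite [rc (_ * L b j)]rmorphM mulrA.
      rewrite exchange_big; apply: eq_bigr => j _; rewrite -mulr_suml -rmorph_sum mulr_sumr; congr (rc _ * _).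
      by apply: eq_bigr => b _; rewrite mulrA.
    rewrite -big_split; apply: eq_bigr => j _ /=; rewrite -mulrDl rmorphB /= addrCA subrr addr0; congr (_ * _).
    by rewrite rmorph_int.
  rewrite Ce_sum; apply: eq_bigr => b _; rewrite dz_exp //; congr Ce.
  by rewrite natrM.
have sq0 : dq R r n * sq a' <= 0.
  apply: le_arch main; rewrite !mulr_ge0 ?ler0n //.
  by apply: sumr_ge0 => t _; exact: nm_ge0.
move=> t; have dq0 : 0 < dq R r n.
  by rewrite ltr0n; apply/card_gt0P; exists t.
have : sq a' <= 0 by rewrite -(ler_pM2l dq0) mulr0.
rewrite /sq (bigD1 t) //= => h.
have h2 : nm (a' t) ^+ 2 <= 0.
  by apply: le_trans h; rewrite lerDl; apply: sumr_ge0 => s _; rewrite exprn_ge0 ?nm_ge0.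
have : nm (a' t) = 0 by apply/eqP; rewrite -sqrf_eq0 eq_le h2 exprn_ge0 ?nm_ge0.
by move/nm_eq0/eqP; rewrite mulf_eq0 (negPf (pc0 t)) orbF => /eqP.
Qed.
End KeyLocal.

(** * Uniform independence of monomials *)

Lemma row_free_row0 (F : fieldType) m n t (A : 'M[F]_(m, n)) : row_free (row_mx A (0 : 'M_(m, t))) = row_free A.
Proof.
rewrite /row_free; congr (_ == _); apply/eqP; rewrite eqn_leq.
have h1 : row_mx A (0 : 'M_(m, t)) = A *m row_mx 1%:M 0 by rewrite mul_mx_row mulmx1 mulmx0.
have h2 : A = row_mx A (0 : 'M_(m, t)) *m col_mx 1%:M (0 : 'M_(t, n)).
  by rewrite mul_row_col mulmx1 mul0mx addr0.
by rewrite {1}h1 mxrankM_maxl /= {1}h2 mxrankM_maxl.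
Qed.

Lemma pkg_gen (k : numFieldType) M (I : {mpoly k[M]} -> Prop) (pk : pkg I) x :
  gen (const_of (pphi pk)) [seq pphi pk 'X_l | l <- enum 'I_M] x.
Proof.
have [P [R [R0 ->]]] := pphi_frac x.
by apply: (sfdiv (gen_sf _ (const_sf (pphi pk)))) => //; exact: phi_gen.
Qed.

Section Deg.
Variables (C : numFieldType) (sg : {rmorphism algC -> C}) (n t s : nat) (X Z : pset (n + t)) (p : point (n + t)).
Local Notation N := (n + t)%N.
Variable pk : pkg (IC sg (dset Z)).
Hypotheses (iZ : zirreducible Z) (sZX : psubset Z X) (Zp : Z p) (oap : X_re_oa X p) (dX : has_dim X s) (sn : (s <= n)%N).
Variable L : 'M[C]_(s, n).
Hypothesis fL : row_free L.
Local Notation phi := (pphi pk).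
Local Notation r := (size (pb pk)).
Let emb : {rmorphism C -> pF pk} := phi \o @mpolyC (N + N) C.

Lemma Z_torus x : Z x -> torus x. Proof. by have [cl _ _] := iZ; exact: zclosed_torus. Qed.
Lemma tor_IC j : IC sg (dset Z) ('X_(lshift N j) * 'X_(rshift N j) - 1).
Proof.
have := tor_Ik j Z_torus => /(Ik_IC sg); rewrite bcB bcM !bcX.
by rewrite (_ : bc sg _ 1 = 1) //; exact: rmorph1.
Qed.

(** A nonzero vector field killed by the forms would give, by [ax_log], m independent monomials
    whose fibre through p has a component of dimension at least e, with s < m + e: an anomalous
    subvariety through p. *)
Lemma lam_kernel (f : 'rV[pF pk]_r) :
  f *m Lam (@pd _ _ _ pk) (fun j : 'I_n => pkx pk (lshift t j)) *m (map_mx emb L)^T = 0 -> f = 0.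
Proof.
move=> ef; apply/eqP; apply: contrapT => /negP f0.
have x0 j : pkx pk j != 0 := pkx_neq0 pk tor_IC j.
have ch0 := const_char0 phi; have sK := const_sf phi.
have x0' (j : 'I_n) : pkx pk (lshift t j) != 0 by [].
have KL b j : const_of phi (map_mx emb L b j) by rewrite mxE; exists (L b j).
have fLe : row_free (map_mx emb L) by rewrite /row_free mxrank_map.
have [e [m [T [mu [fT e0 sme fmu hmu]]]]] := ax_log ch0 sK (ptower pk) (@pkg_gen _ _ _ pk) (@pderd _ _ _ pk)
  (@pdE _ _ _ pk) x0' KL fLe (ex_intro2 _ _ f f0 ef).
pose mu' : 'M[int]_(m, N) := row_mx mu 0.
have mu'0 i (j : 'I_N) : (n <= j)%N -> mu' i j = 0.
  rewrite /mu' -(splitK j); case: (split j) => k /=; first by rewrite leqNgt ltn_ord.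
  by rewrite row_mxEr mxE.
have fmu' : row_free (map_mx intr mu' : 'M[rat]_(m, N)) by rewrite map_row_mx raddf0 row_free_row0.
pose fi i := chp algC (fun j => mu' i j) - (\prod_j p j ^ mu' i j)%:MP.
have fip i : (fi i).@[dbl p] = 0 by rewrite mevalB mevalC chp_eval subrr.
have [b' tb] := tower_ex (const_of phi) [seq phi (bc sg (N + N) (fi i)) | i <- enum 'I_m].
(* The monomials are killed by the e-dimensional T, so their transcendence degree is at most r -
   e. *)
have le : (size b' + e <= r)%N.
  apply: (tower_killed ch0 sK (ptower pk) (@pkg_gen _ _ _ pk) (@pderd _ _ _ pk) (@pdE _ _ _ pk) fT tb).
  move=> _ /mapP[i _ ->] g gT.
  have [dD dK] := derivation_Dv (@pderd _ _ _ pk) g.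
  have sT : subfield (fun _ : pF pk => True) by [].
  rewrite /fi bcB rmorphB (derB sT dD) // chp_bc bcC (dK _ (ex_intro _ _ erefl)) subr0.
  rewrite chp_phi; last by move=> j; exact: pkx_inv pk tor_IC j.
  rewrite -[RHS](hmu i g gT); congr (Dv _ _ _); rewrite /monz big_split_ord /= [X in _ * X]big1 ?mulr1; last first.
    by move=> j _; rewrite /mu' row_mxEr mxE expr0z.
  by apply: eq_bigr => j _; rewrite /mu' row_mxEl.
have [Y [iY Yp cY hY]] := fibre_chain Z_torus (zirr_prime iZ) Zp fip tb le.
have [clZ _ _] := iZ.
apply: (@coset_bound n t X s Y p e m mu' dX sn iY _ Yp cY e0 sme fmu' mu'0 _ oap).
  by move=> y /hY[ty hI _]; apply: sZX; exact: zclosedE.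
by move=> i y /hY[_ _ /(_ i)] /eqP; rewrite mevalB mevalC chp_eval subr_eq0 => /eqP.
Qed.

(** The forms have rank r on the vector fields, so r of them have a nonzero determinant in the
    function field. Times a power of [pa] it is a polynomial outside the ideal, hence nonzero at
    some point of Z. *)
Lemma deg_pt : exists (h : 'I_r -> 'I_s) y, Z y /\
  \det (\matrix_(i, b) \sum_j L (h b) j * (pdel i (lshift N (lshift t j)) * 'X_(rshift N (lshift t j))).@[fun l => sg (dbl y l)]) != 0.
Proof.
pose A := Lam (@pd _ _ _ pk) (fun j : 'I_n => pkx pk (lshift t j)) *m (map_mx emb L)^T.
have fA : row_free A.
  rewrite -kermx_eq0; apply/rowV0P => f /sub_kermxP; rewrite mulmxA; exact: lam_kernel.
have rA : row_full A^T by rewrite /row_full mxrank_tr.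
have : rowsub (fullrankfun rA) A^T \in unitmx by exact: fullrowsub_unit.
move: (fullrankfun rA) => h; rewrite unitmxE unitfE -det_tr => dA.
exists h.
pose M := \matrix_(i < r, b < r) \sum_j L (h b) j *: (pdel i (lshift N (lshift t j)) * 'X_(rshift N (lshift t j))).
have : ~ IC sg (dset Z) (\det M).
  move=> /(pphiE pk); rewrite -det_map_mx => e; move/eqP: dA; apply.
  have pa0 : phi (pa pk) != 0 by apply/eqP => /(pphiE pk); exact: paN.
  have e2 : map_mx phi M = phi (pa pk) *: (rowsub h A^T)^T.
    apply/matrixP => i b; rewrite !mxE rmorph_sum mulr_sumr; apply: eq_bigr => j _.
    rewrite -mul_mpolyC !rmorphM pdelE (pkx_r pk tor_IC) !mxE -/(pkx pk _).
    rewrite -[emb _]/(phi (L (h b) j)%:MP); move: (phi _%:MP) (phi (pa pk)) (pd _ _) (pkx pk _)^-1 => u v w z.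
    by ring.
  by move: e; rewrite e2 detZ => /eqP; rewrite mulf_eq0 expf_eq0 (negPf pa0) andbF => /eqP.
move=> nI; apply: contrapT => nex; apply: nI => w [y [Zy ->]].
apply/eqP; apply: contrapT => /negP ne; apply: nex; exists y; split=> //.
move: ne; rewrite -(det_map_mx (meval _)); congr (\det _ != 0); apply/matrixP => i b.
by rewrite !mxE; apply: etrans (raddf_sum (meval _) _ _ _) _; apply: eq_bigr => j _; exact: mevalZ.
Qed.
End Deg.

Module Cluster.
Import classical_sets topology normedtype sequences.
Import numFieldNormedType.Exports.
Local Open Scope classical_set_scope.
Lemma rV_cluster (R : realType) n (u : nat -> 'I_n -> R) : (forall k j, `|u k j| <= 1) ->
  exists l : 'I_n -> R, forall e, 0 < e -> forall K, exists k, (K <= k)%N /\ forall j, `|u k j - l j| <= e.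
Proof.
move=> hu; pose v k : 'rV[R]_n := \row_j u k j.
have cA := @rV_compact R n (fun _ => `[-1, 1]) (fun _ => @segment_compact R (-1) 1).
have [|l [Al cl]] := cA (v @ \oo) _.
  exists 0%N => // k _ i; rewrite /= mxE in_itv /=.
  by have := hu k i; rewrite ler_norml.
exists (fun j => l ord0 j) => e e0 K.
have [||w [[k Kk <-] wl]] := cl [set v k | k in [set k | (K <= k)%N]] (ball l e).
- by exists K => // k /= Kk; exists k.
- exact: nbhsx_ballx.
exists k; split=> // j; have [_ wl'] := wl; have := wl' ord0 j.
by rewrite -ball_normE /= mxE distrC => /ltW.
Qed.
End Cluster.

(** Compactness in sequential form: counterexamples for larger and larger k would accumulate at a
    point of D, near which the local statement excludes them. *)
Lemma cover_unif (R : realType) (T : finType) (D : (T -> R) -> Prop) (good : (T -> R) -> nat -> Prop) :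
  (forall L, D L -> forall t, `|L t| <= 1) ->
  (forall L0, (forall e, 0 < e -> exists L, D L /\ forall t, `|L t - L0 t| <= e) -> D L0) ->
  (forall L0, D L0 -> exists rho A0, 0 < rho /\ forall L, (forall t, `|L t - L0 t| <= rho) -> forall A, (A0 <= A)%N -> good L A) ->
  exists A0, forall L, D L -> forall A, (A0 <= A)%N -> good L A.
Proof.
move=> bD clD loc; apply: contrapT => nex.
have /choice[L hL] k : exists L, D L /\ exists A, (k <= A)%N /\ ~ good L A.
  apply: contrapT => h; apply: nex; exists k => L DL A kA; apply: contrapT => ng; apply: h.
  by exists L; split=> //; exists A.
have [|l hl] := @Cluster.rV_cluster R #|T| (fun k j => L k (enum_val j)).
  by move=> k j; apply: bD; case: (hL k).
pose L0 t := l (enum_rank t).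
have hL0 e : 0 < e -> forall K, exists k, (K <= k)%N /\ forall t, `|L k t - L0 t| <= e.
  move=> e0 K; have [k [Kk h]] := hl e e0 K; exists k; split=> // t.
  by have := h (enum_rank t); rewrite enum_rankK.
have [|rho [A0 [rho0 h]]] := loc L0.
  apply: clD => e e0; have [k [_ hk]] := hL0 e e0 0%N; exists (L k); split=> //.
  by case: (hL k).
have [k [A0k hk]] := hL0 rho rho0 A0; have [_ [A [kA ng]]] := hL k.
by apply: ng; apply: (h (L k) hk); exact: leq_trans kA.
Qed.

Lemma rmorph_theta (A B : comNzRingType) (f : {rmorphism A -> B}) u u' v w z : f u' = - (f v) ^+ 2 * f u ->
  f (u * (w - v ^+ 2 * z)) = f (u * w) + f (u' * z).
Proof.
move=> e; rewrite (rmorphM f u' z) e (rmorphM f u (w - v ^+ 2 * z)) (rmorphB f) (rmorphM f (v ^+ 2)) (rmorphXn f) (rmorphM f u w).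
ring.
Qed.

Section KeyCover.
Variables (R : realType) (sg : {rmorphism algC -> R[i]}) (n t s : nat) (X Z : pset (n + t)) (p : point (n + t)).
Local Notation N := (n + t)%N.
Local Notation C := R[i].
Variable pk : pkg (IC sg (dset Z)).
Hypotheses (iZ : zirreducible Z) (sZX : psubset Z X) (Zp : Z p) (oap : X_re_oa X p) (dX : has_dim X s) (sn : (s <= n)%N).
Local Notation r := (size (pb pk)).

(** A is fixed while the box size m stays free, because m is later chosen in terms of A. *)
Definition nondeg (A : nat) (L : 'I_s -> 'I_N -> R) := exists h : 'I_r -> 'I_s,
  forall (m : nat) (chi : {ffun 'I_r -> 'I_m} -> 'I_N -> int), (0 < m)%N ->
  (forall u j, `|(chi u j)%:~R - A%:R * \sum_b (u b)%:R * L (h b) j| <= 1 :> R) ->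
  forall a : {ffun 'I_r -> 'I_m} -> C, IC sg (dset Z) (\sum_u a u *: chp C (chi u)) -> forall u, a u = 0.

(** What division by a maximal minor with columns I produces: a closed and bounded condition under
    which the rank remains s in the limit. *)
Definition normalized (I : 'I_s -> 'I_N) (L : 'I_s -> 'I_N -> R) :=
  [/\ forall b j, `|L b j| <= 1, forall b c, L b (I c) = (b == c)%:R & forall b (j : 'I_N), (n <= j)%N -> L b j = 0].

(** [theta] uses only the components on the x_j; in the function field those on the inverses agree
    with it by differentiating 1/x_j. *)
Lemma theta_IC i P : IC sg (dset Z) P -> IC sg (dset Z) (theta (fun (i : 'I_r) j => pdel i (lshift N j)) i P).
Proof.
have tI := tor_IC sg iZ.
move=> IP; have := @ptheta_ideal _ _ _ pk i P IP => /(pphiE pk) e; apply/(pphiE pk); rewrite -[RHS]e.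
rewrite /theta /ptheta !rmorph_sum.
transitivity (\sum_j (pphi pk (pdel i (lshift N j) * P^`M(lshift N j)) + pphi pk (pdel i (rshift N j) * P^`M(rshift N j)))); last first.
  by rewrite big_split [RHS]big_split_ord.
apply: eq_bigr => j _ /=.
have [dD dK] := pderd i; have sT : subfield (fun _ : pF pk => True) by [].
have e2 : pphi pk (pdel i (rshift N j)) = - (pphi pk 'X_(rshift N j)) ^+ 2 * pphi pk (pdel i (lshift N j)).
  rewrite !pdelE (pkx_r pk tI) (derV sT dD) //; last exact: (pkx_neq0 pk tI).
  have := pkx_neq0 pk tI j; rewrite /pkx; move: (pphi pk 'X_(lshift N j)) => w.
  move: (pphi pk (pa pk)) (pd i w) => u v w0.
  by field.
exact: rmorph_theta.
Qed.

Lemma nondeg_local I L0 : normalized I L0 ->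
  exists rho A0, 0 < rho /\ forall L, (forall b j, `|L b j - L0 b j| <= rho) -> forall A, (A0 <= A)%N -> nondeg A L.
Proof.
move=> [_ L0I L0n].
have In c : (I c < n)%N.
  rewrite ltnNge; apply/negP => h; have := L0I c c; rewrite L0n // eqxx => /eqP.
  by rewrite eq_sym oner_eq0.
pose L1 : 'M[C]_(s, n) := \matrix_(b, j) rc (L0 b (lshift t j)).
have fL1 : row_free L1.
  rewrite -kermx_eq0; apply/rowV0P => v /sub_kermxP e; apply/rowP => c.
  have := congr1 (fun M : 'rV_n => M 0 (Ordinal (In c))) e; rewrite !mxE => <-.
  rewrite (bigD1 c) //= big1 ?addr0 => [|b bc]; rewrite mxE.
    have -> : lshift t (Ordinal (In c)) = I c by apply: val_inj.
    by rewrite L0I eqxx rmorph1 mulr1.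
  have -> : lshift t (Ordinal (In c)) = I c by apply: val_inj.
  by rewrite L0I (negPf bc) rmorph0 mulr0.
have [h [y [Zy dy]]] := deg_pt pk iZ sZX Zp oap dX sn fL1.
have tI := tor_IC sg iZ; have hI : idl (IC sg (dset Z)) := IC_ideal sg (dset Z).
have [gs [gsI gsG]] := @noeth_mpoly C (N + N) _ hI.
have ty : torus y by exact: (Z_torus iZ).
have dE : (fun l => sg (dbl y l)) = dblC (fun j => sg (y j)).
  apply: funext => l; rewrite -(splitK l); case: (split l) => j /=.
    by rewrite dblC_l dbl_l.
  by rewrite dblC_r dbl_r fmorphV.
have [||||||rho [A0 [rho0 hk]]] := @keyloc R N (fun j => sg (y j)) _ (IC sg (dset Z)) (size gs) (fun l => gs`_l) r
   (fun i j => pdel i (lshift N j)) _ _ _ _ (fun b j => L0 (h b) j) _.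
- by move=> j; rewrite fmorph_eq0.
- by move=> l; apply: gsI; rewrite mem_nth.
- move=> P /gsG; elim.
    by exists (fun _ => 0); rewrite big1 // => l _; rewrite mul0r.
  move=> a u v us _ [w ew]; have us' : (index u gs < size gs)%N by rewrite index_mem.
  exists (fun l => (l == Ordinal us')%:R * a + w l); under eq_bigr => l _ do rewrite mulrDl.
  rewrite big_split /= -ew (bigD1 (Ordinal us')) //= eqxx mul1r nth_index // big1 ?addr0 // => l /negPf ->.
  by rewrite !mul0r.
- by move=> i P; exact: theta_IC.
- by move=> P IP; rewrite -dE; apply: IP; exists y.
- rewrite dE in dy; move: dy; congr (\det _ != 0); apply/matrixP => i b; rewrite !mxE.
  rewrite [RHS]big_split_ord /= [X in _ = _ + X]big1 ?addr0 => [|j _]; last by rewrite L0n ?rmorph0 ?mul0r //= leq_addr.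
  by apply: eq_bigr => j _; rewrite mxE.
(* The successor supplies the positivity of A required by [keyloc]. *)
exists rho, A0.+1; split=> // L hL A leA; exists h => m chi m0 hchi a Ia u.
apply: (hk (fun b j => L (h b) j)) m0 hchi a Ia u => //; last exact: ltnW.
by apply: leq_ltn_trans leA.
Qed.

Lemma nondeg_unif : exists A0, (0 < A0)%N /\ forall I L, normalized I L -> nondeg A0 L.
Proof.
have /choice[A0 hA0] (I : {ffun 'I_s -> 'I_N}) : exists A0, forall L, normalized I L -> forall A, (A0 <= A)%N -> nondeg A L.
  have [|||A0 h] := @cover_unif R ('I_s * 'I_N)%type (fun L => normalized I (fun b j => L (b, j))) (fun L A => nondeg A (fun b j => L (b, j))).
  - by move=> L [h _ _] [b j].
  - move=> L0 h; have cl (x : R) b j (f : 'I_s -> 'I_N -> R) : (forall L, normalized I (fun b j => L (b, j)) -> L (b, j) = x) -> L0 (b, j) = x.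
      move=> hx; apply/eqP; rewrite -subr_eq0 -normr_le0; apply/ler_addgt0Pr => e e0.
      have [L [nL le]] := h e e0; have := le (b, j); rewrite (hx L nL) add0r distrC.
      by [].
    split=> [b j|b c|b j nj].
    + apply/ler_addgt0Pr => e e0; have [L [[nL _ _] le]] := h e e0.
      have := le (b, j); have := nL b j; rewrite -normrN => h1 h2.
      have -> : L0 (b, j) = - (- L (b, j)) - (L (b, j) - L0 (b, j)) by rewrite opprK opprB addrC subrK.
      apply: le_trans (ler_normB _ _) _; apply: lerD => //.
      by rewrite normrN.
    + by apply: (cl _ _ _ (fun _ _ => 0)) => L [_ -> _].
    + by apply: (cl _ _ _ (fun _ _ => 0)) => L [_ _ ->].
  - move=> L0 /nondeg_local[rho [A0 [rho0 h]]]; exists rho, A0; split=> // L hL A leA.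
    by apply: h leA => b j; exact: hL.
  exists A0 => L nL A leA; have := h (fun bj => L bj.1 bj.2) _ A leA; exact.
exists (\max_I A0 I).+1; split=> // I L nL; apply: (hA0 (finfun I)); last first.
  apply: leqW; exact: (leq_bigmax (F := A0) (finfun I)).
by case: nL => h1 h2 h3; split=> // b c; rewrite ffunE.
Qed.
End KeyCover.

(** * Heights by norms and contents *)

Local Notation pQ := (map_poly (ratr : rat -> algC)).
Local Notation pZ := (map_poly (intr : int -> algC)).

Lemma Crat_polyP (q : {poly algC}) : q \is a polyOver Crat -> exists q0, q = pQ q0.
Proof.
move=> /polyOverP h; exists (map_poly getCrat q); apply/polyP => i.
rewrite coef_map coef_map_id0 /= ?getCratK //.
by rewrite -[in LHS](rmorph0 (ratr : {rmorphism rat -> algC})) ratCK.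
Qed.

Lemma pZQ (q : {poly int}) : pQ (map_poly intr q) = pZ q.
Proof. by rewrite -map_poly_comp; apply: eq_map_poly => b; rewrite /= rmorph_int. Qed.

Lemma int_Crat_poly (q : {poly algC}) : q \is a polyOver Num.int -> q \is a polyOver Crat.
Proof.
move=> /floorpP[q0 ->]; apply/polyOverP => i; rewrite coef_map /=.
by rewrite -(rmorph_int (ratr : {rmorphism rat -> algC})) Crat_rat.
Qed.

Definition fmin x : {poly algC} := (minpoly_lden x)%:R *: minCpoly x.

Lemma lden_gt0 x : (0 < minpoly_lden x)%N.
Proof.
rewrite /minpoly_lden; elim/big_ind: _ => // [a b|i _]; first by rewrite lcmn_gt0 => -> ->.
by rewrite absz_gt0 denq_neq0.
Qed.

Lemma denq_dvd (r : rat) (l k : int) : l%:~R * r = k%:~R -> (denq r %| l)%Z.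
Proof.
move=> h; have : l * numq r = k * denq r.
  apply: (intr_inj (R := rat)); rewrite !intrM numqE mulrA h.
  by [].
move=> e; have c : coprimez (denq r) (numq r) by rewrite coprimezE coprime_sym coprime_num_den.
by rewrite -(Gauss_dvdzl _ c) e dvdz_mull.
Qed.

(** If c divides all coefficients, it divides the leading one l, and l/c is still a common
    denominator; as l is the least one, c is a unit. *)
Lemma fmin_int x : exists F : {poly int}, fmin x = pZ F /\ `|zcontents F|%N = 1%N.
Proof.
have [p [ep mp] _] := minCpolyP x; set l := minpoly_lden x.
have cf i : (minCpoly x)`_i = ratr p`_i by rewrite ep coef_map.
have sp : size (minCpoly x) = size p by rewrite ep size_map_poly.
have dl i : (denq p`_i %| l%:Z)%Z.
  have [ip|ip] := ltnP i (size p); last by rewrite nth_default // dvd1z.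
  rewrite dvdzE absz_nat /l /minpoly_lden sp.
  have /dvdn_biglcmP/(_ (Ordinal ip) isT) := dvdnn (\big[lcmn/1%N]_(i < size p) absz (denq (getCrat (minCpoly x)`_i))).
  by rewrite /= cf ratCK.
have nl i : exists k : int, l%:R * p`_i = k%:~R.
  have /dvdzP[k ek] := dl i; exists (k * numq p`_i).
  rewrite -[X in _ * X]divq_num_den intrM -[l%:R]/((l%:Z)%:~R) ek intrM.
  by rewrite mulrACA [(denq _)%:~R * _]mulrC -mulrA mulVf ?mulr1 // ?intr_eq0 ?denq_neq0 // mulrC.
have [k hk] := choice nl.
pose F := \poly_(i < size p) k i; exists F.
have kF i : F`_i = k i.
  rewrite coef_poly; case: ltnP => // ip.
  by have := hk i; rewrite nth_default // mulr0 => /esym/eqP; rewrite intr_eq0 => /eqP.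
split.
  apply/polyP => i; rewrite coefZ cf coef_map kF /=.
  by rewrite -(rmorph_int (ratr : {rmorphism rat -> algC})) -hk rmorphM rmorph_nat.
set c := zcontents F.
have cd i : (c %| F`_i)%Z by have := dvdz_contents c F; rewrite dvdzz => /esym/polyOverP/(_ i).
have kl : k (size p).-1 = l.
  have := hk (size p).-1; rewrite -lead_coefE (monicP mp) mulr1 => e; apply: (intr_inj (R := rat)); rewrite -e.
  by [].
have /dvdzP[l' el] : (c %| l%:Z)%Z by rewrite -kl -kF.
have l0 : l%:Z != 0 by rewrite -[0]/(0%:Z) eqz_nat -lt0n lden_gt0.
have c0 : c != 0 by apply: contraNneq l0 => c0; rewrite el c0 mulr0.
have : (l%:Z %| l')%Z.
  rewrite dvdzE absz_nat /l /minpoly_lden; apply/dvdn_biglcmP => i _; rewrite cf ratCK -dvdzE.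
  have /dvdzP[q eq] := cd i; apply: (@denq_dvd _ _ q).
  apply: (mulfI (x := c%:~R)); first by rewrite intr_eq0.
  have -> : c%:~R * q%:~R = l%:R * p`_i by rewrite -intrM mulrC -eq kF hk.
  have -> : l%:R = l'%:~R * c%:~R :> rat by rewrite -intrM -el.
  by rewrite mulrA [c%:~R * _]mulrC.
move=> /dvdzP[q eq]; have : (q * c) * l%:Z = 1 * l%:Z by rewrite mul1r [in RHS]el eq; ring.
move=> /(mulIf l0) e; have /eqP : (`|q| * `|c| = 1)%N by rewrite -abszM e.
by rewrite muln_eq1 => /andP[_ /eqP].
Qed.

(** The content is multiplicative, and that of [fmin x] is 1. *)
Lemma gauss x q : q \is a polyOver Crat -> fmin x * q \is a polyOver Num.int -> q \is a polyOver Num.int.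
Proof.
move=> /Crat_polyP[q0 ->] /floorpP[G eG].
have [F [eF cF]] := fmin_int x; have [Q [a a0 eq]] := rat_poly_scale q0.
have e : F * Q = a *: G.
  apply: (map_inj_poly (f := intr : int -> algC)) => //; first exact: intr_inj.
  rewrite rmorphM map_polyZ /= -eG -eF eq map_polyZ /= pZQ fmorphV rmorph_int scalerAr scalerA.
  by rewrite mulfV ?scale1r // intr_eq0.
have aQ : (a %| zcontents Q)%Z.
  have : (absz (zcontents F) * absz (zcontents Q) = absz a * absz (zcontents G))%N.
    by rewrite -!abszM -zcontentsM e zcontentsZ.
  by rewrite cF mul1n => h; rewrite dvdzE h dvdn_mulr.
have /polyOverP hQ : Q \is a polyOver (dvdz a) by rewrite -dvdz_contents.
apply/polyOverP => i; rewrite eq coef_map coefZ coef_map /=.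
have /dvdzP[k ->] := hQ i; rewrite intrM mulrCA mulVf ?intr_eq0 // mulr1 rmorph_int.
exact: intr_int.
Qed.

Lemma gaussX x m q : q \is a polyOver Crat -> fmin x ^+ m * q \is a polyOver Num.int -> q \is a polyOver Num.int.
Proof.
elim: m => [|m IH] rq; first by rewrite mul1r.
rewrite exprS -mulrA => /gauss h; apply: IH => //; apply: h; apply: rpredM => //.
apply: rpredX; apply: int_Crat_poly.
by have [F [-> _]] := fmin_int x; apply/polyOverP => i; rewrite coef_map intr_int.
Qed.

Lemma fmin_polyint x : fmin x \is a polyOver Num.int.
Proof. by have [F [-> _]] := fmin_int x; apply/polyOverP => i; rewrite coef_map intr_int. Qed.

Lemma minCpoly_rat x : minCpoly x \is a polyOver Crat.
Proof. by have [p [-> _] _] := minCpolyP x; apply/polyOverP => i; rewrite coef_map Crat_rat. Qed.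

Lemma conj_minCpoly u x : root (minCpoly x) u -> minCpoly u = minCpoly x.
Proof.
have [p [-> mp] hp] := minCpolyP x; have [q [-> mq] hq] := minCpolyP u.
move=> ru; have : q %| p by rewrite -hq.
move=> qp; congr map_poly; apply/eqP; rewrite -eqp_monic // /eqp qp /=.
have := qp; rewrite dvdp_eq => /eqP e.
have : root (pQ p) x by rewrite hp.
rewrite {1}e rmorphM rootM !hp => /orP[h|//].
have q0 : p %/ q != 0 by apply: contraTneq mp => z; rewrite e z mul0r monicE lead_coef0 eq_sym oner_eq0.
have := dvdp_leq q0 h; rewrite size_divp ?monic_neq0 //.
move=> le; exfalso; move: le; apply/negP; rewrite -ltnNge ltn_subrL.
have : (1 < size q)%N by have := size_minCpoly u; have [q' [-> _] hq'] := minCpolyP u; rewrite size_map_poly => h1; apply: leq_trans h1 (dvdp_leq (monic_neq0 mq) _); rewrite -hq' -[pQ q]/(pQ q) hq.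
have : (0 < size p)%N by rewrite size_poly_gt0 monic_neq0.
by move=> ->; case: (size q) => [|[]].
Qed.

Lemma conjugatesE x : minCpoly x = \prod_(z <- conjugates x) ('X - z%:P).
Proof.
rewrite /conjugates; case: closed_field_poly_normal => r /= {1}->.
by rewrite (monicP (minCpoly_monic x)) scale1r.
Qed.

Lemma conj_power x (P : {poly algC}) n (w : 'I_n -> algC) : P \is a polyOver Crat -> P = \prod_i ('X - (w i)%:P) ->
  (forall i, root (minCpoly x) (w i)) -> exists e, P = minCpoly x ^+ e.
Proof.
move=> rP eP hw; have mP : P \is monic by rewrite eP; apply: monic_prod => i _; rewrite monicXsubC.
have hroot u : root P u -> root (minCpoly x) u.
  rewrite eP => /rootP; rewrite horner_prod => /eqP/prodf_eq0[i _].
  by rewrite hornerXsubC subr_eq0 => /eqP ->.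
have [m] := ubnP (size P); elim: m P rP mP hroot {eP} => // m IH P rP mP hroot sm.
have [s1|s1] := leqP (size P) 1.
  exists 0%N; rewrite expr0; apply/eqP.
  by have := size1_polyC s1 => e; move: mP; rewrite e monicE lead_coefC => /eqP ->.
have [u ru] : exists u, root P u by apply/closed_rootP; rewrite neq_ltn s1 orbT.
have [p0 eP] := Crat_polyP rP; have mu := conj_minCpoly (hroot u ru).
have [q [eq mq] hq] := minCpolyP u.
have qd : q %| p0 by rewrite -hq -eP.
have := qd; rewrite dvdp_eq => /eqP e.
pose P' := pQ (p0 %/ q).
have PE : P = P' * minCpoly x by rewrite eP e rmorphM /P' -mu eq.
have mP' : P' \is monic.
  by move: mP; rewrite PE !monicE lead_coefM (monicP (minCpoly_monic x)) mulr1.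
have [||||f ef] := IH P'.
- by apply/polyOverP => i; rewrite coef_map Crat_rat.
- by [].
- by move=> v rv; apply: hroot; rewrite PE rootM rv.
- move: sm; rewrite PE size_Mmonic ?monic_neq0 ?minCpoly_monic //.
  have := size_minCpoly x; have : (0 < size P')%N by rewrite size_poly_gt0 monic_neq0.
  by lia.
by exists f.+1; rewrite PE ef exprSr.
Qed.

Lemma mmap_comp (A S : comNzRingType) n k (f : {rmorphism A -> S}) (h : 'I_k -> S) (lq : n.-tuple {mpoly A[k]}) (t : {mpoly A[n]}) :
  mmap f h (t \mPo lq) = mmap f (fun i => mmap f h (tnth lq i)) t.
Proof.
elim/mpoly_alg_ind: t => [c|i|p q hp hq|p q hp hq].
- by rewrite comp_mpolyC !mmapC.
- by rewrite comp_mpolyXU mmapX mmap1U -tnth_nth.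
- exact: (etrans (congr1 (mmap f h) (rmorphD (comp_mpoly lq) p q)) (etrans (rmorphD (mmap f h) _ _) (etrans (congr2 _ hp hq) (esym (rmorphD (mmap f _) _ _))))).
- exact: (etrans (congr1 (mmap f h) (rmorphM (comp_mpoly lq) p q)) (etrans (rmorphM (mmap f h) _ _) (etrans (congr2 _ hp hq) (esym (rmorphM (mmap f _) _ _))))).
Qed.

(** * Norms of polynomials over a number field *)

Section Conj.
Variable th : algC.
Let cs := conjugates th.
Let D := size cs.
Definition thi (i : 'I_(size (conjugates th))) := nth 0 (conjugates th) i.
(** Elements of Q(th) are represented by rational polynomials, and [tau i] is the i-th embedding
    read on representatives. *)
Definition tau i : {rmorphism {poly rat} -> algC} := horner_eval (thi i) \o pQ.

Lemma tauE i P : tau i P = (pQ P).[thi i]. Proof. by []. Qed.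
Lemma thi_root i : root (minCpoly th) (thi i).
Proof. by rewrite conjugatesE root_prod_XsubC mem_nth. Qed.
Lemma th_ex : exists i0, thi i0 = th.
Proof.
have : th \in conjugates th by rewrite -root_prod_XsubC -conjugatesE root_minCpoly.
by move=> h; have := h; rewrite -index_mem => h'; exists (Ordinal h'); rewrite /thi /= nth_index.
Qed.
Lemma tau_eq0 i j P : (tau i P == 0) = (tau j P == 0).
Proof.
suff h k : (tau k P == 0) = root (pQ P) th by rewrite !h.
have [p [ep _] ->] := minCpolyP th; have [q [eq _] hq] := minCpolyP (thi k).
rewrite tauE -/(root (pQ P) (thi k)) hq; congr (_ %| _).
by apply: (map_poly_inj (ratr : {rmorphism rat -> algC})); rewrite -eq -ep (conj_minCpoly (thi_root k)).
Qed.

(** The product is symmetric in the conjugates of [th], hence a polynomial in their elementary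
    symmetric functions, which are rational. *)
Lemma norm_rat (g : {poly {poly rat}}) : \prod_i map_poly (tau i) g \is a polyOver Crat.
Proof.
pose iota : {rmorphism {poly rat} -> {poly algC}} := pQ.
(* Exchanging the two variables turns the embedding into evaluation at the constant polynomial
   [v i], so that one symmetric polynomial over [{poly rat}] expresses the norm. *)
pose g' := swapXY g; pose v i := (thi i)%:P.
have e1 i : map_poly (tau i) g = (map_poly iota g').[v i].
  rewrite /v horner_polyC swapXY_map swapXYK -map_poly_comp.
  by apply: eq_map_poly.
pose q : {mpoly {poly rat}[size (conjugates th)]} := \prod_i (map_poly (@mpolyC _ _) g').['X_i].
have -> : \prod_i map_poly (tau i) g = mmap iota v q.
  rewrite (rmorph_prod (mmap iota v)); apply: eq_bigr => i _.
  rewrite e1 -[RHS]horner_map /= mmapX mmap1U -map_poly_comp; congr (_.[_]).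
  by apply: eq_map_poly => c /=; rewrite mmapC.
have sq : q \is symmetric.
  apply/issymP => s; rewrite (rmorph_prod (msym s)) /q [RHS](reindex_inj (@perm_inj _ s)) /=.
  apply: eq_bigr => i _; rewrite -[LHS]horner_map /= -map_poly_comp.
  have -> : msym s 'X_i = 'X_(s i) :> {mpoly {poly rat}[_]} by rewrite /msym mmapX mmap1U.
  by congr (_.[_]); apply: eq_map_poly => c /=; rewrite /msym mmapC.
have [t [<- _]] := sym_fundamental sq; rewrite mmap_comp.
have hS i : mmap iota v (tnth [tuple mesym (size (conjugates th)) {poly rat} i0.+1 | i0 < size (conjugates th)] i) \is a polyOver Crat.
  rewrite tnth_mktuple mesymE (rmorph_sum (mmap iota v)).
  have -> : \sum_(h : {set 'I_(size (conjugates th))} | #|h| == i.+1) mmap iota v 'X_[mesym1 h] = ((mesym (size (conjugates th)) algC i.+1).@[thi])%:P.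
    rewrite mesymE (raddf_sum (meval _)) rmorph_sum; apply: eq_bigr => h _.
    rewrite mmapX -[RHS]/((meval thi 'X_[mesym1 h])%:P) mevalX rmorph_prod /=; apply: eq_bigr => j _.
    by rewrite rmorphXn.
  rewrite polyOverC.
  have := mroots_coeff (in_tuple (conjugates th)) (inord i.+1).
  rewrite inordK ?ltnS // => h.
  have -> : (mesym (size (conjugates th)) algC i.+1).@[thi] = (-1) ^+ i.+1 * (minCpoly th)`_(size (conjugates th) - i.+1).
    rewrite conjugatesE; move: h => /= ->; rewrite mulrA -exprMn mulrNN mulr1 expr1n mul1r.
    by apply: meval_eq => j; rewrite (tnth_nth 0).
  by apply: rpredM; [apply: rpredX; rewrite rpredN rpred1|have /polyOverP := minCpoly_rat th; apply].
move: hS; set w := fun i => mmap iota v _ => hS.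
elim/mpoly_alg_ind: t => [c|i|p1 p2 h1 h2|p1 p2 h1 h2].
- by rewrite mmapC; apply/polyOverP => k; rewrite coef_map Crat_rat.
- by rewrite mmapX mmap1U; exact: hS.
- by rewrite rmorphD; apply: rpredD.
- by rewrite rmorphM; apply: rpredM.
Qed.

Lemma norm_int (g : {poly {poly rat}}) : (forall i, map_poly (tau i) g \is a polyOver Aint) ->
  \prod_i map_poly (tau i) g \is a polyOver Num.int.
Proof.
move=> h; have /polyOverP r := norm_rat g.
have /polyOverP a : \prod_i map_poly (tau i) g \is a polyOver Aint by apply: rpred_prod => i _; exact: h.
by apply/polyOverP => k; apply: Cint_rat_Aint.
Qed.
End Conj.

Lemma rep_ex (T : finType) (f : T -> algC) : exists th (rep : T -> {poly rat}), forall t, (pQ (rep t)).[th] = f t.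
Proof.
have [th _ [ps e]] := algC_PET [seq f t | t <- enum T].
exists th, (fun t => nth 0 ps (enum_rank t)) => t.
have sz : size ps = #|T| by have := congr1 size e; rewrite (size_map f) (size_map (fun p => (pQ p).[th])) -cardT => ->.
have := congr1 (fun s => nth 0 s (enum_rank t)) e.
rewrite /= (nth_map 0) ?sz ?ltn_ord // => <-.
by rewrite (nth_map t) -?cardT ?ltn_ord // nth_enum_rank.
Qed.

(** * Integrality and the fractional ideals (1, x) *)

Lemma Aint_eigen d (A : 'M[int]_d) (u : 'rV[algC]_d) c : u != 0 -> u *m map_mx intr A = c *: u -> c \in Aint.
Proof.
move=> u0 e; apply: (@root_monic_Aint (map_poly intr (char_poly A))).
- by rewrite map_char_poly -eigenvalue_root_char; apply/eigenvalueP; exists u.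
- by apply: monic_map; exact: char_poly_monic.
- by apply/polyOverP => i; rewrite coef_map intr_int.
Qed.

(** By synthetic division, a coefficient of h maps the Z-module spanned by 1, x, ..., x^(d-1) into
    itself, and an eigenvalue of an integer matrix is integral. When F is primitive these
    coefficients generate the inverse of the fractional ideal (1, x). *)
Lemma fac_Aint (F h : {poly algC}) x : F \is a polyOver Num.int -> F = h * ('X - x%:P) ->
  forall k, h`_k \in Aint /\ h`_k * x \in Aint.
Proof.
move=> /polyOverP iF eF.
have hk k : h`_k * x = (if k is k'.+1 then h`_k' else 0) - F`_k.
  by rewrite eF mulrBr coefB coefMX coefMC; case: k => [|k] /=; ring.
have hA k : h`_k \in Aint; last first.
  by split=> //; rewrite hk; apply: rpredB; [case: k => [|k]; rewrite ?rpred0|apply: Aint_Cint].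
have [->|h0] := eqVneq h 0; first by rewrite coef0 rpred0.
pose d := size h.
have d0 : (0 < d)%N by rewrite size_poly_gt0.
pose M y := exists P : {poly int}, (size P <= d)%N /\ y = (pZ P).[x].
have M0 : M 0 by exists 0; rewrite size_poly0 rmorph0 horner0.
have MD y z : M y -> M z -> M (y + z).
  move=> [P [sP ->]] [Q [sQ ->]]; exists (P + Q); rewrite rmorphD hornerD; split=> //.
  by apply: leq_trans (size_polyD _ _) _; rewrite geq_max sP.
have MX c i : c \is a Num.int -> (i < d)%N -> M (c * x ^+ i).
  move=> /intrP[a ->] id; exists (a *: 'X^i); rewrite map_polyZ /= map_polyXn hornerZ hornerXn; split=> //.
  by apply: leq_trans (size_scale_leq _ _) _; rewrite size_polyXn.
have MXN c i : c \is a Num.int -> (i < d)%N -> M (- c * x ^+ i) by move=> ic; apply: MX; rewrite rpredN.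
have up i j : (i <= j)%N -> M (x ^+ i * h`_j).
  have [m] := ubnP (d - j); elim: m i j => // m IH i j lt ij.
  have [dj|jd] := leqP d j; first by rewrite nth_default // mulr0.
  have -> : x ^+ i * h`_j = F`_j.+1 * x ^+ i + x ^+ i.+1 * h`_j.+1.
    by rewrite exprS -mulrA mulrCA [x * _]mulrC hk; ring.
  apply: MD; first by apply: MX => //; exact: leq_ltn_trans jd.
  by apply: IH => //; move: lt jd; clear; lia.
have dn i j : (j < i)%N -> (i <= d)%N -> M (x ^+ i * h`_j).
  elim: j i => [|j IH] [|i] // ji id.
    have -> : x ^+ i.+1 * h`_0 = - F`_0 * x ^+ i by rewrite exprSr -mulrA [x * _]mulrC hk; ring.
    exact: MXN.
  have -> : x ^+ i.+1 * h`_j.+1 = x ^+ i * h`_j + - F`_j.+1 * x ^+ i by rewrite exprSr -mulrA [x * _]mulrC hk; ring.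
  by apply: MD; [apply: IH => //; exact: ltnW|exact: MXN].
have /choice[P hP] (i : 'I_d) : exists P : {poly int}, (size P <= d)%N /\ x ^+ i * h`_k = (pZ P).[x].
  by case: (leqP i k) => h'; [exact: up|apply: dn => //; exact: ltnW].
apply: (@Aint_eigen d (\matrix_(j, i) (P i)`_j) (\row_j x ^+ j)).
  by apply/eqP => /rowP/(_ (Ordinal d0)); rewrite !mxE expr0 => /eqP; rewrite oner_eq0.
apply/rowP => i; rewrite !mxE; have [sP e] := hP i; rewrite mulrC e.
rewrite (@horner_coef_wide _ d); last by apply: leq_trans sP; exact: size_poly.
by apply: eq_bigr => j _; rewrite !mxE coef_map mulrC.
Qed.

Lemma Aint_root u n : (0 < n)%N -> u ^+ n \in Aint -> u \in Aint.
Proof.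
move=> n0 h; have sX : (1 < size ('X^n : {poly algC}))%N by rewrite size_polyXn ltnS.
apply: (@root_monic_Aint (minCpoly (u ^+ n) \Po 'X^n)).
- by rewrite /root horner_comp hornerXn; exact: root_minCpoly.
- by rewrite monicE lead_coef_comp // (monicP (minCpoly_monic _)) lead_coefXn expr1n mulr1.
- by apply: polyOver_comp => //; apply: rpredX; rewrite polyOverX.
Qed.

(** Membership of c in the inverse of the fractional ideal (1, x). *)
Definition good x c := c \in Aint /\ c * x \in Aint.
(** Membership of w in the product of the squares of the ideals (1, x_j), tested against pairs of
    elements of each inverse ideal. *)
Fixpoint adm N (x : 'I_N -> algC) (l : seq 'I_N) (w : algC) : Prop :=
  if l is j :: l' then forall c c', good (x j) c -> good (x j) c' -> adm x l' (c * c' * w) else w \in Aint.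

Section Adm.
Variables (N : nat) (x : 'I_N -> algC).
Lemma admD l w w' : adm x l w -> adm x l w' -> adm x l (w + w').
Proof.
elim: l w w' => [|j l IH] w w' /=; first exact: rpredD.
by move=> h h' c c' gc gc'; rewrite mulrDr; apply: IH; [exact: h|exact: h'].
Qed.
Lemma admZ l a w : a \in Aint -> adm x l w -> adm x l (a * w).
Proof.
move=> aA; elim: l w => [|j l IH] w /=; first exact: rpredM.
by move=> h c c' gc gc'; rewrite mulrCA; apply: IH; exact: h.
Qed.
Lemma adm0 l : adm x l 0.
Proof. by elim: l => [|j l IH] /=; [exact: rpred0|move=> c c' _ _; rewrite mulr0]. Qed.
Lemma adm_sum l (T : Type) (r : seq T) (P : pred T) F : (forall t, P t -> adm x l (F t)) -> adm x l (\sum_(t <- r | P t) F t).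
Proof. by move=> h; elim/big_ind: _ => //; [exact: adm0|exact: admD]. Qed.

Lemma adm_poly l (p : 'I_N -> {poly algC}) (a : {poly algC}) : (forall j k, good (x j) (p j)`_k) ->
  (forall k, adm x l a`_k) -> (\prod_(j <- l) (p j ^+ 2)) * a \is a polyOver Aint.
Proof.
move=> hp; elim: l a => [|j l IH] a ha; first by rewrite big_nil mul1r; apply/polyOverP.
rewrite big_cons mulrAC mulrC; apply: IH => k.
rewrite expr2 -mulrA mulrC coefM -/(_ * _); apply: adm_sum => i _.
rewrite mulrC coefM mulr_sumr; apply: adm_sum => i' _ /=.
rewrite mulrA; apply: ha; exact: hp.
Qed.

(** The d-th power of c c' w is integral at x_j: its exponent there, at most 2 d, is shared between
    d factors c and d factors c'. *)
Lemma adm_pow l d (u w : algC) (e : 'I_N -> nat) : (0 < d)%N -> u \in Aint -> (forall j, (e j <= d + d)%N) ->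
  w ^+ d = u * \prod_(j <- l) x j ^+ e j -> adm x l w.
Proof.
move=> d0; elim: l u w => [|j l IH] u w uA he; first by rewrite big_nil mulr1 => h; apply: (Aint_root d0); rewrite h.
rewrite big_cons => h c c' [cA cx] [cA' cx'].
apply: (IH (u * ((c * c') ^+ d * x j ^+ e j))) => //; last first.
  by rewrite exprMn h; ring.
apply: rpredM => //; have [ed|de] := leqP (e j) d.
  have -> : (c * c') ^+ d * x j ^+ e j = c ^+ (d - e j) * c' ^+ d * (c * x j) ^+ e j.
    have ec : c ^+ d = c ^+ (d - e j) * c ^+ e j by rewrite -exprD subnK.
    by rewrite !exprMn ec; ring.
  by rewrite !rpredM ?rpredX.
have -> : x j ^+ e j = x j ^+ d * x j ^+ (e j - d) by rewrite -exprD subnKC // ltnW.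
have ed : (e j - d <= d)%N by rewrite leq_subLR.
have -> : (c * c') ^+ d * (x j ^+ d * x j ^+ (e j - d)) = (c * x j) ^+ d * ((c' * x j) ^+ (e j - d) * c' ^+ (d - (e j - d))).
  have ec : c' ^+ d = c' ^+ (e j - d) * c' ^+ (d - (e j - d)) by rewrite -exprD subnKC.
  by rewrite !exprMn ec; ring.
by rewrite !rpredM ?rpredX.
Qed.
End Adm.

Arguments tau : simpl never.

Lemma max1E (u : algC) : 0 <= u -> Num.max 1 u = if 1 < u then u else 1.
Proof. by rewrite /Num.max. Qed.
Lemma max1_ge1 (u : algC) : 0 <= u -> 1 <= Num.max 1 u.
Proof. by move=> u0; rewrite max1E //; case: ifP => // /ltW. Qed.
Lemma max1_ge (u : algC) : 0 <= u -> u <= Num.max 1 u.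
Proof.
move=> u0; rewrite max1E //; case: ifP => // /negbT.
by rewrite real_ltNge ?negbK ?real1 ?ger0_real.
Qed.
Lemma max1X (u : algC) k : 0 <= u -> (0 < k)%N -> Num.max 1 (u ^+ k) = Num.max 1 u ^+ k.
Proof.
move=> u0 k0; rewrite !max1E ?exprn_ge0 //; have [u1|u1] := boolP (1 < u).
  by have -> : 1 < u ^+ k by rewrite exprn_egt1 // -lt0n.
have u1' : u <= 1 by move: u1; rewrite real_ltNge ?negbK ?real1 ?ger0_real.
by rewrite expr1n ifF //; apply/le_gtF/exprn_ile1.
Qed.

Lemma root_bound (b : nat -> algC) L y : \sum_(l < L.+1) b l * y ^+ l = 0 ->
  `|b L| * Num.max 1 `|y| <= \sum_(l < L.+1) `|b l|.
Proof.
rewrite max1E //; case: ifP => [y1|_ _]; last first.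
  by rewrite mulr1 big_ord_recr /= lerDr sumr_ge0.
case: L => [|L]; first by rewrite big_ord1 expr0 mulr1 => ->; rewrite normr0 mul0r sumr_ge0.
rewrite big_ord_recr /= addrC => /eqP; rewrite addr_eq0 => /eqP e.
have y0 : 0 < `|y| ^+ L by rewrite exprn_gt0 // (lt_trans ltr01).
rewrite -(ler_pM2r y0) -mulrA -exprS -normrX -normrM e normrN.
apply: le_trans (ler_norm_sum _ _ _) _.
rewrite [X in _ <= X * _]big_ord_recr /= mulrDl; apply: ler_wpDr; first by rewrite mulr_ge0 // ltW.
rewrite mulr_suml; apply: ler_sum => l _; rewrite normrM normrX ler_wpM2l //.
by apply: ler_weXn2l; [exact: ltW|rewrite -ltnS].
Qed.

Lemma mult_height_gt0 x : 0 < mult_height x.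
Proof.
rewrite /mult_height rootC_gt0; last by rewrite -ltnS prednK ?size_minCpoly // ltnW ?size_minCpoly.
rewrite mulr_gt0 ?ltr0n ?lden_gt0 //; apply: prodr_gt0 => z _.
by apply: lt_le_trans ltr01 _; exact: max1_ge1.
Qed.

Lemma big_nseq_flatten (s : seq algC) e (f : algC -> algC) :
  \prod_(z <- flatten (nseq e s)) f z = (\prod_(z <- s) f z) ^+ e.
Proof. by elim: e => [|e IH]; rewrite /= ?big_nil // big_cat IH exprS. Qed.

Lemma gauss_prod (T : Type) (l : seq T) (x : T -> algC) (m : T -> nat) q : q \is a polyOver Crat ->
  (\prod_(j <- l) fmin (x j) ^+ m j) * q \is a polyOver Num.int -> q \is a polyOver Num.int.
Proof.
elim: l q => [|j l IH] q rq; first by rewrite big_nil mul1r.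
rewrite big_cons -mulrA => /gaussX h; apply: IH => //; apply: h; apply: rpredM => //.
by apply: rpred_prod => i _; apply: rpredX; apply: int_Crat_poly; exact: fmin_polyint.
Qed.

Lemma fmin_neq0 x : fmin x != 0.
Proof. by rewrite /fmin scaler_eq0 negb_or pnatr_eq0 -lt0n lden_gt0 minCpoly_eq0. Qed.

(** * Finite and infinite parts of the height *)

Section Reps.
Variable th : algC.
Let D := size (conjugates th).
Definition rval (P : {poly rat}) := (pQ P).[th].
Definition ex x := (D %/ (size (minCpoly x)).-1)%N.
(** The non-archimedean part of the D-th power of the height, as [ht_pow] shows. *)
Definition ell x : algC := (minpoly_lden x)%:R ^+ ex x.
Local Notation tau := (tau (th := th)).

Lemma rval_eq0 i P : (rval P == 0) = (tau i P == 0).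
Proof. by have [i0 e0] := th_ex th; rewrite (tau_eq0 i i0) tauE e0. Qed.
Lemma tau_transfer i P Q : rval P = rval Q -> tau i P = tau i Q.
Proof.
move=> e; apply/eqP; rewrite -subr_eq0 -rmorphB -rval_eq0 /rval rmorphB hornerD hornerN.
by rewrite -/(rval P) -/(rval Q) e subrr.
Qed.
Lemma D_gt0 : (0 < D)%N.
Proof. by have [[i ilt] _] := th_ex th; exact: leq_ltn_trans ilt. Qed.

Lemma tau_root i X : root (minCpoly (rval X)) (tau i X).
Proof.
have [p [ep _] hp] := minCpolyP (rval X).
have hc y : (pQ p).[(pQ X).[y]] = (pQ (p \Po X)).[y] by rewrite map_comp_poly horner_comp.
rewrite ep /root tauE hc -tauE -rval_eq0 /rval -hc -ep; exact: root_minCpoly.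
Qed.
Lemma tau_conj i X : minCpoly (tau i X) = minCpoly (rval X).
Proof. by apply: conj_minCpoly; exact: tau_root. Qed.

Lemma map_tauX i X : map_poly (tau i) ('X - X%:P) = 'X - (tau i X)%:P.
Proof. by rewrite rmorphB /= map_polyX map_polyC. Qed.

Lemma P_pow X : \prod_i ('X - (tau i X)%:P) = minCpoly (rval X) ^+ ex (rval X) /\
  ((size (minCpoly (rval X))).-1 * ex (rval X) = D)%N.
Proof.
have rP : \prod_i ('X - (tau i X)%:P) \is a polyOver Crat.
  by under eq_bigr => i _ do rewrite -map_tauX; exact: norm_rat.
have [e ee] := conj_power rP erefl (fun i => tau_root i X).
have := congr1 (fun p : {poly algC} => (size p).-1) ee.
have -> : size (\prod_i ('X - (tau i X)%:P)) = D.+1.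
  by rewrite size_prod_XsubC -sum1_size (eq_bigl (mem 'I_D)) // sum1_card card_ord.
rewrite size_exp => eD0; have {eD0}eD : D = ((size (minCpoly (rval X))).-1 * e)%N := eD0.
have s0 : (0 < (size (minCpoly (rval X))).-1)%N by rewrite -ltnS prednK ?size_minCpoly // ltnW ?size_minCpoly.
have -> : ex (rval X) = e by rewrite /ex -/D eD mulKn.
by rewrite -eD.
Qed.

Lemma ell_gt0 x : 0 < ell x. Proof. by rewrite exprn_gt0 // ltr0n lden_gt0. Qed.

Lemma ell_P X : ell (rval X) *: \prod_i ('X - (tau i X)%:P) = fmin (rval X) ^+ ex (rval X).
Proof. by rewrite (P_pow X).1 /fmin exprZn. Qed.

Lemma ht_pow X : mult_height (rval X) ^+ D = ell (rval X) * \prod_i Num.max 1 `|tau i X|.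
Proof.
have [eP eD] := P_pow X; have D0 := D_gt0.
have s0 : (0 < (size (minCpoly (rval X))).-1)%N by rewrite -ltnS prednK ?size_minCpoly // ltnW ?size_minCpoly.
rewrite -{1}eD exprM /mult_height rootCK // exprMn; congr (_ * _).
rewrite -(big_nseq_flatten _ _ (fun z => Num.max 1 `|z|)).
rewrite -(big_map (fun i => tau i X) predT (fun z => Num.max 1 `|z|)); apply: perm_big.
rewrite perm_sym; apply: prod_XsubC_eq.
rewrite big_map eP conjugatesE.
by elim: (ex _) => [|e IH]; rewrite /= ?big_nil // big_cat -IH exprS.
Qed.

Lemma quot_ex (g : {poly {poly rat}}) X : (forall i, root (map_poly (tau i) g) (tau i X)) ->
  exists q, forall i, map_poly (tau i) g = map_poly (tau i) q * ('X - (tau i X)%:P).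
Proof.
move=> hr; have : root (g - (g.[X])%:P) X by rewrite /root hornerD hornerN hornerC subrr.
move=> /factor_theorem[q eq]; exists q => i; rewrite -map_tauX -rmorphM -eq; apply: etrans (esym (rmorphB _ _ _)).
have e3 : map_poly (tau i) (g.[X])%:P = (tau i g.[X])%:P by exact: map_polyC.
have e2 : tau i g.[X] = 0 by rewrite -(horner_map (tau i)); apply/rootP; exact: hr.
by rewrite [X in _ = _ - X]e3 e2 polyC0 subr0.
Qed.

(** The cofactor of X - x in [fmin] has coefficients in the inverse of (1, x), and its norm is a
    constant times a power of [fmin]. Multiplication by it removes denominators, and Gauss' lemma
    then removes [fmin]. *)
Lemma hq X : exists h : {poly {poly rat}}, (forall i, map_poly (tau i) h * ('X - (tau i X)%:P) = fmin (rval X)) /\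
  \prod_i map_poly (tau i) h = ell (rval X) *: fmin (rval X) ^+ (D - ex (rval X)).
Proof.
have [p [ep _] _] := minCpolyP (rval X).
pose F0 := (minpoly_lden (rval X))%:R *: p.
have eF : fmin (rval X) = pQ F0 by rewrite map_polyZ /= rmorph_nat -ep.
have mF i : map_poly (tau i) (map_poly polyC F0) = fmin (rval X).
  rewrite eF -map_poly_comp; apply: eq_map_poly => c /=.
  by rewrite /horner_eval map_polyC hornerC.
have [i|q eq] := @quot_ex (map_poly polyC F0) X.
  by rewrite mF /root hornerZ (rootP (tau_root i X)) mulr0.
exists q; split=> [i|]; first by rewrite -eq mF.
have [eP eD] := P_pow X.
have leD : (ex (rval X) <= D)%N.
  rewrite -[X in (_ <= X)%N]eD leq_pmull // -ltnS prednK ?size_minCpoly // ltnW ?size_minCpoly //.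
apply: (mulIf (expf_neq0 (ex (rval X)) (fmin_neq0 (rval X)))).
rewrite -scalerAl -exprD subnK // -{1}ell_P -scalerAr -big_split /=; congr (_ *: _).
rewrite (eq_bigr (fun _ => fmin (rval X))) => [|i _]; last by rewrite -eq mF.
by rewrite prodr_const card_ord.
Qed.

(** With h the cofactor for Z^k, the products of its coefficients with Z^l for l up to k are
    integral, hence so is h (X - Z)^k. Taking norms and removing powers of [fmin] twice leaves the
    constant ell(Z^k)/ell(Z)^k, a positive integer. *)
Lemma ell_pow Z k : (0 < k)%N -> ell (rval Z) ^+ k <= ell (rval (Z ^+ k)).
Proof.
move=> k0; set Y := Z ^+ k; have [h [hh Nh]] := hq Y.
have PkQ : (\prod_i ('X - (tau i Z)%:P)) ^+ k \is a polyOver Crat.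
  by apply: rpredX; rewrite (P_pow Z).1; apply: rpredX; exact: minCpoly_rat.
have cR n : n%:R \in Crat by rewrite rpred_nat.
have : \prod_i map_poly (tau i) (h * ('X - Z%:P) ^+ k) \is a polyOver Num.int.
  apply: norm_int => i; rewrite rmorphM rmorphXn /= map_tauX.
  pose B m (p : {poly algC}) := forall j l, (l <= m)%N -> p`_j * (tau i Z) ^+ l \in Aint.
  have Bk : B k (map_poly (tau i) h).
    move=> j l lk; have [cA cy] := fac_Aint (fmin_polyint (rval Y)) (esym (hh i)) j.
    apply: (Aint_root k0); rewrite exprMn -exprM mulnC exprM -[k in _ ^+ k * _](subnK lk) exprD -mulrA -exprMn.
    by rewrite rpredM ?rpredX //; move: cy; rewrite /Y rmorphXn.
  have step m (p : {poly algC}) : B m.+1 p -> B m (p * ('X - (tau i Z)%:P)).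
    move=> hB j l lm; rewrite mulrBr coefB coefMX coefMC mulrBl -mulrA -exprS.
    apply: rpredB; last exact: hB.
    by case: j => [|j] /=; rewrite ?mul0r ?rpred0 // hB // leqW.
  have : B 0%N (map_poly (tau i) h * ('X - (tau i Z)%:P) ^+ k).
    elim: (k) (map_poly _ h) Bk => [|m IH] p hB; first by rewrite mulr1.
    by rewrite exprS mulrA; apply: IH; exact: step.
  by move=> hB; apply/polyOverP => j; have := hB j 0%N (leqnn _); rewrite expr0 mulr1.
rewrite (eq_bigr (fun i => map_poly (tau i) h * ('X - (tau i Z)%:P) ^+ k)) => [|i _]; last first.
  by rewrite rmorphM rmorphXn /= map_tauX.
rewrite big_split /= prodrXl Nh -scalerAl scalerAr => /gaussX h1.
have {h1}h1 : ell (rval Y) *: (\prod_i ('X - (tau i Z)%:P)) ^+ k \is a polyOver Num.int.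
  by apply: h1; rewrite -mul_polyC; apply: rpredM => //; rewrite polyOverC rpredX.
have ez := ell_gt0 (rval Z); have ey := ell_gt0 (rval Y).
have : (ell (rval Y) / ell (rval Z) ^+ k)%:P \is a polyOver Num.int.
  apply: (@gaussX (rval Z) (ex (rval Z) * k)).
    by rewrite polyOverC rpred_div // ?rpredX.
  rewrite exprM -ell_P exprZn mulrC mul_polyC scalerA divfK // gt_eqF // exprn_gt0 //.
rewrite polyOverC => iq.
have q0 : 0 < ell (rval Y) / ell (rval Z) ^+ k by rewrite divr_gt0 // exprn_gt0.
have := norm_intr_ge1 iq (lt0r_neq0 q0).
rewrite gtr0_norm // => h2.
have := ler_pdivlMr 1 (ell (rval Y)) (exprn_gt0 k ez).
by rewrite h2 mul1r => <-.
Qed.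
End Reps.

(** Finite and infinite places are bounded separately and meet in the top nonzero coefficient b_L.
    The norm of the relation, made integral by the cofactors of the x_j, is divisible by that of X -
    z^kap, which bounds the finite part of the height of z^kap; at each embedding b_L times the size
    of the root is at most the sum of the coefficients. *)
Lemma height_rel N J (T : finType) (a : 'I_J.+1 -> T -> algC) : (forall l t, a l t \in Aint) ->
  forall (x : 'I_N -> algC) (z : algC) (W : T -> algC) kap d (e : T -> 'I_N -> nat), (0 < kap)%N -> (0 < d)%N ->
  (forall t j, (e t j <= d + d)%N) -> (forall t, W t ^+ d = \prod_j x j ^+ e t j) ->
  \sum_l (\sum_t a l t * W t) * z ^+ (kap * l) = 0 -> (exists l, \sum_t a l t * W t != 0) ->
  mult_height z ^+ kap <= (\sum_l \sum_t \sum_(u <- conjugates (a l t)) `|u|) * \prod_j mult_height (x j) ^+ 2.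
Proof.
move=> aA x z W kap d e k0 d0 he hW rel nz.
pose f (s : ('I_N + unit) + (T + 'I_J.+1 * T)) := match s with
  inl (inl j) => x j | inl (inr _) => z | inr (inl t) => W t | inr (inr (l, t)) => a l t end.
have [th [rep hrep]] := rep_ex f; set D := size (conjugates th).
pose X j := rep (inl (inl j)); pose Z := rep (inl (inr tt)); pose Wr t := rep (inr (inl t)).
pose Ar l t := rep (inr (inr (l, t))).
have xE j : rval th (X j) = x j by exact: hrep. have zE : rval th Z = z by exact: hrep.
have WE t : rval th (Wr t) = W t by exact: hrep. have aE l t : rval th (Ar l t) = a l t by exact: hrep.
pose rv : {rmorphism {poly rat} -> algC} := horner_eval th \o map_poly (ratr : rat -> algC).
have rvE P : rval th P = rv P by [].
pose br l := \sum_t Ar l t * Wr t.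
have brE l : rval th (br l) = \sum_t a l t * W t.
  by rewrite rvE (rmorph_sum rv); apply: eq_bigr => t _; rewrite rmorphM -!rvE aE WE.
have [l0 l0P] : exists l, rval th (br l) != 0 by have [l hl] := nz; exists l; rewrite brE.
(* Vanishing is the same at all embeddings, so one top index L serves every conjugate of the
   relation. *)
have [L [LP Lmax]] : exists L, rval th (br L) != 0 /\ forall l, rval th (br l) != 0 -> (l <= L)%N.
  exists (arg_max l0 (fun l => rval th (br l) != 0) (@nat_of_ord _)).
  by case: arg_maxnP => // l.
pose bn (l : nat) : {poly rat} := br (inord l).
have bnE (l : 'I_J.+1) : bn l = br l by rewrite /bn inord_val.
pose g : {poly {poly rat}} := \poly_(l < L.+1) bn l.
pose tau (i : 'I_(size (conjugates th))) : {rmorphism {poly rat} -> algC} := tau i.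
have tM i P Q : tau i (P * Q) = tau i P * tau i Q by exact: rmorphM.
have tX i P k : tau i (P ^+ k) = tau i P ^+ k by exact: rmorphXn.
have tS i (K : finType) (F : K -> {poly rat}) : tau i (\sum_k F k) = \sum_k tau i (F k) by exact: rmorph_sum.
have tP i (K : finType) (F : K -> {poly rat}) : tau i (\prod_k F k) = \prod_k tau i (F k) by exact: rmorph_prod.
pose b (i : 'I_(size (conjugates th))) l := tau i (bn l).
have gE i : map_poly (tau i) g = \poly_(l < L.+1) b i l.
  apply/polyP => l; rewrite coef_map !coef_poly; case: ifP => // _; exact: rmorph0.
have bL i : b i L != 0 by rewrite /b bnE -rval_eq0.
have sg i : lead_coef (map_poly (tau i) g) = b i L.
  by rewrite gE lead_coef_poly.
pose Y := Z ^+ kap.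
have tY i : tau i Y = tau i Z ^+ kap by exact: rmorphXn.
have relb i : \sum_(l < L.+1) b i l * tau i Y ^+ l = 0.
  have e1 : rv (\sum_(l < L.+1) bn l * Y ^+ l) = 0.
    rewrite -[RHS]rel (rmorph_sum rv).
    rewrite (@big_ord_widen _ _ _ L.+1 J.+1 (fun l => rv (bn l * Y ^+ l)) (ltn_ord L)) [RHS](bigID (fun l : 'I__ => (l < L.+1)%N)) /=.
    rewrite [X in _ = _ + X]big1 ?addr0 => [|l]; last first.
      move=> lL; suff -> : \sum_t a l t * W t = 0 by rewrite mul0r.
      by rewrite -brE; apply/eqP; apply: contraNT lL => /Lmax; rewrite ltnS.
    have eY : rv Y = z ^+ kap by rewrite -zE; exact: (rmorphXn rv).
    apply: eq_bigr => l _; rewrite bnE -brE exprM -eY.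
    by apply: etrans (rmorphM rv _ _) _; congr (_ * _); exact: (rmorphXn rv).
  have : tau i (\sum_(l < L.+1) bn l * Y ^+ l) = 0 by apply/eqP; rewrite -rval_eq0 rvE e1.
  by move=> e2; rewrite -[RHS]e2 tS; apply: eq_bigr => l _; rewrite [RHS]tM; congr (_ * _); exact: (esym (tX _ _ _)).
have rootY i : root (map_poly (tau i) g) (tau i Y).
  by rewrite gE /root horner_poly relb.
have [q hqq] := quot_ex rootY.
have /choice[h hh] j := hq th (X j).
pose Ng := \prod_i map_poly (tau i) g; pose E := \prod_j ell th (x j) ^+ 2.
have rNg : Ng \is a polyOver Crat by exact: norm_rat.
have E0 : 0 < E by apply: prodr_gt0 => j _; rewrite exprn_gt0 // ell_gt0.
have ellR u : ell th u \in Crat by rewrite rpredX // rpred_nat.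
have ER : E \in Crat by apply: rpred_prod => j _; rewrite rpredX.
have Wi i t : tau i (Wr t) ^+ d = \prod_j tau i (X j) ^+ e t j.
  rewrite -tX; have -> : \prod_j tau i (X j) ^+ e t j = tau i (\prod_j X j ^+ e t j).
    by rewrite tP; apply: eq_bigr => j _; rewrite tX.
  apply: tau_transfer; rewrite !rvE; apply: etrans (rmorphXn rv _ _) _; rewrite -rvE WE hW (rmorph_prod rv).
  by apply: eq_bigr => j _; apply: esym; apply: etrans (rmorphXn rv _ _) _; rewrite -rvE xE.
(* The squared cofactors [h j] make every conjugate of g integral; their norms contribute E and
   powers of [fmin], which [gauss_prod] removes. *)
have int1 : E *: Ng \is a polyOver Num.int.
  have : \prod_i map_poly (tau i) ((\prod_j h j ^+ 2) * g) \is a polyOver Num.int.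
    apply: norm_int => i; rewrite rmorphM rmorph_prod.
    rewrite (eq_bigr (fun j => map_poly (tau i) (h j) ^+ 2)) => [|j _]; last by rewrite rmorphXn.
    apply: (@adm_poly _ (fun j => tau i (X j))) => [j k|k].
      exact: fac_Aint (fmin_polyint (rval th (X j))) (esym ((hh j).1 i)) k.
    suff : adm (fun j => tau i (X j)) (index_enum 'I_N) (map_poly (tau i) g)`_k by [].
    rewrite gE coef_poly; case: ifP => _; last exact: adm0.
    rewrite /b /bn /br tS; apply: adm_sum => t _; rewrite tM; apply: admZ.
      by rewrite unfold_in tau_conj aE; exact: aA.
    by apply: (adm_pow (e := e t) d0 Aint1 (he t)); rewrite mul1r; exact: Wi.
  rewrite (eq_bigr (fun i => (\prod_j map_poly (tau i) (h j) ^+ 2) * map_poly (tau i) g)) => [|i _]; last first.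
    by rewrite rmorphM rmorph_prod; congr (_ * _); apply: eq_bigr => j _; rewrite rmorphXn.
  rewrite big_split exchange_big /= -/Ng.
  rewrite (eq_bigr (fun j => (ell th (x j) ^+ 2)%:P * fmin (x j) ^+ ((D - ex th (x j)) * 2))) => [|j _]; last first.
    rewrite prodrXl; apply: etrans (congr1 (fun p => p ^+ 2) (hh j).2) _.
    by rewrite xE exprZn -[X in _ *: X]exprM mul_polyC.
  rewrite big_split /= -rmorph_prod /= mulrAC mul_polyC mulrC; apply: gauss_prod.
  by rewrite -mul_polyC; apply: rpredM => //; rewrite polyOverC.
have lead : ell th (rval th Y) <= E * \prod_i `|b i L|.
  pose Nq := \prod_i map_poly (tau i) q.
  have eN : Ng = Nq * \prod_i ('X - (tau i Y)%:P) by rewrite -big_split; apply: eq_bigr => i _; exact: hqq.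
  have ey := ell_gt0 th (rval th Y).
  have : (E / ell th (rval th Y)) *: Nq \is a polyOver Num.int.
    apply: (@gaussX (rval th Y) (ex th (rval th Y))).
      by rewrite -mul_polyC; apply: rpredM; [rewrite polyOverC rpred_div|exact: norm_rat].
    by rewrite -ell_P -scalerAl -scalerAr scalerA mulrCA mulfV ?gt_eqF // mulr1 [_ * Nq]mulrC -eN.
  (* The leading coefficient is a nonzero integer, hence at least 1 in absolute value. *)
  move=> /polyOverP/(_ (size ((E / ell th (rval th Y)) *: Nq)).-1); rewrite -lead_coefE lead_coefZ.
  have -> : lead_coef Nq = \prod_i b i L.
    have := congr1 lead_coef eN; rewrite lead_coef_Mmonic ?monic_prod_XsubC // => <-.
    by rewrite lead_coef_prod; apply: eq_bigr => i _; exact: sg.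
  move=> /norm_intr_ge1 h1; have nz1 : E / ell th (rval th Y) * \prod_i b i L != 0.
    apply: mulf_neq0; first by rewrite gt_eqF ?divr_gt0.
    by apply/prodf_neq0 => i _.
  have := h1 nz1; rewrite normrM gtr0_norm ?divr_gt0 // normr_prod => h2.
  by rewrite -[X in X <= _]mul1r -ler_pdivlMr // mulrAC.
have K0 i : 0 <= \prod_j Num.max 1 `|tau i (X j)| ^+ 2.
  by apply: prodr_ge0 => j _; rewrite exprn_ge0 // (le_trans ler01) // max1_ge1.
pose Cst := \sum_l \sum_t \sum_(u <- conjugates (a l t)) `|u|.
have C0 : 0 <= Cst by rewrite !sumr_ge0 // => l _; rewrite sumr_ge0 // => t _; rewrite sumr_ge0.
have Wb i t : `|tau i (Wr t)| <= \prod_j Num.max 1 `|tau i (X j)| ^+ 2.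
  rewrite -(ler_pXn2r d0) ?nnegrE // -normrX Wi normr_prod -prodrXl; apply: ler_prod => j _.
  rewrite normr_ge0 normrX -exprM mul2n -addnn /=.
  apply: le_trans (_ : Num.max 1 `|tau i (X j)| ^+ e t j <= _).
    by apply: lerXn2r; rewrite ?nnegrE ?max1_ge // (le_trans ler01) // max1_ge1.
  by apply: ler_weXn2l => //; exact: max1_ge1.
have arch i : `|b i L| * Num.max 1 `|tau i Z| ^+ kap <= Cst * \prod_j Num.max 1 `|tau i (X j)| ^+ 2.
  rewrite -max1X // -normrX -tY; apply: le_trans (root_bound (relb i)) _.
  apply: le_trans (_ : \sum_(l < J.+1) `|b i l| <= _).
    rewrite (@big_ord_widen _ _ _ L.+1 J.+1 (fun l => `|b i l|) (ltn_ord L)) [X in _ <= X](bigID (fun l : 'I__ => (l < L.+1)%N)) /=.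
    by rewrite lerDl sumr_ge0.
  rewrite /Cst mulr_suml; apply: ler_sum => l _.
  rewrite /b bnE tS mulr_suml; apply: le_trans (ler_norm_sum _ _ _) _; apply: ler_sum => t _.
  rewrite tM normrM; apply: ler_pM => //.
  have : tau i (Ar l t) \in conjugates (a l t).
    by rewrite -root_prod_XsubC -conjugatesE -aE; exact: tau_root.
  move=> hin; rewrite (big_rem _ hin) /= lerDl sumr_ge0 //.
rewrite -/Cst -(ler_pXn2r (D_gt0 th)); last 2 first.
- by rewrite nnegrE exprn_ge0 // ltW // mult_height_gt0.
- by rewrite nnegrE mulr_ge0 // prodr_ge0 // => j _; rewrite exprn_ge0 // ltW // mult_height_gt0.
rewrite -exprM mulnC exprM -{1}zE ht_pow exprMn -prodrXl.
apply: le_trans (_ : E * \prod_i (`|b i L| * Num.max 1 `|tau i Z| ^+ kap) <= _).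
  rewrite big_split mulrA; apply: ler_wpM2r.
    by apply: prodr_ge0 => i _; rewrite exprn_ge0 // (le_trans ler01) // max1_ge1.
  by apply: le_trans lead; exact: ell_pow.
apply: le_trans (_ : E * \prod_(i < D) (Cst * \prod_j Num.max 1 `|tau i (X j)| ^+ 2) <= _).
  apply: ler_wpM2l; first exact: ltW.
  apply: ler_prod => i _; rewrite arch andbT mulr_ge0 // exprn_ge0 //.
  by rewrite (le_trans ler01) // max1_ge1.
rewrite big_split /= prodr_const card_ord mulrCA exprMn ler_wpM2l ?exprn_ge0 //.
rewrite exchange_big /E -big_split -prodrXl le_eqVlt; apply/orP; left; apply/eqP.
apply: eq_bigr => j _ /=; rewrite prodrXl -exprMn -{1}xE -ht_pow xE.
by rewrite -!exprM mulnC.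
Qed.

(** * The auxiliary relation *)

Lemma lden_Aint z : (minpoly_lden z)%:R * z \in Aint.
Proof.
have /factor_theorem[h eh] : root (fmin z) z by rewrite /root hornerZ (rootP (root_minCpoly z)) mulr0.
have [_] := fac_Aint (fmin_polyint z) eh (size h).-1.
have := congr1 lead_coef eh; rewrite lead_coef_Mmonic ?monicXsubC // lead_coefZ (monicP (minCpoly_monic z)) mulr1.
by rewrite -lead_coefE => ->.
Qed.

Lemma common_denom (T : finType) (a : T -> algC) : exists c, c != 0 /\ forall t, c * a t \in Aint.
Proof.
exists (\prod_t (minpoly_lden (a t))%:R); split.
  by apply/prodf_neq0 => t _; rewrite pnatr_eq0 -lt0n lden_gt0.
move=> t; rewrite (bigD1 t) //= mulrAC mulrC; apply: rpredM; last exact: lden_Aint.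
by apply: rpred_prod => u _; rewrite Aint_Cnat ?natr_nat.
Qed.

Section Rel.
Variables (C : numFieldType) (sg : {rmorphism algC -> C}) (N : nat) (Z : pset N) (pk : pkg (IC sg (dset Z))).
Hypothesis tI : forall j : 'I_N, IC sg (dset Z) ('X_(lshift N j) * 'X_(rshift N j) - 1).
Local Notation r := (size (pb pk)).
Local Notation gsX := [seq pphi pk 'X_l | l <- enum 'I_(N + N)].

Lemma boxX l : boxpol (const_of (pphi pk)) gsX 1 (pphi pk 'X_l).
Proof. by apply: boxpol_mem; [exact: const_sf|apply: map_f; rewrite mem_enum]. Qed.

Lemma chp_boxpol D (a : 'I_N -> int) : (forall j, (absz (a j) <= D)%N) ->
  boxpol (const_of (pphi pk)) gsX (N * D) (pphi pk (chp C a)).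
Proof.
have sK := const_sf (pphi pk).
move=> ha; rewrite /chp rmorph_prod; have -> : (N * D = \sum_(j < N) D)%N by rewrite sum_nat_const card_ord.
elim/big_ind2: _ => [|d d' u u' hu hu'|j _]; first by apply: boxpol_const => //; exact: sf1.
  exact: boxpolM.
have := ha j; case: (a j) => m /= mD; rewrite rmorphXn; apply: boxpol_mono mD _ => //; rewrite -[X in boxpol _ _ X]mul1n;
  apply: boxpolX => //; exact: boxX.
Qed.

(* The excess over [2 * N] leaves one factor [point_height x] in [height_from_coords]. *)
Definition kap := (N + N).+1.

(** A dimension count: (J + 1) m^r products against a Hilbert function that is at most B (Q m)^r,
    all degrees being linear in m. J exceeds B Q^r, and m equals kap J so that the powers of x_i
    contribute degree at most m. *)
Lemma rel_ex A : exists J m, (0 < m)%N /\ forall (chi : {ffun 'I_r -> 'I_m} -> 'I_N -> int) i,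
  (forall u j, (absz (chi u j) <= A * r * m + 1)%N) ->
  exists a : 'I_J.+1 -> {ffun 'I_r -> 'I_m} -> algC, (exists l u, a l u != 0) /\
    Ik (dset Z) (\sum_l \sum_u a l u *: (chp algC (chi u) * 'X_(lshift N i) ^+ (kap * l))).
Proof.
have [B hB] := pkg_hf pk; pose Q := (N * (A * r + 1) + 2)%N; pose J := (B * Q ^ r).+1.
have sK := const_sf (pphi pk).
exists J, (kap * J)%N; split; first by rewrite muln_gt0.
set m := (kap * J)%N; move=> chi i hchi; apply: contrapT => nex.
pose f (lu : 'I_J.+1 * {ffun 'I_r -> 'I_m}) := chp algC (chi lu.2) * 'X_(lshift N i) ^+ (kap * lu.1).
have ind (c : _ -> algC) : Ik (dset Z) (\sum_lu c lu *: f lu) -> forall lu, c lu = 0.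
  move=> hc lu; apply: contrapT => /eqP nz; apply: nex; exists (fun l u => c (l, u)); split.
    by exists lu.1, lu.2; case: lu nz.
  by rewrite pair_big /=; move: hc; congr (Ik _ _); apply: eq_bigr => -[l u] _.
have m0 : (0 < m)%N by rewrite muln_gt0.
have := hB (N * (A * r * m + 1) + kap * J)%N _ (fun lu => bc sg _ (f lu)) _ (IC_indep ind).
rewrite card_prod card_ffun !card_ord => h.
have {h}h : (J.+1 * m ^ r <= B * (N * (A * r * m + 1) + kap * J).+1 ^ r)%N.
  apply: h => -[l u]; rewrite /f /= bcM chp_bc rmorphM; apply: boxpolM => //; first exact: chp_boxpol.
  rewrite (_ : bc sg _ _ = 'X_(lshift N i) ^+ (kap * l)); last by rewrite (rmorphXn (bc sg _)) bcX.
  rewrite rmorphXn; apply: boxpol_mono (_ : kap * l <= kap * J)%N _ => //; first by rewrite leq_mul2l -ltnS ltn_ord orbT.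
  by rewrite -[X in boxpol _ _ X]mul1n; apply: boxpolX => //; exact: boxX.
have le : ((N * (A * r * m + 1) + kap * J).+1 <= Q * m)%N.
  rewrite -/m /Q; have : (N * 1 <= N * m)%N by rewrite leq_mul2l m0 orbT.
  by move: (A * r)%N => w; nia.
have : (J.+1 * m ^ r <= B * Q ^ r * m ^ r)%N.
  apply: leq_trans h _; rewrite -[X in (_ <= X)%N]mulnA -expnMn leq_mul2l; apply/orP; right; exact: leq_exp2rW.
rewrite leq_pmul2r ?expn_gt0 ?m0 // /J; apply/negP; rewrite -ltnNge.
exact: ltnW.
Qed.

Definition mon_indep m (chi : {ffun 'I_r -> 'I_m} -> 'I_N -> int) :=
  forall a : {ffun 'I_r -> 'I_m} -> C, IC sg (dset Z) (\sum_u a u *: chp C (chi u)) -> forall u, a u = 0.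

(** Some coefficient of the relation is nonzero, and independence of the monomials makes the
    corresponding b_l nonzero on Z; this b_l is g. *)
Lemma rel_nd A : exists J m, (0 < m)%N /\ forall (chi : {ffun 'I_r -> 'I_m} -> 'I_N -> int) i,
  (forall u j, (absz (chi u j) <= A * r * m + 1)%N) -> mon_indep chi ->
  exists (a : 'I_J.+1 -> {ffun 'I_r -> 'I_m} -> algC) g, [/\ forall l u, a l u \in Aint, ~ Ik (dset Z) g &
    forall x, Z x -> \sum_l (\sum_u a l u * \prod_j x j ^ chi u j) * x i ^+ (kap * l) = 0 /\
      (g.@[dbl x] != 0 -> exists l, \sum_u a l u * \prod_j x j ^ chi u j != 0)].
Proof.
have [J [m [m0 h]]] := rel_ex A; exists J, m; split=> // chi i bchi ndchi.
have [a' [[l0 [u0 a0]] Ia]] := h chi i bchi.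
have [c [c0 cA]] := common_denom (fun lu : 'I_J.+1 * {ffun 'I_r -> 'I_m} => a' lu.1 lu.2).
exists (fun l u => c * a' l u), (\sum_u (c * a' l0 u) *: chp algC (chi u)).
have ev l x : (\sum_u (c * a' l u) *: chp algC (chi u)).@[dbl x] = \sum_u c * a' l u * \prod_j x j ^ chi u j.
  by rewrite (raddf_sum (meval _)); apply: eq_bigr => u _; rewrite /= mevalZ chp_eval.
split=> [l u||x Zx].
- exact: cA (l, u).
- move=> /(Ik_IC sg); rewrite bc_sum => hI; have := ndchi (fun u => sg (c * a' l0 u)).
  have -> : \sum_u sg (c * a' l0 u) *: chp C (chi u) = \sum_u bc sg _ ((c * a' l0 u) *: chp algC (chi u)).
    by apply: eq_bigr => u _; rewrite bcZ chp_bc.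
  move=> /(_ hI u0) /eqP; rewrite fmorph_eq0 mulf_eq0 (negPf c0) (negPf a0) //.
split; last by rewrite ev => hx; exists l0.
have := Ia _ (ex_intro _ x (conj Zx erefl)); rewrite (raddf_sum (meval _)) /= => e.
have {e}e := congr1 (fun z => c * z) e; rewrite mulr0 in e.
rewrite -[RHS]e mulr_sumr; apply: eq_bigr => l _.
rewrite (raddf_sum (meval _)) /= mulr_suml mulr_sumr; apply: eq_bigr => u _.
rewrite mevalZ mevalM chp_eval (rmorphXn (meval _)) /= mevalXU dbl_l.
by rewrite !mulrA.
Qed.
End Rel.

(** * Normalized relations of a point in a subgroup *)

Lemma colsub_mul (K : pzRingType) m n p q (f : 'I_q -> 'I_p) (A : 'M[K]_(m, n)) (B : 'M[K]_(n, p)) :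
  colsub f (A *m B) = A *m colsub f B.
Proof. by apply/matrixP => i j; rewrite !mxE; apply: eq_bigr => k _; rewrite mxE. Qed.

(** Normalize by the columns of a minor of largest absolute value. By Cramer's rule the entries
    become quotients of minors by the largest one, hence are bounded by 1, and D is its absolute
    value. *)
Lemma lattice s N n (B : 'M[int]_(s, N)) : row_free (map_mx intr B : 'M[rat]_(s, N)) ->
  (forall b (j : 'I_N), (n <= j)%N -> B b j = 0) ->
  exists (I : 'I_s -> 'I_N) (L : 'I_s -> 'I_N -> rat) (D : nat) (K : 'I_s -> 'I_s -> int), [/\ (0 < D)%N,
    forall b j, `|L b j| <= 1, forall b c, L b (I c) = (b == c)%:R, forall b (j : 'I_N), (n <= j)%N -> L b j = 0 &
    forall b j, D%:R * L b j = (\sum_c K b c * B c j)%:~R].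
Proof.
move=> fB Bn; pose Bq : 'M[rat]_(s, N) := map_mx intr B.
pose minor (f : {ffun 'I_s -> 'I_N}) := \det (colsub f B).
have minorE (f : {ffun 'I_s -> 'I_N}) : \det (colsub f Bq) = (minor f)%:~R.
  by rewrite /minor -det_map_mx; congr (\det _); apply/matrixP => i j; rewrite !mxE.
have rA : row_full Bq^T by rewrite /row_full mxrank_tr.
have [f1 f10] : exists f, minor f != 0.
  have : rowsub (fullrankfun rA) Bq^T \in unitmx by exact: fullrowsub_unit.
  rewrite unitmxE unitfE -det_tr => h; exists (fullrankfun rA).
  move: h; rewrite -(intr_eq0 rat) -minorE; congr (\det _ != 0); apply/matrixP => i j.
  by rewrite !mxE.
have [f0 mx] : exists f0, forall f, (absz (minor f) <= absz (minor f0))%N.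
  exists (arg_max f1 predT (fun f => absz (minor f))).
  by case: arg_maxnP => // f _ h g; exact: h.
have f00 : minor f0 != 0 by rewrite -absz_gt0; apply: leq_trans (mx f1); rewrite absz_gt0.
pose M := colsub f0 Bq; have uM : M \in unitmx by rewrite unitmxE unitfE minorE intr_eq0.
pose L := invmx M *m Bq; have ML : M *m L = Bq by rewrite mulKVmx.
have LI b c : L b (f0 c) = (b == c)%:R.
  have : colsub f0 L = 1%:M by rewrite /L colsub_mul -/M mulVmx.
  by move=> /matrixP/(_ b c); rewrite !mxE.
exists f0, (fun b j => L b j), (absz (minor f0)), (fun b c => sgz (minor f0) * (\adj (colsub f0 B)) b c).
split=> [|b j|//|b j nj|b j].
- by rewrite absz_gt0.
- pose f' : {ffun 'I_s -> 'I_N} := [ffun c => if c == b then j else f0 c].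
  have dQ : \det (colsub f' L) = L b j.
    rewrite (expand_det_row _ b) (bigD1 b) //= big1 ?addr0 => [|c cb]; last first.
      by rewrite mxE ffunE (negPf cb) LI eq_sym (negPf cb) mul0r.
    rewrite mxE ffunE eqxx /cofactor addnn -signr_odd odd_double mul1r.
    rewrite (_ : row' b (col' b (colsub f' L)) = 1%:M) ?det1 ?mulr1 //.
    apply/matrixP => i k; rewrite [LHS]mxE [LHS]mxE [LHS]mxE [RHS]mxE ffunE [lift b k == b]eq_sym (negPf (neq_lift b k)) LI.
    by rewrite (inj_eq lift_inj).
  have : \det (colsub f' Bq) = \det M * L b j by rewrite -ML colsub_mul det_mulmx dQ.
  rewrite !minorE => e; have := mx f'; rewrite -(ler_nat rat) => h.
  have e2 : `|(minor f')%:~R| = `|(minor f0)%:~R| * `|L b j| :> rat by rewrite e normrM.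
  have p0 : 0 < `|(minor f0)%:~R| :> rat by rewrite normr_gt0 intr_eq0.
  rewrite -(ler_pM2l p0) mulr1 -e2; move: h; by rewrite !natr_absz !intr_norm.
- by rewrite mxE big1 // => c _; rewrite [Bq _ _]mxE Bn // mulr0.
have eI : (minor f0)%:~R *: L = map_mx intr (\adj (colsub f0 B) *m B).
  rewrite /L scalemxAl /invmx uM minorE scalerA mulfV ?intr_eq0 // scale1r map_mxM map_mx_adj.
  congr (\adj _ *m _); by apply/matrixP => i k; rewrite !mxE.
have := congr1 (fun A : 'M_(_, _) => (sgz (minor f0))%:~R * A b j) eI; rewrite !mxE mulrA -intrM -abszEsg.
move=> ->; rewrite -intrM mulr_sumr; congr (_%:~R); apply: eq_bigr => c _.
by rewrite mulrA.
Qed.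

Lemma restr_rows n t s (x : point (n + t)) : @union_restr_subgroups n t s x ->
  torus x /\ exists B : 'M[int]_(s, n + t), [/\ row_free (map_mx intr B : 'M[rat]_(s, n + t)),
    forall b, \prod_j x j ^ B b j = 1 & forall b (j : 'I_(n + t)), (n <= j)%N -> B b j = 0].
Proof.
move=> [H [d [[L [_ HL]] rH dH sd Hx]]]; have [tx xL] := (HL x).1 Hx; split=> //.
have [m [mu [fmu Lmu Nm]]] := subgroup_rank HL dH.
have sm : (s <= m)%N by rewrite -(leq_add2r d); exact: leq_trans Nm.
exists (rowsub (widen_ord sm) mu); split=> [|b|b j nj].
- rewrite map_mxsub -kermx_eq0; apply/rowV0P => v /sub_kermxP e.
  have e2 : (\row_i (if insub (i : nat) is Some k then v 0 k else 0)) *m map_mx intr mu = 0 :> 'rV[rat]_(n + t).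
    rewrite -e; apply/rowP => j; rewrite !mxE.
    rewrite (bigID (fun i : 'I_m => (i < s)%N)) /= [X in _ + X]big1 ?addr0 => [|i si]; last first.
      by rewrite mxE insubF ?mul0r //; apply/negbTE.
    rewrite (big_ord_narrow sm); apply: eq_bigr => i _; rewrite !mxE.
    by rewrite (insubT (fun k => (k < s)%N) (ltn_ord i)) /=; congr (v 0 _ * _); apply: val_inj.
  have {}e2 := row_free_inj fmu (etrans e2 (esym (mul0mx _ _))).
  apply/rowP => k; have /rowP/(_ (widen_ord sm k)) := e2; rewrite !mxE.
  by rewrite (insubT (fun k => (k < s)%N) (ltn_ord k)) /= => <-; congr (v 0 _); apply: val_inj.
- by rewrite -[RHS](xL _ (Lmu (widen_ord sm b))); apply: eq_bigr => j _; rewrite mxE.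
rewrite mxE; set k := widen_ord _ _.
(* This point, 2 at the coordinate j and 1 elsewhere, lies in H because j is not restricted; hence
   the exponent at j vanishes. *)
pose y : point (n + t) := fun l => if l == j then 2 else 1.
have two : (2 : algC) != 0 by rewrite pnatr_eq0.
have ty : torus y by move=> l; rewrite /y; case: (l == j); [exact: two|exact: oner_neq0].
have Hy : H y.
  apply: rH => // l ln; rewrite /y; case: eqP => // e; move: nj; rewrite -e leqNgt ln //.
have := ((HL y).1 Hy).2 _ (Lmu k); rewrite (bigD1 j) //= big1 ?mulr1 => [|l lj]; last by rewrite /y (negPf lj) exp1rz.
rewrite /y eqxx; case: (mu k j) => [[|l]|l] // /eqP.
  by rewrite -exprnP -natrX -[1]/(1%:R) eqr_nat => /eqP; have := ltn_expl l.+1 (ltnSn 1); lia.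
by rewrite NegzE -invr_expz invr_eq1 -exprnP -natrX -[1]/(1%:R) eqr_nat => /eqP; have := ltn_expl l.+1 (ltnSn 1); lia.
Qed.

(** * Conclusion *)

Lemma prod_exp_lin N (x : point N) (tx : torus x) (S : finType) (k : S -> int) (B : S -> 'I_N -> int) :
  \prod_j x j ^ (\sum_c k c * B c j) = \prod_c (\prod_j x j ^ B c j) ^ k c.
Proof.
transitivity (\prod_c \prod_j x j ^ (k c * B c j)).
  rewrite exchange_big; apply: eq_bigr => j _.
  elim/big_rec2: _ => [|c u v _ <-]; first by rewrite expr0z.
  by rewrite expfzDr ?tx.
apply: eq_bigr => c _; elim/big_ind2: _ => [|u u' v v' -> ->|j _]; rewrite ?exp1rz //; first by rewrite expfzMl.
by rewrite mulrC exprz_exp.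
Qed.

Lemma prime_prod (S : comNzRingType) (I : S -> Prop) (T : finType) (g : T -> S) : prime_pred I ->
  (forall t, ~ I (g t)) -> ~ I (\prod_t g t).
Proof.
move=> [_ _ n1 pr] ng; elim/big_ind: _ => // u v nu nv /pr[]; [exact: nu|exact: nv].
Qed.

Definition house_sum J (T : finType) (a : 'I_J.+1 -> T -> algC) : algC :=
  \sum_l \sum_t \sum_(u <- conjugates (a l t)) `|u|.
Lemma house_sum_ge0 J (T : finType) (a : 'I_J.+1 -> T -> algC) : 0 <= house_sum a.
Proof. by rewrite !sumr_ge0 // => l _; rewrite sumr_ge0 // => t _; rewrite sumr_ge0. Qed.

(* [d * chi u] differs from an exponent killed by [x] by a vector with entries bounded by [d], so that the
   monomials [x ^ chi u] have bounded size compared to [x] whatever the size of [chi u]. *)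
Lemma point_rel N s r (x : point N) (A m : nat) (L : 'I_s -> 'I_N -> rat) (d : nat) (K : 'I_s -> 'I_s -> int) (B : 'M[int]_(s, N))
  (h : 'I_r -> 'I_s) J (a : 'I_J.+1 -> {ffun 'I_r -> 'I_m} -> algC) (chi : {ffun 'I_r -> 'I_m} -> 'I_N -> int) i kap :
  (0 < kap)%N -> torus x -> (forall b, \prod_j x j ^ B b j = 1) -> (0 < d)%N ->
  (forall b j, d%:R * L b j = (\sum_c K b c * B c j)%:~R) ->
  (forall u j, `|(chi u j)%:~R - A%:R * \sum_b (u b)%:R * L (h b) j| <= 1) ->
  (forall l u, a l u \in Aint) -> \sum_l (\sum_u a l u * \prod_j x j ^ chi u j) * x i ^+ (kap * l) = 0 ->
  (exists l, \sum_u a l u * \prod_j x j ^ chi u j != 0) ->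
  mult_height (x i) ^+ kap <= house_sum a * point_height x ^+ 2.
Proof.
move=> k0 tx xB d0 dL hchi aA rel nz.
pose kk (u : {ffun 'I_r -> 'I_m}) c := \sum_b (A%:Z * (u b)%:Z) * K (h b) c.
pose dd u j := chi u j * d%:Z - \sum_c kk u c * B c j.
have ddE u j : (dd u j)%:~R = d%:R * ((chi u j)%:~R - A%:R * \sum_b (u b)%:R * L (h b) j) :> rat.
  rewrite /dd rmorphB rmorphM /= mulrBr [d%:R * _]mulrC; congr (_ - _).
  transitivity (\sum_b A%:R * (u b)%:R * (d%:R * L (h b) j)); last first.
    by rewrite mulrCA mulr_sumr mulr_sumr; apply: eq_bigr => b _; ring.
  transitivity (\sum_b ((A%:Z * (u b)%:Z) * \sum_c K (h b) c * B c j)%:~R : rat); last first.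
    by apply: eq_bigr => b _; rewrite dL !rmorphM.
  rewrite -rmorph_sum; congr (_%:~R); under [RHS]eq_bigr => b _ do rewrite mulr_sumr.
  rewrite exchange_big; apply: eq_bigr => c _; rewrite /kk mulr_suml; apply: eq_bigr => b _.
  by rewrite mulrA.
have ddb u j : (`|dd u j| <= d)%N.
  rewrite -(ler_nat rat) natr_absz intr_norm ddE normrM normr_nat.
  by rewrite -[X in _ <= X]mulr1 ler_wpM2l.
(* Multiplication by the product of all coordinates shifts the exponents from [-d, d] to [0, 2 d];
   this is the source of the square of the height. *)
pose e u j := absz (dd u j + d%:Z).
have eE u j : (e u j)%:Z = dd u j + d%:Z.
  by rewrite /e gez0_abs //; have := ddb u j; move: (dd u j) => z; clear; lia.
have ele u j : (e u j <= d + d)%N.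
  by have := ddb u j; have := eE u j; move: (dd u j) (e u j) => z w; clear; lia.
pose X1 := \prod_j x j.
have X10 : X1 != 0 by apply/prodf_neq0 => j _; exact: tx.
pose W u := (\prod_j x j ^ chi u j) * X1.
have hW u : W u ^+ d = \prod_j x j ^+ e u j.
  rewrite /W /X1 -big_split /= -prodrXl.
  transitivity (\prod_j (x j ^+ e u j * x j ^ (\sum_c kk u c * B c j))); last first.
    rewrite big_split /= prod_exp_lin // [X in _ * X]big1 ?mulr1 // => c _.
    by rewrite xB exp1rz.
  apply: eq_bigr => j _; have xj := tx j.
  rewrite -[X in X ^+ d]/(x j ^ chi u j * x j ^ 1) -expfzDr // !exprnP eE exprz_exp -expfzDr //.
  by congr (_ ^ _); rewrite /dd; ring.
have rel' : \sum_l (\sum_u a l u * W u) * x i ^+ (kap * l) = 0.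
  transitivity ((\sum_l (\sum_u a l u * \prod_j x j ^ chi u j) * x i ^+ (kap * l)) * X1); last by rewrite rel mul0r.
  rewrite mulr_suml; apply: eq_bigr => l _; rewrite [RHS]mulrAC; congr (_ * _).
  by rewrite mulr_suml; apply: eq_bigr => u _; rewrite mulrA.
have nz' : exists l, \sum_u a l u * W u != 0.
  have [l hl] := nz; exists l; rewrite (_ : \sum_u _ = (\sum_u a l u * \prod_j x j ^ chi u j) * X1).
    by rewrite mulf_neq0.
  by rewrite mulr_suml; apply: eq_bigr => u _; rewrite mulrA.
have := height_rel aA k0 d0 ele hW rel' nz'.
by rewrite prodrXl.
Qed.

Lemma point_height_gt0 N (x : point N) : 0 < point_height x.
Proof. by apply: prodr_gt0 => i _; exact: mult_height_gt0. Qed.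

Lemma height_from_coords N (x : point N) (c : algC) : 0 <= c ->
  (forall i, mult_height (x i) ^+ kap N <= c * point_height x ^+ 2) -> point_height x <= c ^+ N.
Proof.
move=> c0 h; have P0 := point_height_gt0 x.
have : point_height x ^+ kap N <= (c * point_height x ^+ 2) ^+ N.
  have -> : (c * point_height x ^+ 2) ^+ N = \prod_(i < N) (c * point_height x ^+ 2) by rewrite prodr_const card_ord.
  rewrite {1}/point_height -prodrXl.
  by apply: ler_prod => i _; rewrite h exprn_ge0 // ltW // mult_height_gt0.
rewrite exprMn -exprM mul2n -addnn /kap exprSr mulrC.
by rewrite ler_pM2r // exprn_gt0.
Qed.

(** Once A and m are fixed, the rounded exponents chi belong to a finite family. Relations are
    chosen once for each member and each coordinate, so one g and one constant serve all x. *)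
Lemma height_key n t s X Z p : has_dim X s -> (s <= n)%N -> zirreducible Z -> psubset Z X -> Z p -> @X_re_oa n t X p ->
  exists g, ~ Ik (dset Z) g /\ exists B, forall x, Z x -> @union_restr_subgroups n t s x ->
    g.@[dbl x] = 0 \/ point_height x <= B.
Proof.
move=> dX sn iZ sZX Zp oap; set N := (n + t)%N.
have [sg _] := sigma_ex Rdefinitions.R.
have [pk] := package (IC_prime sg (zirr_prime iZ)).
have [A [A0 hA]] := nondeg_unif pk iZ sZX Zp oap dX sn.
have [J [m [m0 hrel]]] := rel_nd pk A.
set r := size (pb pk) in hA hrel.
pose Mx := (A * r * m + 1)%N.
pose Fam := {ffun {ffun 'I_r -> 'I_m} * 'I_N -> 'I_(Mx + Mx).+1}.
pose chiof (f : Fam) u j : int := (f (u, j) : nat)%:Z - Mx%:Z.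
have bchi f u j : (absz (chiof f u j) <= Mx)%N.
  by rewrite /chiof; have := ltn_ord (f (u, j)); move: (nat_of_ord _) => k; clear; lia.
pose rels (a : 'I_J.+1 -> {ffun 'I_r -> 'I_m} -> algC) (g : {mpoly algC[N + N]}) (chi : {ffun 'I_r -> 'I_m} -> 'I_N -> int) i x :=
  \sum_l (\sum_u a l u * \prod_j x j ^ chi u j) * x i ^+ (kap N * l) = 0 /\
      (g.@[dbl x] != 0 -> exists l, \sum_u a l u * \prod_j x j ^ chi u j != 0).
have [_ _ n1 _] := zirr_prime iZ.
have /choice[ag hag] (fi : Fam * 'I_N) : exists ag : ('I_J.+1 -> {ffun 'I_r -> 'I_m} -> algC) * {mpoly algC[N + N]},
    [/\ forall l u, ag.1 l u \in Aint, ~ Ik (dset Z) ag.2 &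
    mon_indep (pk := pk) (chiof fi.1) -> forall x, Z x -> rels ag.1 ag.2 (chiof fi.1) fi.2 x].
  have [hn|hn] := pselect (mon_indep (pk := pk) (chiof fi.1)).
    have [a [g [h1 h2 h3]]] := hrel (chiof fi.1) fi.2 (bchi fi.1) hn.
    by exists (a, g); split.
  (* A default for dependent families, which never arise from a normalized matrix; g = 1 keeps the
     product of the g outside the ideal. *)
  by exists (fun _ _ => 0, 1); split=> // l u; exact: rpred0.
exists (\prod_fi (ag fi).2); split.
  by apply: prime_prod (zirr_prime iZ) _ => fi; case: (hag fi).
pose c := \sum_fi house_sum (ag fi).1.
exists (c ^+ N) => x Zx Ux.
have [|/eqP gx] := pselect ((\prod_fi (ag fi).2).@[dbl x] = 0); [by left|right].
have gx' fi : (ag fi).2.@[dbl x] != 0.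
  by move: gx; rewrite (rmorph_prod (meval (dbl x))) /= => /prodf_neq0; apply.
apply: height_from_coords => [|i]; first by apply: sumr_ge0 => fi _; exact: house_sum_ge0.
have [tx [B [fB xB Bn]]] := restr_rows Ux.
have [I [L [d [K [d0 L1 LI Ln dL]]]]] := lattice fB Bn.
have [|h hh] := hA I (fun b j => ratr (L b j)).
  split=> [b j|b c'|b j nj].
  - by rewrite -ratr_norm -[X in _ <= X](rmorph1 (ratr : {rmorphism rat -> Rdefinitions.R})) ler_rat.
  - by rewrite LI rmorph_nat.
  - by rewrite Ln // rmorph0.
pose q (u : {ffun 'I_r -> 'I_m}) j : rat := A%:R * \sum_b (u b)%:R * L (h b) j.
pose chi u j := Num.floor (q u j).
have chiq u j : `|(chi u j)%:~R - q u j| <= 1.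
  have h1 := floor_le (q u j); have h2 := ltW (lt_succ_floor (q u j)).
  rewrite distrC ger0_norm ?subr_ge0 // lerBlDl.
  by move: h2; rewrite intrD.
have qb u j : `|q u j| <= (A * r * m)%:R.
  rewrite /q normrM normr_nat -mulnA natrM ler_wpM2l //; apply: le_trans (ler_norm_sum _ _ _) _.
  apply: le_trans (_ : \sum_(b < r) (m%:R : rat) <= _); last by rewrite sumr_const card_ord -mulrnA mulnC.
  apply: ler_sum => b _; rewrite normrM normr_nat -[X in _ <= X]mulr1; apply: ler_pM => //.
  by rewrite ler_nat ltnW // ltn_ord.
have chib u j : (absz (chi u j) <= Mx)%N.
  rewrite -(ler_nat rat) natr_absz intr_norm /Mx natrD addrC -lerBlDr.
  apply: le_trans (chiq u j); apply: le_trans (lerB_dist _ _).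
  by rewrite lerD2l lerN2; exact: qb.
pose f : Fam := [ffun uj => inord (absz (chi uj.1 uj.2 + Mx%:Z))].
have ef : chiof f = chi.
  apply: funext => u; apply: funext => j; rewrite /chiof ffunE /= inordK.
    by have := chib u j; move: (chi u j) => z; clear; lia.
  by have := chib u j; move: (chi u j) => z; clear; lia.
have ndchi : mon_indep (pk := pk) (chiof f).
  rewrite ef => a Ia; apply: (hh m chi m0 _ a Ia) => u j.
  have -> : (chi u j)%:~R - A%:R * \sum_b (u b)%:R * ratr (L (h b) j) = ratr ((chi u j)%:~R - q u j) :> Rdefinitions.R.
    rewrite rmorphB rmorph_int /q rmorphM rmorph_nat rmorph_sum; congr (_ - _ * _).
    by apply: eq_bigr => b _; rewrite rmorphM rmorph_nat.
  by rewrite -ratr_norm -[X in _ <= X](rmorph1 (ratr : {rmorphism rat -> Rdefinitions.R})) ler_rat.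
have [aA _ /(_ ndchi x Zx)] := hag (f, i); rewrite /= ef => -[rel /(_ (gx' _)) nz].
apply: le_trans (@point_rel N s r x A m L d K B h J _ chi i (kap N) isT tx xB d0 dL chiq aA rel nz) _.
apply: ler_wpM2r; first by rewrite exprn_ge0 // ltW // point_height_gt0.
by rewrite /c (bigD1 (f, i)) //= lerDl; apply: sumr_ge0 => fi _; exact: house_sum_ge0.
Qed.

Theorem theorem5p2 (n t s : nat) (X : pset (n + t)) :
  zirreducible X -> has_dim X s -> (s <= n)%N ->
  exists B : algC, forall x : point (n + t),
    X_re_oa X x -> @union_restr_subgroups n t s x -> point_height x <= B.
Proof.
move=> iX dX sn.
pose bdd Z := exists B : algC, forall x : point (n + t), Z x -> X_re_oa X x -> @union_restr_subgroups n t s x -> point_height x <= B.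
suff [B hB] : bdd X by exists B => x hx; apply: hB => //; case: hx.
apply: contrapT => nX.
(* Noetherian induction: a maximal vanishing ideal among closed subsets of X with unbounded height
   belongs to a minimal such subset. The set [X_re_oa X] remains that of X throughout. *)
pose Phi (I : {mpoly algC[(n + t) + (n + t)]} -> Prop) := exists Z, [/\ zclosed Z, psubset Z X, (forall P, I P <-> Ik (dset Z) P) & ~ bdd Z].
have PhiX : Phi (Ik (dset X)) by exists X; split=> //; case: iX.
have [I [_ PI _ mx]] := noeth_max (@noeth_mpoly _ _) (Ik_ideal (dset X)) PhiX.
have [Z [cZ sZX IZ nZ]] := PI.
have small Z' : zclosed Z' -> psubset Z' Z -> ~ psubset Z Z' -> bdd Z'.
  move=> cZ' sZ' nsub; apply: contrapT => nb; apply: nsub => x Zx.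
  apply: zclosedE => //; first exact: zclosed_torus Zx.
  move=> P IP; have /IZ : I P.
    apply: (mx _ (Ik_ideal (dset Z'))) IP; first by exists Z'; split=> // y /sZ'; exact: sZX.
    by move=> Q /IZ h _ [y [Zy ->]]; apply: h; exists y; split=> //; exact: sZ'.
  by apply; exists x.
have bddU Z1 Z2 : bdd Z1 -> bdd Z2 -> bdd (fun x => Z1 x \/ Z2 x).
  move=> [B1 h1] [B2 h2]; exists (`|B1| + `|B2|) => x hx ox ux; have P0 := ltW (point_height_gt0 x).
  case: hx => hx; have := (h1 x, h2 x).
    move=> [/(_ hx ox ux) le _]; apply: le_trans le _.
    by rewrite ger0_norm ?lerDl // (le_trans P0) // (h1 x).
  move=> [_ /(_ hx ox ux) le]; apply: le_trans le _.
  by rewrite [`|B2|]ger0_norm ?lerDr // (le_trans P0) // (h2 x).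
have Zinter (J : {mpoly algC[(n + t) + (n + t)]} -> Prop) : let Z' := zeros (fun P => Ik (dset Z) P \/ J P) in
    [/\ zclosed Z', psubset Z' Z & forall x, Z x -> (forall P, J P -> P.@[dbl x] = 0) -> Z' x].
  split; first exact: zclosed_zeros.
    by move=> x [tx h]; apply: zclosedE => // P IP; apply: h; left.
  move=> x Zx hJ; split=> [|P [IP|/hJ //]]; first exact: zclosed_torus Zx.
  by apply: IP; exists x.
(* If Z were covered by two closed sets neither of which contains it, both intersections with Z
   would have bounded height by minimality, and so would Z. *)
have iZ : zirreducible Z.
  split=> // [|Z1 Z2 c1 c2 sub].
    by apply: contrapT => ne; apply: nZ; exists 0 => x Zx; exfalso; apply: ne; exists x.
  have hs Zi : zclosed Zi -> ~ psubset Z Zi -> bdd (zeros (fun P => Ik (dset Z) P \/ Ik (dset Zi) P)).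
    move=> ci ni; have [h1 h2 h3] := Zinter (Ik (dset Zi)); apply: small => // h4; apply: ni => x Zx.
    have [tx h5] := h4 x Zx; apply: zclosedE => // P IP; apply: h5; by right.
  apply: contrapT => nor; apply: nZ.
  have [b1 b2] : bdd (zeros (fun P => Ik (dset Z) P \/ Ik (dset Z1) P)) /\ bdd (zeros (fun P => Ik (dset Z) P \/ Ik (dset Z2) P)).
    by split; apply: hs => // h; apply: nor; [left|right].
  have [B hB] := bddU _ _ b1 b2; exists B => x Zx; apply: hB.
  have m1 Zi : Zi x -> zeros (fun P => Ik (dset Z) P \/ Ik (dset Zi) P) x.
    by move=> Zix; have [_ _ h] := Zinter (Ik (dset Zi)); apply: h => // P; apply; exists x.
  by case: (sub x Zx) => /m1; [left|right].
have [p Zp op] : exists2 p, Z p & X_re_oa X p.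
  by apply: contrapT => ne; apply: nZ; exists 0 => x Zx ox; exfalso; apply: ne; exists x.
have [g [ng [B hB]]] := height_key dX sn iZ sZX Zp op.
have [h1 h2 h3] := Zinter (fun P => P = g); apply: nZ.
have b1 : bdd (zeros (fun P => Ik (dset Z) P \/ P = g)).
  apply: small => // h4; apply: ng => _ [x [Zx ->]].
  by have [_ h5] := h4 x Zx; apply: h5; right.
have b2 : bdd (fun x => Z x /\ g.@[dbl x] <> 0).
  by exists B => x [Zx gx] _ ux; case: (hB x Zx ux).
have [B' hB'] := bddU _ _ b1 b2; exists B' => x Zx; apply: hB'.
have [gx|gx] := pselect (g.@[dbl x] = 0); last by right.
by left; apply: h3 => // _ ->.
Qed.
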